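(* Let $L$, $\Omega$, $Q$, $D_0$ and the notion of weak solution be as in the context, with all structural assumptions there. There exists a constant $\varepsilon_0>0$ such that for every $p\in\left[2,\,2+\frac{2Q}{Q+2}\varepsilon_0\right)$ the following holds. If $g,f_1,\dots,f_{m_0}\in L^p(\Omega)$ and $u\in W_2^{1,1}(\Omega)$ is a weak solution of $Lu=g+\sum_{j=1}^{m_0}\partial_{x_j}f_j$ in $\Omega$, then $D_0u\in L^p_{loc}(\Omega)$, and for any open sets $\Omega'\subset\subset\Omega''\subset\subset\Omega$, $$\|D_0u\|_{L^p(\Omega')}\le c\left(\|D_0u\|_{L^2(\Omega'')}+\|g\|_{L^p(\Omega)}+\|f\|_{L^p(\Omega)}\right),$$ where the constant $c>0$ does not depend on $u,g,f$.
   Context: Let $1\le m_0\le N$, let $\Omega\subset\mathbb{R}^{N+1}$ be a bounded domain, $z=(x,t)\in\mathbb{R}^N\times\mathbb{R}$, and $$Lu=\sum_{i,j=1}^{m_0}\partial_{x_i}\big(a_{ij}(z)\partial_{x_j}u\big)+\sum_{i,j=1}^N b_{ij}x_i\partial_{x_j}u-\partial_tu=\mathrm{div}(A(z)D_0u)+Yu,$$ where $D_0=(\partial_{x_1},\dots,\partial_{x_{m_0}},0,\dots,0)$, $D=(\partial_{x_1},\dots,\partial_{x_N})$, $Yu=\langle x,BDu\rangle-\partial_tu$, $B=(b_{ij})_{i,j=1}^N$ is a real constant matrix, $A(z)$ is the $N\times N$ matrix with upper left block $(a_{ij}(z))_{i,j\le m_0}$ and zeros elsewhere, and $f=(f_1,\dots,f_{m_0},0,\dots,0)$.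 (H1) $a_{ij}=a_{ji}\in VMO(\Omega)\cap L^\infty(\Omega)$, and there is $\Lambda>1$ with $\Lambda^{-1}|\xi|^2\le\sum_{i,j=1}^{m_0}a_{ij}(z)\xi_i\xi_j\le\Lambda|\xi|^2$ for all $z\in\mathbb{R}^{N+1}$, $\xi\in\mathbb{R}^{m_0}$. (H2) $B=\begin{pmatrix}0&B_1&0&\cdots&0\\0&0&B_2&\cdots&0\\ \vdots&\vdots&\vdots&\ddots&\vdots\\0&0&0&\cdots&B_r\\0&0&0&\cdots&0\end{pmatrix}$, where $B_k$ is an $m_{k-1}\times m_k$ matrix of rank $m_k$, $m_0\ge m_1\ge\cdots\ge m_r\ge1$, $\sum_{k=0}^rm_k=N$. $Q=m_0+3m_1+\cdots+(2r+1)m_r$. Group law: $(x,t)\circ(\xi,\tau)=(\xi+E(\tau)x,\,t+\tau)$, $E(\tau)=\exp(-\tau B^T)$, with inverse $(x,t)^{-1}=(-E(-t)x,-t)$. Homogeneous norm: $\|(x,t)\|=\sum_{j=1}^N|x_j|^{1/\alpha_j}+|t|^{1/2}$, where $\alpha_j=1$ for $1\le j\le m_0$ and $\alpha_j=2k+3$ for $m_0+\cdots+m_k<j\le m_0+\cdots+m_{k+1}$, $0\le k\le r-1$. Quasidistance $d(z,\zeta)=\|\zeta^{-1}\circ z\|$; balls $B_R(z_0)=\{\zeta\in\mathbb{R}^{N+1}:d(z_0,\zeta)<R\}$. $VMO(\Omega)$: $a\in L^1_{loc}(\Omega)$ with $\sup_{R>0}\eta_R(a)<\infty$ and $\eta_R(a)\to0$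 as $R\to0$, where $\eta_R(a)=\sup_{z_0\in\Omega,\,0<\rho\le R}\frac{1}{|\Omega\cap B_\rho(z_0)|}\int_{\Omega\cap B_\rho(z_0)}|a-a_{\Omega\cap B_\rho(z_0)}|\,dz$ and $a_E$ is the mean of $a$ over $E$. $W_2^{1,1}(\Omega)=\{u\in L^2(\Omega):\partial_{x_i}u\ (1\le i\le m_0),\ Yu\in L^2(\Omega)\}$ (distributional derivatives). A weak solution of $Lu=g+\mathrm{div} f$ in $\Omega$ is $u\in W_2^{1,1}(\Omega)$ such that for all $\psi\in C_0^\infty(\Omega)$: $-\int_\Omega\langle A D_0u,D_0\psi\rangle dz+\int_\Omega\psi\,Yu\,dz=\int_\Omega(g\psi-\langle f,D_0\psi\rangle)dz$. *)

(* Defs.v *)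
From HB Require Import structures.
From mathcomp Require Import all_boot all_order all_algebra.
From mathcomp Require Import all_classical all_reals all_analysis.

Set Implicit Arguments.
Unset Strict Implicit.
Unset Printing Implicit Defensive.
Import Order.TTheory GRing.Theory Num.Theory.
Import numFieldNormedType.Exports.
Local Open Scope classical_set_scope.
Local Open Scope ring_scope.

(* The Borel sigma-algebra of R^n, generated by the coordinates as in the
   library's instance for n.-tuple. A class of Lebesgue measurable functions
   modulo null sets always has a Borel representative; functions are such
   representatives throughout. *)
Section measurable_col.
Context {R : realType} {n : nat}.

Let coors : 'I_n -> 'cV[R]_n -> R := fun i x => x i 0.

Let col_set0 : g_sigma_preimage coors set0.
Proof. exact: sigma_algebra0. Qed.

Let col_setC A : g_sigma_preimage coors A -> g_sigma_preimage coors (~` A).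
Proof. exact: sigma_algebraC. Qed.

Let col_bigcup (F : (set 'cV[R]_n)^nat) :
  (forall i, g_sigma_preimage coors (F i)) ->
  g_sigma_preimage coors (\bigcup_i (F i)).
Proof. exact: sigma_algebra_bigcup. Qed.

HB.instance Definition _ := @isMeasurable.Build default_measure_display
  'cV[R]_n (g_sigma_preimage coors) col_set0 col_setC col_bigcup.

End measurable_col.

Lemma measurable_fun_col d (T : measurableType d) (R : realType) n
    (f : T -> 'cV[R]_n) :
  (forall i, measurable_fun setT (fun x => f x i 0)) -> measurable_fun setT f.
Proof.
move=> mf; apply: (@measurability _ _ _ _ _ _
  (\big[setU/set0]_(i < n) preimage_set_system setT
     (fun x : 'cV[R]_n => x i 0) measurable)) => // _ [A + <-].
rewrite -bigcup_seq => -[i _] [C mC <-].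
by rewrite [X in f @^-1` X]setTI; exact: (mf i measurableT C mC).
Qed.

Lemma measurable_coord (R : realType) n (i : 'I_n) :
  measurable_fun setT (fun x : 'cV[R]_n => x i 0).
Proof.
move=> _ Y mY; apply: sub_sigma_algebra.
by rewrite -bigcup_seq; exists i => /=;
  [rewrite mem_index_enum|exists Y; rewrite ?setTI].
Qed.

Definition consc (R : realType) n (p : R * 'cV[R]_n) : 'cV[R]_n.+1 :=
  \col_(i < n.+1) oapp (fun j => p.2 j 0) p.1 (unlift ord0 i).

Lemma measurable_consc (R : realType) n : measurable_fun setT (@consc R n).
Proof.
apply: measurable_fun_col => i.
case: (unliftP ord0 i) => [j ->|->].
- rewrite (_ : (fun x => _) = (fun x : 'cV[R]_n => x j 0) \o snd).
    exact: measurableT_comp (@measurable_coord R n j) measurable_snd.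
  by apply/funext => x /=; rewrite mxE liftK.
- rewrite (_ : (fun x => _) = fst); first exact: measurable_fst.
  by apply/funext => x /=; rewrite mxE unlift_none.
Qed.

(* The library's Lebesgue measure lives on the alias [measurableTypeR R]; this
   is the same set function on [R] itself, which carries the topology too. *)
Section lebesgue1.
Context {R : realType}.
Local Open Scope ereal_scope.

Definition lebesgue1 : set R -> \bar R := @lebesgue_measure R.

Let lebesgue1_0 : lebesgue1 set0 = 0.
Proof. exact: (measure0 (@lebesgue_measure R)). Qed.

Let lebesgue1_ge0 A : 0 <= lebesgue1 A.
Proof. exact: (measure_ge0 (@lebesgue_measure R)). Qed.

Let lebesgue1_semi_sigma_additive : semi_sigma_additive lebesgue1.
Proof. exact: (@measure_semi_sigma_additive _ _ _ (@lebesgue_measure R)). Qed.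

HB.instance Definition _ := isMeasure.Build _ _ _ lebesgue1
  lebesgue1_0 lebesgue1_ge0 lebesgue1_semi_sigma_additive.

Let lebesgue1_sigma_finite : sigma_finite setT lebesgue1.
Proof. exact: (@sigma_finiteT _ _ _ (@lebesgue_measure R)). Qed.

HB.instance Definition _ := Measure_isSigmaFinite.Build _ _ _ lebesgue1
  lebesgue1_sigma_finite.

End lebesgue1.

(* Lebesgue measure on R^n: the image under [consc] of the product of the
   one-dimensional measure and of the measure on R^(n-1). *)
Section lebesgue_col.
Context {R : realType}.
Local Open Scope ereal_scope.

Fixpoint lebesgue_col n : {measure set 'cV[R]_n -> \bar R} :=
  match n with
  | 0 => \d_(0%R : 'cV[R]_0)
  | n'.+1 => measure_function_pushforward__canonical__measure_function_Measure
      (lebesgue1 \x^ lebesgue_col n') (@measurable_consc R n')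
  end.

End lebesgue_col.

Lemma measurable_box (R : realType) n (A : 'I_n -> set R) :
  (forall i, measurable (A i)) ->
  measurable [set x : 'cV[R]_n | forall i, A i (x i 0)].
Proof.
move=> mA.
rewrite (_ : [set _ | _] = \bigcap_(i in [set: 'I_n])
    ((fun x : 'cV[R]_n => x i 0) @^-1` A i)).
  apply: fin_bigcap_measurable; first exact: finite_finset.
  by move=> i _; rewrite -[X in measurable X]setTI; exact: measurable_coord.
by apply/seteqP; split => x /= H i => [_|]; [exact: H|apply: H].
Qed.

Lemma lebesgue_col_box (R : realType) n (A : 'I_n -> set R) :
  (forall i, measurable (A i)) ->
  lebesgue_col n [set x : 'cV[R]_n | forall i, A i (x i 0)]
   = (\prod_(i < n) lebesgue1 (A i))%E.
Proof.
elim: n A => [|n IH] A mA /=.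
  rewrite big_ord0 diracE mem_set //= => -[] //.
rewrite /pushforward big_ord_recl.
rewrite (_ : _ @^-1` _ = A ord0 `*`
    [set x : 'cV[R]_n | forall i, A (lift ord0 i) (x i 0)]).
  have mB := measurable_box (fun i => mA (lift ord0 i)).
  rewrite [LHS](product_measure2E lebesgue1 (lebesgue_col n) (mA ord0) mB).
  by congr (_ * _)%E; apply: IH => i; exact: mA.
apply/seteqP; split => -[y x] /= H.
  split => [|i].
    by have := H ord0; rewrite mxE unlift_none.
  by have := H (lift ord0 i); rewrite mxE liftK.
move: H => [H0 H1] i; rewrite mxE.
by case: (unliftP ord0 i) => [j ->|->] /=.
Qed.

Definition expmx (R : realType) n (A : 'M[R]_n) : 'M[R]_n :=
  limn (series (fun k : nat => (k`!%:R)^-1 *: A ^+ k)).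

Definition dimx (r : nat) (m : 'I_r.+1 -> nat) : nat := \sum_(k < r.+1) m k.

(* The points z = (x, t) of R^(N+1). *)
Notation spacetime R m := ('cV[R]_(dimx m) * R)%type.

Section kolmogorov.
Context {R : realType} {r : nat}.
Variable m : 'I_r.+1 -> nat.
Local Notation N := (dimx m).
Local Notation pt := (spacetime R m).
Local Notation m0 := (m ord0).
Implicit Types (z : pt) (D Omega : set pt) (u v phi : pt -> R) (B : 'M[R]_N).

(* In particular 1 <= m_0 <= N. *)
Definition block_sizes : Prop :=
  (forall k l : 'I_r.+1, (k <= l)%N -> (m l <= m k)%N) /\ (1 <= m ord_max)%N.

Definition Qdim : nat := \sum_(k < r.+1) (2 * k + 1) * m k.

(* The position, among the N spatial coordinates, of the i-th one of the
   first block. *)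
Definition first_block (i : 'I_m0) : 'I_N := tagnat.Rank ord0 i.

Definition lebesgue_st : {measure set pt -> \bar R} :=
  (lebesgue_col N \x lebesgue1)%E.

Local Notation mu := lebesgue_st.

(* The block in position (k-1, k) is B_k; all the others vanish. *)
Definition block_superdiag B : Prop :=
  forall k l : 'I_r.+1,
    if l == k.+1 :> nat then \rank (@submxblock R _ _ m m B k l) = m l
    else @submxblock R _ _ m m B k l = 0.

Definition Etau B (tau : R) : 'M[R]_N := expmx (- tau *: B^T).

Definition gmul B (z zeta : pt) : pt :=
  (zeta.1 + Etau B zeta.2 *m z.1, z.2 + zeta.2).

Definition ginv B (z : pt) : pt := (- (Etau B (- z.2) *m z.1), - z.2).

(* [tagnat.sig1 j] is the block k of coordinate j, whose weight is 2k+1. *)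
Definition weight (j : 'I_N) : nat := 2 * tagnat.sig1 j + 1.

Definition hnorm (z : pt) : R :=
  \sum_(j < N) `|z.1 j 0| `^ (weight j)%:R^-1 + `|z.2| `^ 2^-1.

Definition qdist B (z zeta : pt) : R := hnorm (gmul B (ginv B zeta) z).

Definition qball B (z0 : pt) (rho : R) : set pt :=
  [set zeta | qdist B z0 zeta < rho].

Definition Lp_norm (p : \bar R) D (v : pt -> R) : \bar R :=
  Lnorm mu p (EFin \o (v \_ D)).

Definition in_Lp (p : \bar R) D v : Prop :=
  measurable_fun D v /\ (Lp_norm p D v < +oo)%E.

Definition in_Lp_loc (p : \bar R) Omega v : Prop :=
  forall K, compact K -> K `<=` Omega -> in_Lp p K v.

(* Pointwise Euclidean length of a vector field. *)
Definition elen (F : 'I_m0 -> pt -> R) : pt -> R :=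
  fun z => Num.sqrt (\sum_(i < m0) F i z ^+ 2).

Definition mean D v : R := (\int[mu]_(z in D) v z) / fine (mu D).

(* When [v] is not integrable on [D], with 0 < mu D < +oo, the value is
   infinite, whatever the default value of [mean D v]. *)
Definition mean_osc D v : \bar R :=
  ((fine (mu D))^-1%:E * \int[mu]_(z in D) `|v z - mean D v|%:E)%E.

Definition vmo_modulus B Omega v (rho : R) : \bar R :=
  ereal_sup [set mean_osc (Omega `&` qball B z0 s) v
            | z0 in Omega & s in [set s | 0 < s <= rho]].

Definition in_VMO B Omega v : Prop :=
  [/\ in_Lp_loc 1%:E Omega v,
      (ereal_sup [set vmo_modulus B Omega v rho | rho in [set rho | 0 < rho]%R]
        < +oo)%E
    & vmo_modulus B Omega v rho @[rho --> 0^'+] --> 0%E].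

Definition vmo_elliptic B Omega (a : 'I_m0 -> 'I_m0 -> pt -> R) : Prop :=
  (forall i j, [/\ a i j = a j i, in_VMO B Omega (a i j)
                 & in_Lp +oo%E Omega (a i j)]) /\
  exists2 Lambda : R, 1 < Lambda &
    forall z (xi : 'I_m0 -> R),
      Lambda^-1 * \sum_(i < m0) xi i ^+ 2
        <= \sum_(i < m0) \sum_(j < m0) a i j z * xi i * xi j
        <= Lambda * \sum_(i < m0) xi i ^+ 2.

Definition bounded_domain Omega : Prop :=
  [/\ Omega !=set0, open Omega, connected Omega & bounded_set Omega].

Definition compactly_included D Omega : Prop :=
  compact (closure D) /\ closure D `<=` Omega.

Definition dx (j : 'I_N) phi : pt -> R := 'D_((delta_mx j 0, 0) : pt) phi.

Definition dt phi : pt -> R := 'D_((0, 1) : pt) phi.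

(* Every iterated directional derivative is differentiable everywhere. *)
Definition smooth phi : Prop :=
  forall (vs : seq pt) z, differentiable (foldr (fun (e : pt) h => 'D_e h) phi vs) z.

Definition test_fun Omega phi : Prop :=
  [/\ smooth phi, compact (closure [set z | phi z != 0])
    & closure [set z | phi z != 0] `<=` Omega].

(* [in_Lp_loc 1] makes [Du] a regular distribution on Omega; as such it is
   unique almost everywhere. *)
Definition weak_D0 Omega u (Du : 'I_m0 -> pt -> R) : Prop :=
  forall i, in_Lp_loc 1%:E Omega (Du i) /\
    forall phi, test_fun Omega phi ->
      \int[mu]_(z in Omega) (Du i z * phi z) =
      - (\int[mu]_(z in Omega) (u z * dx (first_block i) phi z)).

(* Formal adjoint of Y = sum_ij b_ij x_i d_(x_j) - d_t. *)
Definition Yadj B phi : pt -> R := fun z =>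
  - (\sum_(i < N) \sum_(j < N) B i j * dx j (fun w => w.1 i 0 * phi w) z)
  + dt phi z.

Definition weak_Y B Omega u (Yu : pt -> R) : Prop :=
  in_Lp_loc 1%:E Omega Yu /\
  forall phi, test_fun Omega phi ->
    \int[mu]_(z in Omega) (Yu z * phi z) =
    \int[mu]_(z in Omega) (u z * Yadj B phi z).

Definition W112 B Omega u : Prop :=
  [/\ in_Lp 2%:E Omega u,
      exists2 Du, weak_D0 Omega u Du & forall i, in_Lp 2%:E Omega (Du i)
    & exists2 Yu, weak_Y B Omega u Yu & in_Lp 2%:E Omega Yu].

(* <A D_0 u, D_0 psi> and <f, D_0 psi> only involve the first m_0
   coordinates. *)
Definition weak_solution B Omega (a : 'I_m0 -> 'I_m0 -> pt -> R)
    (g : pt -> R) (f : 'I_m0 -> pt -> R) u : Prop :=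
  W112 B Omega u /\
  exists Du Yu, [/\ weak_D0 Omega u Du, weak_Y B Omega u Yu &
    forall psi, test_fun Omega psi ->
      - (\int[mu]_(z in Omega)
           (\sum_(i < m0) \sum_(j < m0)
              a i j z * Du j z * dx (first_block i) psi z))
      + (\int[mu]_(z in Omega) (psi z * Yu z)) =
      \int[mu]_(z in Omega)
        (g z * psi z - \sum_(i < m0) f i z * dx (first_block i) psi z)].

End kolmogorov.

(* Main.v *)
(** Box averages adapted to the group law and the dilations satisfy two estimates. The first
is the Caccioppoli inequality: D_0 u is controlled in L^2 by the oscillation of u. The second is a
Poincare inequality for weak solutions: by the rank condition every direction is a commutator of
d_1, ..., d_m0 and Y, so the difference of two mollifiers is a divergence form
sum_i d_i psi_i + Y psi_0, and the equation turns the difference of the mollifications of u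
into integrals of D_0 u and of the data. Summing over dyadic scales, the fine scales
contribute a small multiple of the L^2 norm of D_0 u, the finitely many coarse ones
its L^1 norm only. Together the two give, with H the sum of the |d_i u| and P that of the data,
int_Q H^2 <= theta int_(kappa Q) H^2 + C (|Q|^-1 (int_(kappa Q) H)^2 + int_(kappa Q) P^2) for boxes Q.

Gehring's lemma is then proved by hand. H is weighted by a power of the distance to the complement
of the domain, so that a stopping-time box at level lambda stays in the domain. A Vitali
covering by such boxes bounds the integral of H^2 over {H > lambda} by lambda times the integral
of H over {H > eta lambda} plus the same for the data, and summing over geometric levels
lambda yields the exponent 2 + delta. *)

(* The solution has weak derivatives only along d_1, ..., d_m0 and Y, so it cannot be tested against
   itself, and Euclidean mollification does not commute with the drift in Y. The remedy is a kernel
   in the group quotient b z^-1: a left invariant field acts on it in b and in z with opposite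
   signs, so doubling the variables and letting the kernel concentrate gives an exact integration by
   parts between weak derivatives ([weak_green]), from which the energy identity follows. In the
   Poincare inequality u may only be paired with functions sum_i d_i psi_i + Y psi_0, since no
   derivative of u in the higher blocks is available; the smooth step, an explicit primitive of the
   bump, turns the difference of two product bumps into derivatives of compactly supported
   functions. The local estimates are proved on the unit cube for the record [wsol], whose constants
   are invariant under the maps [Phi q e], and are then transported to boxes. The factor of the L^2
   term on the larger box has to be arbitrarily small, because Gehring's argument absorbs it only
   after comparing the volumes of enlarged boxes. *)
From HB Require Import structures.
From mathcomp Require Import all_boot all_order all_algebra.
From mathcomp Require Import all_classical all_reals all_analysis.
From mathcomp Require Import measurable_realfun.
From mathcomp Require Import ring lra.
Require Import Defs.

Set Implicit Arguments.
Unset Strict Implicit.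
Unset Printing Implicit Defensive.
Import Order.TTheory GRing.Theory Num.Theory.
Import numFieldNormedType.Exports.
Local Open Scope classical_set_scope.
Local Open Scope ring_scope.

(** * Integrable and square integrable functions on a measure space *)

Section square_integrable.
Context d (T : measurableType d) (R : realType).
Variable mu : {measure set T -> \bar R}.
Implicit Types (f g b : T -> R) (D : set T).

Definition intg f := mu.-integrable setT (EFin \o f).

(** Measurability is a separate clause, since that of the square does not imply it. *)
Definition sq f := measurable_fun setT f /\ intg (fun x => f x ^+ 2).

Lemma intg_meas f : intg f -> measurable_fun setT f.
Proof. by move=> /measurable_int/measurable_EFinP. Qed.

Lemma intg_le f g : measurable_fun setT f -> (forall x, `|f x| <= g x) ->
  intg g -> intg f.
Proof.
move=> mf fg; apply: le_integrable => //; first exact/measurable_EFinP.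
by move=> x _ /=; rewrite lee_fin (le_trans (fg x))// ler_norm.
Qed.

Lemma intgD f g : intg f -> intg g -> intg (fun x => f x + g x).
Proof.
move=> fi gi; have := integrableD measurableT fi gi.
by apply: eq_integrable.
Qed.

Lemma intgZ (c : R) f : intg f -> intg (fun x => c * f x).
Proof.
move=> fi; have := integrableZl measurableT c fi.
by apply: eq_integrable.
Qed.

Lemma intgN f : intg f -> intg (fun x => - f x).
Proof. by move=> /(intgZ (-1)); under eq_fun do rewrite mulN1r. Qed.

Lemma intgB f g : intg f -> intg g -> intg (fun x => f x - g x).
Proof. by move=> fi gi; apply: intgD => //; exact: intgN. Qed.

Lemma intg0 : intg (fun=> 0).
Proof. exact: integrable0. Qed.

Lemma intg_sum (I : Type) (s : seq I) (P : pred I) (F : I -> T -> R) :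
  (forall i, P i -> intg (F i)) -> intg (fun x => \sum_(i <- s | P i) F i x).
Proof.
move=> Fi; elim: s => [|i s IH].
  by under eq_fun do rewrite big_nil; exact: intg0.
have [Pi|/negbTE nPi] := boolP (P i); last first.
  by under eq_fun do rewrite big_cons nPi.
under eq_fun do rewrite big_cons Pi.
by apply: intgD; [exact: Fi|exact: IH].
Qed.

Lemma intg_abs f : intg f -> intg (fun x => `|f x|).
Proof. by move=> /integrable_norm. Qed.

Lemma intgMb b f (C : R) : measurable_fun setT b -> (forall x, `|b x| <= C) ->
  intg f -> intg (fun x => b x * f x).
Proof.
move=> mb bC fi; apply: (@intg_le _ (fun x => C * `|f x|)).
- by apply: measurable_funM => //; exact: intg_meas.
- by move=> x; rewrite normrM ler_wpM2r.
- by apply: intgZ; exact: intg_abs.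
Qed.

Lemma intg_indic_fin D : measurable D -> (mu D < +oo)%E -> intg (\1_D).
Proof.
move=> mD Dfin; apply/integrableP; split; first exact/measurable_EFinP.
under eq_integral do rewrite /= ger0_norm//.
by rewrite integral_indic// setIT.
Qed.

Lemma IntD f g : intg f -> intg g ->
  \int[mu]_x (f x + g x) = \int[mu]_x f x + \int[mu]_x g x.
Proof. by move=> fi gi; rewrite RintegralD. Qed.

Lemma IntZ (c : R) f : intg f -> \int[mu]_x (c * f x) = c * \int[mu]_x f x.
Proof. by move=> fi; rewrite RintegralZl. Qed.

Lemma IntB f g : intg f -> intg g ->
  \int[mu]_x (f x - g x) = \int[mu]_x f x - \int[mu]_x g x.
Proof. by move=> fi gi; rewrite RintegralB. Qed.

Lemma IntN f : intg f -> \int[mu]_x (- f x) = - \int[mu]_x f x.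
Proof.
move=> fi; under eq_Rintegral do rewrite -mulN1r.
by rewrite IntZ// mulN1r.
Qed.

Lemma Int0 : \int[mu]_x (0 : R) = 0.
Proof. by rewrite /Rintegral integral0. Qed.

Lemma Int_sum (I : Type) (s : seq I) (P : pred I) (F : I -> T -> R) :
  (forall i, P i -> intg (F i)) ->
  \int[mu]_x (\sum_(i <- s | P i) F i x) = \sum_(i <- s | P i) \int[mu]_x F i x.
Proof.
move=> Fi; elim: s => [|i s IH].
  by under eq_Rintegral do rewrite big_nil; rewrite big_nil Int0.
have [Pi|/negbTE nPi] := boolP (P i); last first.
  by under eq_Rintegral do rewrite big_cons nPi; rewrite big_cons nPi.
under eq_Rintegral do rewrite big_cons Pi.
rewrite big_cons Pi.
by rewrite IntD// ?IH//; [exact: Fi|exact: intg_sum].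
Qed.

Lemma Int_le f g : intg f -> intg g -> (forall x, f x <= g x) ->
  \int[mu]_x f x <= \int[mu]_x g x.
Proof. by move=> fi gi fg; apply: le_Rintegral. Qed.

Lemma Int_norm f : intg f -> `|\int[mu]_x f x| <= \int[mu]_x `|f x|.
Proof. exact: le_normr_Rintegral. Qed.

Lemma Int_ge0 f : (forall x, 0 <= f x) -> 0 <= \int[mu]_x f x.
Proof. by move=> f0; apply: Rintegral_ge0. Qed.

Lemma IntE f : intg f -> (\int[mu]_x f x)%:E = (\int[mu]_x (f x)%:E)%E.
Proof. by move=> fi; rewrite /Rintegral fineK//; exact: integrable_fin_num. Qed.

Lemma intg_lty f : measurable_fun setT f -> (forall x, 0 <= f x) ->
  (\int[mu]_x (f x)%:E < +oo)%E -> intg f.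
Proof.
move=> mf f0 fi; apply/integrableP; split; first exact/measurable_EFinP.
by under eq_integral do rewrite /= ger0_norm//.
Qed.

Lemma sq_meas f : sq f -> measurable_fun setT f. Proof. by case. Qed.

Lemma sq_intg2 f : sq f -> intg (fun x => f x ^+ 2). Proof. by case. Qed.

Lemma sq_mul f g : sq f -> sq g -> intg (fun x => f x * g x).
Proof.
move=> [mf fi] [mg gi]; apply: intg_le (intgD fi gi).
  exact: measurable_funM.
move=> x; rewrite normrM -(real_normK (num_real (f x))) -(real_normK (num_real (g x))).
by nra.
Qed.

Lemma sqD f g : sq f -> sq g -> sq (fun x => f x + g x).
Proof.
move=> sf sg; split; first by apply: measurable_funD; apply: sq_meas.
have -> : (fun x => (f x + g x) ^+ 2) =
  (fun x => (f x ^+ 2 + g x ^+ 2) + 2 * (f x * g x)).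
  by apply/funext => x; ring.
apply: intgD; last by apply: intgZ; exact: sq_mul.
by apply: intgD; apply: sq_intg2.
Qed.

Lemma sqMb b f (C : R) : measurable_fun setT b -> (forall x, `|b x| <= C) ->
  sq f -> sq (fun x => b x * f x).
Proof.
move=> mb bC [mf fi]; split; first exact: measurable_funM.
under eq_fun do rewrite exprMn.
apply: (@intgMb _ _ (C ^+ 2)) => //; first exact: measurable_funX.
by move=> x; rewrite normrX lerXn2r// nnegrE (le_trans _ (bC x)).
Qed.

Lemma sqZ (c : R) f : sq f -> sq (fun x => c * f x).
Proof. by move=> sf; apply: (@sqMb _ _ `|c|). Qed.

Lemma sqN f : sq f -> sq (fun x => - f x).
Proof. by move=> /(sqZ (-1)); under eq_fun do rewrite mulN1r. Qed.

Lemma sqB f g : sq f -> sq g -> sq (fun x => f x - g x).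
Proof. by move=> sf sg; apply: sqD => //; exact: sqN. Qed.

Lemma sq0 : sq (fun=> 0).
Proof.
by split => //; under eq_fun do rewrite expr0n/=; exact: intg0.
Qed.

Lemma sq_sum (I : Type) (s : seq I) (P : pred I) (F : I -> T -> R) :
  (forall i, P i -> sq (F i)) -> sq (fun x => \sum_(i <- s | P i) F i x).
Proof.
move=> Fi; elim: s => [|i s IH].
  by under eq_fun do rewrite big_nil; exact: sq0.
have [Pi|/negbTE nPi] := boolP (P i); last first.
  by under eq_fun do rewrite big_cons nPi.
under eq_fun do rewrite big_cons Pi.
by apply: sqD; [exact: Fi|exact: IH].
Qed.

Lemma sq_le f g : measurable_fun setT f -> (forall x, `|f x| <= `|g x|) ->
  sq g -> sq f.
Proof.
move=> mf fg [mg gi]; split => //; apply: intg_le gi; first exact: measurable_funX.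
move=> x; rewrite normrX -(real_normK (num_real (g x))) lerXn2r// nnegrE//.
Qed.

Lemma sq_abs f : sq f -> sq (fun x => `|f x|).
Proof.
move=> sf; apply: (sq_le _ _ sf) => [|x]; last by rewrite normr_id.
by apply: measurableT_comp => //; exact: sq_meas.
Qed.

Lemma sq_indic D : measurable D -> (mu D < +oo)%E -> sq (\1_D).
Proof.
move=> mD Dfin; split => //.
have -> : (fun x => (\1_D x : R) ^+ 2) = \1_D.
  by apply/funext => x; rewrite indicE; case: (_ \in _); rewrite ?expr1n ?expr0n.
exact: intg_indic_fin.
Qed.

Lemma sq_bounded f D (C : R) : measurable D -> (mu D < +oo)%E ->
  measurable_fun setT f -> (forall x, `|f x| <= C) -> (forall x, ~ D x -> f x = 0) ->
  sq f.
Proof.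
move=> mD Dfin mf fC f0.
have -> : f = (fun x => f x * \1_D x).
  apply/funext => x; rewrite indicE; case: (boolP (x \in D)) => [_|/negP]; rewrite ?mulr1//.
  by rewrite inE => /f0 ->; rewrite mul0r.
by apply: sqMb fC _ => //; exact: sq_indic.
Qed.

(** The quadratic form in (s, t) given by the integral of (s f + t g)^2 is nonnegative; at (c, - b)
    its value is c (a c - b^2). *)
Lemma cauchy_schwarz f g : sq f -> sq g ->
  (\int[mu]_x (f x * g x)) ^+ 2 <= (\int[mu]_x f x ^+ 2) * (\int[mu]_x g x ^+ 2).
Proof.
move=> sf sg.
set a := \int[mu]_x f x ^+ 2; set c := \int[mu]_x g x ^+ 2; set b := \int[mu]_x _.
have a0 : 0 <= a by apply: Int_ge0 => x; exact: sqr_ge0.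
have c0 : 0 <= c by apply: Int_ge0 => x; exact: sqr_ge0.
have H (s t : R) : 0 <= s ^+ 2 * a + 2 * s * t * b + t ^+ 2 * c.
  have -> : s ^+ 2 * a + 2 * s * t * b + t ^+ 2 * c =
    \int[mu]_x ((s * f x + t * g x) ^+ 2).
    have fg := sq_mul sf sg.
    have [f2 g2] := (sq_intg2 sf, sq_intg2 sg).
    rewrite /a /b /c -(IntZ (s ^+ 2) f2) -(IntZ (2 * s * t) fg) -(IntZ (t ^+ 2) g2).
    have [i1 i2 i3] : [/\ intg (fun x => s ^+ 2 * f x ^+ 2),
      intg (fun x => 2 * s * t * (f x * g x)) & intg (fun x => t ^+ 2 * g x ^+ 2)].
      by split; apply: intgZ.
    rewrite -(IntD i1 i2) -(IntD (intgD i1 i2) i3).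
    by apply: eq_Rintegral => x _; ring.
  by apply: Int_ge0 => x; exact: sqr_ge0.
have [c00|cn0] := eqVneq c 0.
  have [->|bn0] := eqVneq b 0; first by rewrite expr0n/= mulr_ge0.
  (* With c = 0 and b nonzero this point would give the form the value -1. *)
  have := H 1 (- (a + 1) / (2 * b)); rewrite c00 (_ : _ + _ = - 1); last by field.
  by rewrite ler0N1.
have cpos : 0 < c by rewrite lt_neqAle eq_sym cn0.
have := H c (- b).
rewrite (_ : _ + _ = c * (a * c - b ^+ 2)); last by ring.
by rewrite pmulr_rge0// subr_ge0.
Qed.

End square_integrable.

(** * Change of variables for maps that scale a measure *)

Section change_of_variables.
Context d1 d2 (X : measurableType d1) (Y : measurableType d2) (R : realType).
Variables (nu : {measure set X -> \bar R}) (mu : {measure set Y -> \bar R}).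
Variables (phi : X -> Y) (c : {nonneg R}).
Hypothesis mphi : measurable_fun setT phi.
Hypothesis phiE : forall A, measurable A -> nu (phi @^-1` A) = (c%:num%:E * mu A)%E.

Lemma ge0_int_cov (f : Y -> \bar R) : measurable_fun setT f ->
  (forall y, 0 <= f y)%E ->
  (\int[nu]_x f (phi x) = c%:num%:E * \int[mu]_y f y)%E.
Proof.
move=> mf f0.
have := ge0_integral_pushforward mphi nu measurableT mf (fun y _ => f0 y).
rewrite preimage_setT => <-.
rewrite -ge0_integral_mscale//.
apply: (eq_measure_integral (mscale c mu)) => A mA _.
exact: phiE.
Qed.

Lemma intg_cov (f : Y -> R) : intg mu f -> intg nu (f \o phi).
Proof.
move=> fi; have mf := intg_meas fi.
apply/integrableP; split.
  by apply/measurable_EFinP; exact: measurableT_comp.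
have := @ge0_int_cov (fun y => `|f y|%:E).
rewrite /= => ->//; last first.
  by apply/measurable_EFinP; exact: measurableT_comp.
by move/integrableP : fi => [_ fi]; rewrite lte_mul_pinfty// lee_fin.
Qed.

Lemma sq_cov (f : Y -> R) : sq mu f -> sq nu (f \o phi).
Proof.
move=> [mf fi]; split; first exact: measurableT_comp.
exact: (intg_cov fi).
Qed.

Lemma Int_cov (f : Y -> R) : intg mu f ->
  \int[nu]_x f (phi x) = c%:num * \int[mu]_y f y.
Proof.
move=> fi; have mf := intg_meas fi.
have mp : measurable_fun setT (f^\+) by exact: measurable_funrpos.
have mn : measurable_fun setT (f^\-) by exact: measurable_funrneg.
have pE (g : Y -> R) : measurable_fun setT g -> (forall x, 0 <= g x) -> intg mu g ->
    \int[nu]_x g (phi x) = c%:num * \int[mu]_y g y.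
  move=> mg g0 gi; apply: EFin_inj.
  rewrite IntE; last exact: intg_cov.
  rewrite EFinM IntE//.
  by rewrite (@ge0_int_cov (EFin \o g))//; exact/measurable_EFinP.
have fip : intg mu (f^\+) by exact: integrable_funrpos.
have fin : intg mu (f^\-) by exact: integrable_funrneg.
have E1 x : f x = f^\+ x - f^\- x by rewrite -[in LHS](funrposBneg f) fctE.
under eq_Rintegral do rewrite E1.
under [in RHS]eq_Rintegral do rewrite E1.
rewrite !IntB//; try exact: (intg_cov _).
rewrite !pE//; first by rewrite mulrBr.
Qed.

End change_of_variables.

(* The unapplied name, where a section fixes the measure in an abbreviation. *)
Notation intg_of := intg.
Notation sq_of := sq.

Lemma quarter_gt0 (R : realFieldType) (x : R) : 0 < x -> 0 < x / 4.
Proof. by move=> x0; lra. Qed.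

Lemma cvg_sqr (R : realType) (u : nat -> R) (l : R) :
  u n @[n --> \oo] --> l -> u n ^+ 2 @[n --> \oo] --> l ^+ 2.
Proof. by move=> H; under eq_fun do rewrite expr2; rewrite expr2; exact: (cvgM H H). Qed.

(** * Dominated convergence and density in L^2 *)

Section dominated.
Context d (T : measurableType d) (R : realType).
Variable mu : {measure set T -> \bar R}.

Lemma Int_dct (f_ : nat -> T -> R) (f g : T -> R) :
  (forall n, measurable_fun setT (f_ n)) -> measurable_fun setT f ->
  (forall x, f_ n x @[n --> \oo] --> f x) ->
  (forall n x, `|f_ n x| <= g x) -> intg mu g ->
  \int[mu]_x f_ n x @[n --> \oo] --> \int[mu]_x f x.
Proof.
move=> mf_ mf f_f f_g gi.
have [] := @dominated_convergence _ T R mu setT measurableT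
  (fun n x => (f_ n x)%:E) (EFin \o f) (EFin \o g).
- by move=> n; apply/measurable_EFinP.
- exact/measurable_EFinP.
- by apply: aeW => x _; apply: cvg_EFin; [exact: nearW|exact: f_f].
- exact: gi.
- by apply: aeW => x n _ /=; rewrite lee_fin f_g.
move=> fi _; rewrite /Rintegral => H.
apply: fine_cvg; rewrite fineK; last exact: integrable_fin_num.
exact: H.
Qed.

Definition sqd (a b : T -> R) : R := \int[mu]_x (a x - b x) ^+ 2.

Lemma sqd_ge0 a b : 0 <= sqd a b.
Proof. by apply: Int_ge0 => x; exact: sqr_ge0. Qed.

Lemma sqd_tri a b c : sq mu a -> sq mu b -> sq mu c ->
  sqd a c <= 2 * sqd a b + 2 * sqd b c.
Proof.
move=> sa sb sc; rewrite /sqd.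
have [i1 i2 i3] : [/\ intg mu (fun x => (a x - b x) ^+ 2),
  intg mu (fun x => (b x - c x) ^+ 2) & intg mu (fun x => (a x - c x) ^+ 2)].
  by split; apply: (@sq_intg2 _ _ _ mu (fun x => _)); exact: sqB.
rewrite -(IntZ _ i1) -(IntZ _ i2) -IntD; try exact: intgZ.
apply: Int_le => //; first by apply: intgD; exact: intgZ.
by move=> x; have := sqr_ge0 (a x - 2 * b x + c x); nra.
Qed.

Lemma sqd_dct (a : T -> R) (b : nat -> T -> R) (h : T -> R) :
  sq mu a -> sq mu h -> (forall n, measurable_fun setT (b n)) ->
  (forall n x, `|a x - b n x| <= `|h x|) ->
  (forall x, b n x @[n --> \oo] --> a x) ->
  sqd a (b n) @[n --> \oo] --> 0.
Proof.
move=> sa sh mb ab ba; rewrite -(Int0 mu).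
apply: (@Int_dct _ _ (fun x => h x ^+ 2)); last exact: sq_intg2.
- move=> n; apply: measurable_funX; apply: measurable_funB => //; exact: (sq_meas sa).
- exact: measurable_cst.
- move=> x; have H : (a x - b n x) @[n --> \oo] --> a x - a x.
    by apply: cvgB; [exact: cvg_cst|exact: ba].
  by have := cvg_sqr H; rewrite subrr expr0n.
- move=> n x; rewrite normrX -(real_normK (num_real (h x))).
  by rewrite lerXn2r// nnegrE.
Qed.

End dominated.

Section density.
Context d (T : measurableType d) (R : realType).
Variable mu : {measure set T -> \bar R}.
Variables (G : set (set T)) (g : (set T)^nat) (K : set (T -> R)).
Hypotheses (mG : measurable = <<s G >>) (setIG : setI_closed G).
Hypotheses (Gg : forall i, G (g i)) (ndg : nondecreasing_seq g).
Hypothesis g_cover : forall x, exists k, g k x.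
Hypothesis gfin : forall k, (mu (g k) < +oo)%E.
Hypothesis K0 : K (fun=> 0).
Hypothesis KD : forall a b, K a -> K b -> K (fun x => a x + b x).
Hypothesis KZ : forall c a, K a -> K (fun x => c * a x).
Hypothesis Ksq : forall a, K a -> sq mu a.
Hypothesis KG : forall A, G A -> forall eta : R, 0 < eta ->
  exists2 chi, K chi & sqd mu (\1_A) chi <= eta.

Let dens a := sq mu a /\ forall eta : R, 0 < eta ->
  exists2 chi, K chi & sqd mu a chi <= eta.

Let dens_lim a : sq mu a -> (forall eta : R, 0 < eta ->
  exists2 b, dens b & sqd mu a b <= eta) -> dens a.
Proof.
move=> sa H; split => // eta eta0.
have [b [sb Hb] ab] := H (eta / 4) (quarter_gt0 eta0).
have [chi Kchi bchi] := Hb (eta / 4) (quarter_gt0 eta0).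
exists chi => //; have := sqd_tri sa sb (Ksq Kchi).
by move: ab bchi; set u := sqd _ _ _; set v := sqd _ _ _; set w := sqd _ _ _; lra.
Qed.

Let densD a b : dens a -> dens b -> dens (fun x => a x + b x).
Proof.
move=> [sa Ha] [sb Hb]; split; first exact: sqD.
move=> eta eta0.
have [chi Kchi achi] := Ha (eta / 4) (quarter_gt0 eta0).
have [psi Kpsi bpsi] := Hb (eta / 4) (quarter_gt0 eta0).
exists (fun x => chi x + psi x); first exact: KD.
rewrite (@le_trans _ _ (2 * sqd mu a chi + 2 * sqd mu b psi))//; last by lra.
have [schi spsi] := (Ksq Kchi, Ksq Kpsi).
have [i1 i2] : intg mu (fun x => (a x - chi x) ^+ 2) /\
  intg mu (fun x => (b x - psi x) ^+ 2).
  by split; apply: (@sq_intg2 _ _ _ mu (fun x => _)); exact: sqB.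
rewrite /sqd -(IntZ _ i1) -(IntZ _ i2) -IntD; try exact: intgZ.
apply: Int_le => //.
- apply: (@sq_intg2 _ _ _ mu (fun x => _)); apply: sqB; exact: sqD.
- by apply: intgD; exact: intgZ.
- by move=> x; have := sqr_ge0 ((a x - chi x) - (b x - psi x)); nra.
Qed.

Let densZ (c : R) a : dens a -> dens (fun x => c * a x).
Proof.
move=> [sa Ha]; split; first exact: sqZ.
move=> eta eta0.
have c1 : 0 < c ^+ 2 + 1 by have := sqr_ge0 c; lra.
have [chi Kchi achi] := Ha (eta / (c ^+ 2 + 1)) (divr_gt0 eta0 c1).
exists (fun x => c * chi x); first exact: KZ.
have i1 : intg mu (fun x => (a x - chi x) ^+ 2).
  by apply: (@sq_intg2 _ _ _ mu (fun x => _)); apply: sqB => //; exact: Ksq.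
rewrite /sqd; under eq_Rintegral do rewrite -mulrBr exprMn.
rewrite IntZ//; move: achi; rewrite ler_pdivlMr// => /(le_trans _); apply.
by rewrite mulrC ler_wpM2l ?sqd_ge0//; lra.
Qed.

Let dens_sum (I : Type) (s : seq I) (F : I -> T -> R) :
  (forall i, dens (F i)) -> dens (fun x => \sum_(i <- s) F i x).
Proof.
move=> HF; elim: s => [|i s IH].
  under eq_fun do rewrite big_nil.
  split; first exact: sq0.
  move=> eta eta0; exists (fun=> 0) => //; rewrite /sqd.
  by under eq_Rintegral do rewrite subrr expr0n/=; rewrite Int0 ltW.
by under eq_fun do rewrite big_cons; exact: densD.
Qed.

Let mg k : measurable (g k).
Proof. by rewrite mG; exact: sub_sigma_algebra. Qed.

(** The pi-lambda theorem, starting from the generators in [G]. Intersecting with [g k] keeps all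
    measures finite, so that differences and increasing unions remain square integrable limits. *)
Let dens_setI k E : measurable E -> dens (\1_(E `&` g k)).
Proof.
have smallE (A : set T) : measurable A -> (mu (A `&` g k) < +oo)%E.
  move=> mA; apply: le_lt_trans (gfin k).
  by apply: le_measure => //; rewrite inE//; exact: measurableI.
pose H := [set E | measurable E /\ dens (\1_(E `&` g k))].
suff: measurable `<=` H by move=> + mE => /(_ E mE) [].
rewrite mG; apply: lambda_system_subset => //; last first.
- move=> A GA; split; first by rewrite mG; exact: sub_sigma_algebra.
  split; last by apply: KG; exact: setIG.
  apply: sq_indic; last by apply: smallE; rewrite mG; exact: sub_sigma_algebra.
  by apply: measurableI => //; rewrite mG; exact: sub_sigma_algebra.
split => //.
- split => //; rewrite setTI; split; last exact: KG.
  exact: sq_indic.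
- move=> A B BA [mA HA] [mB HB]; split; first exact: measurableD.
  have -> : \1_((A `\` B) `&` g k) =
    (fun x => \1_(A `&` g k) x + (-1) * \1_(B `&` g k) x) :> (T -> R).
    apply/funext => x; rewrite !indicE setDE !in_setI in_setC.
    have [xB|xB] := boolP (x \in B).
      have -> : x \in A by rewrite inE; apply: BA; rewrite inE in xB.
      by case: (x \in g k) => /=; ring.
    by case: (x \in A); case: (x \in g k) => /=; ring.
  by apply: densD => //; exact: densZ.
- move=> F ndF HF; split; first by apply: bigcupT_measurable => n; have [] := HF n.
  have mF n : measurable (F n) by have [] := HF n.
  have mUF : measurable (\bigcup_n F n) by exact: bigcupT_measurable.
  have sU : sq mu (\1_(\bigcup_n F n `&` g k)).
    by apply: sq_indic; [exact: measurableI|exact: smallE].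
  apply: dens_lim => // eta eta0.
  have : sqd mu (\1_(\bigcup_n F n `&` g k)) (\1_(F n `&` g k)) @[n --> \oo] --> 0.
    apply: (@sqd_dct _ _ _ _ _ _ (\1_(\bigcup_n F n `&` g k))) => //.
    + by move=> n; apply: measurable_indic; exact: measurableI.
    + move=> n x; rewrite !indicE !in_setI; case: (boolP (x \in F n)) => xF.
        rewrite (mem_set (_ : (\bigcup_n F n) x)); last first.
          by exists n => //; rewrite inE in xF.
        by rewrite subrr normr0.
      by rewrite subr0.
    + move=> x; apply: cvg_near_cst.
      have [[n _ Fnx]|nF] := pselect ((\bigcup_n F n) x); last first.
        apply: nearW => n; rewrite !indicE !in_setI (memNset nF).
        by rewrite (memNset (_ : ~ F n x))// => Fnx; apply: nF; exists n.
      near=> p; rewrite !indicE !in_setI (mem_set (_ : (\bigcup_n F n) x))//; last by exists n.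
      rewrite mem_set//.
      have np : (n <= p)%N by near: p; exists n.
      by have /subsetPset := ndF _ _ np; exact.
  move=> /cvgr0_norm_le /(_ eta eta0) [n _ /(_ n (leqnn _))] Hn.
  exists (\1_(F n `&` g k)); first by have [] := HF n.
  by apply: le_trans Hn; exact: ler_norm.
Unshelve. all: by end_near. Qed.

Import HBSimple HBNNSimple.

(** Positive and negative parts reduce the claim to nonnegative functions, these are L^2 limits of
    simple functions supported in some [g n], and indicators are covered by [dens_setI]. *)
Lemma sq_density a : sq mu a -> forall eta : R, 0 < eta ->
  exists2 chi, K chi & sqd mu a chi <= eta.
Proof.
suff pos a0 : sq mu a0 -> (forall x, 0 <= a0 x) -> dens a0.
  move=> sa; have [ma _] := sa.
  suff : dens a by case.
  have sp : sq mu a^\+.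
    apply: (sq_le _ _ sa); first exact: measurable_funrpos.
    move=> x; rewrite /funrpos ger0_norm ?le_max ?lexx ?orbT//.
    by rewrite ge_max ler_norm normr_ge0.
  have sn : sq mu a^\-.
    apply: (sq_le _ _ sa); first exact: measurable_funrneg.
    move=> x; rewrite /funrneg ger0_norm ?le_max ?lexx ?orbT//.
    by rewrite ge_max normr_ge0 -normrN ler_norm.
  have -> : a = (fun x => a^\+ x + (-1) * a^\- x).
    apply/funext => x; rewrite mulN1r.
    by rewrite -[in LHS](funrposBneg a) fctE.
  by apply: densD; [|apply: densZ]; apply: pos => //; move=> x; rewrite le_max lexx orbT.
move=> sa0 a00; apply: dens_lim => // eta eta0.
have ma0 : measurable_fun setT (EFin \o a0) by apply/measurable_EFinP; exact: sq_meas sa0.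
pose f_ := nnsfun_approx measurableT ma0.
(* Cutting the simple function to [g n] makes it a finite combination of indicators of sets [E]
   intersected with [g n]. *)
pose b n := fun x => f_ n x * \1_(g n) x.
have f_cvg x : f_ n x @[n --> \oo] --> a0 x.
  have := @cvg_nnsfun_approx _ _ _ _ measurableT _ ma0 (fun x _ => a00 x) x I.
  by move=> /fine_cvg.
have fle n x : 0 <= f_ n x <= a0 x.
  rewrite fun_ge0/= -(cvg_lim _ (f_cvg x))//.
  apply: (@nondecreasing_cvgn_le _ (fun n => f_ n x)) => [p q pq|].
    by have /lefP := nd_nnsfun_approx measurableT ma0 pq; exact.
  by apply/cvg_ex; exists (a0 x).
have : sqd mu a0 (b n) @[n --> \oo] --> 0.
  apply: (@sqd_dct _ _ _ _ _ _ a0) => //.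
  - by move=> n; apply: measurable_funM => //; exact: measurable_indic.
  - move=> n x; have /andP[f0 fa] := fle n x; rewrite /b indicE.
    have ? := a00 x.
    by case: (x \in g n); rewrite ?mulr1 ?mulr0 ?subr0// !ger0_norm//; lra.
  - move=> x; have [k gkx] := g_cover x.
    apply: (@cvg_trans _ (f_ n x @[n --> \oo])); last first.
      exact: f_cvg.
    apply: near_eq_cvg; near=> n; rewrite /b indicE mem_set ?mulr1//.
    have kn : (k <= n)%N by near: n; exists k.
    by have /subsetPset := ndg kn; exact.
move=> /cvgr0_norm_le /(_ eta eta0) [n _ /(_ n (leqnn _))] Hn.
exists (b n); last by apply: le_trans Hn; exact: ler_norm.
have -> : b n = fun x => \sum_(y <- finmap.enum_fset (fset_set (range (f_ n)))) y * \1_(f_ n @^-1` [set y] `&` g n) x.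
  apply/funext => x; rewrite /b fimfunE fsbig_finite//= mulr_suml.
  by apply: eq_bigr => y _; rewrite !indicE in_setI -mulrA; case: (x \in g n); rewrite ?andbT ?andbF ?mulr1 ?mulr0.
apply: dens_sum => y; apply: densZ; apply: dens_setI.
exact: measurable_funPTI.
Unshelve. all: by end_near. Qed.

End density.

(** * Continuity in L^2 of composition *)

Section composition.
Context d (T : measurableType d) (R : realType).
Variables (mu : {measure set T -> \bar R}) (K : set (T -> R)).
Hypothesis Ksq : forall a, K a -> sq mu a.
Hypothesis sq_density : forall a, sq mu a -> forall eta : R, 0 < eta ->
  exists2 chi, K chi & sqd mu a chi <= eta.

(** Approximate [a] by [chi] in [K]. The two errors a - chi, composed with [s_ n] and with [s], are
    controlled by the bounds on the compositions, uniformly in n; the middle term tends to 0 by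
    dominated convergence, as [chi] is bounded and passes to the limit pointwise. Through [avg_cvg],
    this plays the part of Lebesgue's differentiation theorem below. *)
Lemma sq_comp_cvg d' (X : measurableType d') (nu : {measure set X -> \bar R})
    (D : set X) (s_ : nat -> X -> T) (s : X -> T) (C : R) :
  0 <= C -> measurable D -> (nu D < +oo)%E ->
  (forall n, measurable_fun setT (s_ n)) -> measurable_fun setT s ->
  (forall n (f : T -> \bar R), measurable_fun setT f -> (forall y, 0 <= f y)%E ->
     (\int[nu]_(x in D) f (s_ n x) <= C%:E * \int[mu]_y f y)%E) ->
  (forall (f : T -> \bar R), measurable_fun setT f -> (forall y, 0 <= f y)%E ->
     (\int[nu]_(x in D) f (s x) <= C%:E * \int[mu]_y f y)%E) ->
  (forall chi, K chi -> (exists M, forall y, `|chi y| <= M) /\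
     forall x, D x -> chi (s_ n x) @[n --> \oo] --> chi (s x)) ->
  forall a, sq mu a -> forall eta : R, 0 < eta -> \forall n \near \oo,
  (\int[nu]_(x in D) ((a (s_ n x) - a (s x)) ^+ 2)%:E <= eta%:E)%E.
Proof.
move=> C0 mD Dfin ms_ ms s_le s_le0 Kc a sa eta eta0.
(* The three terms of the splitting cost at most (6 C + 3) [e1] in total. *)
pose e1 := eta / (12 * C + 4).
have e10 : 0 < e1 by apply: divr_gt0 => //; lra.
have [chi Kchi achi] := sq_density sa e10.
have [[M chiM] chis] := Kc _ Kchi.
have schi := Ksq Kchi.
have ma : measurable_fun setT a by exact: sq_meas sa.
have mchi : measurable_fun setT chi by exact: sq_meas schi.
pose e y := (a y - chi y) ^+ 2.
have me : measurable_fun setT e.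
  by apply: measurable_funX; exact: measurable_funB.
have ei : (\int[mu]_y (e y)%:E <= e1%:E)%E.
  rewrite -IntE ?lee_fin//.
  by apply: (@sq_intg2 _ _ _ mu (fun x => _)); exact: sqB.
pose J n x := (chi (s_ n x) - chi (s x)) ^+ 2.
have mJ n : measurable_fun setT (J n).
  by apply: measurable_funX; apply: measurable_funB; exact: measurableT_comp.
have e0 y : 0 <= e y by exact: sqr_ge0.
have J0 n x : 0 <= J n x by exact: sqr_ge0.
have HJ : (\int[nu]_(x in D) (J n x)%:E)%E @[n --> \oo] --> 0%E.
  have [] := @dominated_convergence _ X R nu D mD (fun n x => (J n x)%:E) (cst 0%E)
    (EFin \o cst (4 * M ^+ 2)).
  - by move=> n; apply/measurable_EFinP; exact: measurable_funTS.
  - exact: measurable_cst.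
  - apply: aeW => x Dx; apply: cvg_EFin; first exact: nearW.
    have H : (chi (s_ n x) - chi (s x)) @[n --> \oo] --> chi (s x) - chi (s x).
      by apply: cvgB; [exact: chis|exact: cvg_cst].
    by have := cvg_sqr H; rewrite subrr expr0n.
  - apply/integrableP; split; first exact/measurable_EFinP.
    rewrite (eq_integral (cst `|4 * M ^+ 2|%:E)) ?integral_cst//.
    by rewrite lte_mul_pinfty// lee_fin.
  - apply: aeW => x n _ /=; rewrite lee_fin ger0_norm// /J.
    have := chiM (s_ n x); have := chiM (s x); rewrite !ler_norml => /andP[? ?] /andP[? ?].
    nra.
  by move=> _ _; rewrite integral0.
have [HJfin /cvgr0_norm_le /(_ _ e10) HJ1] := (fine_cvgP _ _).1 HJ.
near=> n.
have Jn : (\int[nu]_(x in D) (J n x)%:E <= e1%:E)%E.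
  rewrite -(@fineK _ (\int[nu]_(x in D) (J n x)%:E)%E); last by near: n.
  by rewrite lee_fin (le_trans (ler_norm _))//; near: n.
have mD' (f : X -> R) : measurable_fun setT f -> measurable_fun D (EFin \o f).
  by move=> mf; apply/measurable_EFinP; exact: measurable_funTS.
have mes1 : measurable_fun setT (e \o s_ n) by exact: measurableT_comp.
have mes : measurable_fun setT (e \o s) by exact: measurableT_comp.
apply: (@le_trans _ _ (\int[nu]_(x in D) (3 * e (s_ n x) + (3 * J n x + 3 * e (s x)))%:E)%E).
  apply: ge0_le_integral => //.
  - by move=> x _; rewrite lee_fin sqr_ge0.
  - apply/measurable_EFinP; apply: measurable_funTS; apply: measurable_funX.
    by apply: measurable_funB; exact: measurableT_comp.
  - apply/measurable_EFinP; apply: measurable_funTS; apply: measurable_funD; first exact: measurable_funM.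
    by apply: measurable_funD; exact: measurable_funM.
  - move=> x _; rewrite lee_fin /e /J.
    move: (a (s_ n x)) (chi (s_ n x)) (chi (s x)) (a (s x)) => p q r t.
    have := sqr_ge0 ((p - q) - (q - r)); have := sqr_ge0 ((p - q) - (r - t)).
    by have := sqr_ge0 ((q - r) - (r - t)); nra.
under eq_integral do rewrite !EFinD !(EFinM 3).
have mZ (f : X -> R) : measurable_fun setT f -> measurable_fun D (fun x => 3%:E * (f x)%:E)%E.
  by move=> mf; apply: emeasurable_funM => //; exact: mD'.
have p0 (f : X -> R) : (forall x, 0 <= f x) -> forall x, D x -> (0 <= 3%:E * (f x)%:E)%E.
  by move=> f0 x _; rewrite mule_ge0 ?lee_fin.
rewrite ge0_integralD//; try exact: (p0 _ (fun x => e0 (s_ n x))); try exact: (mZ (e \o s_ n));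
  try by [apply: emeasurable_funD; [exact: (mZ (J n))|exact: (mZ (e \o s))]];
  try by [move=> x Dx; rewrite adde_ge0//; [exact: (p0 _ (J0 n))|exact: (p0 _ (fun x => e0 (s x)))]].
rewrite ge0_integralD//; try exact: (p0 _ (J0 n)); try exact: (mZ (J n)); try exact: (p0 _ (fun x => e0 (s x))); try exact: (mZ (e \o s)).
rewrite !ge0_integralZl_EFin//; try exact: (mD' (e \o s)); try exact: (mD' (J n)); try exact: (mD' (e \o s_ n)); try by move=> x _; rewrite lee_fin /=.
have em : measurable_fun setT (EFin \o e) by exact/measurable_EFinP.
have e0' y : (0 <= (EFin \o e) y)%E by rewrite lee_fin.
have H2 := s_le n _ em e0'; have H1 := s_le0 _ em e0'.
have Ce : (C%:E * \int[mu]_y (e y)%:E <= (C * e1)%:E)%E by rewrite EFinM lee_wpmul2l// lee_fin.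
have {}H1 := le_trans H1 Ce.
have {}H2 := le_trans H2 Ce.
apply: (@le_trans _ _ (3%:E * (C * e1)%:E + (3%:E * e1%:E + 3%:E * (C * e1)%:E))%E).
  by rewrite leeD ?leeD ?lee_pmul2l ?lte_fin//.
rewrite -!EFinM -!EFinD lee_fin.
have -> : eta = e1 * (12 * C + 4) by rewrite /e1; field; lra.
have : 0 <= C * e1 by apply: mulr_ge0 => //; exact: ltW.
lra.
Unshelve. all: by end_near. Qed.

End composition.

Lemma measurable_itvR (R : realType) (i : interval R) : measurable ([set` i] : set R).
Proof. exact: measurable_itv. Qed.

(** * Lebesgue measure under triangular affine maps *)

Section affine_line.
Context {R : realType}.
Implicit Types (A : set R).

Lemma measurable_affine (a c : R) : measurable_fun setT (fun y : R => a * y + c).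
Proof. by apply: measurable_funD => //; exact: measurable_funM. Qed.

(** The image measure multiplied by a agrees with Lebesgue measure on half-open intervals, which
    determine it. *)
Lemma lebesgue1_affine (a c : R) : 0 < a -> forall A, measurable A ->
  lebesgue1 ((fun y => a * y + c) @^-1` A) = ((a^-1)%:E * lebesgue1 A)%E.
Proof.
move=> a0.
pose phi := (fun y : R => a * y + c).
have mphi : measurable_fun [set: measurableTypeR R] (phi : measurableTypeR R -> measurableTypeR R).
  exact: measurable_affine.
pose m := mscale (NngNum (ltW a0)) (measure_function_pushforward__canonical__measure_function_Measure (@lebesgue_measure R) mphi).
have H : forall A, measurable A -> @lebesgue_measure R A = m A.
  apply: lebesgue_measure_unique => X [[u v] /= _ <-].
  rewrite /m /mscale/= /pushforward.
  have -> : phi @^-1` `]u, v] = `](u - c) / a, (v - c) / a]%classic.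
    apply/seteqP; split => y /=; rewrite !in_itv/= ltr_pdivrMr// ler_pdivlMr// /phi;
      rewrite ltrBlDr lerBrDr (mulrC y).
      by [].
    by [].
  rewrite !lebesgue_measure_itv/= !lte_fin ltr_pM2r ?invr_gt0// ltrD2r.
  case: ifPn => uv; last by rewrite mule0.
  rewrite -!EFinB -EFinM; congr EFin; field.
  by rewrite gt_eqF.
move=> A mA; rewrite /lebesgue1 (H A mA) /m /mscale/= /pushforward muleA -EFinM.
by rewrite mulVf ?mul1e// gt_eqF.
Qed.

Lemma ge0_int1_affine (a c : R) (f : R -> \bar R) : 0 < a ->
  measurable_fun setT f -> (forall y, 0 <= f y)%E ->
  (\int[lebesgue1]_y f (a * y + c)%R = (a^-1)%:E * \int[lebesgue1]_y f y)%E.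
Proof.
move=> a0 mf f0.
have a1 : 0 <= a^-1 by rewrite invr_ge0 ltW.
apply: (@ge0_int_cov _ _ _ _ _ _ _ _ (NngNum a1) (@measurable_affine a c)) => //.
exact: lebesgue1_affine.
Qed.

End affine_line.

Section lebesgue_col_sigma_finite.
Context {R : realType} (n : nat).

(** The same set function under a name to which the sigma-finite structure required by Tonelli's
    theorem can be attached. *)
Definition lcol : set 'cV[R]_n -> \bar R := lebesgue_col n.

Let lcol0 : lcol set0 = 0%E. Proof. exact: (measure0 (lebesgue_col n)). Qed.
Let lcol_ge0 A : (0 <= lcol A)%E. Proof. exact: (measure_ge0 (lebesgue_col n)). Qed.
Let lcol_sigma : semi_sigma_additive lcol.
Proof. exact: (@measure_semi_sigma_additive _ _ _ (lebesgue_col n)). Qed.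

HB.instance Definition _ := isMeasure.Build _ _ _ lcol lcol0 lcol_ge0 lcol_sigma.

Let cube (k : nat) : set 'cV[R]_n := [set x | forall i, `[- k%:R, k%:R]%classic (x i 0)].

Lemma sigma_finite_lebesgue_col : sigma_finite setT lcol.
Proof.
exists cube.
  apply/esym; rewrite -subTset => x _.
  have [k Hk] : exists k : nat, forall i, `|x i 0| <= k%:R.
    exists (\max_(i < n) Num.truncn (`|x i 0|)%R)%N.+1 => i.
    rewrite (le_trans (ltW (truncnS_gt _)))// ler_nat ltnS.
    exact: (leq_bigmax (F := fun i => Num.truncn `|x i 0|)).
  by exists k => // i; rewrite /= in_itv/= -ler_norml.
move=> k; split; first exact: (@measurable_box R n (fun=> `[- k%:R, k%:R]%classic) (fun=> measurable_itvR _)).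
have -> : lcol (cube k) = (\prod_(i < n) @lebesgue1 R (`[- k%:R, k%:R]%classic)%R)%E.
  exact: (@lebesgue_col_box R n (fun=> `[- k%:R, k%:R]%classic) (fun=> measurable_itvR _)).
suff : (\prod_(i < n) @lebesgue1 R (`[- k%:R, k%:R]%classic)%R)%E \is a fin_num.
  by rewrite fin_numElt => /andP[].
apply: (big_ind (fun x : \bar R => x \is a fin_num)) => //; first exact: fin_numM.
move=> i _; rewrite /lebesgue1 lebesgue_measure_itv/=.
by case: ifP.
Qed.

HB.instance Definition _ := Measure_isSigmaFinite.Build _ _ _ lcol
  sigma_finite_lebesgue_col.

End lebesgue_col_sigma_finite.

Section lebesgue_col_affine.
Context {R : realType}.

Lemma consc0 n (p : R * 'cV[R]_n) : consc p ord0 0 = p.1.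
Proof. by rewrite mxE unlift_none. Qed.

Lemma consc_lift n (p : R * 'cV[R]_n) j : consc p (lift ord0 j) 0 = p.2 j 0.
Proof. by rewrite mxE liftK. Qed.

Lemma ge0_int_consc n (f : 'cV[R]_n.+1 -> \bar R) :
  measurable_fun setT f -> (forall x, 0 <= f x)%E ->
  (\int[@lcol R n.+1]_x f x =
   \int[lebesgue1]_y \int[@lcol R n]_x f (consc (y, x)))%E.
Proof.
move=> mf f0.
have := @ge0_integral_pushforward _ _ _ _ R _ (@measurable_consc R n) (lebesgue1 \x^ @lcol R n)%E setT f measurableT mf (fun y _ => f0 y).
rewrite preimage_setT => H; transitivity (\int[(lebesgue1 \x^ @lcol R n)%E]_x (f \o @consc R n) x)%E; first exact: H.
have mfc : measurable_fun setT (f \o @consc R n).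
  by apply: measurableT_comp => //; exact: measurable_consc.
(* The two product measures, integrated in opposite orders, agree on rectangles and hence
   everywhere; this makes the first coordinate the outer variable. *)
have E12 A : measurable A -> (@lebesgue1 R \x^ @lcol R n)%E A = (@lebesgue1 R \x @lcol R n)%E A.
  move=> mA; apply/esym/product_measure_unique => // B C mB mC.
  exact: product_measure2E.
rewrite (eq_measure_integral (@lebesgue1 R \x @lcol R n)%E (fun A mA _ => E12 A mA)).
by rewrite (@fubini_tonelli1 _ _ _ _ R (@lebesgue1 R) (@lcol R n) _ mfc)// => z; exact: f0.
Qed.

Lemma measurable_mulmxD m n (M : 'M[R]_(m, n)) (c : 'cV[R]_m) :
  measurable_fun setT (fun x : 'cV[R]_n => M *m x + c).
Proof.
apply: measurable_fun_col => i.
under eq_fun do rewrite !mxE.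
apply: measurable_funD => //; apply: measurable_sum => j.
by apply: measurable_funM => //; exact: measurable_coord.
Qed.

(** A lower triangular map sends the first coordinate to a function of itself alone. For a frozen
    first coordinate y the other ones undergo a triangular map in one dimension less, translated by
    [c' y], so induction and Tonelli give the product of the diagonal entries. *)
Lemma ge0_int_col_affine n (M : 'M[R]_n) (c : 'cV[R]_n) (f : 'cV[R]_n -> \bar R) :
  (forall i j : 'I_n, (i < j)%N -> M i j = 0) -> (forall i, 0 < M i i) ->
  measurable_fun setT f -> (forall x, 0 <= f x)%E ->
  (\int[@lcol R n]_x f (M *m x + c)%R =
   (\prod_(i < n) M i i)^-1%:E * \int[@lcol R n]_x f x)%E.
Proof.
elim: n M c f => [|n IH] M c f lowM posM mf f0.
  rewrite big_ord0 invr1 mul1e; apply: eq_integral => x _.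
  by congr f; apply/matrixP => -[].
have mfa : measurable_fun setT (fun x => f (M *m x + c)).
  by apply: measurableT_comp => //; exact: measurable_mulmxD.
rewrite !ge0_int_consc//.
pose M' : 'M[R]_n := \matrix_(i, j) M (lift ord0 i) (lift ord0 j).
pose c' (y : R) : 'cV[R]_n := \col_i (M (lift ord0 i) ord0 * y + c (lift ord0 i) 0).
have E y x : M *m consc (y, x) + c = consc (M ord0 ord0 * y + c ord0 0, M' *m x + c' y).
  apply/colP => i; rewrite mxE [(M *m _) _ _]mxE big_ord_recl consc0/=.
  have [j ->|->] := unliftP ord0 i.
    rewrite consc_lift/= mxE [c' y _ _]mxE [(M' *m x) _ _]mxE addrAC addrC; congr (_ + _).
    by apply: eq_bigr => k _; rewrite consc_lift [M' _ _]mxE.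
  rewrite consc0/= big1 ?addr0// => k _.
  by rewrite lowM ?mul0r.
have mfc : measurable_fun setT (f \o @consc R n).
  by apply: measurableT_comp => //; exact: measurable_consc.
have mF : measurable_fun setT (fun y => \int[@lcol R n]_x f (consc (y, x)))%E.
  exact: (@measurable_fun_fubini_tonelli_F _ _ _ _ R (@lcol R n) _ mfc (fun z => f0 _)).
have prod0 : 0 <= (\prod_(i < n) M' i i)^-1.
  by rewrite invr_ge0 prodr_ge0// => i _; rewrite mxE ltW.
under eq_integral => y _.
  under eq_integral do rewrite E.
  rewrite (IH M' (c' y) (fun x => f (consc (M ord0 ord0 * y + c ord0 0, x)))); first last.
  - by move=> x; exact: f0.
  - apply: measurableT_comp => //.
    apply: (measurableT_comp (@measurable_consc R n)).
    exact: measurable_pair1.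
  - by move=> i; rewrite mxE.
  - by move=> i j ij; rewrite mxE lowM.
  over.
rewrite ge0_integralZl_EFin; [|exact: measurableT| | |exact: prod0]; first last.
- exact: (measurableT_comp mF (measurable_affine _ _)).
- by move=> y _; exact: integral_ge0.
rewrite (@ge0_int1_affine _ _ _ (fun y => \int[@lcol R n]_x f (consc (y, x)))%E)//; last first.
  by move=> y; exact: integral_ge0.
rewrite muleA -EFinM; congr (_%:E * _)%E.
rewrite big_ord_recl invfM mulrC; congr (_ * _^-1).
by apply: eq_bigr => i _; rewrite mxE.
Qed.

End lebesgue_col_affine.

(** * Lebesgue measure on space-time *)

Section spacetime_measure.
Context {R : realType} {n : nat}.
Local Notation pt := ('cV[R]_n * R)%type.

Definition vol : set pt -> \bar R := (lebesgue_col n \x lebesgue1)%E.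

Let vol0 : vol set0 = 0%E. Proof. exact: (measure0 (lebesgue_col n \x lebesgue1)%E). Qed.
Let vol_ge0 A : (0 <= vol A)%E. Proof. exact: (measure_ge0 (lebesgue_col n \x lebesgue1)%E). Qed.
Let vol_sigma : semi_sigma_additive vol.
Proof. exact: (@measure_semi_sigma_additive _ _ _ (lebesgue_col n \x lebesgue1)%E). Qed.

HB.instance Definition _ := isMeasure.Build _ _ _ vol vol0 vol_ge0 vol_sigma.

(** [None] stands for time, so that statements about all coordinates need no separate clause for
    it. *)
Definition crd (o : option 'I_n) (z : pt) : R := if o is Some j then z.1 j 0 else z.2.

Lemma measurable_crd o : measurable_fun setT (crd o).
Proof.
case: o => [j|]; last exact: measurable_snd.
exact: (measurableT_comp (@measurable_coord R n j) measurable_fst).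
Qed.

Lemma measurable_fun_pt d (T : measurableType d) (f : T -> pt) :
  (forall o, measurable_fun setT (fun x => crd o (f x))) -> measurable_fun setT f.
Proof.
move=> mf; apply/measurable_fun_pairP; split; last exact: (mf None).
by apply: measurable_fun_col => i; exact: (mf (Some i)).
Qed.

Lemma ge0_int_vol (f : pt -> \bar R) :
  measurable_fun setT f -> (forall x, 0 <= f x)%E ->
  (\int[vol]_z f z = \int[lebesgue1]_t \int[@lcol R n]_x f (x, t))%E.
Proof.
move=> mf f0.
have := @fubini_tonelli1 _ _ _ _ R (@lcol R n) lebesgue1 f mf f0.
rewrite (@fubini_tonelli _ _ _ _ R (@lcol R n) lebesgue1 f mf f0) => H.
by transitivity (\int[(@lcol R n \x lebesgue1)%E]_z f z)%E.
Qed.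

(** The space part may depend on t, because Tonelli integrates in x at fixed t first; the Jacobian
    only sees the diagonal, which is constant in t. Left and right translations and dilations of the
    group all have this form. *)
Lemma ge0_int_fibered (M : R -> 'M[R]_n) (c : R -> 'cV[R]_n) (a : 'I_n -> R)
    (b s : R) (f : pt -> \bar R) :
  (forall t (i j : 'I_n), (i < j)%N -> M t i j = 0) -> (forall t i, M t i i = a i) ->
  (forall i, 0 < a i) -> 0 < b ->
  measurable_fun setT (fun z : pt => (M z.2 *m z.1 + c z.2, b * z.2 + s)) ->
  measurable_fun setT f -> (forall z, 0 <= f z)%E ->
  (\int[vol]_z f (M z.2 *m z.1 + c z.2, b * z.2 + s)%R =
   (b * \prod_(i < n) a i)^-1%:E * \int[vol]_z f z)%E.
Proof.
move=> lowM aM a0 b0 mPhi mf f0.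
have mfP := measurableT_comp mf mPhi.
rewrite !ge0_int_vol//.
have mF : measurable_fun setT (fun t => \int[@lcol R n]_x f (x, t))%E.
  exact: (@measurable_fun_fubini_tonelli_G _ _ _ _ R (@lcol R n) f mf f0).
have prod0 : 0 < \prod_(i < n) a i by rewrite prodr_gt0.
under eq_integral => t _.
  rewrite /= (@ge0_int_col_affine _ _ (M t) (c t) (fun x => f (x, b * t + s)))//; first last.
  - exact: (measurableT_comp mf (measurable_pair2 _)).
  - by move=> i; rewrite aM.
  - exact: lowM.
  under eq_bigr do rewrite aM.
  over.
have prod1 : 0 <= (\prod_(i < n) a i)^-1 by rewrite invr_ge0 ltW.
rewrite ge0_integralZl_EFin; [|exact: measurableT| | |exact: prod1]; first last.
- exact: (measurableT_comp mF (measurable_affine _ _)).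
- by move=> y _; exact: integral_ge0.
rewrite (@ge0_int1_affine _ _ _ (fun t => \int[@lcol R n]_x f (x, t))%E)//; last first.
  by move=> y; exact: integral_ge0.
by rewrite muleA -EFinM invfM mulrC.
Qed.

Lemma vol_fibered (M : R -> 'M[R]_n) (c : R -> 'cV[R]_n) (a : 'I_n -> R)
    (b s : R) (A : set pt) :
  (forall t (i j : 'I_n), (i < j)%N -> M t i j = 0) -> (forall t i, M t i i = a i) ->
  (forall i, 0 < a i) -> 0 < b ->
  measurable_fun setT (fun z : pt => (M z.2 *m z.1 + c z.2, b * z.2 + s)) ->
  measurable A ->
  vol ((fun z : pt => (M z.2 *m z.1 + c z.2, b * z.2 + s)) @^-1` A) =
   ((b * \prod_(i < n) a i)^-1%:E * vol A)%E.
Proof.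
move=> lowM aM a0 b0 mPhi mA.
have := @ge0_int_fibered M c a b s (EFin \o \1_A) lowM aM a0 b0 mPhi.
have mi : measurable_fun setT (EFin \o (\1_A : pt -> R)).
  by apply/measurable_EFinP; exact: measurable_indic.
have i0 z : (0 <= (EFin \o (\1_A : pt -> R)) z)%E by rewrite lee_fin.
have E1 : (\int[vol]_z (EFin \o (\1_A : pt -> R)) z)%E = vol A.
  by rewrite integral_indic// setIT.
move=> /(_ mi i0); rewrite E1 => <-.
transitivity (\int[vol]_z (\1_((fun z : pt => (M z.2 *m z.1 + c z.2, b * z.2 + s)) @^-1` A) z)%:E)%E => //.
rewrite integral_indic ?setIT//.
by rewrite -[X in measurable X]setTI; exact: mPhi.
Qed.

Lemma vol_box (A : option 'I_n -> set R) : (forall o, measurable (A o)) ->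
  vol [set z | forall o, A o (crd o z)] =
  (\prod_(i < n) lebesgue1 (A (Some i)) * lebesgue1 (A None))%E.
Proof.
move=> mA.
rewrite (_ : [set _ | _] = [set x : 'cV[R]_n | forall i, A (Some i) (x i 0)] `*` A None).
  have mB := measurable_box (fun i => mA (Some i)).
  have := @product_measure1E _ _ _ _ R (lebesgue_col n) lebesgue1 _ _ mB (mA None).
  move=> H; transitivity (lebesgue_col n [set x : 'cV[R]_n | forall i, A (Some i) (x i 0%R)] * lebesgue1 (A None))%E; first exact: H.
  by congr (_ * _)%E; exact: (lebesgue_col_box (fun i => mA (Some i))).
apply/seteqP; split => [[x t] /= H|[x t] /= [H1 H2] [i|]].
- by split => [i|]; [exact: (H (Some i))|exact: (H None)].
- exact: H1.
- exact: H2.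
Qed.

Lemma measurable_ptbox (A : option 'I_n -> set R) : (forall o, measurable (A o)) ->
  measurable [set z : pt | forall o, A o (crd o z)].
Proof.
move=> mA.
rewrite (_ : [set _ | _] = \bigcap_(o in [set: option 'I_n]) (crd o @^-1` A o)).
  apply: fin_bigcap_measurable; first exact: finite_finset.
  by move=> i _; rewrite -[X in measurable X]setTI; exact: measurable_crd.
by apply/seteqP; split => x /= H i => [_|]; [exact: H|apply: H].
Qed.

Lemma ex_crd_le (z : pt) : exists k : nat, forall o, `|crd o z| <= k%:R.
Proof.
exists (\max_(o : option 'I_n) Num.truncn (`|crd o z|)%R)%N.+1 => o.
rewrite (le_trans (ltW (truncnS_gt _)))// ler_nat ltnS.
exact: (leq_bigmax (F := fun o => Num.truncn `|crd o z|)).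
Qed.

Lemma sigma_finite_vol : sigma_finite setT vol.
Proof.
pose I (k : nat) := `[- k%:R, k%:R]%classic : set R.
exists (fun k => [set z | forall o, I k (crd o z)]).
  apply/esym; rewrite -subTset => z _.
  by have [k Hk] := ex_crd_le z; exists k => // o; rewrite /I /= in_itv/= -ler_norml.
move=> k; split; first by refine (@measurable_ptbox (fun=> I k) (fun=> measurable_itvR _)).
rewrite (@vol_box (fun=> I k) (fun=> measurable_itvR _)).
have fI : @lebesgue1 R (I k) \is a fin_num.
  by rewrite /lebesgue1 lebesgue_measure_itv/=; case: ifP.
suff : (\prod_(i < n) @lebesgue1 R (I k) * @lebesgue1 R (I k))%E \is a fin_num.
  by rewrite fin_numElt => /andP[].
by rewrite fin_numM//; apply: (big_ind (fun x : \bar R => x \is a fin_num)) => //; exact: fin_numM.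
Qed.

HB.instance Definition _ := Measure_isSigmaFinite.Build _ _ _ vol sigma_finite_vol.

End spacetime_measure.

(** * Smooth functions of one variable: steps and bumps *)

Section smooth_line.
Context {R : realType}.

(** The functions x^(-k) exp(-1/x), extended by 0: up to linear combinations they are closed under
    differentiation. *)
Definition flat (k : nat) (x : R) : R :=
  if x <= 0 then 0 else x^-1 ^+ k * expR (- x^-1).

Lemma flat_le0 k x : x <= 0 -> flat k x = 0.
Proof. by rewrite /flat => ->. Qed.

Lemma flat_pos k x : 0 < x -> flat k x = x^-1 ^+ k * expR (- x^-1).
Proof. by move=> x0; rewrite /flat leNgt x0. Qed.

Lemma flat_gt0 k x : 0 < x -> 0 < flat k x.
Proof.
move=> x0; rewrite /flat leNgt x0/=.
by rewrite mulr_gt0 ?expR_gt0// exprn_gt0 ?invr_gt0.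
Qed.

Lemma flat_ge0 k x : 0 <= flat k x.
Proof. by have [x0|x0] := leP x 0; [rewrite flat_le0|exact/ltW/flat_gt0]. Qed.

Lemma flatS k (x : R) : 0 < x -> flat k.+1 x = x^-1 * flat k x.
Proof. by move=> x0; rewrite /flat leNgt x0/= exprS mulrA. Qed.

(** Quadratic decay settles the derivative at 0. With y = 1 / ((k + 2) x), the inequality exp(-y) <=
    1/y is raised to the power k + 2. *)
Lemma flat_le_sqr k (x : R) : 0 < x -> flat k x <= (k.+2%:R) ^+ k.+2 * x ^+ 2.
Proof.
move=> x0; rewrite flat_pos//.
have k0 : 0 < k.+2%:R :> R by rewrite ltr0n.
have E : expR (- x^-1) <= (k.+2%:R * x) ^+ k.+2.
  rewrite (_ : - x^-1 = k.+2%:R * (- (k.+2%:R * x)^-1)); last first.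
    by field; rewrite !gt_eqF.
  rewrite expRM_natl lerXn2r ?nnegrE ?expR_ge0//; first by rewrite mulr_ge0// ltW.
  rewrite expRN -[leRHS]invrK lef_pV2 ?posrE ?invr_gt0 ?mulr_gt0 ?expR_gt0//.
  by rewrite (le_trans _ (expR_ge1Dx _))// lerDr.
apply: (le_trans (ler_wpM2l _ E)); first by rewrite exprn_ge0// invr_ge0 ltW.
rewrite exprMn mulrCA ler_wpM2l ?exprn_ge0 ?(ltW k0)//.
by rewrite -addn2 exprD mulrA -exprMn mulVf ?gt_eqF// expr1n mul1r.
Qed.

Lemma is_derive_flat k (x : R) :
  is_derive x 1 (flat k) (flat k.+2 x - k%:R * flat k.+1 x).
Proof.
have [x0|x0|->] := ltgtP x 0.
- rewrite !flat_le0 ?ltW// mulr0 subr0.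
  apply: (@near_eq_is_derive _ _ _ (cst 0)).
  near=> y; rewrite flat_le0//; apply/ltW; near: y.
  exact: lt_nbhsl.
- have xn0 : x != 0 by rewrite gt_eqF.
  have dV : is_derive x 1 (fun y : R => y^-1) (- x ^- 2).
    have := @is_deriveV R id x 1 1 xn0 (is_derive_id _ _).
    by rewrite scaler1.
  elim: k => [|k IH].
    have dN : is_derive x 1 (fun y : R => - y^-1) (x ^- 2).
      by rewrite -[X in is_derive _ _ _ X]opprK; apply: is_deriveN.
    apply: (@near_eq_is_derive _ _ _ (fun x : R => expR (- x^-1))).
      near=> y; rewrite flat_pos ?expr0 ?mul1r//; near: y.
      exact: lt_nbhsr.
    rewrite mul0r subr0 flat_pos// exprVn mulrC.
    exact: (is_derive1_comp (is_derive_expR _) dN).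
  apply: (@near_eq_is_derive _ _ _ (fun x : R => x^-1 * flat k x)).
    near=> y; rewrite flatS//; near: y.
    exact: lt_nbhsr.
  apply: is_derive_eq (is_deriveM dV IH) _.
  rewrite !flatS// /GRing.scale/= -exprVn -[k.+1]addn1 natrD.
  by set t := x^-1; set e := flat k x; ring.
- rewrite !flat_le0// mulr0 subr0.
  have H : h^-1 *: ((flat k \o shift 0) (h *: 1) - flat k 0) @[h --> 0^'] --> 0.
    apply/cvgr0Pnorm_le => e e0.
    set C : R := (k.+2%:R) ^+ k.+2.
    have C0 : 0 < C by rewrite exprn_gt0// ltr0n.
    near=> h; rewrite /= addr0 (flat_le0 k (lexx 0)) subr0 -[h%:A]/(h * 1) mulr1 -[_ *: _]/(h^-1 * flat k h).
    have [h0|h0] := leP h 0; first by rewrite flat_le0// mulr0 normr0 ltW.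
    rewrite normrM normfV (ger0_norm (flat_ge0 _ _)) gtr0_norm// mulrC ler_pdivrMr//.
    rewrite (le_trans (flat_le_sqr _ h0))// expr2 mulrA ler_pM2r//.
    rewrite -ler_pdivlMl// mulrC -(gtr0_norm h0).
    near: h; apply: dnbhs0_le; exact: divr_gt0.
  apply: DeriveDef; last exact: cvg_lim H.
  by apply/cvg_ex; exists 0.
Unshelve. all: end_near. Qed.

Lemma is_derive_affcomp f (a b x d : R) : is_derive (a * x + b) 1 f d ->
  is_derive x 1 (fun y => f (a * y + b)) (a * d).
Proof.
move=> df; have da : is_derive x 1 (fun y => a * y + b) a.
  have := is_deriveD (is_deriveZ a (is_derive_id x 1)) (is_derive_cst b x 1).
  by rewrite addr0 scaler1.
have := @is_derive1_comp R f (fun y => a * y + b) x d a df da.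
by rewrite mulrC.
Qed.

(** A syntactic class closed under differentiation: its members have derivatives of all orders, and
    no order has to be tracked. *)
Inductive c1 : (R -> R) -> Prop :=
| c1_flat k : c1 (flat k)
| c1_cst c : c1 (fun=> c)
| c1_id : c1 id
| c1_add f g : c1 f -> c1 g -> c1 (fun x => f x + g x)
| c1_mul f g : c1 f -> c1 g -> c1 (fun x => f x * g x)
| c1_aff (a b : R) f : c1 f -> c1 (fun x => f (a * x + b))
| c1_inv f : (forall x, f x != 0) -> c1 f -> c1 (fun x => (f x)^-1).

Lemma c1_derive f : c1 f -> exists2 f', c1 f' & forall x : R, is_derive x 1 f (f' x).
Proof.
elim=> {f} [k|c||f g _ [f' cf' df] _ [g' cg' dg]|f g cf [f' cf' df] cg [g' cg' dg]
  |a b f _ [f' cf' df]|f f0 cf [f' cf' df]].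
- exists (fun x => flat k.+2 x + (- k%:R) * flat k.+1 x).
    by apply: c1_add; [exact: c1_flat|apply: c1_mul; [exact: c1_cst|exact: c1_flat]].
  by move=> x; rewrite mulNr; exact: is_derive_flat.
- by exists (fun=> 0) => [|x]; [exact: c1_cst|exact: is_derive_cst].
- by exists (fun=> 1) => [|x]; [exact: c1_cst|exact: is_derive_id].
- by exists (fun x => f' x + g' x) => [|x]; [exact: c1_add|exact: is_deriveD].
- exists (fun x => f x * g' x + g x * f' x).
    by apply: c1_add; apply: c1_mul.
  by move=> x; exact: is_deriveM.
- exists (fun x => a * f' (a * x + b)).
    by apply: c1_mul; [exact: c1_cst|exact: c1_aff].
  by move=> x; exact: is_derive_affcomp.
- exists (fun x => (-1) * ((f x)^-1 * (f x)^-1) * f' x).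
    apply: c1_mul => //; apply: c1_mul; first exact: c1_cst.
    by apply: c1_mul; exact: c1_inv.
  move=> x; apply: is_derive_eq (is_deriveV (f0 x) (df x)) _.
  by rewrite /GRing.scale/= mulN1r expr2 invfM.
Qed.

Lemma c1_continuous f : c1 f -> continuous f.
Proof.
move=> /c1_derive[f' _ df] x; apply: differentiable_continuous.
by apply/derivable1_diffP; have [] := df x.
Qed.

Lemma c1_bounded f : c1 f -> forall M, exists C, forall x, `|x| <= M -> `|f x| <= C.
Proof.
move=> cf M.
have [M0|M0] := ltP M 0.
  by exists 0 => x /le_lt_trans /(_ M0); rewrite normr_lt0.
have cnf : {within `[- M, M], continuous (fun x => `|f x|)}.
  apply: continuous_subspaceT => x; apply: (@continuous_comp _ _ _ f).
    exact: c1_continuous.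
  exact: norm_continuous.
have MM : - M <= M by rewrite ge0_cp.
have [c _ Hc] := EVT_max MM cnf.
by exists `|f c| => x xM; apply: Hc; rewrite in_itv/= -ler_norml.
Qed.

Lemma c1_measurable f : c1 f -> measurable_fun setT f.
Proof. by move=> /c1_continuous; exact: continuous_measurable_fun. Qed.

Definition step_den (x : R) : R := flat 0 (1 * x + 1) + flat 0 (-1 * x + 1).

Lemma step_den_gt0 x : 0 < step_den x.
Proof.
rewrite /step_den mul1r mulN1r; have [x0|x0] := leP x 0.
  by rewrite ltr_wpDl ?flat_ge0// flat_gt0//; lra.
by rewrite ltr_wpDr ?flat_ge0// flat_gt0//; lra.
Qed.

(** A smooth Heaviside function, 0 up to -1 and 1 from 1 on. *)
Definition step (x : R) : R := flat 0 (1 * x + 1) * (step_den x)^-1.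

(** The derivative of [step], written out. Bumps are chosen with an explicit primitive so that the
    difference of two of them is the derivative of a compactly supported function. *)
Definition bump (x : R) : R :=
  (flat 2 (1 * x + 1) * flat 0 (-1 * x + 1) + flat 0 (1 * x + 1) * flat 2 (-1 * x + 1))
  * ((step_den x)^-1 * (step_den x)^-1).

Lemma c1_step_den : c1 step_den.
Proof. by apply: c1_add; apply: c1_aff; exact: c1_flat. Qed.

Lemma c1_step_denV : c1 (fun x => (step_den x)^-1).
Proof.
by apply: c1_inv; [move=> x; rewrite gt_eqF// step_den_gt0|exact: c1_step_den].
Qed.

Lemma c1_step : c1 step.
Proof. by apply: c1_mul; [apply: c1_aff; exact: c1_flat|exact: c1_step_denV]. Qed.

Lemma c1_bump : c1 bump.
Proof.
apply: c1_mul; last by apply: c1_mul; exact: c1_step_denV.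
by apply: c1_add; apply: c1_mul; apply: c1_aff; exact: c1_flat.
Qed.

Lemma is_derive_flat_aff k (a b x : R) :
  is_derive x 1 (fun y => flat k (a * y + b))
   (a * (flat k.+2 (a * x + b) - k%:R * flat k.+1 (a * x + b))).
Proof.
exact/is_derive_affcomp/is_derive_flat.
Qed.

Lemma is_derive_step (x : R) : is_derive x 1 step (bump x).
Proof.
have d1 := is_derive_flat_aff 0 1 1 x.
have d2 := is_derive_flat_aff 0 (-1) 1 x.
have d0 : step_den x != 0 by rewrite gt_eqF// step_den_gt0.
have dV := is_deriveV (f := step_den) d0 (is_deriveD d1 d2).
apply: is_derive_eq (is_deriveM d1 dV) _.
rewrite /GRing.scale/= /bump !mul0r !subr0 -exprVn.
have : (flat 0 (1 * x + 1) + flat 0 (-1 * x + 1)) * (step_den x)^-1 = 1.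
  exact: divff d0.
move: (step_den x)^-1 (flat 0 (1 * x + 1)) (flat 0 (-1 * x + 1)) (flat 2 _) (flat 2 _).
move=> t p q r s pq.
have -> : t * (1 * s) = (p + q) * t * (t * s) by rewrite pq; ring.
ring.
Qed.

Lemma step_le x : x <= -1 -> step x = 0.
Proof. by move=> x1; rewrite /step flat_le0 ?mul0r//; lra. Qed.

Lemma step_ge x : 1 <= x -> step x = 1.
Proof.
move=> x1; have := step_den_gt0 x; rewrite /step /step_den => d0.
by rewrite (flat_le0 0 (x := -1 * x + 1)) ?addr0 in d0 *; [rewrite divff// gt_eqF|lra..].
Qed.

Lemma step_ge0 x : 0 <= step x.
Proof. by rewrite mulr_ge0 ?flat_ge0// invr_ge0 ltW// step_den_gt0. Qed.

Lemma step_le1 x : step x <= 1.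
Proof.
have H : flat 0 (1 * x + 1) <= step_den x by rewrite /step_den lerDl flat_ge0.
by rewrite /step ler_pdivrMr ?step_den_gt0// [leRHS]mul1r.
Qed.

Lemma bump_ge0 x : 0 <= bump x.
Proof.
rewrite /bump mulr_ge0//; last by rewrite mulr_ge0// invr_ge0 ltW// step_den_gt0.
by rewrite addr_ge0// mulr_ge0// flat_ge0.
Qed.

Lemma bump_gt0 x : `|x| < 1 -> 0 < bump x.
Proof.
rewrite ltr_norml => /andP[x1 x2].
rewrite /bump mulr_gt0//; last by rewrite mulr_gt0// invr_gt0 step_den_gt0.
by rewrite addr_gt0// mulr_gt0// flat_gt0//; lra.
Qed.

Lemma bump_eq0 x : 1 <= `|x| -> bump x = 0.
Proof.
rewrite ler_normr => /orP[x1|x1]; rewrite /bump.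
  by rewrite !(flat_le0 _ (x := -1 * x + 1)) ?mulr0 ?addr0 ?mul0r//; lra.
by rewrite !(flat_le0 _ (x := 1 * x + 1)) ?mul0r ?addr0 ?mul0r//; lra.
Qed.

End smooth_line.

(** * Families of smooth functions on space-time *)

Section smooth_families.
Context {R : realType} {n : nat}.
Local Notation pt := ('cV[R]_n * R)%type.
Implicit Types (z e : pt) (o : option 'I_n).

Definition dir o : pt := if o is Some j then (delta_mx j 0, 0) else (0, 1).

(* Families, indexed by P, of smooth functions of z all of whose derivatives
   are bounded on bounded sets, uniformly in the index. *)
Inductive fam (P : Type) : (P -> pt -> R) -> Prop :=
| fam_par (c : P -> R) (M : R) : (forall p, `|c p| <= M) -> fam (fun p _ => c p)
| fam_crd o : fam (fun _ z => crd o z)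
| fam_add f g : fam f -> fam g -> fam (fun p z => f p z + g p z)
| fam_mul f g : fam f -> fam g -> fam (fun p z => f p z * g p z)
| fam_comp g f : c1 g -> fam f -> fam (fun p z => g (f p z)).

Lemma crd_lin o (a : R) z e : crd o (a *: e + z) = a * crd o e + crd o z.
Proof. by case: o => [j|] //=; rewrite !mxE. Qed.

Lemma crd_dir o o' : crd o (dir o') = (o == o')%:R.
Proof.
case: o o' => [j|] [j'|] //=; rewrite ?mxE//.
by rewrite andbT eqE/=.
Qed.

Lemma differentiable_crd o z : differentiable (crd o) z.
Proof.
case: o => [j|] /=.
  apply: (@differentiable_comp _ _ _ _ fst (fun x : 'cV[R]_n => x j 0)).
    by apply: linear_differentiable => y; exact: cvg_fst.
  exact: differentiable_coord.
rewrite -[crd None]/(snd : pt -> R).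
by apply: linear_differentiable => y; exact: cvg_snd.
Qed.

Lemma derive_crd o z e : 'D_e (crd o) z = crd o e.
Proof.
rewrite /derive; apply/cvg_lim => //.
apply: (@cvg_trans _ (cst (crd o e) h @[h --> 0^'])); last exact: cvg_cst.
apply: near_eq_cvg; near=> h.
rewrite /= crd_lin addrK -[_ *: _]/(h^-1 * (h * crd o e)) mulrA mulVf ?mul1r//.
near: h; exact: nbhs_dnbhs_neq.
Unshelve. all: end_near. Qed.

Lemma differentiable_fam P (f : P -> pt -> R) p z : fam f -> differentiable (f p) z.
Proof.
move=> ff; elim: ff p z => {f} [c M cM|o|f g _ IHf _ IHg|f g _ IHf _ IHg|g f cg _ IHf] p z.
- exact: differentiable_cst.
- exact: differentiable_crd.
- exact: differentiableD.
- exact: differentiableM.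
- apply: (@differentiable_comp _ _ _ _ (f p) g) => //.
  have [g' _ dg] := c1_derive cg.
  by apply/derivable1_diffP; have [] := dg (f p z).
Qed.

Lemma derive_comp_line (g : R -> R) (f : pt -> R) (d : R) z e :
  is_derive (f z) 1 g d -> differentiable f z ->
  'D_e (fun w => g (f w)) z = d * 'D_e f z.
Proof.
move=> [dg <-] df; have dg' : differentiable g (f z) by exact/derivable1_diffP.
rewrite !deriveE//; last exact: differentiable_comp.
rewrite (@diff_comp _ _ _ _ f g)//=.
rewrite -[X in 'd g _ X = _]mulr1 -[_ * 1]/(_ *: 1) linearZ/= mulrC.
by congr (_ * _); rewrite deriveE.
Qed.

Lemma deriveDE (f g : pt -> R) z e : differentiable f z -> differentiable g z ->
  'D_e (fun w => f w + g w) z = 'D_e f z + 'D_e g z.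
Proof. by move=> df dg; rewrite (@deriveD _ _ _ f g)//; exact: diff_derivable. Qed.

Lemma deriveME (f g : pt -> R) z e : differentiable f z -> differentiable g z ->
  'D_e (fun w => f w * g w) z = f z * 'D_e g z + g z * 'D_e f z.
Proof. by move=> df dg; rewrite (@deriveM _ _ f g)//; exact: diff_derivable. Qed.

Lemma fam_derive P (f : P -> pt -> R) e : fam f -> fam (fun p => 'D_e (f p)).
Proof.
have fc (c : R) : fam (fun (_ : P) _ => c) by exact: (@fam_par _ _ `|c|).
elim=> {f} [c M cM|o|f g ff IHf fg IHg|f g ff IHf fg IHg|g f cg ff IHf].
- rewrite (_ : (fun _ => _) = (fun _ _ => 0)); first exact: fc.
  by apply/funext => p; apply/funext => z; rewrite derive_cst.
- rewrite (_ : (fun _ => _) = (fun _ _ => crd o e)); first exact: fc.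
  by apply/funext => p; apply/funext => z; rewrite derive_crd.
- rewrite (_ : (fun _ => _) = (fun p z => 'D_e (f p) z + 'D_e (g p) z)).
    exact: fam_add.
  by apply/funext => p; apply/funext => z; rewrite deriveDE//; exact: differentiable_fam.
- rewrite (_ : (fun _ => _) = (fun p z => f p z * 'D_e (g p) z + g p z * 'D_e (f p) z)).
    by apply: fam_add; apply: fam_mul.
  by apply/funext => p; apply/funext => z; rewrite deriveME//; exact: differentiable_fam.
- have [g' cg' dg] := c1_derive cg.
  rewrite (_ : (fun _ => _) = (fun p z => g' (f p z) * 'D_e (f p) z)).
    by apply: fam_mul => //; exact: fam_comp.
  apply/funext => p; apply/funext => z; apply: derive_comp_line => //.
  exact: differentiable_fam.
Qed.

(** Symmetry of second derivatives by induction on the syntax: every constructor reduces it to an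
    algebraic identity. *)
Lemma fam_deriveC P (f : P -> pt -> R) e e' p z : fam f ->
  'D_e ('D_e' (f p)) z = 'D_e' ('D_e (f p)) z.
Proof.
move=> ff; elim: ff p z => {f} [c M cM|o|f g ff IHf fg IHg|f g ff IHf fg IHg|g f cg ff IHf] p z.
- have E v : 'D_v (fun=> c p) = (fun=> 0) :> (pt -> R).
    by apply/funext => w; rewrite derive_cst.
  by rewrite !E !derive_cst.
- have E (v : pt) : 'D_v (crd o) = (fun=> crd o v) :> (pt -> R).
    by apply/funext => w; rewrite derive_crd.
  by rewrite !E !derive_cst.
- have E v : 'D_v (fun w => f p w + g p w) = (fun w => 'D_v (f p) w + 'D_v (g p) w).
    by apply/funext => w; rewrite deriveDE//; exact: differentiable_fam.
  have df v w : differentiable ('D_v (f p)) w by exact: (@differentiable_fam _ _ p w (fam_derive v ff)).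
  have dg v w : differentiable ('D_v (g p)) w by exact: (@differentiable_fam _ _ p w (fam_derive v fg)).
  apply: etrans (etrans (congr1 (fun h => 'D_e h z) (E e')) (deriveDE e (df e' z) (dg e' z))) _.
  apply: esym (etrans (etrans (congr1 (fun h => 'D_e' h z) (E e)) (deriveDE e' (df e z) (dg e z))) _).
  by rewrite -(IHf p z) -(IHg p z).
- have df v w : differentiable ('D_v (f p)) w by exact: (@differentiable_fam _ _ p w (fam_derive v ff)).
  have dg v w : differentiable ('D_v (g p)) w by exact: (@differentiable_fam _ _ p w (fam_derive v fg)).
  have df0 w : differentiable (f p) w by exact: differentiable_fam.
  have dg0 w : differentiable (g p) w by exact: differentiable_fam.
  have E (v : pt) : 'D_v (fun w => f p w * g p w) =
      (fun w => f p w * 'D_v (g p) w + g p w * 'D_v (f p) w) :> (pt -> R).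
    by apply/funext => w; rewrite (deriveME v (df0 w) (dg0 w)).
  have L (v v' : pt) : 'D_v (fun w => f p w * 'D_v' (g p) w + g p w * 'D_v' (f p) w) z =
      (f p z * 'D_v ('D_v' (g p)) z + 'D_v' (g p) z * 'D_v (f p) z) +
      (g p z * 'D_v ('D_v' (f p)) z + 'D_v' (f p) z * 'D_v (g p) z).
    have d1 := differentiableM (df0 z) (dg v' z).
    have d2 := differentiableM (dg0 z) (df v' z).
    rewrite (deriveDE v d1 d2).
    by rewrite (deriveME v (df0 z) (dg v' z)) (deriveME v (dg0 z) (df v' z)).
  apply: etrans (etrans (congr1 (fun h => 'D_e h z) (E e')) (L e e')) _.
  apply: esym (etrans (etrans (congr1 (fun h => 'D_e' h z) (E e)) (L e' e)) _).
  rewrite -(IHf p z) -(IHg p z); move: ('D_e (f p) z) ('D_e (g p) z) ('D_e' (f p) z) ('D_e' (g p) z) => a1 a2 a3 a4.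
  by move: ('D_e ('D_e' (f p)) z) ('D_e ('D_e' (g p)) z) => a5 a6; ring.
- have [g' cg' dg'] := c1_derive cg; have [g'' cg'' dg''] := c1_derive cg'.
  have df v w : differentiable ('D_v (f p)) w by exact: (@differentiable_fam _ _ p w (fam_derive v ff)).
  have df0 w : differentiable (f p) w by exact: differentiable_fam.
  have E (v : pt) : 'D_v (fun w => g (f p w)) = (fun w => g' (f p w) * 'D_v (f p) w) :> (pt -> R).
    by apply/funext => w; exact: (derive_comp_line v (dg' _) (df0 w)).
  have dg w : differentiable (fun w => g' (f p w)) w.
    exact: (@differentiable_fam _ _ p w (fam_comp cg' ff)).
  have L (v v' : pt) : 'D_v (fun w => g' (f p w) * 'D_v' (f p) w) z =
      g' (f p z) * 'D_v ('D_v' (f p)) z + 'D_v' (f p) z * (g'' (f p z) * 'D_v (f p) z).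
    by rewrite (deriveME v (dg z) (df v' z)) (derive_comp_line v (dg'' _) (df0 z)).
  apply: etrans (etrans (congr1 (fun h => 'D_e h z) (E e')) (L e e')) _.
  apply: esym (etrans (etrans (congr1 (fun h => 'D_e' h z) (E e)) (L e' e)) _).
  rewrite -(IHf p z).
  move: ('D_e (f p) z) ('D_e' (f p) z) ('D_e ('D_e' (f p)) z) => a1 a2 a3; ring.
Qed.

Lemma fam_bounded P (f : P -> pt -> R) : fam f ->
  forall r, exists M, forall p z, (forall o, `|crd o z| <= r) -> `|f p z| <= M.
Proof.
move=> ff r; elim: ff => {f} [c M cM|o|f g ff [M1 H1] fg [M2 H2]|f g ff [M1 H1] fg [M2 H2]|g f cg ff [M H]].
- by exists M.
- by exists r => p z; exact.
- by exists (M1 + M2) => p z zr; rewrite (le_trans (ler_normD _ _))// lerD ?H1 ?H2.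
- by exists (M1 * M2) => p z zr; rewrite normrM ler_pM ?H1 ?H2.
- by have [C HC] := c1_bounded cg M; exists C => p z zr; exact/HC/H.
Qed.

Lemma fam_measurable P (f : P -> pt -> R) p : fam f -> measurable_fun setT (f p).
Proof.
elim=> {f} [c M cM|o|f g ff IHf fg IHg|f g ff IHf fg IHg|g f cg ff IHf].
- exact: measurable_cst.
- exact: measurable_crd.
- exact: measurable_funD.
- exact: measurable_funM.
- by apply: measurableT_comp => //; exact: c1_measurable.
Qed.

Lemma fam_continuous P (f : P -> pt -> R) p : fam f -> continuous (f p).
Proof. by move=> ff z; apply: differentiable_continuous; exact: differentiable_fam. Qed.

Lemma fam_cst P (c : R) : fam (fun (_ : P) _ => c).
Proof. exact: (@fam_par _ _ `|c|). Qed.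

Lemma fam_reparam P Q (pi : Q -> P) (f : P -> pt -> R) : fam f -> fam (fun q => f (pi q)).
Proof.
elim=> {f} [c M cM|o|f g ff IHf fg IHg|f g ff IHf fg IHg|g f cg ff IHf].
- by apply: (@fam_par _ (fun q => c (pi q)) M) => q; exact: cM.
- exact: fam_crd.
- exact: fam_add.
- exact: fam_mul.
- exact: fam_comp.
Qed.

Lemma fam_subst P (f : P -> pt -> R) (Psi : P -> pt -> pt) :
  (forall o, fam (fun p z => crd o (Psi p z))) -> fam f -> fam (fun p z => f p (Psi p z)).
Proof.
move=> fPsi; elim=> {f} [c M cM|o|f g ff IHf fg IHg|f g ff IHf fg IHg|g f cg ff IHf].
- exact: (@fam_par _ _ M).
- exact: fPsi.
- exact: fam_add.
- exact: fam_mul.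
- exact: fam_comp.
Qed.

(** The chain rule in coordinates, again by induction on the syntax of [f]; only the coordinates of
    [Psi] have to be differentiable. *)
Lemma derive_subst P (f : P -> pt -> R) (Psi : pt -> pt) p z e : fam f ->
  (forall o, differentiable (fun w => crd o (Psi w)) z) ->
  differentiable (fun w => f p (Psi w)) z /\
  'D_e (fun w => f p (Psi w)) z =
  \sum_(o : option 'I_n) 'D_(dir o) (f p) (Psi z) * 'D_e (fun w => crd o (Psi w)) z.
Proof.
move=> ff dPsi; elim: ff => {f} [c M cM|o|f g ff [df IHf] fg [dg IHg]
  |f g ff [df IHf] fg [dg IHg]|g f cg ff [df IHf]].
- split; first exact: differentiable_cst.
  rewrite derive_cst big1// => o _.
  by rewrite (@derive_cst _ _ _ (c p)) mul0r.
- split; first exact: dPsi.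
  rewrite (bigD1 o)//= derive_crd crd_dir eqxx mul1r big1 ?addr0// => o' oo'.
  by rewrite derive_crd crd_dir eq_sym (negbTE oo') mul0r.
- split; first exact: differentiableD.
  rewrite deriveDE// IHf IHg -big_split/=; apply: eq_bigr => o _.
  by rewrite deriveDE ?mulrDl//; exact: differentiable_fam.
- split; first exact: differentiableM.
  rewrite deriveME// IHf IHg !mulr_sumr -big_split/=; apply: eq_bigr => o _.
  by rewrite deriveME ?mulrDl ?mulrA//; exact: differentiable_fam.
- have [g' _ dg] := c1_derive cg; split.
    apply: (@differentiable_comp _ _ _ _ (fun w => f p (Psi w)) g) => //.
    by apply/derivable1_diffP; have [] := dg (f p (Psi z)).
  rewrite (derive_comp_line _ (dg _))// IHf mulr_sumr; apply: eq_bigr => o _.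
  by rewrite (derive_comp_line _ (dg _)) ?mulrA//; exact: differentiable_fam.
Qed.

Lemma fam_sum P (I : Type) (s : seq I) (Q : pred I) (f : I -> P -> pt -> R) :
  (forall i, Q i -> fam (f i)) -> fam (fun p z => \sum_(i <- s | Q i) f i p z).
Proof.
move=> ff; elim: s => [|i s IH].
  by under eq_fun do under eq_fun do rewrite big_nil; exact: fam_cst.
have [Qi|/negbTE Qi] := boolP (Q i); last first.
  by under eq_fun do under eq_fun do rewrite big_cons Qi.
under eq_fun do under eq_fun do rewrite big_cons Qi.
by apply: fam_add => //; exact: ff.
Qed.

Lemma fam_prod P (I : Type) (s : seq I) (Q : pred I) (f : I -> P -> pt -> R) :
  (forall i, Q i -> fam (f i)) -> fam (fun p z => \prod_(i <- s | Q i) f i p z).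
Proof.
move=> ff; elim: s => [|i s IH].
  by under eq_fun do under eq_fun do rewrite big_nil; exact: fam_cst.
have [Qi|/negbTE Qi] := boolP (Q i); last first.
  by under eq_fun do under eq_fun do rewrite big_cons Qi.
under eq_fun do under eq_fun do rewrite big_cons Qi.
by apply: fam_mul => //; exact: ff.
Qed.

Lemma fam_exp P (f : P -> pt -> R) k : fam f -> fam (fun p z => f p z ^+ k).
Proof.
move=> ff; elim: k => [|k IH].
  by under eq_fun do under eq_fun do rewrite expr0; exact: fam_cst.
by under eq_fun do under eq_fun do rewrite exprS; exact: fam_mul.
Qed.

Lemma derive_eq0_open (f : pt -> R) (U : set pt) e z : open U -> U z ->
  (forall w, U w -> f w = 0) -> 'D_e f z = 0.
Proof.
move=> oU Uz f0; rewrite -(derive_cst (0 : R) z e); apply: near_eq_derive.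
near=> w; rewrite f0//; near: w.
exact: open_nbhs_nbhs.
Unshelve. all: end_near. Qed.

End smooth_families.

(** * Topology of space-time in coordinates; test functions *)

Section spacetime_topology.
Context {R : realType} {n : nat}.
Local Notation pt := ('cV[R]_n * R)%type.
Implicit Types (z w : pt) (o : option 'I_n) (U K : set pt).

Definition cbox (r : R) : set pt := [set z | forall o, `|crd o z| <= r].

Lemma crd_le_norm o z : `|crd o z| <= `|z|.
Proof.
rewrite prod_normE; case: o => [j|] /=; last by rewrite le_max lexx orbT.
rewrite le_max; apply/orP; left.
rewrite [leRHS]mx_normrE.
exact: (le_bigmax _ (fun i : 'I_n * 'I_1 => `|z.1 i.1 i.2|) (j, 0)).
Qed.

Lemma norm_lt_crd z (e : R) : 0 < e -> (forall o, `|crd o z| < e) -> `|z| < e.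
Proof.
move=> e0 H; rewrite prod_normE gt_max (H None) andbT [ltLHS]mx_normrE.
by apply: bigmax_lt => // -[i j] _ /=; rewrite [j]ord1; exact: (H (Some i)).
Qed.

Lemma crdB o z w : crd o (z - w) = crd o z - crd o w.
Proof. by case: o => [j|] //=; rewrite !mxE. Qed.

Lemma open_crd U z : open U -> U z ->
  exists2 e : R, 0 < e & forall w, (forall o, `|crd o z - crd o w| < e) -> U w.
Proof.
move=> oU Uz; have /nbhs_ballP[e /= e0 He] : nbhs z U by exact: open_nbhs_nbhs.
exists e => // w Hw; apply: He; rewrite -ball_normE /=.
by apply: norm_lt_crd => // o; rewrite crdB.
Qed.

Lemma crd_open U : (forall z, U z -> exists2 e : R, 0 < e &
  forall w, (forall o, `|crd o z - crd o w| < e) -> U w) -> open U.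
Proof.
move=> H; rewrite openE => z Uz; apply/nbhs_ballP.
have [e e0 He] := H z Uz; exists e => // w; rewrite -ball_normE /= => zw.
by apply: He => o; rewrite -crdB (le_lt_trans (crd_le_norm _ _)).
Qed.

Lemma continuous_crdP (T : topologicalType) (Psi : T -> pt) :
  (forall o, continuous (fun x => crd o (Psi x))) -> continuous Psi.
Proof.
move=> cPsi x; apply/cvgrPdist_lt => e e0.
have : \forall y \near x, forall o, `|crd o (Psi x) - crd o (Psi y)| < e.
  by apply: filter_forall => o; have /cvgrPdist_lt := cPsi o x; exact.
apply: filterS => y H; apply: norm_lt_crd => // o.
by rewrite crdB.
Qed.

Lemma continuous_crd o : continuous (@crd R n o).
Proof. by move=> z; apply: differentiable_continuous; exact: differentiable_crd. Qed.

Lemma compact_cbox (r : R) : compact (cbox r).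
Proof.
have cr : compact (`[- r, r]%classic : set R) by exact: segment_compact.
have crow := rV_compact (fun _ : 'I_n => cr).
have ccol : compact (trmx @` [set v : 'rV[R]_n | forall i, `[- r, r]%classic (v ord0 i)]).
  apply: continuous_compact crow; apply: continuous_subspaceT => v.
  move=> P [Q HQ QP]; exists (fun i j => Q j i).
    by move=> i j; have := HQ j i; rewrite mxE.
  by move=> M HM; apply: QP => i j; rewrite mxE; exact: HM.
have := compact_setX ccol cr; set A := _ `*` _ => cA; suff -> : cbox r = A by [].
apply/esym/seteqP; split => [[x t] /= [[v Hv vx] Ht] [j|] /=|[x t] /= H].
- by move: vx => /= <-; rewrite mxE; have := Hv j; rewrite /= in_itv/= -ler_norml.
- by move: Ht; rewrite /= in_itv/= -ler_norml.
- split; last by have := H None; rewrite /= in_itv/= -ler_norml.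
  exists x^T; last by rewrite trmxK.
  by move=> i; rewrite mxE /= in_itv/= -ler_norml; exact: (H (Some i)).
Qed.

Lemma compact_sub_cbox K : compact K -> exists r : R, 0 < r /\ K `<=` cbox r.
Proof.
move=> cK.
have H o : exists M : R, forall z, K z -> `|crd o z| <= M.
  have : compact (crd o @` K).
    by apply: continuous_compact cK; apply: continuous_subspaceT; exact: continuous_crd.
  move=> /compact_bounded [M [_ HM]]; exists (M + 1) => z Kz.
  by apply: (HM (M + 1)); [rewrite ltrDl|exists z].
have [M HM] := choice H.
exists (1 + \sum_o `|M o|); split.
  by rewrite ltr_pwDl// sumr_ge0.
move=> z Kz o; rewrite (le_trans (HM o z Kz))//.
rewrite (bigD1 o)//= addrA (le_trans (ler_norm _))//.
by rewrite addrAC lerDr addr_ge0// sumr_ge0.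
Qed.

Lemma closed_cbox (r : R) : closed (cbox r).
Proof. by apply: compact_closed; [exact: norm_hausdorff|exact: compact_cbox]. Qed.

Lemma measurable_cbox (r : R) : measurable (cbox r).
Proof.
rewrite (_ : cbox r = [set z | forall o, `[- r, r]%classic (crd o z)]).
  exact: (@measurable_ptbox _ _ (fun=> `[- r, r]%classic) (fun=> measurable_itvR _)).
by apply/seteqP; split => z /= H o; have := H o; rewrite in_itv/= -ler_norml.
Qed.

Lemma vol_cbox_lty (r : R) : (vol (cbox r) < +oo)%E.
Proof.
rewrite (_ : cbox r = [set z | forall o, `[- r, r]%classic (crd o z)]); last first.
  by apply/seteqP; split => z /= H o; have := H o; rewrite in_itv/= -ler_norml.
rewrite (@vol_box _ _ (fun=> `[- r, r]%classic) (fun=> measurable_itvR _)).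
have fI : @lebesgue1 R `[- r, r]%classic \is a fin_num.
  by rewrite /lebesgue1 lebesgue_measure_itv/=; case: ifP.
suff : (\prod_(i < n) @lebesgue1 R (`[- r, r]%classic)%R * @lebesgue1 R (`[- r, r]%classic)%R)%E \is a fin_num.
  by rewrite fin_numElt => /andP[].
by rewrite fin_numM//; apply: (big_ind (fun x : \bar R => x \is a fin_num)) => //; exact: fin_numM.
Qed.

Definition ratpt (q : 'cV[rat]_n * rat) : pt := (map_mx ratr q.1, ratr q.2).

Lemma ratpt_dense z (e : R) : 0 < e ->
  exists q, forall o, `|crd o z - crd o (ratpt q)| < e.
Proof.
move=> e0.
have H (x : R) : exists q : rat, `|x - ratr q| < e.
  have xe : x - e < x + e by lra.
  have [q] := rat_in_itvoo xe; rewrite in_itv/= => /andP[q1 q2].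
  by exists q; rewrite ltr_norml; apply/andP; split; lra.
have [q1 Hq1] := choice (fun j => H (z.1 j 0)); have [q2 Hq2] := H z.2.
exists (\col_j q1 j, q2) => -[j|] //=.
by rewrite !mxE; exact: Hq1.
Qed.

(** The sigma-algebra comes from the coordinates and not from the topology. The link is that an open
    set is the union of the boxes it contains with rational centre and half-width 1/(k+1), and these
    are countably many. *)
Lemma open_measurable_pt U : open U -> measurable U.
Proof.
move=> oU.
pose b (q : ('cV[rat]_n * rat) * nat) : set pt :=
  [set w | forall o, `](crd o (ratpt q.1) - q.2.+1%:R^-1), (crd o (ratpt q.1) + q.2.+1%:R^-1)[%classic (crd o w)].
pose I := [set q | b q `<=` U].
have -> : U = \bigcup_(q in I) b q.
  apply/seteqP; split => [z Uz|z [q Iq bq]]; last exact: Iq.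
  have [e e0 He] := open_crd oU Uz.
  have [k] : exists k : nat, (k.+1%:R^-1 : R) < e / 2.
    have e2 : 0 < e / 2 by rewrite divr_gt0.
    have [k _ Hk] := near_infty_natSinv_lt (PosNum e2).
    by exists k; exact: (Hk k (leqnn k)).
  move=> ke; have k0 : 0 < (k.+1%:R^-1 : R) by rewrite invr_gt0 ltr0n.
  have [q Hq] := ratpt_dense z k0.
  exists (q, k) => [w /= bw|o /=].
    apply: He => o; move: ke (Hq o) (bw o); rewrite /= in_itv/= !ltr_norml.
    move: (k.+1%:R^-1) => d ke /andP[? ?] /andP[? ?].
    by apply/andP; split; lra.
  have := Hq o; rewrite in_itv/= ltr_norml; move: (k.+1%:R^-1) => d /andP[? ?].
  by apply/andP; split; lra.
rewrite bigcup_mkcond; apply: countable_bigcupT_measurable => [|q].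
  exact: countableP.
case: ifP => // _.
apply: (@measurable_ptbox _ _ (fun o => `](crd o (ratpt q.1) - q.2.+1%:R^-1), (crd o (ratpt q.1) + q.2.+1%:R^-1)[%classic)) => o.
exact: measurable_itvR.
Qed.

Lemma continuous_measurable_pt (f : pt -> R) : continuous f -> measurable_fun setT f.
Proof.
move=> /continuousP cf; apply: (measurability _ (RGenOInfty.measurableE R)) => //.
move=> _ [_ [x ->] <-]; rewrite setTI; apply: open_measurable_pt.
by apply: cf; exact: rray_open.
Qed.

Lemma closed_measurable_pt U : closed U -> measurable U.
Proof.
move=> cU; rewrite -(setCK U); apply: measurableC; apply: open_measurable_pt.
exact: closed_openC.
Qed.

Lemma compact_measurable_pt K : compact K -> measurable K.
Proof. by move=> cK; apply: closed_measurable_pt; apply: compact_closed. Qed.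

Lemma compact_vol_lty K : compact K -> (vol K < +oo)%E.
Proof.
move=> cK; have [r [_ Kr]] := compact_sub_cbox cK.
apply: le_lt_trans (vol_cbox_lty r); apply: le_measure => //; rewrite inE.
  exact: compact_measurable_pt.
exact: measurable_cbox.
Qed.

(* Test functions: elements of the class fam vanishing off a compact subset
   of U. *)
Definition sm (f : pt -> R) := fam (fun _ : unit => f).

Definition tst U (f : pt -> R) : Prop :=
  sm f /\ exists2 K, compact K /\ K `<=` U & forall z, ~ K z -> f z = 0.

Lemma sm_measurable f : sm f -> measurable_fun setT f.
Proof. exact: (fam_measurable tt). Qed.

Lemma sm_continuous f : sm f -> continuous f.
Proof. exact: (fam_continuous (p := tt)). Qed.

Lemma tst_meas U f : tst U f -> measurable_fun setT f.
Proof. by move=> [sf _]; exact: sm_measurable. Qed.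

Lemma tst_bounded U f : tst U f -> exists M : R, forall z, `|f z| <= M.
Proof.
move=> [sf [K [cK _] f0]]; have [r [_ Kr]] := compact_sub_cbox cK.
have [M HM] := fam_bounded sf r.
exists `|M| => z; have [Kz|nKz] := pselect (K z).
  by apply: le_trans (ler_norm _); exact: (HM tt z (Kr z Kz)).
by rewrite f0// normr0.
Qed.

Lemma tst_sq U f : tst U f -> sq vol f.
Proof.
move=> tf; have [M HM] := tst_bounded tf; have [sf [K [cK _] f0]] := tf.
apply: (@sq_bounded _ _ _ _ f K M) => //; first exact: compact_measurable_pt.
  exact: compact_vol_lty.
exact: sm_measurable.
Qed.

Lemma tst_intg U f : tst U f -> intg vol f.
Proof.
move=> tf; have [M HM] := tst_bounded tf; have [sf [K [cK _] f0]] := tf.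
have mK := compact_measurable_pt cK.
apply: (@intg_le _ _ _ _ _ (fun z => M * \1_K z)).
- exact: sm_measurable.
- move=> z; rewrite indicE; case: (boolP (z \in K)) => [_|/negP]; rewrite ?mulr1//.
  by rewrite inE => /f0 ->; rewrite normr0 mulr0.
- by apply: intgZ; apply: intg_indic_fin => //; exact: compact_vol_lty.
Qed.

Lemma tstD U f g : tst U f -> tst U g -> tst U (fun z => f z + g z).
Proof.
move=> [sf [K [cK KU] f0]] [sg [L [cL LU] g0]]; split; first exact: fam_add.
exists (K `|` L).
  by split; [exact: compactU|rewrite subUset].
by move=> z /not_orP[nK nL]; rewrite f0// g0// addr0.
Qed.

Lemma tstMl U f g : sm f -> tst U g -> tst U (fun z => f z * g z).
Proof.
move=> sf [sg [L [cL LU] g0]]; split; first exact: fam_mul.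
by exists L => // z /g0 ->; rewrite mulr0.
Qed.

Lemma tstMr U f g : tst U f -> sm g -> tst U (fun z => f z * g z).
Proof. by move=> tf sg; under eq_fun do rewrite mulrC; exact: tstMl. Qed.

Lemma tstZ U c f : tst U f -> tst U (fun z => c * f z).
Proof. by apply: tstMl; exact: fam_cst. Qed.

Lemma tst0 U : tst U (fun=> 0).
Proof.
split; first exact: fam_cst.
by exists set0 => //; split; [exact: compact0|].
Qed.

Lemma tst_sum U (I : Type) (s : seq I) (P : pred I) (f : I -> pt -> R) :
  (forall i, P i -> tst U (f i)) -> tst U (fun z => \sum_(i <- s | P i) f i z).
Proof.
move=> tf; elim: s => [|i s IH].
  by under eq_fun do rewrite big_nil; exact: tst0.
have [Pi|/negbTE Pi] := boolP (P i); last first.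
  by under eq_fun do rewrite big_cons Pi.
under eq_fun do rewrite big_cons Pi.
by apply: tstD => //; exact: tf.
Qed.

Lemma tst_derive U f e : tst U f -> tst U ('D_e f).
Proof.
move=> [sf [K [cK KU] f0]]; split; first exact: fam_derive.
exists K => // z nKz; apply: (@derive_eq0_open _ _ _ (~` K)) => //.
by apply: closed_openC; exact: compact_closed.
Qed.

Lemma tstS U V f : U `<=` V -> tst U f -> tst V f.
Proof.
by move=> UV [sf [K [cK KU] f0]]; split => //; exists K => //; split => //; exact: subset_trans UV.
Qed.

End spacetime_topology.

(** * Boxes, density of test functions, vanishing of distributions *)

Section boxes.
Context {R : realType} {n : nat}.
Local Notation pt := ('cV[R]_n * R)%type.
Local Notation idx := (option 'I_n).
Implicit Types (z w : pt) (o : idx) (U K : set pt) (a b : idx -> R).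

Definition obox a b : set pt := [set z | forall o, a o < crd o z < b o].

Definition clbox a b : set pt := [set z | forall o, a o <= crd o z <= b o].

Lemma compact_clbox a b : compact (clbox a b).
Proof.
apply: (subclosed_compact _ (@compact_cbox R n (\sum_o (`|a o| + `|b o|)))).
- rewrite -[clbox a b]setCK; apply: open_closedC; apply: crd_open => z /existsNP[i].
  move=> /negP; rewrite negb_and -!ltNge => /orP[zo|zo].
  + exists (a i - crd i z); first by rewrite subr_gt0.
    move=> w /(_ i) zw /(_ i) /andP[aw _]; move: zw; rewrite ltNge => /negP; apply.
    by rewrite distrC (le_trans _ (ler_norm _))// lerB.
  + exists (crd i z - b i); first by rewrite subr_gt0.
    move=> w /(_ i) zw /(_ i) /andP[_ bw]; move: zw; rewrite ltNge => /negP; apply.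
    by rewrite (le_trans _ (ler_norm _))// lerB.
- move=> z Hz o; have /andP[az zb] := Hz o.
  rewrite (bigD1 o)//= (@le_trans _ _ (`|a o| + `|b o|))//; last first.
    by rewrite lerDl sumr_ge0// => i _; rewrite addr_ge0.
  rewrite ler_norml; have := ler_norm (b o); have := ler_norm (- a o); rewrite normrN => ? ?.
  by have := normr_ge0 (a o); have := normr_ge0 (b o) => ? ?; apply/andP; split; lra.
Qed.

Lemma oboxE a b : obox a b = [set z | forall o, `]a o, b o[%classic (crd o z)].
Proof. by apply/seteqP; split => z /= H o; have := H o; rewrite in_itv. Qed.

Lemma measurable_obox a b : measurable (obox a b).
Proof.
rewrite oboxE; apply: (@measurable_ptbox _ _ (fun o => `]a o, b o[%classic)) => o.
exact: measurable_itvR.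
Qed.

Lemma obox_vol_lty a b : (vol (obox a b) < +oo)%E.
Proof.
apply: (@le_lt_trans _ _ (vol (clbox a b))).
  apply: le_measure; rewrite ?inE.
  - exact: measurable_obox.
  - by apply: compact_measurable_pt; exact: compact_clbox.
  - by move=> z H o; have /andP[? ?] := H o; apply/andP; split; exact: ltW.
by apply: compact_vol_lty; exact: compact_clbox.
Qed.

(** It vanishes off ]a, b[ and equals 1 at distance 2/(k+1) from both ends, hence increases the use
    of [step] to a smooth approximation of the indicator. *)
Definition plateau (k : nat) (a b x : R) : R :=
  step (k.+1%:R * x + (- k.+1%:R * a - 1)) * step (- k.+1%:R * x + (k.+1%:R * b - 1)).

Lemma c1_plateau k (a b : R) : c1 (plateau k a b).
Proof. by apply: c1_mul; apply: c1_aff; exact: c1_step. Qed.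

Lemma plateau_itv k (a b x : R) : 0 <= plateau k a b x <= 1.
Proof.
by rewrite /plateau mulr_ge0 ?step_ge0//= mulr_ile1 ?step_ge0 ?step_le1.
Qed.

Lemma plateau_eq0 k (a b x : R) : ~~ (a < x < b) -> plateau k a b x = 0.
Proof.
have k0 : 0 < k.+1%:R :> R by rewrite ltr0n.
rewrite negb_and -!leNgt => /orP[xa|bx]; rewrite /plateau.
  by rewrite step_le ?mul0r//; nra.
by rewrite mulrC step_le ?mul0r//; nra.
Qed.

Lemma plateau_cvg (a b x : R) : plateau k a b x @[k --> \oo] --> ((a < x < b)%R%:R : R).
Proof.
have [/andP[ax xb]|nx] := boolP (a < x < b); last first.
  by apply: cvg_near_cst; apply: nearW => k; rewrite plateau_eq0.
apply: cvg_near_cst; near=> k.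
have k1 : k.+1%:R * (x - a) >= 2.
  by rewrite -ler_pdivrMr ?subr_gt0// (le_trans (ltW (truncnS_gt _)))// ler_nat ltnS; near: k; exists (Num.truncn (2 / (x - a))).
have k2 : k.+1%:R * (b - x) >= 2.
  by rewrite -ler_pdivrMr ?subr_gt0// (le_trans (ltW (truncnS_gt _)))// ler_nat ltnS; near: k; exists (Num.truncn (2 / (b - x))).
by rewrite /plateau !step_ge ?mulr1//; nra.
Unshelve. all: end_near. Qed.

Definition boxfun (k : nat) a b z : R := \prod_(o : idx) plateau k (a o) (b o) (crd o z).

Lemma boxfun_itv k a b z : 0 <= boxfun k a b z <= 1.
Proof.
rewrite /boxfun; apply/andP; split.
  by apply: prodr_ge0 => o _; have /andP[] := plateau_itv k (a o) (b o) (crd o z).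
by apply: prodr_ile1 => o _; exact: plateau_itv.
Qed.

Lemma boxfun_eq0 k a b z : ~ obox a b z -> boxfun k a b z = 0.
Proof.
move=> /existsNP[i /negP zi]; rewrite /boxfun (bigD1 i)//=.
by rewrite plateau_eq0 ?mul0r.
Qed.

Lemma boxfun_cvg a b z : boxfun k a b z @[k --> \oo] --> (\1_(obox a b) z : R).
Proof.
have -> : (\1_(obox a b) z : R) = \prod_(i : idx) ((a i < crd i z < b i)%R%:R : R).
  rewrite indicE; have [zb|zb] := boolP (z \in obox a b).
    by rewrite big1// => i _; rewrite inE in zb; rewrite (zb i).
  move: zb; rewrite notin_setE => /existsNP[i /negP/negbTE zi].
  by rewrite (bigD1 i)//= zi mul0r.
rewrite /boxfun; elim: (index_enum _) => [|i s IH].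
  by under eq_fun do rewrite big_nil; rewrite big_nil; exact: cvg_cst.
under eq_fun do rewrite big_cons; rewrite big_cons.
by apply: cvgM => //; exact: plateau_cvg.
Qed.

Lemma tst_boxfun k a b U : clbox a b `<=` U -> tst U (boxfun k a b).
Proof.
move=> abU; split.
  by apply: fam_prod => i _; apply: fam_comp; [exact: c1_plateau|exact: fam_crd].
exists (clbox a b); first by split => //; exact: compact_clbox.
move=> z nz; apply: boxfun_eq0 => zo; apply: nz => i.
by have /andP[? ?] := zo i; apply/andP; split; exact: ltW.
Qed.

Definition oboxes : set (set pt) := [set A | exists a b, A = obox a b].

Lemma obox_setI a b a' b' : obox a b `&` obox a' b' =
  obox (fun i => Num.max (a i) (a' i)) (fun i => Num.min (b i) (b' i)).
Proof.
apply/seteqP; split => z /=.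
  by move=> [H1 H2] i; have := H1 i; have := H2 i; rewrite gt_max lt_min => /andP[-> ->] /andP[-> ->].
by move=> H; split => i; have := H i; rewrite gt_max lt_min => /andP[/andP[? ?] /andP[? ?]]; apply/andP.
Qed.

Lemma oboxes_setI : setI_closed oboxes.
Proof.
move=> _ _ [a [b ->]] [c [d ->]]; rewrite obox_setI; by do 2 eexists.
Qed.

Let cube (k : nat) : set pt := obox (fun=> - k.+1%:R) (fun=> k.+1%:R).

Lemma ex_cube z : exists k, cube k z.
Proof.
have [k Hk] := ex_crd_le z; exists k => i; have := Hk i.
rewrite ler_norml -ltr_norml => /andP[? ?].
have kk : k%:R < k.+1%:R :> R by rewrite ltr_nat.
by rewrite ltr_norml; apply/andP; split; lra.
Qed.

Lemma nd_cube : nondecreasing_seq cube.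
Proof.
move=> p q pq; apply/subsetPset => z H i; have /andP[? ?] := H i.
have pq' : p.+1%:R <= q.+1%:R :> R by rewrite ler_nat.
by apply/andP; split; lra.
Qed.

Lemma oboxes_generate : measurable = <<s oboxes >>.
Proof.
apply/seteqP; split; last first.
  apply: smallest_sub; first exact: sigma_algebra_measurable.
  by move=> _ [a [b ->]]; exact: measurable_obox.
move=> A mA.
pose T := g_sigma_algebraType oboxes.
suff mid : measurable_fun [set: T] (id : T -> pt).
  by have := mid measurableT A mA; rewrite setTI.
apply: measurable_fun_pt => i.
apply: (measurability _ (RGenOInfty.measurableE R)) => // _ [_ [x ->] <-].
rewrite setTI (_ : _ @^-1` _ = \bigcup_k obox (fun j => if j == i then x else - k.+1%:R) (fun=> k.+1%:R)).
  apply: bigcupT_measurable => k; apply: sub_sigma_algebra.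
  by exists (fun j => if j == i then x else - k.+1%:R), (fun=> k.+1%:R).
apply/seteqP; split => z /=.
  rewrite in_itv/= andbT => xz; have [k Hk] := ex_cube z; exists k => // j.
  by have /andP[H1 H2] := Hk j; rewrite H2 andbT; case: eqP => [->|_].
by move=> [k _ /(_ i)]; rewrite eqxx in_itv/= andbT => /andP[].
Qed.

Lemma tst_density (a : pt -> R) : sq vol a -> forall eta : R, 0 < eta ->
  exists2 chi, tst setT chi & sqd vol a chi <= eta.
Proof.
apply: (@sq_density _ _ _ vol oboxes cube (tst setT) oboxes_generate oboxes_setI).
- by move=> k; exists (fun=> - k.+1%:R), (fun=> k.+1%:R).
- exact: nd_cube.
- exact: ex_cube.
- by move=> k; exact: obox_vol_lty.
- exact: tst0.
- by move=> f g; exact: tstD.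
- by move=> c f; exact: tstZ.
- by move=> f; exact: tst_sq.
- move=> _ [a0 [b ->]] eta eta0.
  have sA := @sq_indic _ _ R vol _ (measurable_obox a0 b) (obox_vol_lty a0 b).
  have H : sqd vol (\1_(obox a0 b)) (boxfun k a0 b) @[k --> \oo] --> 0.
    apply: (@sqd_dct _ _ _ _ _ _ (\1_(obox a0 b))) => //.
    + by move=> k; apply: (@tst_meas _ _ setT); exact: tst_boxfun.
    + move=> k z; rewrite indicE; have [zb|zb] := boolP (z \in obox a0 b).
        have /andP[? ?] := boxfun_itv k a0 b z.
        by rewrite -[true%:R]/(1 : R) normr1 ger0_norm; lra.
      by rewrite boxfun_eq0 ?subr0//; rewrite notin_setE in zb.
    + by move=> z; exact: boxfun_cvg.
  move: H => /cvgr0_norm_le /(_ eta eta0) [k _ /(_ k (leqnn _))] Hk.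
  exists (boxfun k a0 b); first exact: tst_boxfun.
  by apply: le_trans Hk; exact: ler_norm.
Qed.

(** Smooth box functions show that v has integral 0 on every open box inside U, the pi-lambda
    theorem extends this to Borel subsets of such a box, so v vanishes almost everywhere in it, and
    countably many boxes cover U. *)
Lemma du_bois_reymond U (v : pt -> R) : open U ->
  (forall K, compact K -> K `<=` U -> intg vol (fun z => \1_K z * v z)) ->
  (forall phi, tst U phi -> \int[vol]_z (v z * phi z) = 0) ->
  {ae vol, forall z, U z -> v z = 0}.
Proof.
move=> oU vint v0.
have boxint c e : clbox c e `<=` U -> \int[vol]_z (\1_(obox c e) z * v z) = 0.
  move=> ceU; have vC := vint _ (@compact_clbox c e) ceU.
  have sub : obox c e `<=` clbox c e.
    by move=> z H i; have /andP[? ?] := H i; apply/andP; split; exact: ltW.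
  have vB (f : pt -> R) : (forall z, ~ obox c e z -> f z = 0) ->
      (fun z => f z * v z) = (fun z => f z * (\1_(clbox c e) z * v z)).
    move=> f0; apply/funext => z; rewrite indicE; have [zo|zo] := pselect (obox c e z).
      by rewrite mem_set ?mul1r//; exact: sub.
    by rewrite f0// !mul0r.
  have H : \int[vol]_z (boxfun k c e z * v z) @[k --> \oo] -->
      \int[vol]_z (\1_(obox c e) z * v z).
    apply: (@Int_dct _ _ _ _ _ _ (fun z => `|\1_(clbox c e) z * v z|)).
    - move=> k; rewrite vB; last by move=> z; exact: boxfun_eq0.
      apply: measurable_funM; last exact: intg_meas vC.
      by apply: (@tst_meas _ _ setT); exact: tst_boxfun.
    - rewrite vB; last by move=> z zo; rewrite indicE memNset.
      apply: measurable_funM; last exact: intg_meas vC.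
      by apply: measurable_indic; exact: measurable_obox.
    - by move=> z; apply: cvgMl; exact: boxfun_cvg.
    - move=> k z; have [zo|zo] := pselect (obox c e z); last first.
        by rewrite boxfun_eq0// mul0r normr0.
      rewrite indicE mem_set ?mul1r; last exact: sub.
      rewrite normrM ler_piMl//; have /andP[? ?] := boxfun_itv k c e z.
      by rewrite ger0_norm.
    - exact: intg_abs.
  apply: (cvg_unique _ H) => //; apply: cvg_near_cst; apply: nearW => k.
  under eq_Rintegral do rewrite mulrC; apply: v0; exact: tst_boxfun.
have box0 a b : clbox a b `<=` U -> {ae vol, forall z, obox a b z -> v z = 0}.
  move=> abU; have cC := @compact_clbox a b.
  have vC := vint _ cC abU.
  have mB := measurable_obox a b.
  have sub : obox a b `<=` clbox a b.
    by move=> z H i; have /andP[? ?] := H i; apply/andP; split; exact: ltW.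
  have vE E : measurable E -> intg vol (fun z => \1_(E `&` obox a b) z * v z).
    move=> mE.
    have -> : (fun z => \1_(E `&` obox a b) z * v z) =
        (fun z => \1_(E `&` obox a b) z * (\1_(clbox a b) z * v z)).
      apply/funext => z; rewrite !indicE; case: (boolP (z \in E `&` obox a b)) => [|_]; last by rewrite !mul0r.
      by rewrite inE => -[_ /sub zC]; rewrite mem_set// !mul1r.
    apply: (@intgMb _ _ _ _ _ _ 1) => //.
      by apply: measurable_indic; exact: measurableI.
    by move=> z; rewrite indicE; case: (_ \in _); rewrite ?normr1 ?normr0.
  pose H := [set E | measurable E /\ \int[vol]_z (\1_(E `&` obox a b) z * v z) = 0].
  suff HH : measurable `<=` H.
    have : ae_eq vol setT (fun z => (\1_(obox a b) z * v z)%:E) (cst 0%E).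
      apply: integral_ae_eq => //.
        by have := vE _ measurableT; rewrite setTI.
      move=> E _ mE; rewrite integral0 integral_mkcond.
      have [_ E0] := HH _ mE.
      have -> : ((fun z => (\1_(obox a b) z * v z)%:E) \_ E) =
          (fun z => (\1_(E `&` obox a b) z * v z)%:E).
        apply/funext => z; rewrite patchE !indicE in_setI.
        by case: (z \in E); rewrite //= mul0r.
      by rewrite -IntE ?E0//; exact: vE.
    apply: filterS => z /(_ I) /= E zo.
    by move: E; rewrite indicE mem_set// mul1r => -[].
  rewrite oboxes_generate; apply: lambda_system_subset => //; first exact: oboxes_setI.
    split => //.
    - by split => //; rewrite setTI; exact: boxint.
    - move=> A C CA [mA HA] [mC HC]; split; first exact: measurableD.
      rewrite -[RHS](subrr 0) -{1}HA -HC -IntB; try exact: vE.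
      apply: eq_Rintegral => z _; rewrite -mulrBl; congr (_ * _).
      rewrite !indicE setDE !in_setI in_setC.
      have [zC|zC] := boolP (z \in C).
        have -> : z \in A by rewrite inE; apply: CA; rewrite inE in zC.
        by case: (z \in obox a b) => /=; ring.
      by case: (z \in A); case: (z \in obox a b) => /=; ring.
    - move=> F ndF HF; split; first by apply: bigcupT_measurable => k; have [] := HF k.
      have mF k : measurable (F k) by have [] := HF k.
      have H1 : \int[vol]_z (\1_(F k `&` obox a b) z * v z) @[k --> \oo] -->
          \int[vol]_z (\1_(\bigcup_k F k `&` obox a b) z * v z).
        apply: (@Int_dct _ _ _ _ _ _ (fun z => `|\1_(setT `&` obox a b) z * v z|)).
        + by move=> k; exact: intg_meas (vE _ (mF k)).
        + by apply: intg_meas (vE _ _); exact: bigcupT_measurable.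
        + move=> z; apply: cvg_near_cst.
          have [[k _ Fkz]|nF] := pselect ((\bigcup_k F k) z); last first.
            apply: nearW => k; rewrite !indicE !in_setI (memNset nF).
            by rewrite (memNset (_ : ~ F k z))// => Fkz; apply: nF; exists k.
          near=> p; rewrite !indicE !in_setI (mem_set (_ : (\bigcup_k F k) z))//; last by exists k.
          rewrite (mem_set (_ : F p z))//.
          have kp : (k <= p)%N by near: p; exists k.
          by have /subsetPset := ndF _ _ kp; exact.
        + move=> k z; rewrite setTI !indicE in_setI.
          by case: (z \in F k); case: (z \in obox a b); rewrite //= mul0r normr0.
        + by apply: intg_abs; exact: vE.
      apply: (cvg_unique _ H1) => //; apply: cvg_near_cst; apply: nearW => k.
      by have [] := HF k.
  move=> _ [c [e ->]]; split; first exact: measurable_obox.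
  rewrite obox_setI; apply: boxint => z Hz; apply: abU => i.
  by have := Hz i; rewrite ge_max le_min => /andP[/andP[? ?] /andP[? ?]]; apply/andP.
(* Corners of the box with rational centre [q.1] and half-width 1/([q.2]+1). Coding these boxes by
   natural numbers allows a countable intersection of sets of full measure. *)
pose C (q : ('cV[rat]_n * rat) * nat) (s : R) o := crd o (@ratpt R n q.1) + s * q.2.+1%:R^-1.
pose Q k z := if @unpickle (('cV[rat]_n * rat) * nat)%type k is Some q then
  clbox (C q (-1)) (C q 1) `<=` U -> obox (C q (-1)) (C q 1) z -> v z = 0 else True.
have HQ k : {ae vol, forall z, Q k z}.
  rewrite /Q; case: (unpickle k) => [q|]; last exact: aeW.
  have [qU|nqU] := pselect (clbox (C q (-1)) (C q 1) `<=` U); last exact: aeW.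
  by apply: filterS (box0 _ _ qU) => z Hz _.
have := ae_foralln HQ; apply: filterS => z Hz Uz.
have [e e0 He] := open_crd oU Uz.
have [k] : exists k : nat, (k.+1%:R^-1 : R) < e / 2.
  have e2 : 0 < e / 2 by rewrite divr_gt0.
  have [k _ Hk] := near_infty_natSinv_lt (PosNum e2).
  by exists k; exact: (Hk k (leqnn k)).
move=> ke; have k0 : 0 < (k.+1%:R^-1 : R) by rewrite invr_gt0 ltr0n.
have [q Hq] := ratpt_dense z k0.
have := Hz (pickle (q, k)); rewrite /Q pickleK; apply.
- move=> w /= bw; apply: He => i; move: ke (Hq i) (bw i); rewrite /C !ltr_norml /=.
  move: (k.+1%:R^-1) => d ke /andP[? ?] /andP[? ?].
  by apply/andP; split; lra.
- move=> i; move: (Hq i); rewrite /C ltr_norml /=.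
  by move: (k.+1%:R^-1) => d /andP[? ?]; apply/andP; split; lra.
Unshelve. all: end_near.
Qed.

Lemma is_derive_line (f : pt -> R) z e (s : R) : differentiable f (s *: e + z) ->
  is_derive s 1 (fun t : R => f (t *: e + z)) ('D_e f (s *: e + z)).
Proof.
move=> df; have df' : derivable f (s *: e + z) e by exact: diff_derivable.
have E : (fun h : R => h^-1 *: (((fun t : R => f (t *: e + z)) \o shift s) (h *: 1) - f (s *: e + z))) =
         (fun h : R => h^-1 *: ((f \o shift (s *: e + z)) (h *: e) - f (s *: e + z))).
  apply/funext => h /=; congr (_ *: (f _ - _)).
  by rewrite -[h *: 1]/(h * 1) mulr1 scalerDl addrA.
apply: DeriveDef; first by rewrite /derivable E.
by rewrite /derive E.
Qed.

Lemma vol_translate (e : pt) A : measurable A ->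
  vol ((fun z => z + e) @^-1` A) = (1%:E * vol A)%E.
Proof.
move=> mA; have := @vol_fibered R n (fun=> 1%:M) (fun=> e.1) (fun=> 1) 1 e.2 A.
rewrite big1 ?mulr1 ?invr1//.
rewrite (_ : (fun z : pt => (1%:M *m z.1 + e.1, 1 * z.2 + e.2)) = (fun z => z + e)); last first.
  by apply/funext => -[x t]; rewrite mul1mx mul1r.
move=> /(_ _ _ _ _ _ mA) -> //.
- by move=> _ i j ij; rewrite !mxE; case: eqP => // /(congr1 val) /= ij'; rewrite ij' ltnn in ij.
- by move=> _ i; rewrite mxE eqxx.
- apply: measurable_fun_pt => i.
  rewrite (_ : (fun x => _) = (fun z => crd i z + crd i e)).
    by apply: measurable_funD => //; exact: measurable_crd.
  by apply/funext => z; case: i => [j|]//=; rewrite mxE.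
Qed.

Lemma measurable_translate (e : pt) : measurable_fun setT (fun z : pt => z + e).
Proof.
apply: measurable_fun_pt => i.
rewrite (_ : (fun x => _) = (fun z => crd i z + crd i e)).
  by apply: measurable_funD => //; exact: measurable_crd.
by apply/funext => z; case: i => [j|]//=; rewrite mxE.
Qed.

Lemma Int_translate (e : pt) (f : pt -> R) : intg vol f ->
  \int[vol]_z f (z + e) = \int[vol]_z f z.
Proof.
move=> fi.
have := @Int_cov _ _ _ _ R vol vol (fun z : pt => z + e) (NngNum (@ler01 R)) (measurable_translate e) (@vol_translate e) f fi.
by rewrite mul1r.
Qed.

Lemma intg_translate (e : pt) (f : pt -> R) : intg vol f -> intg vol (fun z => f (z + e)).
Proof.
move=> fi.
exact: (@intg_cov _ _ _ _ R vol vol (fun z : pt => z + e) (NngNum (@ler01 R)) (measurable_translate e) (@vol_translate e) f fi).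
Qed.

Lemma crd_dir_le1 i j : `|crd i (@dir R n j)| <= 1.
Proof. by rewrite crd_dir; case: eqP; rewrite ?normr1 ?normr0. Qed.

(** Translation invariance makes the integral of every difference quotient vanish. By the mean value
    theorem the quotients converge pointwise and are dominated by a constant on a slightly larger
    cube. *)
Lemma Int_derive0 i (f : pt -> R) : tst setT f -> \int[vol]_z 'D_(dir i) f z = 0.
Proof.
move=> tf; have [sf [K [cK _] f0]] := tf.
have [r [r0 Kr]] := compact_sub_cbox cK.
have [M HM] := tst_bounded (tst_derive (dir i) tf).
have fi := tst_intg tf.
pose h (k : nat) : R := k.+1%:R^-1.
have h0 k : 0 < h k by rewrite invr_gt0 ltr0n.
have df z : differentiable f z by exact: (differentiable_fam tt z sf).
pose F k z := (h k)^-1 * (f (z + h k *: dir i) - f z).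
have Fi k : intg vol (F k).
  by apply: intgZ; apply: intgB => //; exact: intg_translate.
have F0 k : \int[vol]_z F k z = 0.
  rewrite IntZ ?IntB ?Int_translate ?subrr ?mulr0//; first exact: intg_translate.
  by apply: intgB => //; exact: intg_translate.
have MV k z : exists c, 0 <= c <= h k /\ F k z = 'D_(dir i) f (c *: dir i + z).
  have dg (t : R) : is_derive t 1 (fun t : R => f (t *: dir i + z)) ('D_(dir i) f (t *: dir i + z)).
    by apply: is_derive_line.
  have cont : {within `[0, h k], continuous (fun t : R => f (t *: dir i + z))}.
    apply: continuous_subspaceT => t; apply: differentiable_continuous.
    by apply/derivable1_diffP; apply: ex_derive; exact: dg.
  have [c] := @MVT_segment R (fun t => f (t *: dir i + z))
    (fun t => 'D_(dir i) f (t *: dir i + z)) 0 (h k) (ltW (h0 k)) (fun t _ => dg t) cont.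
  rewrite in_itv/= scale0r add0r subr0 => chk E; exists c; split => //.
  rewrite /F addrC [z + _]addrC addrC E mulrCA mulVf ?mulr1//.
  by rewrite gt_eqF.
have H : \int[vol]_z F k z @[k --> \oo] --> \int[vol]_z 'D_(dir i) f z.
  apply: (@Int_dct _ _ _ _ _ _ (fun z => M * \1_(@cbox R n (r + 1)) z)).
  - by move=> k; exact: intg_meas (Fi k).
  - exact: tst_meas (tst_derive _ tf).
  - move=> z; have [c Hc] := choice (MV ^~ z).
    have c0 : c k @[k --> \oo] --> (0 : R).
      apply: (@squeeze_cvgr _ _ _ _ (cst 0) h); last 2 first.
      + exact: cvg_cst.
      + exact: cvg_harmonic.
      by apply: nearW => k; have [] := Hc k.
    have cg : {for (0 : R), continuous (fun t : R => 'D_(dir i) f (t *: dir i + z))}.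
      apply: differentiable_continuous; apply/derivable1_diffP.
      exact: (@ex_derive _ _ _ _ _ _ _ (@is_derive_line ('D_(dir i) f) z (dir i) 0
        (differentiable_fam tt _ (fam_derive (dir i) sf)))).
    have := cvg_comp _ _ c0 cg; rewrite scale0r add0r.
    by under [X in X @ _ --> _ -> _]funext => k do rewrite /= -(Hc k).2.
  - move=> k z; rewrite indicE; have [zb|zb] := boolP (z \in @cbox R n (r + 1)).
      by rewrite mulr1; have [c [_ ->]] := MV k z; exact: HM.
    rewrite mulr0 /F !f0 ?subrr ?mulr0 ?normr0//.
    + move=> /Kr zr; move: zb; rewrite notin_setE; apply => j.
      by rewrite (le_trans (zr j))// lerDl.
    + move=> /Kr zr; move: zb; rewrite notin_setE; apply => j.
      have -> : crd j z = crd j (z + h k *: dir i) - h k * crd j (dir i).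
        by rewrite [z + _]addrC crd_lin addrC addKr.
      rewrite (le_trans (ler_normB _ _))// lerD//.
      rewrite normrM -[leRHS](mulr1 1) ler_pM// ?crd_dir_le1//.
      by rewrite ger0_norm ?(ltW (h0 k))// /h invf_le1 ?ler1n// ltr0n.
  - by apply: intgZ; apply: intg_indic_fin; [exact: measurable_cbox|exact: vol_cbox_lty].
apply: (cvg_unique _ H) => //; apply: cvg_near_cst; exact: nearW.
Qed.

End boxes.

(** * The group, its dilations and the vector field Y *)

Section homogeneous_group.
Context {R : realType} {n : nat}.
Local Notation pt := ('cV[R]_n * R)%type.
Local Notation idx := (option 'I_n).
Variables (B : 'M[R]_n) (blk : 'I_n -> nat) (r : nat).
Hypothesis B_blk : forall i j, B i j != 0 -> blk j = (blk i).+1.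
Hypothesis blk_ord : forall i j : 'I_n, (blk i < blk j)%N -> (i < j)%N.
Hypothesis blk_le : forall i, (blk i <= r)%N.
Implicit Types (z w : pt) (o : idx) (x : 'cV[R]_n).

Definition wt (j : 'I_n) : nat := (2 * blk j + 1)%N.

(** The matrix exponential exp(- s B^T): a finite sum, since the powers of B^T above r vanish. *)
Definition flow (s : R) : 'M[R]_n :=
  \sum_(k < r.+1) ((- s) ^+ k / k`!%:R) *: (B^T ^+ k).

Lemma trBX0E i j : (B^T ^+ 0) i j = (i == j)%:R.
Proof. by rewrite expr0 -[1]/(1%:M) mxE. Qed.

Lemma trBX_neq0 k i j : (B^T ^+ k) i j != 0 -> blk i = (blk j + k)%N.
Proof.
elim: k i j => [|k IH] i j.
  by rewrite trBX0E addn0; have [->//|_] := eqVneq i j; rewrite eqxx.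
rewrite exprS -[_ * _]/(_ *m _) mxE => H.
have [l] : exists l, B^T i l * (B^T ^+ k) l j != 0.
  apply/existsP; apply: contra_neqT H; rewrite negb_exists => /forallP H.
  by rewrite big1// => l _; apply/eqP; move: (H l); rewrite negbK.
rewrite mulf_eq0 negb_or mxE => /andP[/B_blk -> /IH ->].
by rewrite addnS.
Qed.

Lemma trBX_eq0 k : (r < k)%N -> B^T ^+ k = 0.
Proof.
move=> rk; apply/matrixP => i j; rewrite [RHS]mxE; apply/eqP/negPn/negP => /trBX_neq0 E.
by have := blk_le i; rewrite E leqNgt ltn_addl.
Qed.

Lemma flowE s i j : flow s i j =
  if (blk j <= blk i)%N then
    (- s) ^+ (blk i - blk j) / (blk i - blk j)`!%:R * (B^T ^+ (blk i - blk j)) i j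
  else 0.
Proof.
rewrite /flow summxE; case: ifPn => [ji|nji].
  have dr : (blk i - blk j < r.+1)%N by rewrite ltnS (leq_trans (leq_subr _ _)).
  rewrite (bigD1 (Ordinal dr))//= mxE big1 ?addr0// => k kd.
  rewrite mxE; have [->|/trBX_neq0 E] := eqVneq ((B^T ^+ k) i j) 0; first by rewrite mulr0.
  by move: kd; rewrite -val_eqE/= E addKn eqxx.
rewrite big1// => k _; rewrite mxE.
have [->|/trBX_neq0 E] := eqVneq ((B^T ^+ k) i j) 0; first by rewrite mulr0.
by move: nji; rewrite E leq_addr.
Qed.

Lemma flow_upper s (i j : 'I_n) : (i < j)%N -> flow s i j = 0.
Proof.
move=> ij; rewrite flowE; case: ifP => // ji.
move: ji; rewrite leq_eqVlt => /orP[/eqP e|/blk_ord ji]; last first.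
  by move: (ltn_trans ij ji); rewrite ltnn.
rewrite e subnn trBX0E.
by case: eqP => [e'|_]; [rewrite e' ltnn in ij|rewrite mulr0].
Qed.

Lemma flow_diag s (i : 'I_n) : flow s i i = 1.
Proof.
by rewrite flowE leqnn subnn trBX0E expr0 fact0 divr1 mul1r eqxx.
Qed.

(** Entry (i, j) of the flow is a monomial in s of degree [blk i - blk j], half the difference of
    the two weights. *)
Lemma flow_homog (rho s : R) i j :
  rho ^+ wt i * flow s i j = flow (rho ^+ 2 * s) i j * rho ^+ wt j.
Proof.
rewrite !flowE; case: ifP => ji; last by rewrite mulr0 mul0r.
rewrite -mulrN exprMn -exprM.
have -> : wt i = (2 * (blk i - blk j) + wt j)%N.
  by rewrite /wt addnA -mulnDr subnK.
rewrite exprD; set a := rho ^+ _; set b := rho ^+ _; ring.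
Qed.

(** The binomial theorem. The truncated double sums differ from the full ones only by terms with a
    power of B^T above r, which are 0. *)
Lemma flowD s t : flow (s + t) = flow s *m flow t.
Proof.
have E (k : nat) : (- (s + t)) ^+ k / k`!%:R =
    \sum_(a < k.+1) ((- s) ^+ a / a`!%:R) * ((- t) ^+ (k - a) / (k - a)`!%:R).
  rewrite opprD addrC exprDn mulr_suml; apply: eq_bigr => a _.
  have ak : (a <= k)%N by rewrite -ltnS.
  rewrite -mulr_natr.
  have a0 : a`!%:R != 0 :> R by rewrite pnatr_eq0 -lt0n fact_gt0.
  have ka0 : (k - a)`!%:R != 0 :> R by rewrite pnatr_eq0 -lt0n fact_gt0.
  have k0 : k`!%:R != 0 :> R by rewrite pnatr_eq0 -lt0n fact_gt0.
  have -> : 'C(k, a)%:R = k`!%:R / (a`!%:R * (k - a)`!%:R) :> R.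
    by rewrite -(bin_fact ak) !natrM; field; apply/andP.
  by field; apply/and3P.
rewrite /flow mulmx_suml.
pose G (a b : nat) : 'M[R]_n :=
  (((- s) ^+ a / a`!%:R) * ((- t) ^+ b / b`!%:R)) *: (B^T ^+ (a + b)).
have G0 a b : (r < a + b)%N -> G a b = 0.
  by move=> ab; rewrite /G trBX_eq0 ?scaler0.
transitivity (\sum_(a < r.+1) \sum_(b < r.+1) G a b); last first.
  apply: eq_bigr => a _; rewrite mulmx_sumr; apply: eq_bigr => b _.
  by rewrite -scalemxAl -scalemxAr scalerA /G exprD.
transitivity (\sum_(k < r.+1) \sum_(a < r.+1 | (a <= k)%N) G a (k - a)%N).
  apply: eq_bigr => k _; rewrite E scaler_suml.
  transitivity (\sum_(a < k.+1) G a (k - a)%N).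
    by apply: eq_bigr => a _; rewrite /G subnKC// -ltnS.
  rewrite (big_ord_widen r.+1 (fun a => G a (k - a)%N)) ?ltn_ord//.
rewrite (exchange_big_dep predT)//=; apply: eq_bigr => a _.
rewrite -(big_mkord (fun k => a <= k)%N (fun k => G a (k - a)%N)).
rewrite -(big_mkord predT (fun b => G a b)).
rewrite [RHS](big_cat_nat _ (n := (r.+1 - a)%N)) ?leq_subr//=.
rewrite [X in _ = _ + X]big_nat_cond [X in _ = _ + X]big1 ?addr0; last first.
  move=> b; rewrite andbT => /andP[b1 _]; apply: G0.
  by rewrite leq_subLR in b1.
rewrite [LHS](big_cat_nat _ (n := a)) ?(ltnW (ltn_ord a))//=.
rewrite [X in X + _ = _]big_nat_cond [X in X + _ = _]big1 ?add0r; last by move=> k /andP[/andP[_ ka]]; rewrite leqNgt ka.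
rewrite -{1}[nat_of_ord a]add0n big_addn; apply: eq_big => [k|k _]; first by rewrite leq_addl.
by rewrite addnK.
Qed.

Lemma flow0 : flow 0 = 1%:M.
Proof.
rewrite /flow big_ord_recl expr0 fact0 divr1 scale1r expr0 big1 ?addr0// => k _.
by rewrite oppr0 expr0n/= mul0r scale0r.
Qed.

Lemma flowK s : flow (- s) *m flow s = 1%:M.
Proof. by rewrite -flowD addNr flow0. Qed.

Lemma is_derive_flow (s : R) i j :
  is_derive s 1 (fun s => flow s i j) (- (B^T *m flow s) i j).
Proof.
pose c (k : nat) : R := (B^T ^+ k) i j / k`!%:R.
have -> : (fun s => flow s i j) = (fun s => \sum_(k < r.+1) c k * (- s) ^+ k).
  apply/funext => u; rewrite /flow summxE; apply: eq_bigr => k _.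
  by rewrite mxE /c; ring.
have dk (k : nat) : is_derive s 1 (fun u : R => c k * (- u) ^+ k) (- (k%:R * c k * (- s) ^+ k.-1)).
  have dN : is_derive s 1 (fun u : R => - u) (-1 : R) by exact: is_deriveNid.
  have dX := @is_deriveX _ _ (fun u : R => - u) k s 1 _ dN.
  have := @is_deriveZ _ _ _ _ (c k) s 1 _ dX.
  have -> : c k \*: (fun u : R => - u) ^+ k = (fun u => c k * (- u) ^+ k).
    by apply/funext => u; rewrite /= exprfctE.
  move=> H; apply: is_derive_eq H _.
  rewrite -[_ *: -1]/(k%:R * (- s) ^+ k.-1 * -1) -[c k *: _]/(c k * _); ring.
have := is_derive_sum (fun k : 'I_r.+1 => dk k).
have -> : \sum_(k < r.+1) (fun u : R => c k * (- u) ^+ k) = (fun u => \sum_(k < r.+1) c k * (- u) ^+ k).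
  by apply/funext => u; rewrite fct_sumE.
move=> H; apply: is_derive_eq H _.
rewrite sumrN; congr (- _); rewrite big_ord_recl mul0r mul0r add0r.
rewrite /flow mulmx_sumr summxE big_ord_recr/=.
rewrite -scalemxAr -[B^T *m _]/(B^T * _) -exprS trBX_eq0 ?scaler0// [X in _ = _ + X]mxE addr0.
apply: eq_bigr => k _.
rewrite -scalemxAr -[B^T *m _]/(B^T * _) -exprS mxE /c factS natrM.
rewrite /fintype.bump leq0n add1n add0n; field.
by rewrite nat1r !pnatr_eq0 -lt0n fact_gt0.
Qed.

Definition dil (rho : R) : 'M[R]_n := diag_mx (\row_j rho ^+ wt j).

Lemma dilE rho x j : (dil rho *m x) j 0 = rho ^+ wt j * x j 0.
Proof.
rewrite mxE (bigD1 j)//= !mxE eqxx mulr1n big1 ?addr0// => k kj.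
by rewrite !mxE eq_sym (negbTE kj) mulr0n mul0r.
Qed.

Lemma dilM rho sigma : dil rho *m dil sigma = dil (rho * sigma).
Proof.
rewrite /dil mulmx_diag; congr diag_mx; apply/rowP => j; by rewrite !mxE exprMn.
Qed.

Lemma dil1 : dil 1 = 1%:M.
Proof.
rewrite /dil -[RHS]diag_const_mx; congr diag_mx; apply/rowP => j.
by rewrite !mxE expr1n.
Qed.

Lemma dil_flow rho s : dil rho *m flow s = flow (rho ^+ 2 * s) *m dil rho.
Proof.
apply/matrixP => i j; rewrite !mxE (bigD1 i)//= [X in _ + X]big1; last first.
  by move=> k ki; rewrite !mxE eq_sym (negbTE ki) mulr0n mul0r.
rewrite [RHS](bigD1 j)//= [X in _ = _ + X]big1; last first.
  by move=> k kj; rewrite !mxE (negbTE kj) mulr0n mulr0.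
by rewrite !mxE !eqxx !mulr1n !addr0 flow_homog.
Qed.

(* Phi z0 rho w is the group product of z0 and the dilation of w; Psi z0 rho
   is its inverse. *)
Definition Phi z0 (rho : R) w : pt :=
  (dil rho *m w.1 + flow (rho ^+ 2 * w.2) *m z0.1, rho ^+ 2 * w.2 + z0.2).

Definition Psi z0 (rho : R) z : pt :=
  (dil rho^-1 *m (z.1 - flow (z.2 - z0.2) *m z0.1), rho ^- 2 * (z.2 - z0.2)).

Lemma PhiK z0 rho : rho != 0 -> cancel (Phi z0 rho) (Psi z0 rho).
Proof.
move=> r0 [x t]; rewrite /Phi /Psi /= addrK; congr (_, _).
  by rewrite addrK mulmxA dilM mulVf// dil1 mul1mx.
by rewrite mulrA mulVf ?mul1r// expf_neq0.
Qed.

Lemma PsiK z0 rho : rho != 0 -> cancel (Psi z0 rho) (Phi z0 rho).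
Proof.
move=> r0 [x t]; rewrite /Phi /Psi /= mulrA divff ?mul1r ?expf_neq0//.
by rewrite subrK mulmxA dilM divff// dil1 mul1mx subrK.
Qed.

(** A box seen from inside another box is again a box: this identity carries every comparison of two
    boxes back to unit scale. *)
Lemma Phi_comp z0 rho w sigma v :
  Phi z0 rho (Phi w sigma v) = Phi (Phi z0 rho w) (rho * sigma) v.
Proof.
rewrite /Phi /=; congr (_, _); last by rewrite exprMn mulrDr addrA mulrA.
rewrite mulmxDr mulmxA dilM -addrA; congr (_ + _).
rewrite mulmxDr !mulmxA dil_flow -flowD exprMn mulrDr.
by rewrite [rho ^+ 2 * (_ * _)]mulrA.
Qed.

Lemma measurable_flow i j : measurable_fun setT (fun s => flow s i j).
Proof.
apply: continuous_measurable_fun => s; apply: differentiable_continuous.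
by apply/derivable1_diffP; have [] := is_derive_flow s i j.
Qed.

Lemma measurable_Phi z0 rho : measurable_fun setT (Phi z0 rho).
Proof.
apply: measurable_fun_pt => -[j|] /=; last first.
  by apply: measurable_funD => //; apply: measurable_funM => //; exact: measurable_snd.
have -> : (fun w : pt => (dil rho *m w.1 + flow (rho ^+ 2 * w.2) *m z0.1) j 0) =
   (fun w : pt => rho ^+ wt j * crd (Some j) w + \sum_k flow (rho ^+ 2 * w.2) j k * z0.1 k 0).
  by apply/funext => w; rewrite mxE dilE mxE.
apply: measurable_funD.
  by apply: measurable_funM => //; exact: measurable_crd.
apply: measurable_sum => k; apply: measurable_funM => //.
apply: (measurableT_comp (measurable_flow _ _)).
by apply: measurable_funM => //; exact: measurable_snd.
Qed.

(** The Jacobian exponent of the dilations: 2 for time plus the weights of the space coordinates,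
    that is Q + 2 for the blocks of the theorem. *)
Definition hdim : nat := (2 + \sum_j wt j)%N.

Lemma vol_Phi z0 rho (A : set pt) : 0 < rho -> measurable A ->
  vol (Phi z0 rho @^-1` A) = ((rho ^+ hdim)^-1%:E * vol A)%E.
Proof.
move=> r0 mA.
have := @vol_fibered R n (fun=> dil rho) (fun t => flow (rho ^+ 2 * t) *m z0.1)
  (fun j => rho ^+ wt j) (rho ^+ 2) z0.2 A.
rewrite -expr_sum -exprD => -> //.
- by move=> _ i j ij; rewrite !mxE; case: eqP => [e|_]; rewrite ?mulr0n//; rewrite e ltnn in ij.
- by move=> _ i; rewrite !mxE eqxx mulr1n.
- by move=> i; rewrite exprn_gt0.
- by rewrite exprn_gt0.
- exact: measurable_Phi.
Qed.

Lemma measurable_Phi_left rho w : measurable_fun setT (fun z => Phi z rho w).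
Proof.
apply: measurable_fun_pt => -[j|] /=; last first.
  by apply: measurable_funD => //; exact: measurable_snd.
have -> : (fun z : pt => (dil rho *m w.1 + flow (rho ^+ 2 * w.2) *m z.1) j 0) =
   (fun z : pt => rho ^+ wt j * w.1 j 0 + \sum_k flow (rho ^+ 2 * w.2) j k * crd (Some k) z).
  by apply/funext => z; rewrite mxE dilE mxE.
apply: measurable_funD => //.
by apply: measurable_sum => k; apply: measurable_funM => //; exact: measurable_crd.
Qed.

(** Right translation preserves the volume as well: z enters through a unipotent triangular matrix.
    Integrals over z of functions shifted by a fixed right factor depend on this. *)
Lemma vol_Phi_left rho w (A : set pt) : measurable A ->
  vol ((fun z => Phi z rho w) @^-1` A) = (1%:E * vol A)%E.
Proof.
move=> mA.
have := @vol_fibered R n (fun=> flow (rho ^+ 2 * w.2)) (fun t => dil rho *m w.1)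
  (fun j => 1) 1 (rho ^+ 2 * w.2) A.
rewrite big1// mulr1 invr1.
have -> : (fun z : pt => (flow (rho ^+ 2 * w.2) *m z.1 + dil rho *m w.1, 1 * z.2 + rho ^+ 2 * w.2)) =
  (fun z => Phi z rho w).
  by apply/funext => z; rewrite /Phi mul1r addrC [z.2 + _]addrC.
apply => //.
- by move=> _ i j ij; exact: flow_upper.
- by move=> _ i; exact: flow_diag.
- exact: measurable_Phi_left.
Qed.

Definition Yop (f : pt -> R) z : R :=
  \sum_i \sum_j B i j * (crd (Some i) z * 'D_(dir (Some j)) f z) - 'D_(dir None) f z.

Lemma fam_flow P (c : P -> R) (M : R) (i j : 'I_n) : (forall p, `|c p| <= M) ->
  fam (fun p (z : pt) => flow (z.2 - c p) i j).
Proof.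
move=> cM.
have -> : (fun p (z : pt) => flow (z.2 - c p) i j) = (fun p z => \sum_(k < r.+1)
   ((-1) * (crd None z + (-1) * c p)) ^+ k * ((B^T ^+ k) i j / k`!%:R)).
  apply/funext => p; apply/funext => z; rewrite /flow summxE; apply: eq_bigr => k _.
  by rewrite mxE /= mulN1r mulN1r; ring.
apply: fam_sum => k _; apply: fam_mul; last exact: fam_cst.
apply: fam_exp; apply: fam_mul; first exact: fam_cst.
apply: fam_add; first exact: fam_crd.
by apply: fam_mul; [exact: fam_cst|exact: fam_par cM].
Qed.

(** The centre is a parameter of the family, which makes bounds on derivatives uniform for centres
    in a bounded set. *)
Lemma fam_Psi P (z0 : P -> pt) (rho M : R) o : (forall p o, `|crd o (z0 p)| <= M) ->
  fam (fun p z => crd o (Psi (z0 p) rho z)).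
Proof.
move=> z0M; case: o => [j|].
  have -> : (fun p z => crd (Some j) (Psi (z0 p) rho z)) = (fun p z => rho^-1 ^+ wt j *
     (crd (Some j) z + (-1) * \sum_k flow (z.2 - (z0 p).2) j k * (z0 p).1 k 0)).
    apply/funext => p; apply/funext => z; rewrite /Psi [LHS]/= dilE mxE [in LHS]mxE mulN1r.
    by rewrite [(flow _ *m _) _ _]mxE.
  apply: fam_mul; first exact: fam_cst.
  apply: fam_add; first exact: fam_crd.
  apply: fam_mul; first exact: fam_cst.
  apply: fam_sum => k _; apply: fam_mul.
    by apply: (fam_flow (M := M)) => p; exact: (z0M p None).
  by apply: (@fam_par _ _ _ (fun p => (z0 p).1 k 0) M) => p; exact: (z0M p (Some k)).
have -> : (fun p z => crd None (Psi (z0 p) rho z)) = (fun p z => rho ^- 2 *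
     (crd None z + (-1) * (z0 p).2)).
  by apply/funext => p; apply/funext => z; rewrite /Psi /= mulN1r.
apply: fam_mul; first exact: fam_cst.
apply: fam_add; first exact: fam_crd.
apply: fam_mul; first exact: fam_cst.
by apply: (@fam_par _ _ _ (fun p => (z0 p).2) M) => p; exact: (z0M p None).
Qed.

Lemma sm_Psi z0 rho o : sm (fun z => crd o (Psi z0 rho z)).
Proof.
apply: (@fam_Psi unit (fun=> z0) rho (\sum_o `|crd o z0|)) => _ {}o.
by rewrite (bigD1 o)//= lerDl sumr_ge0.
Qed.

Lemma sm_comp_Psi z0 rho f : sm f -> sm (fun z => f (Psi z0 rho z)).
Proof.
move=> sf; apply: (@fam_subst _ _ _ (fun _ => f) (fun _ => Psi z0 rho)) => // o.
exact: sm_Psi.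
Qed.

Lemma differentiable_Psi z0 rho o z : differentiable (fun z => crd o (Psi z0 rho z)) z.
Proof. exact: (differentiable_fam tt z (sm_Psi z0 rho o)). Qed.

Lemma derive_affine_None (g : R -> R) (s : R) z d :
  is_derive (z.2 - s) 1 g d -> 'D_(dir None) (fun w : pt => g (w.2 - s)) z = d.
Proof.
move=> dg.
have df : differentiable (fun w : pt => crd None w + - s) z.
  by apply: differentiableD; [exact: differentiable_crd|exact: differentiable_cst].
rewrite (@derive_comp_line _ _ g (fun w : pt => crd None w + - s) d)//.
rewrite deriveDE; [|exact: differentiable_crd|exact: differentiable_cst].
by rewrite derive_crd derive_cst addr0 crd_dir eqxx mulr1.
Qed.

Lemma derive_dep_None (g : R -> R) (s : R) z j : (forall t, derivable g t 1) ->
  'D_(dir (Some j)) (fun w : pt => g (w.2 - s)) z = 0.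
Proof.
move=> dg.
have df : differentiable (fun w : pt => crd None w + - s) z.
  by apply: differentiableD; [exact: differentiable_crd|exact: differentiable_cst].
have dgt : is_derive (crd None z + - s) 1 g ('D_1 g (crd None z + - s)).
  exact/derivableP.
rewrite (@derive_comp_line _ _ g (fun w : pt => crd None w + - s) _ z (dir (Some j)) dgt df).
rewrite deriveDE; [|exact: differentiable_crd|exact: differentiable_cst].
by rewrite derive_crd derive_cst addr0 crd_dir mulr0.
Qed.

Lemma is_derive_flowx x k (t : R) :
  is_derive t 1 (fun s => (flow s *m x) k 0) (- (B^T *m (flow t *m x)) k 0).
Proof.
have -> : (fun s => (flow s *m x) k 0) = \sum_l (fun s => x l 0 *: flow s k l).
  apply/funext => s; rewrite mxE fct_sumE; apply: eq_bigr => l _.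
  by rewrite -[RHS]/(x l 0 * _) mulrC.
have dl (l : 'I_n) : is_derive t 1 (fun s => x l 0 *: flow s k l) (x l 0 *: - (B^T *m flow t) k l).
  exact: is_deriveZ (is_derive_flow t k l).
apply: is_derive_eq (is_derive_sum dl) _.
rewrite mulmxA mxE -sumrN; apply: eq_bigr => l _.
by rewrite -[_ *: _]/(x l 0 * _) mulrN mulrC.
Qed.

Lemma crd_PsiE z0 rho k : (fun w => crd (Some k) (Psi z0 rho w)) =
  (fun w => rho^-1 ^+ wt k * (crd (Some k) w + (-1) * (flow (w.2 - z0.2) *m z0.1) k 0)).
Proof. by apply/funext => w; rewrite /Psi [LHS]/= dilE mxE [in LHS]mxE mulN1r. Qed.

Lemma sm_flowx s x k : sm (fun w : pt => (flow (w.2 - s) *m x) k 0).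
Proof.
have -> : (fun w : pt => (flow (w.2 - s) *m x) k 0) =
    (fun w : pt => \sum_l flow (w.2 - s) k l * x l 0).
  by apply/funext => w; rewrite mxE.
apply: fam_sum => l _; apply: fam_mul; last exact: fam_cst.
exact: (@fam_flow unit (fun=> s) `|s|).
Qed.

Lemma derive_crd_Psi z0 rho o o' z :
  'D_(dir o') (fun w => crd o (Psi z0 rho w)) z =
  match o, o' with
  | Some k, Some j => rho^-1 ^+ wt k * (k == j)%:R
  | Some k, None => rho^-1 ^+ wt k * (B^T *m (flow (z.2 - z0.2) *m z0.1)) k 0
  | None, Some _ => 0
  | None, None => rho ^- 2
  end.
Proof.
have dc (c : R) w : differentiable (fun _ : pt => c) w by exact: differentiable_cst.
have dcr o1 w : differentiable (@crd R n o1) w by exact: differentiable_crd.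
case: o => [k|]; last first.
  have -> : (fun w => crd None (Psi z0 rho w)) = (fun w => rho ^- 2 * (crd None w + - z0.2)) by [].
  rewrite (deriveME _ (dc _ _) (differentiableD (dcr _ _) (dc _ _))) derive_cst mulr0 addr0.
  rewrite (deriveDE _ (dcr _ _) (dc _ _)) derive_cst addr0 derive_crd crd_dir.
  by case: o' => [j|] /=; rewrite ?mulr0 ?mulr1.
rewrite crd_PsiE.
have df w : differentiable (fun w : pt => (flow (w.2 - z0.2) *m z0.1) k 0) w.
  exact: (differentiable_fam tt w (sm_flowx z0.2 z0.1 k)).
have dm w := differentiableM (dc (-1) w) (df w).
rewrite (deriveME _ (dc _ _) (differentiableD (dcr _ _) (dm _))) derive_cst mulr0 addr0.
rewrite (deriveDE _ (dcr _ _) (dm _)) (deriveME _ (dc _ _) (df _)) derive_cst mulr0 addr0.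
rewrite derive_crd crd_dir; case: o' => [j|].
  rewrite (@derive_dep_None (fun t => (flow t *m z0.1) k 0)) ?mulr0 ?addr0//.
  by move=> t; have [] := is_derive_flowx z0.1 k t.
rewrite (@derive_affine_None (fun t => (flow t *m z0.1) k 0) _ _ _ (is_derive_flowx z0.1 k _)).
by rewrite add0r mulN1r opprK.
Qed.

Lemma derive_Psi f z0 rho o' z : sm f ->
  'D_(dir o') (fun w => f (Psi z0 rho w)) z =
  \sum_(o : idx) 'D_(dir o) f (Psi z0 rho z) * 'D_(dir o') (fun w => crd o (Psi z0 rho w)) z.
Proof.
move=> sf.
by have [] := @derive_subst R n unit (fun=> f) (Psi z0 rho) tt z (dir o') sf (fun o => differentiable_Psi z0 rho o z).
Qed.

Lemma big_option (F : idx -> R) : \sum_(o : idx) F o = F None + \sum_j F (Some j).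
Proof.
rewrite (perm_big (None :: map Some (index_enum 'I_n))) ?big_cons ?big_map//.
apply: uniq_perm; first exact: index_enum_uniq.
  rewrite /= map_inj_uniq; last by move=> ? ? [].
  by rewrite index_enum_uniq andbT; apply/mapP => -[].
case=> [j|]; rewrite mem_index_enum// in_cons/=; apply/esym/mapP.
by exists j => //; rewrite mem_index_enum.
Qed.

Lemma derive_Psi_Some f z0 rho j z : sm f ->
  'D_(dir (Some j)) (fun w => f (Psi z0 rho w)) z =
  rho^-1 ^+ wt j * 'D_(dir (Some j)) f (Psi z0 rho z).
Proof.
move=> sf; rewrite derive_Psi// big_option.
under eq_bigr => k _ do rewrite (derive_crd_Psi z0 rho (Some k) (Some j) z).
rewrite (derive_crd_Psi z0 rho None (Some j) z) mulr0 add0r (bigD1 j)// eqxx mulr1 big1; first exact: etrans (addr0 _) (mulrC _ _).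
by move=> k /negbTE kj; rewrite kj !mulr0.
Qed.

(** Left invariance and homogeneity of degree 2. The time derivative of the flow inside [Psi]
    cancels the part of the drift due to z0, and [wt j = 2 + wt i] wherever B i j is nonzero. *)
Lemma Yop_Psi f z0 (rho : R) z : rho != 0 -> sm f ->
  Yop (fun w => f (Psi z0 rho w)) z = rho ^- 2 * Yop f (Psi z0 rho z).
Proof.
move=> r0 sf; rewrite /Yop derive_Psi// big_option derive_crd_Psi.
set y := flow (z.2 - z0.2) *m z0.1.
pose F j := 'D_(dir (Some j)) f (Psi z0 rho z).
have -> : \sum_j 'D_(dir (Some j)) f (Psi z0 rho z) *
    'D_(dir None) (fun w => crd (Some j) (Psi z0 rho w)) z =
    \sum_i \sum_j B i j * (y i 0 * (rho^-1 ^+ wt j * F j)).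
  rewrite exchange_big; apply: eq_bigr => j _; rewrite (derive_crd_Psi z0 rho (Some j) None z) -/y mxE.
  rewrite mulr_sumr mulr_sumr; apply: eq_bigr => i _; rewrite mxE /F; ring.
have -> : \sum_i \sum_j B i j * (crd (Some i) z *
      'D_(dir (Some j)) (fun w => f (Psi z0 rho w)) z) =
    \sum_i \sum_j B i j * (crd (Some i) z * (rho^-1 ^+ wt j * F j)).
  by apply: eq_bigr => i _; apply: eq_bigr => j _; rewrite derive_Psi_Some.
have reg (a b c d e : R) : a - c = d * e -> a - (b / rho ^+ 2 + c) = d * e - rho ^- 2 * b.
  by move=> <-; ring.
rewrite mulrBr; apply: reg.
rewrite -sumrB mulr_sumr; apply: eq_bigr => i _.
rewrite -sumrB mulr_sumr; apply: eq_bigr => j _.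
rewrite -/(F j) -mulrBr -mulrBl.
have [->|/B_blk e] := eqVneq (B i j) 0; first by rewrite !mul0r mulr0.
have -> : crd (Some i) (Psi z0 rho z) = rho^-1 ^+ wt i * (crd (Some i) z - y i 0).
  by rewrite /Psi [LHS]/= dilE mxE [in LHS]mxE.
have -> : wt j = (2 + wt i)%N by rewrite /wt e mulnS addnA.
rewrite exprD exprVn; ring.
Qed.

End homogeneous_group.

Notation wt_of := wt.
Notation flow_of := flow.
Notation Phi_of := Phi.
Notation Yop_of := Yop.
Notation hdim_of := hdim.

(** * Quasi-metric geometry of the boxes *)

Section geometry.
Context {R : realType} {n : nat}.
Local Notation pt := ('cV[R]_n * R)%type.
Local Notation idx := (option 'I_n).
Variables (B : 'M[R]_n) (blk : 'I_n -> nat) (r : nat).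
Hypothesis B_blk : forall i j, B i j != 0 -> blk j = (blk i).+1.
Hypothesis blk_ord : forall i j : 'I_n, (blk i < blk j)%N -> (i < j)%N.
Hypothesis blk_le : forall i, (blk i <= r)%N.
Local Notation flow := (flow B r).
Local Notation Phi := (Phi B blk r).
Local Notation Psi := (Psi B blk r).
Local Notation wt := (wt blk).
Local Notation hdim := (hdim blk).
Implicit Types (z w q y : pt) (o : idx) (x : 'cV[R]_n).

(** The unit cube dilated by rho and translated to q, described through the inverse map so that
    membership bounds coordinates. These boxes take the place of the balls of the group distance. *)
Definition bx q (rho : R) : set pt := [set y | cbox 1 (Psi q rho y)].

Definition flowC : R := \sum_i \sum_j \sum_(k < r.+1) `|(B^T ^+ k) i j|.

Lemma flowC_ge0 : 0 <= flowC.
Proof. by apply: sumr_ge0 => i _; apply: sumr_ge0 => j _; apply: sumr_ge0. Qed.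

Lemma fact_inv_le1 k : (k`!%:R)^-1 <= 1 :> R.
Proof. by rewrite invf_le1 ?ltr0n ?fact_gt0// ler1n fact_gt0. Qed.

Lemma row_flow_le (s : R) x i (M : R) : `|s| <= 1 -> 0 <= M -> (forall j, `|x j 0| <= M) ->
  `|(flow s *m x) i 0| <= flowC * M.
Proof.
move=> s1 M0 xM; rewrite mxE.
apply: (le_trans (ler_norm_sum _ _ _)).
rewrite /flowC [X in X * _](bigD1 i)//= mulrDl -[leLHS]addr0 lerD ?mulr_ge0//; last first.
  by apply: sumr_ge0 => k _; apply: sumr_ge0 => j _; apply: sumr_ge0.
rewrite mulr_suml; apply: ler_sum => j _; rewrite normrM.
apply: ler_pM => //; rewrite /flow_of summxE.
apply: (le_trans (ler_norm_sum _ _ _)); apply: ler_sum => k _.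
rewrite mxE normrM ler_piMl// normrM normrX normrN normfV [`|_%:R|]ger0_norm//.
by rewrite mulr_ile1// ?invr_ge0// ?fact_inv_le1// exprn_ile1.
Qed.

Lemma row_flow1_le (s : R) x i (M : R) : `|s| <= 1 -> 0 <= M -> (forall j, `|x j 0| <= M) ->
  `|(flow s *m x) i 0 - x i 0| <= `|s| * (flowC * M).
Proof.
move=> s1 M0 xM.
have -> : (flow s *m x) i 0 - x i 0 = \sum_j (flow s - 1%:M) i j * x j 0.
  transitivity (((flow s - 1%:M) *m x) i 0); last by rewrite mxE.
  by rewrite mulmxBl mul1mx [RHS]mxE [X in _ = _ + X]mxE.
apply: (le_trans (ler_norm_sum _ _ _)).
rewrite /flowC [X in X * M](bigD1 i)//= mulrDl mulrDr -[leLHS]addr0 lerD ?mulr_ge0//; last first.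
  by apply: sumr_ge0 => k _; apply: sumr_ge0 => j _; apply: sumr_ge0.
rewrite mulrA mulr_sumr mulr_suml; apply: ler_sum => j _; rewrite normrM.
apply: ler_pM => //; rewrite /flow_of big_ord_recl expr0 fact0 divr1 scale1r expr0.
rewrite addrAC subrr add0r summxE.
apply: (le_trans (ler_norm_sum _ _ _)).
rewrite big_ord_recl mulrDr -[leLHS]add0r lerD ?mulr_ge0// mulr_sumr; apply: ler_sum => k _.
rewrite mxE normrM ler_wpM2r// normrM normrX normrN normfV [`|_%:R|]ger0_norm//.
apply: (@le_trans _ _ (`|s| ^+ (lift ord0 k))).
  by rewrite ler_piMr ?exprn_ge0 ?fact_inv_le1.
by rewrite exprS ler_piMr ?exprn_ile1.
Qed.

(** The quasi-metric constant: one factor is paid for exchanging centre and point ([bx_sym]) and one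
    for each triangle inequality ([bx_trans]). *)
Definition geoC : R := 2 + flowC.

Lemma geoC_ge1 : 1 <= geoC.
Proof. rewrite /geoC; have := flowC_ge0; lra. Qed.

Lemma geoC_gt0 : 0 < geoC.
Proof. exact: lt_le_trans geoC_ge1. Qed.

Lemma Phi_cbox w v (s : R) : 0 <= s <= 1 -> cbox 1 w -> cbox 1 v -> cbox geoC (Phi w s v).
Proof.
move=> /andP[s0 s1] w1 v1; have s2 : `|s ^+ 2 * v.2| <= 1.
  by rewrite normrM mulr_ile1// ?(v1 None)// ger0_norm ?exprn_ge0// exprn_ile1.
have := flowC_ge0; rewrite /geoC => fC0 -[j|] /=.
  rewrite mxE dilE; apply: le_trans (ler_normD _ _) _.
  have := row_flow_le j s2 ler01 (fun j => w1 (Some j)); rewrite mulr1.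
  have : `|s ^+ wt j * v.1 j 0| <= 1.
    by rewrite normrM mulr_ile1// ?(v1 (Some j))// ger0_norm ?exprn_ge0// exprn_ile1.
  lra.
apply: le_trans (ler_normD _ _) _.
have := w1 None; rewrite /=; lra.
Qed.

Definition wto o : nat := if o is Some j then wt j else 2.

Lemma wto_gt0 o : (0 < wto o)%N.
Proof. by case: o => [j|]//=; rewrite /wt_of addn1. Qed.

Lemma crd_Psi_scale q (c rho : R) y o : crd o (Psi q (c * rho) y) = c^-1 ^+ wto o * crd o (Psi q rho y).
Proof.
case: o => [j|] /=; first by rewrite !dilE invfM exprMn mulrA.
by rewrite exprMn invfM exprVn mulrA.
Qed.

(** Every weight is at least 1, so enlarging the radius by c >= 1 shrinks each coordinate at least
    by the factor c. *)
Lemma bx_scale q (c rho : R) y : 1 <= c -> cbox c (Psi q rho y) -> bx q (c * rho) y.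
Proof.
move=> c1 H o; rewrite crd_Psi_scale normrM ger0_norm ?exprn_ge0 ?invr_ge0 ?(le_trans ler01)//.
have c0 : 0 < c by exact: lt_le_trans c1.
rewrite exprVn mulrC ler_pdivrMr ?exprn_gt0// mul1r (le_trans (H o))//.
by rewrite -[leLHS]expr1 ler_weXn2l// wto_gt0.
Qed.

Lemma bxS q (rho sigma : R) : 0 < rho <= sigma -> bx q rho `<=` bx q sigma.
Proof.
move=> /andP[r0 rs] y qy.
have -> : sigma = (sigma / rho) * rho by rewrite divfK ?gt_eqF.
have c1 : 1 <= sigma / rho by rewrite ler_pdivlMr// mul1r.
by apply: bx_scale => // o; rewrite (le_trans (qy o)).
Qed.

Lemma bx_sym q (rho : R) y : 0 < rho -> bx q rho y -> bx y (geoC * rho) q.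
Proof.
move=> r0 qy; apply: bx_scale; first exact: geoC_ge1.
set w := Psi q rho y; have yE : y = Phi q rho w by rewrite PsiK ?gt_eqF.
have q0 : q = Phi q rho 0.
  by rewrite /Phi_of/= mulmx0 mulr0 flow0 mul1mx !add0r; case: (q).
have : Phi y rho (Psi w 1 0) = q.
  by rewrite yE -[X in Phi_of _ _ _ _ X _](mulr1 rho) -Phi_comp// PsiK ?oner_eq0// -q0.
move=> E; rewrite -[in cbox _ _]E PhiK ?gt_eqF// => o.
have := flowC_ge0; case: o => [j|] /=; rewrite /geoC.
  rewrite dilE sub0r add0r mxE invr1 expr1n mul1r normrN => fC.
  have w2 : `|- w.2| <= 1 by rewrite normrN; exact: (qy None).
  have := row_flow_le j w2 ler01 (fun j => qy (Some j)); rewrite mulr1; lra.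
rewrite sub0r expr1n invr1 mul1r normrN; have := qy None; rewrite /=; lra.
Qed.

Lemma bx_trans q (rho sigma : R) y : 0 < sigma <= rho -> bx q rho y ->
  bx y sigma `<=` bx q (geoC * rho).
Proof.
move=> /andP[s0 sr] qy v yv; have r0 : 0 < rho by exact: lt_le_trans sr.
apply: bx_scale; first exact: geoC_ge1.
have <- : Phi q rho (Phi (Psi q rho y) (sigma / rho) (Psi y sigma v)) = v.
  by rewrite Phi_comp// PsiK ?gt_eqF// mulrC divfK ?gt_eqF// PsiK ?gt_eqF.
rewrite PhiK ?gt_eqF//; apply: Phi_cbox => //.
by rewrite divr_ge0 ?(ltW s0) ?(ltW r0)//= ler_pdivrMr// mul1r.
Qed.

Lemma measurable_Psi q (rho : R) : measurable_fun setT (Psi q rho).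
Proof.
apply: measurable_fun_pt => o; apply: sm_measurable; exact: sm_Psi.
Qed.

Lemma measurable_bx q (rho : R) : measurable (bx q rho).
Proof.
by rewrite -[bx _ _]setTI; apply: measurable_Psi => //; exact: measurable_cbox.
Qed.

Lemma preimage_Phi_bx q (rho : R) : rho != 0 -> Phi q rho @^-1` bx q rho = cbox 1.
Proof. by move=> r0; apply/seteqP; split=> w; rewrite /bx /= PhiK. Qed.

Lemma vol_bx q (rho : R) : 0 < rho -> vol (bx q rho) = ((rho ^+ hdim)%:E * vol (@cbox R n 1))%E.
Proof.
move=> r0; have := vol_Phi B_blk blk_le q r0 (measurable_bx q rho).
rewrite (preimage_Phi_bx _ (lt0r_neq0 r0)) => ->.
by rewrite muleA -EFinM divff ?mul1e// expf_neq0 ?gt_eqF.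
Qed.

Lemma vol_bx_lty q (rho : R) : 0 < rho -> (vol (bx q rho) < +oo)%E.
Proof.
move=> r0; rewrite vol_bx// lte_mul_pinfty// ?lee_fin ?exprn_ge0 ?ltW//.
by rewrite vol_cbox_lty.
Qed.

(** On bounded sets a box of radius rho <= 1 has Euclidean size of order rho. This compares boxes
    with the distance to the complement. *)
Lemma bx_close (r0 : R) q (rho : R) y o : 1 <= r0 -> 0 < rho <= 1 -> cbox r0 q -> bx q rho y ->
  `|crd o y - crd o q| <= rho * (1 + flowC * r0).
Proof.
move=> r1 /andP[p0 p1] q0 qy; have [w w1 ->] : exists2 w, cbox 1 w & y = Phi q rho w.
  by exists (Psi q rho y) => //; rewrite PsiK ?gt_eqF.
have fr : 0 <= flowC * r0 by rewrite mulr_ge0 ?flowC_ge0// (le_trans ler01).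
have s1 : `|rho ^+ 2 * w.2| <= rho.
  rewrite normrM ger0_norm ?exprn_ge0 ?(ltW p0)//.
  apply: (@le_trans _ _ (rho ^+ 2)); first by rewrite ler_piMr ?exprn_ge0 ?(ltW p0)//; exact: (w1 None).
  by rewrite -[leRHS]expr1 ler_wiXn2l// (ltW p0).
case: o => [j|] /=; last by rewrite addrK (le_trans s1)// ler_peMr ?lerDl ?(ltW p0).
rewrite mxE dilE -addrA mulrDr mulr1 (le_trans (ler_normD _ _))// lerD//.
  rewrite normrM ger0_norm ?exprn_ge0 ?(ltW p0)//.
  apply: (@le_trans _ _ (rho ^+ wt j)); first by rewrite ler_piMr ?exprn_ge0 ?(ltW p0)//; exact: (w1 (Some j)).
  by rewrite -[leRHS]expr1 ler_wiXn2l ?(ltW p0)// (wto_gt0 (Some j)).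
have := row_flow1_le j (le_trans s1 p1) (le_trans ler01 r1) (fun j => q0 (Some j)).
by move=> /le_trans -> //; rewrite ler_wpM2r.
Qed.

End geometry.

Notation geoC_of := geoC.

(** * Weak solutions under translations and dilations *)

Section weak_solutions.
Context {R : realType} {n : nat}.
Local Notation pt := ('cV[R]_n * R)%type.
Local Notation idx := (option 'I_n).
Variables (B : 'M[R]_n) (blk : 'I_n -> nat) (r : nat).
Hypothesis B_blk : forall i j, B i j != 0 -> blk j = (blk i).+1.
Hypothesis blk_ord : forall i j : 'I_n, (blk i < blk j)%N -> (i < j)%N.
Hypothesis blk_le : forall i, (blk i <= r)%N.
Local Notation Phi := (Phi B blk r).
Local Notation Psi := (Psi B blk r).
Local Notation hdim := (hdim blk).
Local Notation Yop := (Yop B).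
Local Notation sq := (sq (@vol R n)).
Local Notation intg := (intg (@vol R n)).
Implicit Types (z w q y : pt) (o : idx) (U : set pt) (p phi : pt -> R).

Definition fb : pred 'I_n := fun i => blk i == 0%N.

(* F stands for A D_0 u - f; only its pointwise bounds matter. *)
Record wsol (lam M : R) U (u : pt -> R) (h F : 'I_n -> pt -> R) (k : pt -> R)
    (f : 'I_n -> pt -> R) (g : pt -> R) : Prop := Wsol {
  wsol_u : sq u;
  wsol_h : forall i, fb i -> sq (h i);
  wsol_F : forall i, fb i -> sq (F i);
  wsol_k : sq k;
  wsol_f : forall i, fb i -> sq (f i);
  wsol_g : sq g;
  wsol_dx : forall phi i, tst U phi -> fb i ->
    \int[vol]_z (h i z * phi z) = - \int[vol]_z (u z * 'D_(dir (Some i)) phi z);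
  wsol_Y : forall phi, tst U phi ->
    \int[vol]_z (k z * phi z) = - \int[vol]_z (u z * Yop phi z);
  wsol_eq : forall phi, tst U phi ->
    \int[vol]_z (k z * phi z) = \int[vol]_z (g z * phi z)
      + \sum_(i | fb i) \int[vol]_z (F i z * 'D_(dir (Some i)) phi z);
  wsol_ell : forall z, lam * (\sum_(i | fb i) h i z ^+ 2) <= \sum_(i | fb i) (F i z + f i z) * h i z;
  wsol_bd : forall i z, fb i ->
    `|F i z| <= M * (\sum_(j | fb j) `|h j z| + \sum_(j | fb j) `|f j z|) }.

Lemma continuous_Psi q (rho : R) : continuous (Psi q rho).
Proof. by apply: continuous_crdP => o; apply: sm_continuous; exact: sm_Psi. Qed.

Lemma sm_Yop phi : sm phi -> sm (Yop phi).
Proof.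
move=> sp; apply: fam_add.
  apply: fam_sum => i _; apply: fam_sum => j _; apply: fam_mul; first exact: fam_cst.
  by apply: fam_mul; [exact: fam_crd|exact: fam_derive].
have -> : (fun (_ : unit) z => - 'D_(dir None) phi z) = (fun _ z => -1 * 'D_(dir None) phi z).
  by apply/funext => ?; apply/funext => z; rewrite mulN1r.
by apply: fam_mul; [exact: fam_cst|exact: fam_derive].
Qed.

Lemma tst_Yop U phi : tst U phi -> tst U (Yop phi).
Proof.
move=> tp.
have -> : Yop phi = (fun z => \sum_i \sum_j B i j * (crd (Some i) z * 'D_(dir (Some j)) phi z)
    + -1 * 'D_(dir None) phi z).
  by apply/funext => z; rewrite mulN1r.
apply: tstD; last exact/tstZ/tst_derive.
apply: tst_sum => i _; apply: tst_sum => j _; apply: tstZ; apply: tstMl; first exact: (@fam_crd _ _ unit (Some i)).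
exact: tst_derive.
Qed.

Lemma Int_Phi q (rho : R) p : 0 < rho -> intg p ->
  \int[vol]_w p (Phi q rho w) = rho ^- hdim * \int[vol]_z p z.
Proof.
move=> r0 ip; have c0 : 0 <= rho ^- hdim by rewrite invr_ge0 exprn_ge0 ?ltW.
apply: (@Int_cov _ _ _ _ _ vol vol (Phi q rho) (NngNum c0)) => //.
  exact: measurable_Phi.
by move=> A mA; apply: vol_Phi.
Qed.

Lemma sq_Phi q (rho : R) p : 0 < rho -> sq p -> sq (fun w => p (Phi q rho w)).
Proof.
move=> r0 ip; have c0 : 0 <= rho ^- hdim by rewrite invr_ge0 exprn_ge0 ?ltW.
apply: (@sq_cov _ _ _ _ _ vol vol (Phi q rho) (NngNum c0)) => //.
  exact: measurable_Phi.
by move=> A mA; apply: vol_Phi.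
Qed.

Lemma Phi01 w : Phi 0 1 w = w.
Proof. by rewrite /Phi_of mulmx0 !addr0 dil1 mul1mx expr1n mul1r; case: w. Qed.

Lemma continuous_Phi q (rho : R) : rho != 0 -> continuous (Phi q rho).
Proof.
(* Inverses stay in the family of maps [Psi], so the continuity of [Phi] is that of a map [Psi] with
   other data. *)
move=> r0; rewrite (_ : Phi q rho = Psi (Psi q rho 0) rho^-1); first exact: continuous_Psi.
have r0' : rho^-1 != 0 by rewrite invr_eq0.
apply/funext => w; rewrite -[w in LHS](@PsiK _ _ B blk r (Psi q rho 0) _ r0').
by rewrite Phi_comp// PsiK// divff// Phi01.
Qed.

Lemma tst_Psi q (rho : R) U phi : rho != 0 -> tst (Phi q rho @^-1` U) phi ->
  tst U (fun z => phi (Psi q rho z)).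
Proof.
move=> r0 [sp [K [cK KU] K0]]; split; first exact: sm_comp_Psi.
exists (Phi q rho @` K); first split.
- by apply: continuous_compact => //; apply: continuous_subspaceT; exact: continuous_Phi.
- by move=> _ [w Kw <-]; exact: KU.
move=> z Kz; apply: K0 => Kp; apply: Kz; exists (Psi q rho z) => //.
by rewrite PsiK.
Qed.

Lemma Int_Phi_mul q (rho : R) U p phi : 0 < rho -> sq p -> tst (Phi q rho @^-1` U) phi ->
  \int[vol]_w (p (Phi q rho w) * phi w) = rho ^- hdim * \int[vol]_z (p z * phi (Psi q rho z)).
Proof.
move=> r0 sp tp; rewrite -(@Int_Phi q rho (fun z => p z * phi (Psi q rho z)))//; last first.
  by apply: sq_mul => //; apply: (@tst_sq _ _ U); apply: tst_Psi; rewrite ?gt_eqF.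
by under [in RHS]eq_Rintegral => w _ do rewrite PhiK ?gt_eqF//.
Qed.

(** First order quantities scale by rho, those of the order of Y by rho^2. The bounds [wsol_ell] and
    [wsol_bd] are homogeneous, hence lam and M do not change and estimates on the unit cube apply at
    every centre and scale. *)
Lemma wsol_Phi lam M U u h F k f g q (rho : R) : 0 < rho ->
  wsol lam M U u h F k f g ->
  wsol lam M (Phi q rho @^-1` U) (fun w => u (Phi q rho w))
    (fun i w => rho * h i (Phi q rho w)) (fun i w => rho * F i (Phi q rho w))
    (fun w => rho ^+ 2 * k (Phi q rho w)) (fun i w => rho * f i (Phi q rho w))
    (fun w => rho ^+ 2 * g (Phi q rho w)).
Proof.
move=> r0 [su sh sF sk sf sg dx dY deq ell bd].
have rn0 : rho != 0 by rewrite gt_eqF.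
have fbD phi i z : sm phi -> fb i ->
    'D_(dir (Some i)) (fun w => phi (Psi q rho w)) z = rho^-1 * 'D_(dir (Some i)) phi (Psi q rho z).
  by move=> sp /eqP fi; rewrite derive_Psi_Some// /wt_of fi muln0 add0n expr1.
have YE phi z : sm phi -> Yop (fun w => phi (Psi q rho w)) z = rho ^- 2 * Yop phi (Psi q rho z).
  by move=> sp; apply: Yop_Psi.
have ZE (c : R) p phi : sq p -> tst (Phi q rho @^-1` U) phi ->
   \int[vol]_w (c * p (Phi q rho w) * phi w) = c * rho ^- hdim * \int[vol]_z (p z * phi (Psi q rho z)).
  move=> sp tp; under eq_Rintegral => w _ do rewrite -mulrA.
  rewrite IntZ ?(Int_Phi_mul r0 sp tp) ?mulrA//.
  by apply: sq_mul; [exact: sq_Phi|exact: tst_sq tp].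
have sD (phi : pt -> R) i : tst (Phi q rho @^-1` U) phi ->
    sq (fun z => 'D_(dir (Some i)) phi (Psi q rho z)).
  move=> tp; apply: (@tst_sq _ _ U).
  exact: (@tst_Psi _ _ U ('D_(dir (Some i)) phi) rn0 (tst_derive _ tp)).
split.
- exact: sq_Phi.
- by move=> i fi; apply: sqZ; apply: sq_Phi => //; exact: sh.
- by move=> i fi; apply: sqZ; apply: sq_Phi => //; exact: sF.
- by apply: sqZ; exact: sq_Phi.
- by move=> i fi; apply: sqZ; apply: sq_Phi => //; exact: sf.
- by apply: sqZ; exact: sq_Phi.
- move=> phi i tp fi; rewrite ZE//; last exact: sh.
  rewrite (dx _ _ (tst_Psi rn0 tp) fi) (Int_Phi_mul r0 su (tst_derive _ tp)).
  under eq_Rintegral => z _ do rewrite (fbD _ _ _ tp.1 fi) mulrCA.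
  rewrite IntZ; last by apply: sq_mul => //; exact: sD.
  by field; rewrite rn0 expf_neq0.
- move=> phi tp; rewrite ZE// (dY _ (tst_Psi rn0 tp)) (Int_Phi_mul r0 su (tst_Yop tp)).
  under eq_Rintegral => z _ do rewrite (YE _ _ tp.1) mulrCA.
  rewrite IntZ; last first.
    apply: sq_mul => //; apply: (@tst_sq _ _ U).
    exact: (@tst_Psi _ _ U (Yop phi) rn0 (tst_Yop tp)).
  by field; rewrite rn0 expf_neq0.
- move=> phi tp; rewrite !ZE// (deq _ (tst_Psi rn0 tp)) mulrDr; congr (_ + _).
  rewrite mulr_sumr; apply: eq_bigr => i fi; 
  rewrite (ZE rho (F i) ('D_(dir (Some i)) phi) (sF i fi) (tst_derive _ tp)).
  under eq_Rintegral => z _ do rewrite (fbD _ _ _ tp.1 fi) mulrCA.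
  rewrite IntZ; last by apply: sq_mul; [exact: sF|exact: sD].
  by field; rewrite rn0 expf_neq0.
- move=> z; move: (ell (Phi q rho z)) => /(ler_wpM2l (exprn_ge0 2 (ltW r0))).
  rewrite mulrCA !mulr_sumr; under eq_bigr do rewrite -exprMn.
  move=> /le_trans; apply; rewrite le_eqVlt; apply/orP; left; apply/eqP.
  by apply: eq_bigr => i _; ring.
- move=> i z fi; rewrite normrM ger0_norm ?(ltW r0)//.
  move: (bd i (Phi q rho z) fi) => /(ler_wpM2l (ltW r0)) /le_trans; apply.
  rewrite mulrCA mulrDr !mulr_sumr.
  by under eq_bigr do rewrite -{1}(ger0_norm (ltW r0)) -normrM; under [X in _ + X]eq_bigr do rewrite -{1}(ger0_norm (ltW r0)) -normrM.
Qed.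

End weak_solutions.

Notation fb_of := fb.

(** * Fubini's theorem for real-valued integrals *)

Section real_fubini.
Context d1 d2 (X : measurableType d1) (Y : measurableType d2) (R : realType).
Variables (m1 : {sigma_finite_measure set X -> \bar R}) (m2 : {sigma_finite_measure set Y -> \bar R}).

Lemma intg_prod (p : X -> R) (a : Y -> R) : intg m1 p -> intg m2 a ->
  intg (m1 \x m2)%E (fun z => p z.1 * a z.2).
Proof.
move=> ip ia; apply/integrable12ltyP => /=.
  apply/measurable_EFinP; apply: measurable_funM.
    by apply: (measurableT_comp (intg_meas ip)); exact: measurable_fst.
  by apply: (measurableT_comp (intg_meas ia)); exact: measurable_snd.
have -> : (\int[m1]_x \int[m2]_y `|(p x * a y)%:E| =
    \int[m1]_x ((\int[m2]_y `|a y|) * `|p x|)%:E)%E.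
  apply: eq_integral => x _.
  rewrite mulrC EFinM (IntE (intg_abs ia)) -ge0_integralZl_EFin ?normr_ge0//.
    by apply: eq_integral => y _; rewrite abse_EFin normrM.
  by apply/measurable_EFinP; apply: intg_meas (intg_abs ia).
have i1 := intgZ (\int[m2]_y `|a y|) (intg_abs ip).
by rewrite -(IntE i1) ltry.
Qed.

Lemma Int_fubini1 (f : X * Y -> R) : intg (m1 \x m2)%E f ->
  (forall x, intg m2 (fun y => f (x, y))) ->
  \int[m1]_x \int[m2]_y f (x, y) = \int[(m1 \x m2)%E]_z f z.
Proof.
move=> fi i2; rewrite /Rintegral; congr (fine _); rewrite -(integral12_prod_meas1 fi).
by apply: eq_integral => x _; exact: (IntE (i2 x)).
Qed.

Lemma Int_fubini2 (f : X * Y -> R) : intg (m1 \x m2)%E f ->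
  (forall y, intg m1 (fun x => f (x, y))) ->
  \int[m2]_y \int[m1]_x f (x, y) = \int[(m1 \x m2)%E]_z f z.
Proof.
move=> fi i1; rewrite /Rintegral; congr (fine _); rewrite -(integral21_prod_meas1 fi).
by apply: eq_integral => y _; exact: (IntE (i1 y)).
Qed.

Lemma intg_fubini1 (f : X * Y -> R) : intg (m1 \x m2)%E f ->
  (forall x, intg m2 (fun y => f (x, y))) -> intg m1 (fun x => \int[m2]_y f (x, y)).
Proof.
move=> fi i2; have := integrable_fubini_F fi; congr (integrable _ _ _).
by apply/funext => x; rewrite /fubini_F/= IntE.
Qed.

End real_fubini.

(** * Kernels in the group quotient *)

Section right_kernel.
Context {R : realType} {n : nat}.
Local Notation pt := ('cV[R]_n * R)%type.
Local Notation idx := (option 'I_n).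
Variables (B : 'M[R]_n) (blk : 'I_n -> nat) (r : nat).
Hypothesis B_blk : forall i j, B i j != 0 -> blk j = (blk i).+1.
Hypothesis blk_ord : forall i j : 'I_n, (blk i < blk j)%N -> (i < j)%N.
Hypothesis blk_le : forall i, (blk i <= r)%N.
Local Notation flow := (flow B r).
Local Notation Phi := (Phi B blk r).
Local Notation Yop := (Yop B).
Implicit Types (z w q y b e : pt) (o : idx) (U : set pt) (p phi : pt -> R).

Lemma pt_dir e : e = \sum_o crd o e *: dir o.
Proof.
have sE (F : idx -> pt) : \sum_o F o = (\sum_o (F o).1, \sum_o (F o).2).
  by elim/big_rec3 : _ => // o ? ? ? _ ->.
case: e => x t; rewrite sE; congr (_, _).
  apply/colP => j; rewrite summxE (bigD1 (Some j))//= !mxE !eqxx mulr1 big1 ?addr0//.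
  case=> [k|] kj; rewrite !mxE ?mulr0//.
  have /negbTE -> : j != k by apply: contra_neq kj => ->.
  by rewrite mulr0.
rewrite (bigD1 None)//= big1 ?addr0; first by rewrite -[RHS]/(t * 1) mulr1.
by case=> // k _; rewrite -[LHS]/(_ * 0) mulr0.
Qed.

Lemma derive_dir (f : pt -> R) z e : differentiable f z ->
  'D_e f z = \sum_o crd o e * 'D_(dir o) f z.
Proof.
move=> df; rewrite [in LHS](pt_dir e) deriveE// linear_sum.
by apply: eq_bigr => o _; rewrite linearZ deriveE.
Qed.

(* The vector fields of the equation: fld None is Y. *)
Definition fld o z : pt := if o is Some j then dir (Some j) else (B^T *m z.1, -1).

Lemma Yop_fld (f : pt -> R) z : differentiable f z -> Yop f z = 'D_(fld None z) f z.
Proof.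
move=> df; rewrite derive_dir// big_option addrC /Yop_of; congr (_ + _); last by rewrite /= mulN1r.
rewrite exchange_big; apply: eq_bigr => j _.
by rewrite /= mxE mulr_suml; apply: eq_bigr => i _; rewrite mxE mulrA.
Qed.

Definition X o (f : pt -> R) z : R := 'D_(fld o z) f z.

Lemma X_Some j f z : X (Some j) f z = 'D_(dir (Some j)) f z.
Proof. by []. Qed.

Lemma X_None (f : pt -> R) z : sm f -> X None f z = Yop f z.
Proof. by move=> sf; rewrite Yop_fld//; exact: (differentiable_fam tt z sf). Qed.

Lemma sm_X o f : sm f -> sm (X o f).
Proof.
move=> sf; case: o => [j|]; first exact: fam_derive.
rewrite (_ : X None f = Yop f); first exact: sm_Yop.
by apply/funext => z; rewrite X_None.
Qed.

Lemma tst_X o U f : tst U f -> tst U (X o f).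
Proof.
move=> sf; case: o => [j|]; first exact: tst_derive.
rewrite (_ : X None f = Yop f); first exact: tst_Yop.
by apply/funext => z; rewrite X_None//; exact: sf.1.
Qed.

(** The group element b z^-1, as [quo_Phi] confirms. With this order of the factors the left
    invariant fields acting in b and in z are exchanged up to sign. *)
Definition quo b z : pt := (flow (- z.2) *m (b.1 - z.1), b.2 - z.2).

Lemma quo_Phi w z : quo (Phi w 1 z) z = w.
Proof.
rewrite /quo /Phi_of /= dil1 mul1mx expr1n mul1r addrAC subrr add0r [z.2 + _]addrC addrK.
by rewrite mulmxA (flowK B_blk blk_le) mul1mx; case: w.
Qed.

Lemma quoE_Some b z k : crd (Some k) (quo b z) =
  \sum_l flow (- z.2) k l * (crd (Some l) b + -1 * crd (Some l) z).
Proof. by rewrite /= mxE; apply: eq_bigr => l _; rewrite mulN1r !mxE. Qed.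

Lemma fam_flowN (P : Type) i j : fam (fun (_ : P) z => flow (- z.2) i j).
Proof.
have -> : (fun (_ : P) z => flow (- z.2) i j) = (fun _ z => \sum_(k < r.+1)
   (crd None z) ^+ k * ((B^T ^+ k) i j / k`!%:R)).
  apply/funext => p; apply/funext => z; rewrite /flow_of summxE; apply: eq_bigr => k _.
  by rewrite mxE /= opprK; ring.
by apply: fam_sum => k _; apply: fam_mul; [apply: fam_exp; exact: fam_crd|exact: fam_cst].
Qed.

Lemma fam_quo_l (b : pt) o : fam (fun (_ : unit) z => crd o (quo b z)).
Proof.
case: o => [k|].
  have -> : (fun (_ : unit) z => crd (Some k) (quo b z)) = (fun _ z =>
    \sum_l flow (- z.2) k l * (crd (Some l) b + -1 * crd (Some l) z)).
    by apply/funext => ?; apply/funext => z; exact: quoE_Some.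
  apply: fam_sum => l _; apply: fam_mul; first exact: fam_flowN.
  by apply: fam_add; [exact: fam_cst|apply: fam_mul; [exact: fam_cst|exact: fam_crd]].
have -> : (fun (_ : unit) z => crd None (quo b z)) = (fun _ z => crd None b + -1 * crd None z).
  by apply/funext => ?; apply/funext => z; rewrite mulN1r.
by apply: fam_add; [exact: fam_cst|apply: fam_mul; [exact: fam_cst|exact: fam_crd]].
Qed.

Lemma fam_quo_r (z : pt) o : fam (fun (_ : unit) b => crd o (quo b z)).
Proof.
case: o => [k|].
  have -> : (fun (_ : unit) b => crd (Some k) (quo b z)) = (fun _ b =>
    \sum_l flow (- z.2) k l * (crd (Some l) b + -1 * crd (Some l) z)).
    by apply/funext => ?; apply/funext => b; exact: quoE_Some.
  apply: fam_sum => l _; apply: fam_mul; first exact: fam_cst.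
  by apply: fam_add; [exact: fam_crd|exact: fam_cst].
have -> : (fun (_ : unit) b => crd None (quo b z)) = (fun _ b => crd None b + -1 * crd None z).
  by apply/funext => ?; apply/funext => b; rewrite mulN1r.
by apply: fam_add; [exact: fam_crd|exact: fam_cst].
Qed.

Lemma derive_line (f : pt -> R) (g : R -> R) z e (s d : R) : is_derive s 1 g d ->
  (forall h : R, f (h *: e + z) = g (h + s)) -> 'D_e f z = d.
Proof.
move=> [_ <-] fE; rewrite /derive.
suff -> : (fun h : R => h^-1 *: ((f \o shift z) (h *: e) - f z)) =
    (fun h : R => h^-1 *: ((g \o shift s) (h *: (1 : R)) - g s)) by [].
apply/funext => h /=; rewrite fE -[z in f z]add0r -(scale0r e) fE add0r.
by rewrite -[h *: 1]/(h * 1) mulr1.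
Qed.

Lemma derive_affine (f : pt -> R) z e (d : R) :
  (forall h : R, f (h *: e + z) = f z + h * d) -> 'D_e f z = d.
Proof.
move=> fE; apply: (@derive_line f (fun h : R => f z + h * d) z e 0).
  have H : is_derive (0 : R) 1 (fun h : R => d *: h) (d *: 1) by exact: is_deriveZ.
  have := is_deriveD (is_derive_cst (f z) (0 : R) 1) H.
  rewrite add0r -[d *: 1]/(d * 1) mulr1.
  by congr (is_derive _ _ _ _); apply/funext => h; rewrite /= mulrC.
by move=> h; rewrite fE addr0.
Qed.

(** The differential in b of [quo b z], which is affine in b. *)
Definition lin z e : pt := (flow (- z.2) *m e.1, e.2).

Lemma derive_quo_r b z e o : 'D_e (fun b => crd o (quo b z)) b = crd o (lin z e).
Proof.
apply: derive_affine => h; case: o => [k|] /=; last first.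
  by rewrite -[h *: e.2]/(h * e.2); ring.
by rewrite -addrA mulmxDr -scalemxAr [LHS]mxE addrC; congr (_ + _); rewrite mxE.
Qed.

Lemma derive_quo_l_Some b z i o : 'D_(dir (Some i)) (fun z => crd o (quo b z)) z = - crd o (lin z (dir (Some i))).
Proof.
apply: derive_affine => h; case: o => [k|].
  rewrite [LHS]/= -[_ + z.2]/(h * 0 + z.2) mulr0 add0r opprD addrCA mulmxDr.
  rewrite mulmxN -scalemxAr [RHS]/= [LHS]mxE addrC; congr (_ + _).
  by rewrite mxE [X in - X]mxE mulrN.
by rewrite /= -[_ *: 0]/(h * 0) mulr0 add0r oppr0 mulr0 addr0.
Qed.

Lemma flow_trB s : flow s *m B^T = B^T *m flow s.
Proof.
rewrite /flow_of mulmx_suml mulmx_sumr; apply: eq_bigr => k _.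
by rewrite -scalemxAl -scalemxAr -[_ *m B^T]/(_ * B^T) -[B^T *m _]/(B^T * _) -exprSr exprS.
Qed.

Lemma derive_quo_l_None b z o :
  'D_(dir None) (fun z => crd o (quo b z)) z = crd o (B^T *m (flow (- z.2) *m (b.1 - z.1)), -1).
Proof.
case: o => [k|]; last first.
  apply: derive_affine => h.
  by rewrite /= -[_ *: 1]/(h * 1) opprD addrA addrAC mulr1 mulrN mulr1 [_ - h]addrAC.
apply: (@derive_line _ (fun t : R => (flow (- t) *m (b.1 - z.1)) k 0) z (dir None) z.2).
  have := is_derive_flowx B_blk blk_le (b.1 - z.1) k (- 1 * z.2 + 0).
  move=> /(is_derive_affcomp (a := -1) (b := 0)); rewrite !mulN1r !addr0 opprK.
  by congr (is_derive _ _ _ _); apply/funext => t; rewrite mulN1r addr0.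
by move=> h; rewrite /= scaler0 add0r -[_ *: 1]/(h * 1) mulr1.
Qed.

(** Moving z along a left invariant field changes b z^-1 as moving b backwards along the same field.
    For Y the time derivative of the flow removes the drift at z and leaves the drift at b, because
    the flow commutes with B^T. *)
Lemma derive_quo_l b z o o' : 'D_(fld o z) (fun z => crd o' (quo b z)) z = - crd o' (lin z (fld o b)).
Proof.
case: o => [i|]; first exact: derive_quo_l_Some.
rewrite derive_dir; last exact: (differentiable_fam tt z (fam_quo_l b o')).
rewrite big_option derive_quo_l_None.
under eq_bigr => j _ do rewrite derive_quo_l_Some.
case: o' => [k|]; rewrite /lin.
  rewrite [crd None _ * _]mulN1r.
  have -> : \sum_j crd (Some j) (fld None z) * - crd (Some k) (flow (- z.2) *m (dir (Some j)).1, (dir (Some j)).2)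
     = - (flow (- z.2) *m (B^T *m z.1)) k 0.
    rewrite [X in _ = - X]mxE -sumrN; apply: eq_bigr => j _.
    rewrite mulrN; congr (- _); rewrite mulrC; congr (_ * _).
    rewrite /= mxE (bigD1 j)//= !mxE !eqxx mulr1 big1 ?addr0// => l lj.
    by rewrite !mxE (negbTE lj) mulr0.
  rewrite -opprD; congr (- _); rewrite [crd _ _]/= [RHS]/= !mulmxA -flow_trB mulmxBr mxE [X in _ + X + _]mxE.
  by rewrite subrK -!mulmxA.
by rewrite /= mulN1r big1 ?addr0// => j _; rewrite oppr0 mulr0.
Qed.

Definition kerX (G : pt -> R) o b z : R := \sum_(o' : idx) 'D_(dir o') G (quo b z) * crd o' (lin z (fld o b)).

Lemma X_ker_r G o b z : sm G -> X o (fun b => G (quo b z)) b = kerX G o b z.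
Proof.
move=> sG; rewrite /X.
have [_ ->] := @derive_subst R n unit (fun=> G) (fun b => quo b z) tt b (fld o b) sG
  (fun o => differentiable_fam tt b (fam_quo_r z o)).
by apply: eq_bigr => o' _; rewrite derive_quo_r.
Qed.

Lemma X_ker_l G o b z : sm G -> X o (fun z => G (quo b z)) z = - kerX G o b z.
Proof.
move=> sG; rewrite /X.
have [_ ->] := @derive_subst R n unit (fun=> G) (fun z => quo b z) tt z (fld o z) sG
  (fun o => differentiable_fam tt z (fam_quo_l b o)).
by rewrite -sumrN; apply: eq_bigr => o' _; rewrite derive_quo_l mulrN.
Qed.

Lemma measurable_lin_fld o o' :
  measurable_fun setT (fun zb : pt * pt => crd o' (lin zb.1 (fld o zb.2))).
Proof.
have mfld o1 : measurable_fun setT (fun zb : pt * pt => crd o1 (fld o zb.2)).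
  case: o => [i|] //; case: o1 => [j|] //=.
  have -> : (fun zb : pt * pt => (B^T *m zb.2.1) j 0) =
     (fun zb => \sum_l B^T j l * crd (Some l) zb.2) by apply/funext => zb; rewrite mxE.
  apply: measurable_sum => l; apply: measurable_funM => //.
  by apply: (measurableT_comp (@measurable_crd R n (Some l))); exact: measurable_snd.
case: o' => [k|]; last exact: (mfld None).
have -> : (fun zb : pt * pt => crd (Some k) (lin zb.1 (fld o zb.2))) =
   (fun zb => \sum_l flow (- zb.1.2) k l * crd (Some l) (fld o zb.2)).
  by apply/funext => zb; rewrite /= mxE.
apply: measurable_sum => l; apply: measurable_funM; last exact: mfld.
apply: (measurableT_comp (f := fun z : pt => flow (- z.2) k l)); last exact: measurable_fst.
exact: (fam_measurable tt (fam_flowN unit k l)).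
Qed.

Lemma measurable_quo : measurable_fun setT (fun zb : pt * pt => quo zb.2 zb.1).
Proof.
have mc o : measurable_fun setT (fun zb : pt * pt => crd o zb.2 + -1 * crd o zb.1).
  apply: measurable_funD.
    by apply: (measurableT_comp (@measurable_crd R n o)); exact: measurable_snd.
  apply: measurable_funM => //.
  by apply: (measurableT_comp (@measurable_crd R n o)); exact: measurable_fst.
apply: measurable_fun_pt => -[k|]; last first.
  have -> : (fun zb : pt * pt => crd None (quo zb.2 zb.1)) = (fun zb => crd None zb.2 + -1 * crd None zb.1).
    by apply/funext => zb; rewrite mulN1r.
  exact: mc.
under eq_fun => zb do rewrite quoE_Some.
apply: measurable_sum => l; apply: measurable_funM; last exact: mc.
apply: (measurableT_comp (f := fun z : pt => flow (- z.2) k l)); last exact: measurable_fst.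
exact: (fam_measurable tt (fam_flowN unit k l)).
Qed.

Lemma measurable_ker G : sm G -> measurable_fun setT (fun zb : pt * pt => G (quo zb.2 zb.1)).
Proof. by move=> sG; apply: (measurableT_comp (sm_measurable sG)) measurable_quo. Qed.

Lemma measurable_kerX G o : sm G -> measurable_fun setT (fun zb : pt * pt => kerX G o zb.2 zb.1).
Proof.
move=> sG; apply: measurable_sum => o'; apply: measurable_funM; last exact: measurable_lin_fld.
by apply: (measurable_ker (G := 'D_(dir o') G)); exact: fam_derive.
Qed.

Lemma lin_fld_bounded o o' (rad : R) : exists M : R, forall z b, cbox rad z -> cbox rad b ->
  `|crd o' (lin z (fld o b))| <= M.
Proof.
have [C fldC] : exists C : R, forall o1 b, cbox rad b -> `|crd o1 (fld o b)| <= C.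
  case: o => [i|]; first by exists 1 => o1 b _; exact: crd_dir_le1.
  exists (1 + (\sum_k \sum_l `|B^T k l|) * `|rad|) => -[k|] b bb /=; last first.
    by rewrite normrN normr1 lerDl mulr_ge0// sumr_ge0// => k _; rewrite sumr_ge0.
  rewrite mxE -[leLHS]add0r lerD// mulr_suml [leRHS](bigD1 k)//= -[leLHS]addr0 lerD//; last first.
    by rewrite sumr_ge0// => k' _; rewrite mulr_ge0// sumr_ge0.
  apply: le_trans (ler_norm_sum _ _ _) _; rewrite mulr_suml; apply: ler_sum => l _.
  by rewrite normrM ler_wpM2l// (le_trans (bb (Some l)))// ler_norm.
case: o' => [k|]; last by exists C => z b _ /(fldC None).
have /choice[M flM] (l : 'I_n) : exists M : R, forall z, cbox rad z -> `|flow (- z.2) k l| <= M.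
  have [M HM] := fam_bounded (fam_flowN unit k l) rad.
  by exists M => z /(HM tt).
exists (\sum_l M l * C) => z b zr br; rewrite /= mxE.
apply: le_trans (ler_norm_sum _ _ _) _; apply: ler_sum => l _.
by rewrite normrM ler_pM// ?flM// (fldC (Some l)).
Qed.

Lemma kerX_bounded G o (rad : R) : tst setT G -> exists M : R, forall z b, cbox rad z -> cbox rad b ->
  `|kerX G o b z| <= M.
Proof.
move=> tG.
have /choice[M1 H1] (o' : idx) : exists M : R, forall z, `|'D_(dir o') G z| <= M.
  exact: tst_bounded (tst_derive (dir o') tG).
have /choice[M2 H2] o' := lin_fld_bounded o o' rad.
exists (\sum_o' M1 o' * M2 o') => z b zr br.
apply: le_trans (ler_norm_sum _ _ _) _; apply: ler_sum => o' _.
by rewrite normrM ler_pM// ?H1// H2.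
Qed.

End right_kernel.

Notation X_of := X.
Notation quo_of := quo.

(** * Convergence of averages over shrinking sets *)

Section averages.
Context {R : realType} {n : nat}.
Local Notation pt := ('cV[R]_n * R)%type.
Local Notation idx := (option 'I_n).
Local Notation sq := (sq (@vol R n)).
Implicit Types (z w q y b e v : pt) (o : idx) (U : set pt) (p a : pt -> R).
Local Notation vol2 := (@vol R n \x @vol R n)%E.

Lemma cvg_crd_pt (s_ : nat -> pt) z (C : R) :
  (forall k o, `|crd o (s_ k) - crd o z| <= k.+1%:R^-1 * C) -> s_ k @[k --> \oo] --> z.
Proof.
move=> H; apply/cvgrPdist_lt => e e0.
have C0 : 0 <= C by have := le_trans (normr_ge0 _) (H 0%N None); rewrite invr1 mul1r.
have C1 : 0 < C + 1 by lra.
near=> k; apply: norm_lt_crd => // o; rewrite crdB distrC (le_lt_trans (H k o))//.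
apply: (@le_lt_trans _ _ (k.+1%:R^-1 * (C + 1))).
  by rewrite ler_wpM2l ?invr_ge0//; lra.
rewrite -ltr_pdivlMr//; near: k.
exact: (near_infty_natSinv_lt (PosNum (divr_gt0 e0 C1))).
Unshelve. all: by end_near. Qed.

Lemma int_shift_le (kap rad : R) (t : pt * pt -> pt) (f : pt -> \bar R) :
  measurable_fun setT t ->
  (forall v (f : pt -> \bar R), measurable_fun setT f -> (forall y, 0 <= f y)%E ->
    (\int[vol]_z f (t (v, z)) = \int[vol]_z f z)%E) ->
  measurable_fun setT f -> (forall y, 0 <= f y)%E ->
  (\int[vol2]_(x in cbox kap `*` cbox rad) f (t x) <= vol (@cbox R n kap) * \int[vol]_y f y)%E.
Proof.
move=> mt tE mf f0; have mft : measurable_fun setT (fun x => f (t x)) by exact: measurableT_comp.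
have mD : measurable (@cbox R n kap `*` @cbox R n rad) by apply: measurableX; exact: measurable_cbox.
have m1 : measurable_fun setT (fun x : pt * pt => (\1_(@cbox R n kap) x.1 : R)).
  have mi : measurable_fun setT (\1_(@cbox R n kap) : pt -> R).
    by apply: measurable_indic; exact: measurable_cbox.
  exact: (measurableT_comp mi measurable_fst).
rewrite integral_mkcond.
apply: (@le_trans _ _ (\int[vol2]_x ((\1_(cbox kap) x.1)%:E * f (t x)))%E).
  apply: ge0_le_integral => //.
  - by move=> x _; rewrite /patch; case: ifP.
  - by apply/(measurable_restrictT _ mD); exact: measurable_funTS.
  - by apply: emeasurable_funM => //; exact/measurable_EFinP.
  - move=> x _; rewrite /patch; case: ifPn => [|_].
      by rewrite inE => -[x1 _]; rewrite indicE mem_set// mul1e.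
    by rewrite mule_ge0// lee_fin.
rewrite fubini_tonelli1//; last first.
- by move=> x; rewrite mule_ge0// lee_fin.
- by apply: emeasurable_funM => //; exact/measurable_EFinP.
rewrite /fubini_F.
under eq_integral => x _.
  rewrite /= ge0_integralZl_EFin//; last first.
    by apply: (measurableT_comp mft); exact: pair1_measurable.
  rewrite (tE x)//; over.
rewrite ge0_integralZr//; last 2 first.
- by apply/measurable_EFinP; apply: measurable_indic; exact: measurable_cbox.
- exact: integral_ge0.
by rewrite integral_indic ?setIT//; exact: measurable_cbox.
Qed.

(* Averages over shrinking sets: v runs over the unit box and the maps
   z |-> s_ k (v, z) preserve the measure and tend to the identity. *)
Lemma avg_cvg (s_ : nat -> pt * pt -> pt) (rad : R) :
  (forall k, measurable_fun setT (s_ k)) ->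
  (forall k v (f : pt -> \bar R), measurable_fun setT f -> (forall y, 0 <= f y)%E ->
    (\int[vol]_z f (s_ k (v, z)) = \int[vol]_z f z)%E) ->
  (forall v z, cbox 1 v -> s_ k (v, z) @[k --> \oo] --> z) ->
  forall a, sq a -> forall eta : R, 0 < eta -> \forall k \near \oo,
  (\int[vol2]_(x in cbox 1 `*` cbox rad) ((a (s_ k x) - a x.2) ^+ 2)%:E <= eta%:E)%E.
Proof.
move=> ms sE sc.
have mD : measurable (@cbox R n 1 `*` @cbox R n rad) by apply: measurableX; exact: measurable_cbox.
have cf : vol (@cbox R n 1) \is a fin_num by rewrite ge0_fin_numE// vol_cbox_lty.
have [c c0 cE] : exists2 c : R, 0 <= c & vol (@cbox R n 1) = c%:E.
  by exists (fine (vol (@cbox R n 1))); rewrite ?fine_ge0// fineK.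
have Dfin : (vol2 (@cbox R n 1 `*` @cbox R n rad) < +oo)%E.
  have -> : vol2 (@cbox R n 1 `*` @cbox R n rad) = (c%:E * vol (@cbox R n rad))%E.
    by rewrite -cE; apply: product_measure1E; exact: measurable_cbox.
  by rewrite lte_mul_pinfty ?lee_fin ?vol_cbox_lty.
apply: (@sq_comp_cvg _ _ _ vol (tst setT) (fun a => @tst_sq _ _ setT a) tst_density _ _ vol2 _ s_ snd c) => //.
- by move=> k f mf f0; rewrite -cE; exact: (@int_shift_le 1 rad (s_ k) f (ms k) (sE k) mf f0).
- by move=> f mf f0; rewrite -cE; exact: (@int_shift_le 1 rad snd).
move=> chi tchi; split; first exact: tst_bounded tchi.
move=> [v z] [v1 _]; have cc := @sm_continuous _ _ _ tchi.1 z.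
exact: (continuous_cvg _ cc (sc v z v1)).
Qed.

End averages.

Lemma intg_fubini2 d1 d2 (X : measurableType d1) (Y : measurableType d2) (R : realType)
    (m1 : {sigma_finite_measure set X -> \bar R}) (m2 : {sigma_finite_measure set Y -> \bar R})
    (f : X * Y -> R) : intg (m1 \x m2)%E f ->
  (forall y, intg m1 (fun x => f (x, y))) -> intg m2 (fun y => \int[m1]_x f (x, y)).
Proof.
move=> fi i1.
have mf : measurable_fun setT (EFin \o f) by exact/measurable_EFinP/intg_meas/fi.
have iG : m2.-integrable setT (fubini_G m1 (EFin \o f)).
  apply/integrableP; split; first exact: measurable_fubini_G fi.
  apply: le_lt_trans ((integrable21ltyP _ _ mf).1 fi).
  apply: ge0_le_integral => //.
  - by apply: measurableT_comp => //; exact: measurable_fubini_G fi.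
  - have ma : measurable_fun setT (fun x => `|(EFin \o f) x|)%E by exact: measurableT_comp.
    by apply: (@measurable_fun_fubini_tonelli_G _ _ _ _ _ m1 _ ma) => x; exact: abse_ge0.
  - move=> y _; apply: le_abse_integral => //.
    by apply: (measurableT_comp mf); exact: pair2_measurable.
move: iG; congr (integrable _ _ _).
by apply/funext => y; rewrite /fubini_G /= IntE.
Qed.

Lemma frac_le1 (R : realFieldType) (t : R) : 0 <= t -> t / (t + 1) <= 1.
Proof. by move=> t0; rewrite ler_pdivrMr; lra. Qed.

(** * The product bump on space-time *)

Section standard_bump.
Context {R : realType} {n : nat}.
Local Notation pt := ('cV[R]_n * R)%type.
Local Notation idx := (option 'I_n).

Definition bumpf (z : pt) : R := \prod_(o : idx) bump (crd o z).

Lemma bumpf_ge0 z : 0 <= bumpf z.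
Proof. by apply: prodr_ge0 => o _; exact: bump_ge0. Qed.

Lemma bumpf_eq0 z : ~ cbox 1 z -> bumpf z = 0.
Proof.
move=> /existsNP[ o /negP]; rewrite -ltNge => /ltW o1.
by apply/eqP; rewrite prodf_seq_eq0; apply/hasP; exists o; rewrite ?mem_index_enum// bump_eq0 ?eqxx.
Qed.

Lemma bumpf_gt0 z : (forall o, `|crd o z| < 1) -> 0 < bumpf z.
Proof. by move=> H; apply: prodr_gt0 => o _; exact: bump_gt0. Qed.

Lemma sm_bumpf : sm bumpf.
Proof. by apply: fam_prod => o _; apply: fam_comp; [exact: c1_bump|exact: fam_crd]. Qed.

Lemma tst_bumpf : tst setT bumpf.
Proof.
split; first exact: sm_bumpf.
by exists (cbox 1); [split=> //; exact: compact_cbox|exact: bumpf_eq0].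
Qed.

Definition mass : R := \int[vol]_z bumpf z.

(** A vanishing integral would make the bump vanish almost everywhere, yet it is positive on the
    open unit box, whose volume is positive. *)
Lemma mass_gt0 : 0 < mass.
Proof.
have m0 : 0 <= mass by apply: Int_ge0; exact: bumpf_ge0.
rewrite lt_neqAle m0 andbT; apply/negP => /eqP E.
have ib := tst_intg tst_bumpf.
have : (\int[vol]_z `|(bumpf z)%:E| = 0)%E.
  rewrite -(IntE (intg_abs ib)); congr (_%:E); rewrite [RHS]E.
  by apply: eq_Rintegral => z _; rewrite ger0_norm ?bumpf_ge0.
move/(ae_eq_integral_abs vol measurableT ((measurable_EFinP _ _).2 (tst_meas tst_bumpf))).
case=> N [mN N0 sN].
have : (vol (@obox R n (fun=> (-1)%R) (fun=> 1%R)) <= vol N)%E.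
  apply: le_measure; rewrite ?inE//; first exact: measurable_obox.
  move=> z oz; apply: sN => /= /(_ I) [] b0.
  have : 0 < bumpf z by apply: bumpf_gt0 => o; rewrite ltr_norml; exact: oz.
  by rewrite b0 ltxx.
have oE : vol (@obox R n (fun=> (-1)%R) (fun=> 1%R)) = (\prod_(i < n) lebesgue1 `](-1)%R, 1%R[%classic * @lebesgue1 R `](-1)%R, 1%R[%classic)%E.
  by rewrite oboxE (@vol_box _ _ (fun=> `](-1)%R, 1%R[%classic))// => o; exact: measurable_itvR.
rewrite N0 oE.
have l1 : (0 < @lebesgue1 R `](-1)%R, 1%R[%classic)%E.
  rewrite /lebesgue1 lebesgue_measure_itv/= lte_fin ifT; last by lra.
  by rewrite -EFinB lte_fin; lra.
rewrite leNgt mule_gt0//.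
by elim/big_ind : _ => // x y; exact: mule_gt0.
Qed.

End standard_bump.

(** * Integration by parts between weak derivatives *)

Section weak_green.
Context {R : realType} {n : nat}.
Local Notation pt := ('cV[R]_n * R)%type.
Local Notation idx := (option 'I_n).
Variables (B : 'M[R]_n) (blk : 'I_n -> nat) (r : nat).
Hypothesis B_blk : forall i j, B i j != 0 -> blk j = (blk i).+1.
Hypothesis blk_ord : forall i j : 'I_n, (blk i < blk j)%N -> (i < j)%N.
Hypothesis blk_le : forall i, (blk i <= r)%N.
Local Notation flow := (flow B r).
Local Notation Phi := (Phi B blk r).
Local Notation Psi := (Psi B blk r).
Local Notation hdim := (hdim blk).
Local Notation X := (X B).
Local Notation quo := (quo B r).
Local Notation kerX := (kerX B r).
Local Notation sq := (sq (@vol R n)).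
Local Notation intg := (intg (@vol R n)).
Local Notation vol2 := (@vol R n \x @vol R n)%E.
Implicit Types (z w q y b e : pt) (o : idx) (U : set pt) (p a phi G : pt -> R).

Definition supp rad p := forall z, ~ cbox rad z -> p z = 0.

Lemma supp_intg rad p : sq p -> supp rad p -> intg p.
Proof.
move=> sp p0.
have sc := @sq_indic _ _ R vol _ (measurable_cbox rad) (@vol_cbox_lty R n rad).
have := sq_mul sp sc; congr (integrable _ _ _); apply/funext => z; rewrite /= indicE.
have [zr|zr] := pselect (cbox rad z); first by rewrite mem_set// mulr1.
by rewrite (p0 _ zr) mul0r.
Qed.

Section exchange.
Variables (rad C : R) (p a : pt -> R) (M : pt -> pt -> R).
Hypotheses (sp : sq p) (sa : sq a) (p0 : supp rad p) (a0 : supp rad a).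
Hypothesis mM : measurable_fun setT (fun zb : pt * pt => M zb.2 zb.1).
Hypothesis MC : forall z b, cbox rad z -> cbox rad b -> `|M b z| <= C.

Let ip : intg p. Proof. exact: supp_intg p0. Qed.
Let ia : intg a. Proof. exact: supp_intg a0. Qed.

Let paM z b : `|p z * a b * M b z| <= C * `|p z * a b|.
Proof.
have [zr|/p0 ->] := pselect (cbox rad z); last by rewrite !mul0r normr0 mulr0.
have [br|/a0 ->] := pselect (cbox rad b); last by rewrite mulr0 mul0r normr0 mulr0.
by rewrite normrM mulrC ler_wpM2r// MC.
Qed.

Let m1 : measurable_fun setT (fun zb : pt * pt => p zb.1 * a zb.2 * M zb.2 zb.1).
Proof.
apply: measurable_funM => //; apply: measurable_funM.
  exact: (measurableT_comp (sq_meas sp) measurable_fst).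
exact: (measurableT_comp (sq_meas sa) measurable_snd).
Qed.

Lemma intg_pair : intg_of vol2 (fun zb => p zb.1 * a zb.2 * M zb.2 zb.1).
Proof.
apply: (intg_le m1 (fun zb => paM zb.1 zb.2)).
by apply: intgZ; apply: intg_abs; exact: intg_prod.
Qed.

Lemma intg_pair_r z : intg (fun b => p z * a b * M b z).
Proof.
have mz : measurable_fun setT (fun b => p z * a b * M b z).
  exact: (measurableT_comp m1 (pair1_measurable z)).
apply: (intg_le mz (paM z)); apply: intgZ; apply: intg_abs; exact: intgZ.
Qed.

Lemma intg_pair_l b : intg (fun z => p z * a b * M b z).
Proof.
have mb : measurable_fun setT (fun z => p z * a b * M b z).
  exact: (measurableT_comp m1 (pair2_measurable b)).
apply: (intg_le mb (fun z => paM z b)); apply: intgZ; apply: intg_abs.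
have := intgZ (a b) ip; congr (integrable _ _ _); apply/funext => z.
by rewrite /= mulrC.
Qed.

Lemma Int_exchange :
  \int[vol]_z \int[vol]_b (p z * a b * M b z) = \int[vol]_b \int[vol]_z (p z * a b * M b z).
Proof.
by rewrite (Int_fubini1 intg_pair intg_pair_r) (Int_fubini2 intg_pair intg_pair_l).
Qed.

End exchange.

Lemma quo_inv b z : b = (z.1 + flow z.2 *m (quo b z).1, z.2 + (quo b z).2).
Proof.
rewrite /quo_of /= mulmxA -{1}[z.2]opprK (flowK B_blk blk_le) mul1mx.
by rewrite addrC subrK [z.2 + _]addrC subrK; case: b.
Qed.

(** Together with a bound on time it makes a kernel in b z^-1 compactly supported in each variable
    when the other one is fixed. *)
Lemma quo_close (c T : R) : exists C : R, forall b z, cbox c (quo b z) -> `|z.2| <= T ->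
  forall o, `|crd o b - crd o z| <= C.
Proof.
have /choice[M flM] (kl : 'I_n * 'I_n) : exists M : R, forall s, `|s| <= T -> `|flow s kl.1 kl.2| <= M.
  have [M HM] := fam_bounded (@fam_flowN R n B r unit kl.1 kl.2) T.
  exists M => s sT; have := HM tt (0, - s); rewrite /= opprK; apply => -[j|] /=.
    by rewrite mxE normr0 (le_trans _ sT).
  by rewrite normrN.
exists (`|c| + \sum_k \sum_l `|M (k, l)| * `|c|) => b z cq zT o.
have cc o1 : `|crd o1 (quo b z)| <= `|c| by rewrite (le_trans (cq o1)) ?ler_norm.
rewrite {1}(quo_inv b z); case: o => [k|] /=.
  rewrite mxE addrAC subrr add0r mxE -[leLHS]add0r lerD//.
  rewrite [leRHS](bigD1 k)//= -[leLHS]addr0 lerD//; last by apply: sumr_ge0 => ? _; rewrite sumr_ge0.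
  apply: le_trans (ler_norm_sum _ _ _) _; apply: ler_sum => l _.
  rewrite normrM ler_pM//; last exact: (cc (Some l)).
  by rewrite (le_trans (flM (k, l) _ zT)) ?ler_norm.
rewrite addrAC subrr add0r (le_trans (cc None))// lerDl.
by apply: sumr_ge0 => ? _; rewrite sumr_ge0.
Qed.

Section doubling.
Variable G : pt -> R.
Hypothesis tG : tst setT G.

Let sG : sm G. Proof. by case: tG. Qed.

Let G_supp : exists c : R, supp c G.
Proof.
have [_ [K [cK _] K0]] := tG; have [c [_ Kc]] := compact_sub_cbox cK.
by exists c => z zc; apply: K0 => /Kc.
Qed.

Lemma tst_ker_r z : tst setT (fun b => G (quo b z)).
Proof.
split.
  by apply: (@fam_subst _ _ _ (fun _ => G) (fun _ b => quo b z)) => // o; exact: fam_quo_r.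
have [c Gc] := G_supp; have [C HC] := quo_close c `|z.2|.
exists (cbox (\sum_o `|crd o z| + C)); first by split=> //; exact: compact_cbox.
move=> b bC; apply: Gc => cq; apply: bC => o.
have := HC b z cq (lexx _) o; rewrite (bigD1 o)//=.
have : 0 <= \sum_(i | i != o) `|crd i z| by apply: sumr_ge0.
have := ler_normD (crd o b - crd o z) (crd o z); rewrite subrK; lra.
Qed.

Lemma tst_ker_l b : tst setT (fun z => G (quo b z)).
Proof.
split.
  by apply: (@fam_subst _ _ _ (fun _ => G) (fun _ z => quo b z)) => // o; exact: fam_quo_l.
have [c Gc] := G_supp; have [C HC] := quo_close c (`|b.2| + `|c|).
exists (cbox (\sum_o `|crd o b| + C)); first by split=> //; exact: compact_cbox.
move=> z zC; apply: Gc => cq; apply: zC => o.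
have zT : `|z.2| <= `|b.2| + `|c|.
  have := cq None; rewrite /=; have := ler_norm c.
  have := ler_normD (z.2 - b.2) b.2; rewrite subrK distrC; lra.
have := HC b z cq zT o; rewrite (bigD1 o)//=.
have : 0 <= \sum_(i | i != o) `|crd i b| by apply: sumr_ge0.
have := ler_normD (crd o z - crd o b) (crd o b); rewrite subrK distrC; lra.
Qed.

Variables (rad : R) (P : pred idx) (p0 v : pt -> R) (q w : idx -> pt -> R).
Hypotheses (sp : sq p0) (sv : sq v) (squ : forall o, P o -> sq (q o)) (sw : forall o, P o -> sq (w o)).
Hypotheses (zp : supp rad p0) (zv : supp rad v) (zq : forall o, P o -> supp rad (q o))
  (zw : forall o, P o -> supp rad (w o)).
Hypothesis p_div : forall phi, tst setT phi ->
  \int[vol]_z (p0 z * phi z) = \sum_(o | P o) \int[vol]_z (q o z * X o phi z).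
Hypothesis w_der : forall phi o, tst setT phi -> P o ->
  \int[vol]_z (w o z * phi z) = - \int[vol]_z (v z * X o phi z).

Definition dbl p a : R := \int[vol]_z (p z * \int[vol]_b (a b * G (quo b z))).

Let ker_bd : exists C, forall z b, cbox rad z -> cbox rad b -> `|G (quo b z)| <= C.
Proof. by have [M HM] := tst_bounded tG; exists M. Qed.

Let exG p a : sq p -> sq a -> supp rad p -> supp rad a ->
  dbl p a = \int[vol]_b (a b * \int[vol]_z (p z * G (quo b z))).
Proof.
move=> sp1 sa zp1 za; have [C HC] := ker_bd.
transitivity (\int[vol]_z \int[vol]_b (p z * a b * G (quo b z))).
  apply: eq_Rintegral => z _; rewrite -IntZ; last exact: sq_mul sa (tst_sq (tst_ker_r z)).
  by apply: eq_Rintegral => b _; rewrite mulrA.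
rewrite (Int_exchange sp1 sa zp1 za (measurable_ker B r sG) HC).
apply: eq_Rintegral => b _; rewrite -IntZ; last exact: sq_mul sp1 (tst_sq (tst_ker_l b)).
by apply: eq_Rintegral => z _; ring.
Qed.

(** At fixed b the kernel is a test function of z for [p_div]; its derivative in z is minus that in
    b. After Fubini it is, at fixed z, a test function of b for [w_der], and the two minus signs
    cancel. *)
Lemma double_green : dbl p0 v = \sum_(o | P o) dbl (q o) (w o).
Proof.
rewrite (exG sp sv zp zv).
have kE o b z : X o (fun z => G (quo b z)) z = - kerX G o b z by exact: (X_ker_l B_blk).
have kE' o b z : X o (fun b => G (quo b z)) b = kerX G o b z by exact: (X_ker_r B).
have kEf o b : X o (fun z => G (quo b z)) = (fun z => - kerX G o b z) by apply/funext => z.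
have kEf' o z : X o (fun b => G (quo b z)) = (fun b => kerX G o b z) by apply/funext => b.
have sk_l o b : sq (fun z => kerX G o b z).
  have := sqN (tst_sq (tst_X B o (tst_ker_l b))); rewrite kEf; congr (sq_of _ _).
  by apply/funext => z; rewrite opprK.
have sk_r o z : sq (fun b => kerX G o b z).
  by have := tst_sq (tst_X B o (tst_ker_r z)); rewrite kEf'.
have mk o := measurable_kerX B r o sG.
have mk' o : measurable_fun setT (fun bz : pt * pt => kerX G o bz.1 bz.2).
  exact: (measurableT_comp (mk o) (@measurable_swap _ _ _ _)).
have kC o : exists C, forall z b, cbox rad z -> cbox rad b -> `|kerX G o b z| <= C.
  exact: kerX_bounded.
have iM o : P o -> intg (fun b => \int[vol]_z (v b * q o z * kerX G o b z)).
  move=> Po; have [C HC] := kC o.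
  have HC' z b : cbox rad z -> cbox rad b -> `|(fun z b => kerX G o b z) b z| <= C by move=> *; exact: HC.
  apply: (intg_fubini1 (f := fun bz => v bz.1 * q o bz.2 * kerX G o bz.1 bz.2)).
    exact: (@intg_pair rad C v (q o) (fun z b => kerX G o b z) sv (squ Po) zv (zq Po) (mk' o) HC').
  exact: (@intg_pair_r rad C v (q o) (fun z b => kerX G o b z) sv (squ Po) zv (zq Po) (mk' o) HC').
transitivity (\int[vol]_b \sum_(o | P o) - \int[vol]_z (v b * q o z * kerX G o b z)).
  apply: eq_Rintegral => b _; rewrite p_div ?mulr_sumr; last exact: tst_ker_l.
  apply: eq_bigr => o Po; rewrite kEf.
  under eq_Rintegral => z _ do rewrite mulrN.
  rewrite IntN ?mulrN -?IntZ; try exact: (sq_mul (squ Po) (sk_l o b)).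
  by congr (- _); apply: eq_Rintegral => z _; rewrite mulrA.
rewrite Int_sum; last by move=> o Po; apply: intgN; exact: iM.
apply: eq_bigr => o Po; rewrite IntN; last exact: iM.
have [C HC] := kC o.
transitivity (- \int[vol]_b \int[vol]_z (q o z * v b * kerX G o b z)).
  by congr (- _); apply: eq_Rintegral => b _; apply: eq_Rintegral => z _; rewrite (mulrC (v b)).
rewrite -(Int_exchange (squ Po) sv (zq Po) zv (mk o) HC) /dbl -IntN; last first.
  apply: (intg_fubini1 (f := fun zb => q o zb.1 * v zb.2 * kerX G o zb.2 zb.1)).
    exact: (intg_pair (squ Po) sv (zq Po) zv (mk o) HC).
  exact: (intg_pair_r (squ Po) sv (zq Po) zv (mk o) HC).
apply: eq_Rintegral => z _; rewrite (w_der (tst_ker_r z) Po) kEf' mulrN; congr (- _).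
rewrite -IntZ; last exact: (sq_mul sv (sk_r o z)).
by apply: eq_Rintegral => b _; rewrite mulrA.
Qed.
End doubling.
Lemma measurable_Phi2 (rho : R) : measurable_fun setT (fun zv : pt * pt => Phi zv.1 rho zv.2).
Proof.
have m2 : measurable_fun setT (fun zv : pt * pt => rho ^+ 2 * zv.2.2).
  by apply: measurable_funM => //; exact: (measurableT_comp (@measurable_crd R n None) measurable_snd).
apply: measurable_fun_pt => -[j|] /=; last first.
  by apply: measurable_funD => //; exact: (measurableT_comp (@measurable_crd R n None) measurable_fst).
have -> : (fun zv : pt * pt => (dil blk rho *m zv.2.1 + flow (rho ^+ 2 * zv.2.2) *m zv.1.1) j 0) =
   (fun zv => rho ^+ wt blk j * crd (Some j) zv.2 + \sum_k flow (rho ^+ 2 * zv.2.2) j k * crd (Some k) zv.1).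
  by apply/funext => w; rewrite mxE dilE mxE.
apply: measurable_funD.
  by apply: measurable_funM => //; exact: (measurableT_comp (@measurable_crd R n (Some j)) measurable_snd).
apply: measurable_sum => k; apply: measurable_funM.
  exact: (measurableT_comp (measurable_flow B_blk blk_le j k) m2).
exact: (measurableT_comp (@measurable_crd R n (Some k)) measurable_fst).
Qed.

Lemma vol_Phi1 q (A : set pt) : measurable A -> vol (Phi q 1 @^-1` A) = (1%:E * vol A)%E.
Proof. by move=> mA; have := vol_Phi B_blk blk_le q ltr01 mA; rewrite expr1n invr1. Qed.

Definition eps (k : nat) : R := k.+1%:R^-1.

Lemma eps_gt0 k : 0 < eps k. Proof. by rewrite invr_gt0 ltr0n. Qed.

Lemma eps_le1 k : eps k <= 1. Proof. by rewrite invf_le1 ?ltr0n// ler1n. Qed.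

(** Left translation of z by a small group element. It preserves the volume for each fixed element,
    as [avg_cvg] requires. *)
Definition lshift_ (k : nat) (vz : pt * pt) : pt := Phi (Phi 0 (eps k) vz.1) 1 vz.2.

Lemma lshift_cvg v z : lshift_ k (v, z) @[k --> \oo] --> z.
Proof.
apply: (@cvg_crd_pt _ _ _ _ (`|v.2| + \sum_i \sum_l `|flow z.2 i l| * `|v.1 l 0|)) => k o.
have e0 := ltW (eps_gt0 k); have e1 := eps_le1 k.
have S0 : 0 <= \sum_i \sum_l `|flow z.2 i l| * `|v.1 l 0|.
  by apply: sumr_ge0 => i _; apply: sumr_ge0 => l _; rewrite mulr_ge0.
rewrite -/(eps k) /lshift_ mulrDr; case: o => [j|]; last first.
  rewrite [crd _ _]/= expr1n mul1r addr0 addrAC subrr add0r.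
  rewrite normrM ger0_norm ?exprn_ge0// -[leLHS]addr0 lerD ?mulr_ge0//.
  by rewrite ler_wpM2r// expr2 ler_piMl.
rewrite [crd _ _]/= dil1 mul1mx expr1n mul1r mulmx0 addr0 mxE addrAC subrr add0r mxE.
rewrite -[leLHS]add0r lerD ?mulr_ge0//.
rewrite mulr_sumr [leRHS](bigD1 j)//= -[leLHS]addr0 lerD//; last first.
  by apply: sumr_ge0 => i _; rewrite mulr_ge0// sumr_ge0// => l _; rewrite mulr_ge0.
rewrite mulr_sumr; apply: le_trans (ler_norm_sum _ _ _) _; apply: ler_sum => l _.
rewrite dilE !normrM mulrCA ler_wpM2r ?mulr_ge0//.
rewrite normrX ger0_norm// -[leRHS]expr1 ler_wiXn2l//.
by rewrite /wt_of addn1.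
Qed.

Definition gk k : pt -> R := fun w => eps k ^- hdim * bumpf (Psi 0 (eps k) w).

Lemma tst_gk k : tst setT (gk k).
Proof.
apply: tstZ; exact: (@tst_Psi _ _ B blk r B_blk blk_le 0 (eps k) setT _ (lt0r_neq0 (eps_gt0 k)) tst_bumpf).
Qed.

Lemma sq_Phi_left (w : pt) (rho : R) a : sq a -> sq (fun z => a (Phi z rho w)).
Proof.
move=> sa; apply: (@sq_cov _ _ _ _ _ vol vol (fun z => Phi z rho w) 1%:nng) => //.
  exact: measurable_Phi_left.
by move=> A mA; apply: vol_Phi_left.
Qed.

(** Substitute b = w z, a right translation, and then let w be the dilation of v by [eps k]: the
    kernel integral at z becomes an average of a over left translates of z. *)
Lemma ker_avg k a z : sq a ->
  \int[vol]_b (a b * gk k (quo b z)) = \int[vol]_v (bumpf v * a (lshift_ k (v, z))).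
Proof.
move=> sa; have e0 := eps_gt0 k.
have <- : \int[vol]_w ((fun b => a b * gk k (quo b z)) (Phi w 1 z)) =
    \int[vol]_b (a b * gk k (quo b z)).
  rewrite -[RHS]mul1r; apply: (@Int_cov _ _ _ _ _ vol vol (fun w => Phi w 1 z) 1%:nng).
  - exact: measurable_Phi_left.
  - by move=> A mA; apply: vol_Phi_left.
  - exact: (sq_mul sa (tst_sq (tst_ker_r (tst_gk k) z))).
under eq_Rintegral => w _ do rewrite (quo_Phi B_blk blk_le) /gk mulrCA.
have sw : sq (fun w => a (Phi w 1 z)) by exact: sq_Phi_left.
have sb : sq (fun w => bumpf (Psi 0 (eps k) w)).
  apply: (@tst_sq _ _ setT).
  exact: (@tst_Psi _ _ B blk r B_blk blk_le 0 (eps k) setT _ (lt0r_neq0 e0) tst_bumpf).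
rewrite IntZ; last exact: sq_mul.
rewrite -(Int_Phi B_blk blk_le 0 e0 (sq_mul sw sb)).
by apply: eq_Rintegral => v _; rewrite PhiK ?gt_eqF// mulrC.
Qed.

Lemma dbl_cvg rad p a : sq p -> sq a -> supp rad p ->
  dbl (gk k) p a @[k --> \oo] --> @mass R n * \int[vol]_z (p z * a z).
Proof.
move=> sp sa p0.
(* The error is the integral of [f1] times [dl] over the pairs (v, z); Cauchy-Schwarz reduces it to
   the L^2 convergence of the translates of a. The factor [mass] is the integral of the bump, which
   is not normalised. *)
pose f1 (x : pt * pt) := bumpf x.1 * p x.2.
pose D : set (pt * pt) := cbox 1 `*` cbox rad.
have mD : measurable D by apply: measurableX; exact: measurable_cbox.
pose dl k (x : pt * pt) := \1_D x * (a (lshift_ k x) - a x.2).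
have msh k : measurable_fun setT (lshift_ k).
  have m2 : measurable_fun setT (fun x : pt * pt => (Phi 0 (eps k) x.1, x.2)).
    apply: measurable_fun_pair; last exact: measurable_snd.
    exact: (measurableT_comp (measurable_Phi B_blk blk_le 0 (eps k)) measurable_fst).
  exact: (measurableT_comp (measurable_Phi2 1) m2).
have mdl k : measurable_fun setT (dl k).
  apply: measurable_funM; first exact: measurable_indic.
  apply: measurable_funB; first exact: (measurableT_comp (sq_meas sa) (msh k)).
  exact: (measurableT_comp (sq_meas sa) measurable_snd).
have sf1 : sq_of vol2 f1.
  split; last first.
    have := intg_prod (sq_intg2 (tst_sq (@tst_bumpf R n))) (sq_intg2 sp).
    by congr (integrable _ _ _); apply/funext => x; rewrite /= exprMn.
  apply: measurable_funM; first exact: (measurableT_comp (tst_meas tst_bumpf) measurable_fst).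
  exact: (measurableT_comp (sq_meas sp) measurable_snd).
have sh_int k v (f : pt -> \bar R) : measurable_fun setT f -> (forall y, 0 <= f y)%E ->
    (\int[vol]_z f (lshift_ k (v, z)) = \int[vol]_z f z)%E.
  move=> mf f0; rewrite (@ge0_int_cov _ _ _ _ _ vol vol (Phi (Phi 0 (eps k) v) 1) 1%:nng) ?mul1e//.
    exact: measurable_Phi.
  by move=> A mA; apply: vol_Phi1.
have key eta : 0 < eta -> \forall k \near \oo,
    (dbl (gk k) p a - @mass R n * \int[vol]_z (p z * a z)) ^+ 2 <= (\int[vol2]_x f1 x ^+ 2) * eta.
  move=> eta0; have lc v z : cbox 1 v -> lshift_ k (v, z) @[k --> \oo] --> z by move=> _; exact: lshift_cvg.
  have H := avg_cvg rad msh sh_int lc sa eta0.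
  near=> k.
  have dE : (\int[vol2]_x ((dl k x) ^+ 2)%:E <= eta%:E)%E.
    have : (\int[vol2]_(x in D) ((a (lshift_ k x) - a x.2) ^+ 2)%:E <= eta%:E)%E by near: k.
    rewrite integral_mkcond; congr (_ <= _)%E; apply: eq_integral => x _.
    rewrite /patch /dl indicE; case: ifP => _; first by rewrite mul1r.
    by rewrite mul0r expr0n.
  have sdl : sq_of vol2 (dl k).
    split=> //; apply: intg_lty => //; first exact: measurable_funX.
      by move=> x; exact: sqr_ge0.
    exact: le_lt_trans dE (ltry _).
  have := cauchy_schwarz sf1 sdl.
  have : \int[vol2]_x dl k x ^+ 2 <= eta by rewrite -lee_fin (IntE (sq_intg2 sdl)).
  move=> dle /le_trans; move/(_ _ (ler_wpM2l _ dle)) => -/(_ _) H2.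
  apply: le_trans (H2 _); last by apply: Int_ge0 => x; exact: sqr_ge0.
  rewrite le_eqVlt; apply/orP; left; apply/eqP; congr (_ ^+ 2).
  have secE z v : f1 (v, z) * dl k (v, z) = p z * (bumpf v * (a (lshift_ k (v, z)) - a z)).
    rewrite /f1 /dl /= indicE.
    have [vz|vz] := pselect (D (v, z)); first by rewrite mem_set// mul1r; ring.
    rewrite memNset// mul0r mulr0.
    have [v1|/bumpf_eq0 ->] := pselect (cbox 1 v); last by rewrite mul0r mulr0.
    by rewrite p0 ?mul0r// => zr; apply: vz.
  have sec z : intg (fun v => f1 (v, z) * dl k (v, z)).
    have -> : (fun v => f1 (v, z) * dl k (v, z)) =
       (fun v => p z * (bumpf v * (a (lshift_ k (v, z)) - a z))).
      by apply/funext => v; exact: secE.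
    apply: intgZ; under eq_fun do rewrite mulrBr; apply: intgB.
      apply: (sq_mul (tst_sq tst_bumpf)).
      exact: (sq_Phi B_blk blk_le 0 (eps_gt0 k) (sq_Phi_left z 1 sa)).
    under eq_fun do rewrite mulrC; apply: intgZ; exact: tst_intg tst_bumpf.
  rewrite -(Int_fubini2 (sq_mul sf1 sdl) sec).
  rewrite /dbl -IntZ; last exact: sq_mul.
  have i1 z : intg (fun v => bumpf v * a (lshift_ k (v, z))).
    apply: (sq_mul (tst_sq tst_bumpf)).
    exact: (sq_Phi B_blk blk_le 0 (eps_gt0 k) (sq_Phi_left z 1 sa)).
  have i2 z : intg (fun v => a z * bumpf v) by apply: intgZ; exact: tst_intg tst_bumpf.
  have E z : \int[vol]_v (f1 (v, z) * dl k (v, z)) =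
     p z * \int[vol]_b (a b * gk k (quo b z)) - @mass R n * (p z * a z).
    transitivity (\int[vol]_v (p z * (bumpf v * a (lshift_ k (v, z)) - a z * bumpf v))).
      by apply: eq_Rintegral => v _; rewrite secE; ring.
    rewrite IntZ; last exact: intgB.
    by rewrite (IntB (i1 z) (i2 z)) ker_avg// IntZ ?/mass; [ring|exact: tst_intg tst_bumpf].
  rewrite -IntB; last first.
  - by apply: intgZ; exact: sq_mul.
  - have := intgD (intg_fubini2 (sq_mul sf1 sdl) sec) (intgZ (@mass R n) (sq_mul sp sa)).
    by congr (integrable _ _ _); apply/funext => z; rewrite /= E subrK.
  by apply: eq_Rintegral => z _; rewrite E.

have A0 : 0 <= \int[vol2]_x f1 x ^+ 2 by apply: Int_ge0 => x; exact: sqr_ge0.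
apply/cvgrPdist_le => e e0.
have eta0 : 0 < e ^+ 2 / (\int[vol2]_x f1 x ^+ 2 + 1) by rewrite divr_gt0 ?exprn_gt0//; lra.
near=> k; rewrite distrC -ler_sqr ?nnegrE ?(ltW e0)// real_normK ?num_real//.
have : (dbl (gk k) p a - @mass R n * \int[vol]_z (p z * a z)) ^+ 2 <=
    (\int[vol2]_x f1 x ^+ 2) * (e ^+ 2 / (\int[vol2]_x f1 x ^+ 2 + 1)).
  by near: k; exact: key.
move=> /le_trans; apply; rewrite mulrCA ler_piMr ?exprn_ge0 ?(ltW e0)//.
exact: frac_le1.
Unshelve. all: by end_near. Qed.

(** The kernel in [double_green] concentrates. If p0 is minus the weak divergence of q along the
    fields, and w the weak derivatives of v, the pairing of p0 with v is moved onto w; this is what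
    allows testing the equation with the solution. *)
Lemma weak_green (rad : R) (P : pred idx) (p0 v : pt -> R) (q w : idx -> pt -> R) :
  sq p0 -> sq v -> (forall o, P o -> sq (q o)) -> (forall o, P o -> sq (w o)) ->
  supp rad p0 -> supp rad v -> (forall o, P o -> supp rad (q o)) ->
  (forall o, P o -> supp rad (w o)) ->
  (forall phi, tst setT phi ->
    \int[vol]_z (p0 z * phi z) = \sum_(o | P o) \int[vol]_z (q o z * X o phi z)) ->
  (forall phi o, tst setT phi -> P o ->
    \int[vol]_z (w o z * phi z) = - \int[vol]_z (v z * X o phi z)) ->
  \int[vol]_z (p0 z * v z) = \sum_(o | P o) \int[vol]_z (q o z * w o z).
Proof.
move=> sp sv sq_ sw zp zv zq zw pd wd.
have H1 := dbl_cvg sp sv zp.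
have H2 : \sum_(o | P o) dbl (gk k) (q o) (w o) @[k --> \oo] -->
    \sum_(o | P o) (@mass R n * \int[vol]_z (q o z * w o z)).
  apply: cvg_big => [|o Po]; first exact: add_continuous.
  exact: dbl_cvg (sq_ o Po) (sw o Po) (zq o Po).
have E k : dbl (gk k) p0 v = \sum_(o | P o) dbl (gk k) (q o) (w o).
  by apply: (double_green (tst_gk k) (rad := rad)).
move: H1; under eq_fun do rewrite E; move=> H1.
rewrite -mulr_sumr in H2.
have m0 : @mass R n != 0 by rewrite gt_eqF ?mass_gt0.
apply: (mulfI m0); exact: (cvg_unique (@Rhausdorff R) H1 H2).
Qed.

End weak_green.

(** * The Caccioppoli inequality *)

Lemma young (R : realFieldType) (d a b : R) : 0 < d ->
  a * b <= d * a ^+ 2 + (4 * d)^-1 * b ^+ 2.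
Proof.
move=> d0; have -> : d * a ^+ 2 + (4 * d)^-1 * b ^+ 2 = a * b + d * (a - (2 * d)^-1 * b) ^+ 2.
  by field; rewrite gt_eqF.
by rewrite lerDl mulr_ge0 ?sqr_ge0 ?ltW.
Qed.

Lemma sqr_sum_le (R : realFieldType) n (P : pred 'I_n) (a : 'I_n -> R) :
  (\sum_(i | P i) a i) ^+ 2 <= n.+1%:R * \sum_(i | P i) a i ^+ 2.
Proof.
rewrite expr2 mulr_suml.
apply: (@le_trans _ _ (\sum_(i | P i) \sum_(j | P j) (2^-1 * a i ^+ 2 + 2^-1 * a j ^+ 2))).
  apply: ler_sum => i _; rewrite mulr_sumr; apply: ler_sum => j _.
  by have := sqr_ge0 (a i - a j); nra.
set S := \sum_(i | P i) a i ^+ 2.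
have -> : \sum_(i | P i) \sum_(j | P j) (2^-1 * a i ^+ 2 + 2^-1 * a j ^+ 2) =
    2^-1 * S * #|P|%:R + 2^-1 * S * #|P|%:R.
  transitivity (\sum_(i | P i) (2^-1 * a i ^+ 2 * #|P|%:R + 2^-1 * S)).
    by apply: eq_bigr => i _; rewrite big_split sumr_const -mulr_sumr /= -[_ *+ _]mulr_natr.
  by rewrite big_split sumr_const /= -mulr_suml -mulr_sumr -(mulr_natr (2^-1 * S)).
have S0 : 0 <= S by apply: sumr_ge0 => i _; exact: sqr_ge0.
have cn : #|P|%:R <= n.+1%:R :> R.
  by rewrite ler_nat (leq_trans (max_card _))// card_ord.
by have := ler_wpM2r S0 cn; lra.
Qed.

(* The algebra of the energy estimate: [x] is the cutoff at a point, [A] the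
   sum of the |h_i|, [D] that of the |f_i|, [T] the cutoff part of the energy identity. *)
Lemma energy_alg (R : realFieldType) (N lam K C1 x A D H g v T : R) :
  0 < N -> 0 < lam -> 0 <= K -> 0 <= C1 -> 0 <= x <= 1 -> 0 <= A -> 0 <= D ->
  A ^+ 2 <= N * H -> 0 <= H ->
  lam * (x ^+ 2 * H) - x ^+ 2 * (D * A) - C1 * v ^+ 2 - 2^-1 * (g ^+ 2 + v ^+ 2)
    - K * x * `|v| * (A + D) <= T ->
  lam / 2 * (x ^+ 2 * H) <= T +
   (C1 + 1 + 2 * N / lam * (K ^+ 2 + 1) + 2 * K) * (v ^+ 2 + g ^+ 2 + D ^+ 2).
Proof.
move=> N0 l0 K0 C0 /andP[x0 x1] A0 D0 AH H0 HT.
(* Two Young inequalities with this weight absorb together at most lam / 4 times x^2 H. *)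
have d0 : 0 < lam / (8 * N) by rewrite divr_gt0// mulr_gt0.
have H1 := young (x * A) (x * D) d0.
have H2 := young (x * A) (K * `|v|) d0.
have dE : (4 * (lam / (8 * N)))^-1 = 2 * N / lam by field; rewrite !gt_eqF.
rewrite dE in H1 H2.
have v2 : `|v| ^+ 2 = v ^+ 2 by rewrite real_normK ?num_real.
have vv := normr_ge0 v.
have x2 : x ^+ 2 <= 1 by rewrite expr_le1.
have q0 : 0 <= 2 * N / lam by rewrite divr_ge0 ?mulr_ge0 ?ltW.
have H3 : x * `|v| * D <= v ^+ 2 + D ^+ 2.
  rewrite -v2; apply: (@le_trans _ _ (`|v| * D)); last by have := sqr_ge0 (`|v| - D); nra.
  by rewrite -mulrA ler_piMl// mulr_ge0.
have H4 : x ^+ 2 * A ^+ 2 <= N * (x ^+ 2 * H).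
  by rewrite [leRHS]mulrCA ler_wpM2l ?sqr_ge0.
have H5 : 2 * (lam / (8 * N)) * (x * A) ^+ 2 <= lam / 4 * (x ^+ 2 * H).
  rewrite exprMn; apply: (@le_trans _ _ (2 * (lam / (8 * N)) * (N * (x ^+ 2 * H)))).
    by rewrite ler_wpM2l// mulr_ge0// ltW.
  by rewrite le_eqVlt; apply/orP; left; apply/eqP; field; rewrite gt_eqF.
have H6 : (x * D) ^+ 2 <= D ^+ 2 by rewrite exprMn ler_piMl ?sqr_ge0.
have H7 := ler_wpM2l q0 H6.
have H8 := ler_wpM2l K0 H3.
have X0 : 0 <= x ^+ 2 * H by rewrite mulr_ge0 ?sqr_ge0.
have X1 := mulr_ge0 (ltW l0) X0.
have E1 : (K * `|v|) ^+ 2 = K ^+ 2 * v ^+ 2 by rewrite exprMn v2.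
rewrite E1 in H2.
have s1 := sqr_ge0 v; have s2 := sqr_ge0 g; have s3 := sqr_ge0 D.
have g1 : 0 <= 2 * N / lam * (K ^+ 2 + 1) by rewrite mulr_ge0// addr_ge0 ?sqr_ge0.
have q2 : 0 <= 2 * N / lam * K ^+ 2 by rewrite mulr_ge0 ?sqr_ge0.
have P1 := mulr_ge0 g1 s2; have P2 := mulr_ge0 C0 s2; have P3 := mulr_ge0 C0 s3.
have P4 := mulr_ge0 K0 s2; have P5 := mulr_ge0 q2 s3; have P6 := mulr_ge0 q0 s1.
have P7 := mulr_ge0 K0 s1; have P8 := mulr_ge0 K0 s3.
rewrite ![2 * N / lam * (K ^+ 2 + 1)]mulrDr mulr1 in P1 *.
set q := 2 * N / lam in H1 H2 H7 P1 P5 P6 q0 q2 *.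
set e := lam / (8 * N) in H1 H2 H5.
set Y := x ^+ 2 * H in HT H4 H5 X0 X1 *.
have E2 : x ^+ 2 * (D * A) = x * A * (x * D) by ring.
have E3 : K * x * `|v| * (A + D) = x * A * (K * `|v|) + K * (x * `|v| * D) by ring.
rewrite E2 E3 in HT; nra.
Qed.

Section energy_terms.
Variable R : realFieldType.
Implicit Types a b d e x y g v N : R.

Lemma le_subr_add a b d e : a <= b + d -> d <= e -> a - e <= b.
Proof. lra. Qed.

Lemma le_scale_add N a b d e : d <= N * e -> 1 <= N -> 0 <= b -> 0 <= a ->
  a + b + d <= N * (a + b + e).
Proof. nra. Qed.

Lemma lower_mul x y a : `|y| <= a -> 0 <= x -> x <= 1 -> - `|a| <= x * y.
Proof.
move=> ya x0 x1; rewrite lerNl (le_trans (ler_norm _))// normrN normrM (ger0_norm x0).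
by rewrite (le_trans _ (ler_norm a))// (le_trans _ ya)// ler_piMl.
Qed.

Lemma young_cutoff x g v : 0 <= x -> x <= 1 -> - (2^-1 * (g ^+ 2 + v ^+ 2)) <= x ^+ 2 * g * v.
Proof.
move=> x0 x1; have x2 : x ^+ 2 <= 1 by rewrite expr_le1.
by have := sqr_ge0 (g + v); have := sqr_ge0 g; have := sqr_ge0 v; have := sqr_ge0 x; nra.
Qed.

End energy_terms.

Section caccioppoli.
Context {R : realType} {n : nat}.
Local Notation pt := ('cV[R]_n * R)%type.
Local Notation idx := (option 'I_n).
Variables (B : 'M[R]_n) (blk : 'I_n -> nat) (r : nat).
Hypothesis B_blk : forall i j, B i j != 0 -> blk j = (blk i).+1.
Hypothesis blk_ord : forall i j : 'I_n, (blk i < blk j)%N -> (i < j)%N.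
Hypothesis blk_le : forall i, (blk i <= r)%N.
Local Notation X := (X B).
Local Notation fb := (fb blk).
Local Notation wsol := (wsol B blk).
Local Notation sq := (sq (@vol R n)).
Local Notation intg := (intg (@vol R n)).
Implicit Types (z w q y b e : pt) (o : idx) (U : set pt) (p a phi G : pt -> R).

Lemma XM o f g z : sm f -> sm g -> X o (fun z => f z * g z) z = f z * X o g z + g z * X o f z.
Proof.
by move=> sf sg; apply: deriveME; [exact: (differentiable_fam tt z sf)|exact: (differentiable_fam tt z sg)].
Qed.

(** Y has no divergence: a nonzero B i j links different blocks, so i differs from j and x_i may be
    moved under d_j. *)
Lemma Int_X0 o phi : tst setT phi -> \int[vol]_z X o phi z = 0.
Proof.
move=> tp; case: o => [i|]; first exact: Int_derive0.
under eq_Rintegral => z _ do rewrite (X_None B z tp.1).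
have tx (i : 'I_n) : tst setT (fun z => crd (Some i) z * phi z).
  by apply: tstMl => //; exact: (@fam_crd _ _ unit (Some i)).
have E z : Yop B phi z = \sum_i \sum_j B i j * 'D_(dir (Some j)) (fun z => crd (Some i) z * phi z) z - 'D_(dir None) phi z.
  rewrite /Yop; congr (_ - _); apply: eq_bigr => i _; apply: eq_bigr => j _.
  have [->|/B_blk Bij] := eqVneq (B i j) 0; first by rewrite !mul0r.
  rewrite (deriveME _ (differentiable_crd (Some i) z) (differentiable_fam tt z tp.1)).
  rewrite derive_crd crd_dir; case: eqP => [[e]|_]; last by rewrite mulr0 addr0.
  by move: Bij; rewrite e => /eqP; rewrite -[X in X == _]addn0 -addn1 eqn_add2l.
under eq_Rintegral => z _ do rewrite E.
have it i j : intg (fun z => B i j * 'D_(dir (Some j)) (fun z => crd (Some i) z * phi z) z).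
  by apply: intgZ; exact: tst_intg (tst_derive _ (tx i)).
rewrite IntB ?Int_derive0 ?subr0//; last first.
- exact: tst_intg (tst_derive _ tp).
- by apply: intg_sum => i _; apply: intg_sum.
rewrite Int_sum; last by move=> i _; apply: intg_sum.
rewrite big1// => i _; rewrite Int_sum// big1// => j _.
by rewrite IntZ ?Int_derive0 ?mulr0//; exact: tst_intg (tst_derive _ (tx i)).
Qed.

Lemma sm_sub_sq phi u c U : sq u -> tst U phi -> sq (fun z => phi z * (u z - c)).
Proof.
move=> su tp; have [M HM] := tst_bounded tp.
have := sqB (sqMb (tst_meas tp) HM su) (sqZ c (tst_sq tp)).
by congr (sq_of _ _); apply/funext => z; ring.
Qed.

(** The product rule for a weak derivative multiplied by a cutoff; the result holds against all test
    functions on the whole space. Subtracting the constant c is free because [X o] of a test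
    function has integral 0. *)
Lemma cut_derivative U u D c o chi : sq u -> sq D ->
  (forall phi, tst U phi -> \int[vol]_z (D z * phi z) = - \int[vol]_z (u z * X o phi z)) ->
  tst U chi -> forall phi, tst setT phi ->
  \int[vol]_z ((chi z * D z + X o chi z * (u z - c)) * phi z) =
  - \int[vol]_z (chi z * (u z - c) * X o phi z).
Proof.
move=> su sD HD tc phi tp.
have tcp : tst U (fun z => chi z * phi z) by apply: tstMr => //; exact: tp.1.
have tcp' := tst_X B o tcp.
have i1 : intg (fun z => D z * (chi z * phi z)) by exact: sq_mul sD (tst_sq tcp).
have i2 : intg (fun z => u z * X o (fun z => chi z * phi z) z) by exact: sq_mul su (tst_sq tcp').
have i3 : intg (fun z => X o chi z * (u z - c) * phi z).
  by apply: sq_mul; [exact: sm_sub_sq su (tst_X B o tc)|exact: tst_sq tp].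
have i4 : intg (fun z => chi z * (u z - c) * X o phi z).
  by apply: sq_mul; [exact: sm_sub_sq su tc|exact: tst_sq (tst_X B o tp)].
have i5 : intg (fun z => c * X o (fun z => chi z * phi z) z).
  by apply: intgZ; exact: tst_intg tcp'.
transitivity (\int[vol]_z (D z * (chi z * phi z)) + \int[vol]_z (X o chi z * (u z - c) * phi z)).
  by rewrite -IntD//; apply: eq_Rintegral => z _; ring.
rewrite HD//; apply/eqP; rewrite -subr_eq0 opprK; apply/eqP.
rewrite -(IntN i2) -IntD//; last exact: intgN.
rewrite -IntD//; last by apply: intgD => //; exact: intgN.
transitivity (- \int[vol]_z (c * X o (fun z => chi z * phi z) z)).
  rewrite -(IntN i5); apply: eq_Rintegral => z _; rewrite (XM o z tc.1 tp.1); ring.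
by rewrite IntZ ?Int_X0 ?mulr0 ?oppr0//; [exact: tstS tcp|exact: tst_intg tcp'].
Qed.

(** With k = 1 the plateau attains 1 at distance 1 from its ends, so this cutoff is 1 on the unit
    cube and vanishes off [cbox 2]. *)
Definition cutf : pt -> R := boxfun 1 (fun=> -2) (fun=> 2).

Lemma tst_cutf U : cbox 2 `<=` U -> tst U cutf.
Proof.
move=> H; apply: tst_boxfun => z zc; apply: H => o; rewrite ler_norml; exact: zc.
Qed.

Lemma cutf_itv z : 0 <= cutf z <= 1. Proof. exact: boxfun_itv. Qed.

Lemma cutf_eq0 z : ~ cbox 2 z -> cutf z = 0.
Proof.
move=> zc; apply: boxfun_eq0 => H; apply: zc => o.
by have /andP[? ?] := H o; rewrite ler_norml !ltW.
Qed.

Lemma cutf_eq1 z : cbox 1 z -> cutf z = 1.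
Proof.
move=> zc; rewrite /cutf /boxfun big1// => o _; rewrite /plateau.
have := zc o; rewrite ler_norml => /andP[? ?].
by rewrite !step_ge ?mulr1//; lra.
Qed.

Lemma X_cutf_eq0 o z : ~ cbox 2 z -> X o cutf z = 0.
Proof.
move=> zc; apply: (@derive_eq0_open _ _ _ (~` cbox 2)) => //.
  by rewrite openC; exact: closed_cbox.
by move=> w; exact: cutf_eq0.
Qed.

(** The weak form of testing the equation with cutf^2 (u - c). With v = cutf (u - c), [weak_green]
    is used twice: once for the field Y, once for the flux in the first block. *)
Lemma energy_identity lam M U u h F k f g c : cbox 2 `<=` U -> wsol lam M U u h F k f g ->
  let E z := cutf z ^+ 2 * (\sum_(i | fb i) F i z * h i z)
    + cutf z * X None cutf z * (u z - c) ^+ 2 + cutf z ^+ 2 * g z * (u z - c)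
    + 2 * cutf z * (u z - c) * \sum_(i | fb i) F i z * X (Some i) cutf z in
  intg E /\ \int[vol]_z E z = 0.
Proof.
move=> UC [su sh sF sk sf sg dx dY deq ell bd] E.
have tc := tst_cutf UC; have [C HC] := tst_bounded tc.
have tcT : tst setT cutf by exact: tstS tc.
have mb (phi p : pt -> R) : tst U phi -> sq p -> sq (fun z => phi z * p z).
  by move=> tp sp; have [C' HC'] := tst_bounded tp; exact: sqMb (tst_meas tp) HC' sp.
pose v z := cutf z * (u z - c).
pose w o z := cutf z * (if o is Some i then h i z else k z) + X o cutf z * (u z - c).
pose P o := if o is Some i then fb i else false.
have sv : sq v by exact: sm_sub_sq su tc.
have zv : supp 2 v by move=> z /cutf_eq0 cz; rewrite /v cz mul0r.
have sw o : (o == None) || P o -> sq (w o).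
  move=> H; apply: sqD; last exact: sm_sub_sq su (tst_X B o tc).
  by apply: mb => //; case: o H => [i|] //= fi; exact: sh.
have zw o : supp 2 (w o).
  by move=> z nz; rewrite /w (cutf_eq0 nz) (X_cutf_eq0 o nz) !mul0r addr0.
have wd o : (o == None) || P o -> forall phi, tst setT phi ->
    \int[vol]_z (w o z * phi z) = - \int[vol]_z (v z * X o phi z).
  move=> H phi tp; apply: (cut_derivative (U := U)) => //.
    by case: o H => [i|] //= fi; exact: sh.
  move=> psi ts; case: o H => [i fi|_]; first exact: dx.
  rewrite dY//; congr (- _); apply: eq_Rintegral => z _.
  by rewrite (X_None B z ts.1).
(* The rigorous version of v Y v being half of Y (v^2): Green's formula shows that the integral
   equals its own opposite. *)
have I2 : \int[vol]_z (w None z * v z) = 0.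
  have swN : sq (w None) by exact: sw.
  have : \int[vol]_z (w None z * v z) = \sum_(o | pred1 None o) \int[vol]_z (- v z * w o z).
    apply: (@weak_green _ _ B blk r B_blk blk_ord blk_le 2 (pred1 None) (w None) v (fun _ z => - v z) w swN sv).
    - by move=> o _; exact: sqN.
    - by move=> o /eqP ->.
    - exact: zw.
    - exact: zv.
    - by move=> o _ z /zv ->; rewrite oppr0.
    - by move=> o _; exact: zw.
    - move=> phi tp; rewrite big_pred1_eq wd// -IntN; last exact: sq_mul sv (tst_sq (tst_X B None tp)).
      by apply: eq_Rintegral => z _; rewrite mulNr.
    - by move=> phi o tp /eqP ->; exact: wd.
  rewrite big_pred1_eq.
  under [X in _ = X -> _]eq_Rintegral => z _ do rewrite mulNr mulrC.
  rewrite IntN; last exact: sq_mul (sw None isT) sv.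
  lra.
(* By the equation this is minus the weak divergence of [cutf] times the flux F. *)
pose p0 z := cutf z * (k z - g z) - \sum_(i | fb i) X (Some i) cutf z * F i z.
have sp0 : sq p0.
  apply: sqB; first by apply: mb => //; exact: sqB.
  by apply: sq_sum => i fi; apply: mb; [exact: tst_X|exact: sF].
have bigP (G : idx -> R) : \sum_(o | P o) G o = \sum_(i | fb i) G (Some i).
  by rewrite big_mkcond big_option add0r -big_mkcond.
have I1 : \int[vol]_z (p0 z * v z) = \sum_(i | fb i) \int[vol]_z (cutf z * F i z * w (Some i) z).
  rewrite -(bigP (fun o => \int[vol]_z (cutf z * (if o is Some i then F i z else 0) * w o z))).
  apply: (@weak_green _ _ B blk r B_blk blk_ord blk_le 2 P p0 v
    (fun o z => cutf z * (if o is Some i then F i z else 0)) w sp0 sv).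
  - by case=> [i|] //= fi; apply: mb => //; exact: sF.
  - by move=> o Po; apply: sw; rewrite Po orbT.
  - move=> z nz; rewrite /p0 (cutf_eq0 nz) mul0r big1 ?subr0// => i _.
    by rewrite (X_cutf_eq0 (Some i) nz) mul0r.
  - exact: zv.
  - by move=> o _ z /cutf_eq0 ->; rewrite mul0r.
  - by move=> o _; exact: zw.
  - move=> phi tp; rewrite bigP.
    have tcp : tst U (fun z => cutf z * phi z) by apply: tstMr => //; exact: tp.1.
    have sFt i p : fb i -> tst U p -> intg (fun z => F i z * p z).
      by move=> fi tp'; apply: sq_mul (sF i fi) (tst_sq tp').
    have tXc i : tst U (fun z => X (Some i) cutf z * phi z).
      by apply: tstMr; [exact: tst_X|exact: tp.1].
    have tcX i : tst U (fun z => cutf z * X (Some i) phi z).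
      by apply: tstMr => //; apply: sm_X; exact: tp.1.
    have i1 : intg (fun z => \sum_(i | fb i) F i z * (X (Some i) cutf z * phi z)).
      by apply: intg_sum => i fi; exact: sFt.
    have ik : intg (fun z => k z * (cutf z * phi z)) by exact: sq_mul sk (tst_sq tcp).
    have ig : intg (fun z => g z * (cutf z * phi z)) by exact: sq_mul sg (tst_sq tcp).
    transitivity (\int[vol]_z (k z * (cutf z * phi z)) - \int[vol]_z (g z * (cutf z * phi z))
      - \int[vol]_z (\sum_(i | fb i) F i z * (X (Some i) cutf z * phi z))).
      rewrite -!IntB//; last exact: intgB.
      apply: eq_Rintegral => z _; rewrite /p0 mulrBl mulr_suml; congr (_ - _); first by ring.
      by apply: eq_bigr => i _; ring.
    rewrite (deq _ tcp) Int_sum; last by move=> i fi; exact: sFt.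
    rewrite [X in X - _ = _]addrAC subrr add0r -sumrB; apply: eq_bigr => i fi.
    rewrite -IntB; [|exact: sFt (tst_derive _ tcp)|exact: sFt].
    apply: eq_Rintegral => z _; rewrite -(X_Some B) (XM (Some i) z tc.1 tp.1); ring.
  - by move=> phi o tp Po; apply: wd => //; rewrite Po orbT.
have iw : intg (fun z => w None z * v z) by exact: sq_mul (sw None isT) sv.
have ip : intg (fun z => p0 z * v z) by exact: sq_mul sp0 sv.
have iF i : fb i -> intg (fun z => cutf z * F i z * w (Some i) z).
  by move=> fi; apply: sq_mul; [apply: mb => //; exact: sF|apply: sw; rewrite /P fi].
have iS : intg (fun z => \sum_(i | fb i) cutf z * F i z * w (Some i) z) by exact: intg_sum.
have EE z : E z = \sum_(i | fb i) cutf z * F i z * w (Some i) z - p0 z * v z + w None z * v z.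
  have -> : \sum_(i | fb i) cutf z * F i z * w (Some i) z =
     cutf z ^+ 2 * (\sum_(i | fb i) F i z * h i z) +
     cutf z * (u z - c) * \sum_(i | fb i) F i z * X (Some i) cutf z.
    by rewrite !mulr_sumr -big_split; apply: eq_bigr => i _; rewrite /w /=; ring.
  have -> : p0 z = cutf z * (k z - g z) - \sum_(i | fb i) F i z * X (Some i) cutf z.
    by congr (_ - _); apply: eq_bigr => i _; rewrite mulrC.
  by rewrite /E /v /w; ring.
split.
  have := intgD (intgB iS ip) iw; congr (integrable _ _ _).
  by apply/funext => z; rewrite /= EE.
under eq_Rintegral => z _ do rewrite EE.
rewrite IntD//; last exact: intgB.
by rewrite IntB// I1 I2 Int_sum// subrr addr0.
Qed.

(** [energy_alg] at each point: ellipticity provides the gradient term, the bounds on F and on the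
    derivatives of the cutoff control the others. The constant c is free, to be chosen by the
    Poincare inequality. *)
Lemma caccioppoli (lam M : R) : 0 < lam -> 0 <= M -> exists2 C : R, 0 <= C &
  forall U u h F k f g c, cbox 2 `<=` U -> wsol lam M U u h F k f g ->
  \int[vol]_z (\1_(cbox 1) z * \sum_(i | fb i) h i z ^+ 2) <=
  C * \int[vol]_z (\1_(cbox 2) z *
    ((u z - c) ^+ 2 + g z ^+ 2 + \sum_(i | fb i) f i z ^+ 2)).
Proof.
move=> l0 M0.
have [C0 HC0] := tst_bounded (tst_X B None (@tst_cutf setT (@subsetT _ _))).
have /choice[C_ HC_] (i : 'I_n) : exists C, forall z, `|X (Some i) cutf z| <= C.
  exact: tst_bounded (tst_X B (Some i) (@tst_cutf setT (@subsetT _ _))).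
pose C1 := \sum_i `|C_ i|; pose N : R := n.+1%:R.
have N0 : 0 < N by rewrite ltr0n.
have C10 : 0 <= C1 by apply: sumr_ge0.
have XC i z : `|X (Some i) cutf z| <= C1.
  rewrite (le_trans (HC_ i z))// (le_trans (ler_norm _))// /C1 (bigD1 i)//= lerDl sumr_ge0//.
pose K := 2 * N * M * C1.
have K0 : 0 <= K by rewrite /K !mulr_ge0// ltW.
pose C := (`|C0| + 1 + 2 * N / lam * (K ^+ 2 + 1) + 2 * K).
have CC0 : 0 <= C.
  have := mulr_ge0 (divr_ge0 (mulr_ge0 (ler0n R 2) (ltW N0)) (ltW l0)) (addr_ge0 (sqr_ge0 K) ler01).
  by rewrite /C; have := normr_ge0 C0; lra.
exists (2 / lam * (C * N)); first by rewrite (mulr_ge0 (divr_ge0 (ler0n _ 2) (ltW l0)) (mulr_ge0 CC0 (ltW N0))).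
move=> U u h F k f g c UC ws; have [iE E0] := energy_identity c UC ws.
have [su sh sF sk sf sg dx dY deq ell bd] := ws.
set E := (fun z => _) in iE E0.
have sc : sq (\1_(@cbox R n 2)) by apply: sq_indic; [exact: measurable_cbox|exact: vol_cbox_lty].
have mi t : measurable_fun setT (\1_(@cbox R n t) : pt -> R) by apply: measurable_indic; exact: measurable_cbox.
have i1 t z : `|(\1_(@cbox R n t) z : R)| <= 1 by rewrite indicE; case: (_ \in _); rewrite ?normr1 ?normr0.
have iR : intg (fun z => \1_(cbox 2) z * ((u z - c) ^+ 2 + g z ^+ 2 + \sum_(i | fb i) f i z ^+ 2)).
  have i2 : intg (fun z => \1_(cbox 2) z * (u z - c) ^+ 2).
    have := sq_intg2 (sqB (sqMb (mi 2) (i1 2) su) (sqZ c sc)); congr (integrable _ _ _).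
    apply/funext => z /=; rewrite indicE; congr (_%:E); case: (_ \in _); rewrite ?mul1r ?mulr1//.
    by rewrite !mul0r mulr0 subr0 expr0n.
  have i3 := intgMb (mi 2) (i1 2) (sq_intg2 sg).
  have i4 : intg (fun z => \1_(cbox 2) z * \sum_(i | fb i) f i z ^+ 2).
    by apply: (intgMb (mi 2) (i1 2)); apply: intg_sum => i fi; exact: sq_intg2 (sf i fi).
  have := intgD (intgD i2 i3) i4; congr (integrable _ _ _).
  by apply/funext => z; rewrite /= !mulrDr.
have iH : intg (fun z => \1_(cbox 1) z * \sum_(i | fb i) h i z ^+ 2).
  by apply: (intgMb (mi 1) (i1 1)); apply: intg_sum => i fi; exact: sq_intg2 (sh i fi).
have d0 : 0 < 2 / lam by rewrite divr_gt0.
rewrite -(mulrA (2 / lam)) -(ler_pdivrMl _ _ d0) -(IntZ _ iH) -(IntZ (C * N) iR).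
have iR' := intgZ (C * N) iR.
(* Adding the integral of [E], which is 0, makes a pointwise comparison of integrands possible. *)
rewrite -[leRHS]add0r -[X in X + _]E0 -(IntD iE iR').
apply: Int_le.
- exact: intgZ.
- exact: intgD.
move=> z; have [z2|z2] := pselect (cbox 2 z); last first.
  rewrite /E (cutf_eq0 z2) !indicE !memNset//; last by move=> z1; apply: z2 => o; rewrite (le_trans (z1 o))// ler1n.
  by rewrite !(mul0r, mulr0, expr0n, addr0)/= ?(mul0r, mulr0, addr0).
set A := \sum_(i | fb i) `|h i z|; set D := \sum_(i | fb i) `|f i z|.
set H := \sum_(i | fb i) h i z ^+ 2; set D2 := \sum_(i | fb i) f i z ^+ 2.
have A0 : 0 <= A by exact: sumr_ge0.
have D0 : 0 <= D by exact: sumr_ge0.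
have H0 : 0 <= H by apply: sumr_ge0 => i _; exact: sqr_ge0.
have D20 : 0 <= D2 by apply: sumr_ge0 => i _; exact: sqr_ge0.
have sqabs (q : 'I_n -> pt -> R) : \sum_(i | fb i) `|q i z| ^+ 2 = \sum_(i | fb i) q i z ^+ 2.
  by apply: eq_bigr => i _; rewrite real_normK ?num_real.
have AH : A ^+ 2 <= N * H by rewrite /H -sqabs; exact: sqr_sum_le.
have DD : D ^+ 2 <= N * D2 by rewrite /D2 -sqabs; exact: sqr_sum_le.
have FH : lam * H - D * A <= \sum_(i | fb i) F i z * h i z.
  have := ell z; under [X in _ <= X]eq_bigr do rewrite mulrDl.
  rewrite big_split => ellz.
  apply: le_subr_add ellz _.
  rewrite /D mulr_suml; apply: ler_sum => i fi.
  rewrite (le_trans (ler_norm _))// normrM ler_wpM2l// /A (bigD1 i)//= lerDl.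
  exact: sumr_ge0.
have FX : `|\sum_(i | fb i) F i z * X (Some i) cutf z| <= N * M * C1 * (A + D).
  apply: le_trans (ler_norm_sum _ _ _) _.
  apply: (@le_trans _ _ (\sum_(i | fb i) M * C1 * (A + D))).
    by apply: ler_sum => i fi; rewrite normrM mulrAC ler_pM// bd.
  rewrite sumr_const -mulr_natl -!mulrA ler_wpM2r ?mulr_ge0 ?addr_ge0//.
  by rewrite ler_nat (leq_trans (max_card _))// card_ord.
have XN := HC0 z; have x01 := cutf_itv z; have /andP[x0 x1] := x01.
have := @energy_alg _ N lam K `|C0| (cutf z) A D H (g z) (u z - c) (E z) N0 l0 K0 (normr_ge0 _) x01 A0 D0 AH H0.
rewrite -/C.
have N1 : 1 <= N by rewrite ler1n.
have R1 : C * ((u z - c) ^+ 2 + g z ^+ 2 + D ^+ 2) <= C * N * ((u z - c) ^+ 2 + g z ^+ 2 + D2).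
  rewrite -mulrA ler_wpM2l//; move: (sqr_ge0 (g z)) (sqr_ge0 (u z - c)).
  by move=> v2 g2; exact: le_scale_add.
have L1 : (2 / lam)^-1 * ((\1_(cbox 1) z : R) * H) <= lam / 2 * (cutf z ^+ 2 * H).
  rewrite invf_div ler_wpM2l ?divr_ge0 ?(ltW l0)//.
  rewrite ler_wpM2r// indicE; have [z1|z1] := pselect (cbox 1 z).
    by rewrite mem_set// (cutf_eq1 z1) expr1n.
  by rewrite memNset// sqr_ge0.
have -> : (\1_(cbox 2) z : R) = 1 by rewrite indicE mem_set.
rewrite mul1r => ALG; apply: (le_trans L1); apply: le_trans (ALG _) _; last by rewrite lerD2l.
have T1 : cutf z ^+ 2 * (lam * H - D * A) <= cutf z ^+ 2 * \sum_(i | fb i) F i z * h i z.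
  by rewrite ler_wpM2l ?sqr_ge0.
have T2 : - `|C0| * (u z - c) ^+ 2 <= cutf z * X None cutf z * (u z - c) ^+ 2.
  by rewrite ler_wpM2r ?sqr_ge0//; exact: lower_mul.
have T3 : - (2^-1 * (g z ^+ 2 + (u z - c) ^+ 2)) <= cutf z ^+ 2 * g z * (u z - c).
  by apply: young_cutoff.
have T4 : - (K * cutf z * `|u z - c| * (A + D)) <=
    2 * cutf z * (u z - c) * \sum_(i | fb i) F i z * X (Some i) cutf z.
  rewrite lerNl (le_trans (ler_norm _))// normrN !normrM [`|2|]ger0_norm// (ger0_norm x0).
  have -> : K * cutf z * `|u z - c| * (A + D) = 2 * cutf z * `|u z - c| * (N * M * C1 * (A + D)).
    by rewrite /K; ring.
  by rewrite ler_wpM2l ?mulr_ge0.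
by rewrite /E; apply: le_trans (lerD (lerD (lerD T1 T2) T3) T4); rewrite -subr_ge0 le_eqVlt; apply/orP; left; apply/eqP; field.
Qed.

End caccioppoli.

(** * Divergences along the fields *)

Section representation.
Context {R : realType} {n : nat}.
Local Notation pt := ('cV[R]_n * R)%type.
Local Notation idx := (option 'I_n).
Variables (B : 'M[R]_n) (blk : 'I_n -> nat) (r : nat).
Hypothesis B_blk : forall i j, B i j != 0 -> blk j = (blk i).+1.
Hypothesis blk_ord : forall i j : 'I_n, (blk i < blk j)%N -> (i < j)%N.
Hypothesis blk_le : forall i, (blk i <= r)%N.
Hypothesis B_rank : forall j, (0 < blk j)%N -> exists c : 'I_n -> R,
  (forall i, c i != 0 -> (blk i).+1 = blk j) /\
  forall l, \sum_i c i * B i l = (l == j)%:R.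
Local Notation X := (X B).
Local Notation Yop := (Yop B).
Local Notation fb := (fb blk).
Local Notation wsol := (wsol B blk).
Implicit Types (z w y : pt) (o : idx).

Lemma fam_sm (P : Type) (f : P -> pt -> R) p : fam f -> sm (f p).
Proof. exact: (@fam_reparam _ _ _ _ (fun _ : unit => p)). Qed.

Lemma fam_Yop (P : Type) (f : P -> pt -> R) : fam f -> fam (fun p => Yop (f p)).
Proof.
move=> sf.
have -> : (fun p => Yop (f p)) = (fun p z => \sum_i \sum_j B i j * (crd (Some i) z * 'D_(dir (Some j)) (f p) z)
    + -1 * 'D_(dir None) (f p) z).
  by apply/funext => p; apply/funext => z; rewrite mulN1r.
apply: fam_add; last by apply: fam_mul; [exact: fam_cst|exact: fam_derive].
apply: fam_sum => i _; apply: fam_sum => j _; apply: fam_mul; first exact: fam_cst.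
by apply: fam_mul; [exact: fam_crd|exact: fam_derive].
Qed.

Lemma XD o (f g : pt -> R) z : sm f -> sm g -> X o (fun z => f z + g z) z = X o f z + X o g z.
Proof.
by move=> sf sg; apply: deriveDE; [exact: (differentiable_fam tt z sf)|exact: (differentiable_fam tt z sg)].
Qed.

Lemma XZ o (c : R) (f : pt -> R) z : sm f -> X o (fun z => c * f z) z = c * X o f z.
Proof.
move=> sf; rewrite (XM B o z (@fam_cst _ _ unit c) sf).
by rewrite /X_of derive_cst mulr0 addr0.
Qed.

Lemma X_crdM i k (f : pt -> R) z : sm f ->
  X (Some i) (fun z => crd (Some k) z * f z) z = crd (Some k) z * X (Some i) f z + (k == i)%:R * f z.
Proof.
move=> sf; rewrite /X_of (deriveME _ (differentiable_crd (Some k) z) (differentiable_fam tt z sf)).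
by rewrite derive_crd crd_dir (inj_eq Some_inj) mulrC; congr (_ + _); rewrite mulrC.
Qed.

Lemma sm_comb (I : Type) (s : seq I) (c : I -> R) (f : I -> pt -> R) : (forall i, sm (f i)) ->
  sm (fun z => \sum_(i <- s) c i * f i z).
Proof. by move=> sf; apply: fam_sum => i _; apply: fam_mul; [exact: fam_cst|exact: sf]. Qed.

Lemma X_comb o (I : Type) (s : seq I) (c : I -> R) (f : I -> pt -> R) z : (forall i, sm (f i)) ->
  X o (fun z => \sum_(i <- s) c i * f i z) z = \sum_(i <- s) c i * X o (f i) z.
Proof.
move=> sf; elim: s => [|i s IH].
  under eq_fun do rewrite big_nil; by rewrite big_nil /X_of derive_cst.
under eq_fun do rewrite big_cons; rewrite big_cons XD ?XZ ?IH//.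
  by apply: fam_mul; [exact: fam_cst|exact: sf].
exact: sm_comb.
Qed.

Lemma commutator (f : pt -> R) i z : sm f ->
  'D_(dir (Some i)) (Yop f) z = Yop ('D_(dir (Some i)) f) z + \sum_l B i l * 'D_(dir (Some l)) f z.
Proof.
move=> sf; have sD o : sm ('D_(dir o) f) by exact: fam_derive.
pose G (kl : 'I_n * 'I_n) (z : pt) := crd (Some kl.1) z * 'D_(dir (Some kl.2)) f z.
have sG kl : sm (G kl) by apply: fam_mul; [exact: fam_crd|exact: sD].
have YE : Yop f = (fun z => \sum_(kl : 'I_n * 'I_n) B kl.1 kl.2 * G kl z + -1 * 'D_(dir None) f z).
  by apply/funext => w; rewrite /Yop_of pair_big mulN1r.
rewrite YE -(X_Some B) XD; last 2 first.
- by apply: sm_comb.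
- by apply: fam_mul; [exact: fam_cst|exact: sD].
rewrite X_comb// XZ// /Yop_of mulN1r.
rewrite [X in _ - X](fam_deriveC _ _ tt z sf) addrAC; congr (_ - _).
have E (kl : 'I_n * 'I_n) : B kl.1 kl.2 * X (Some i) (G kl) z =
    B kl.1 kl.2 * (crd (Some kl.1) z * 'D_(dir (Some kl.2)) ('D_(dir (Some i)) f) z) +
    (kl.1 == i)%:R * (B kl.1 kl.2 * 'D_(dir (Some kl.2)) f z).
  rewrite (X_crdM i kl.1 z (sD (Some kl.2))) X_Some.
  have DC : 'D_(dir (Some i)) ('D_(dir (Some kl.2)) f) z = 'D_(dir (Some kl.2)) ('D_(dir (Some i)) f) z.
    exact: (@fam_deriveC R n unit (fun=> f) (dir (Some i)) (dir (Some kl.2)) tt z sf).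
  apply: etrans (congr1 (fun t => B kl.1 kl.2 *
    (crd (Some kl.1) z * t + (kl.1 == i)%:R * 'D_(dir (Some kl.2)) f z)) DC) _.
  by rewrite mulrDr (mulrCA (B kl.1 kl.2) (kl.1 == i)%:R).
under eq_bigr => kl _ do rewrite E.
rewrite big_split/=; congr (_ + _); first by rewrite pair_big.
rewrite -(pair_big xpredT xpredT (fun k l => (k == i)%:R * (B k l * 'D_(dir (Some l)) f z)))/=.
rewrite (bigD1 i)//= [X in _ + X]big1 ?addr0; last first.
  by move=> k /negbTE ->; rewrite big1// => l _; rewrite mul0r.
by apply: eq_bigr => l _; rewrite eqxx mul1r.
Qed.

Section with_parameter.
Variables (P : Type) (rad : R).
Implicit Types (phi eta : P -> pt -> R).

Definition psupp eta := forall p z, ~ cbox rad z -> eta p z = 0.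

(** The functions whose integral against a solution is controlled by its first derivatives and the
    data ([rep_bound]). The parameter p makes the control uniform in the position of the bump. *)
Definition rep phi := exists psi0 (psi : 'I_n -> P -> pt -> R),
  [/\ fam psi0, forall i, fam (psi i), psupp psi0, forall i, psupp (psi i) &
   forall p z, phi p z = \sum_(i | fb i) 'D_(dir (Some i)) (psi i p) z + Yop (psi0 p) z].

Lemma psupp_derive eta e : psupp eta -> psupp (fun p => 'D_e (eta p)).
Proof.
move=> e0 p z nz; apply: (@derive_eq0_open _ _ _ (~` cbox rad)) => //.
  by rewrite openC; exact: closed_cbox.
by move=> w; exact: e0.
Qed.

Lemma psupp_Yop eta : psupp eta -> psupp (fun p => Yop (eta p)).
Proof.
move=> e0 p z nz; rewrite /Yop_of (psupp_derive _ e0)// subr0 big1// => i _.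
by rewrite big1// => j _; rewrite (psupp_derive _ e0)// !mulr0.
Qed.

Lemma rep_comb (I : Type) (s : seq I) (c : I -> R) (phi : I -> P -> pt -> R) :
  (forall i, rep (phi i)) -> rep (fun p z => \sum_(i <- s) c i * phi i p z).
Proof.
move=> /choice[psi0 /choice[psi H]].
exists (fun p z => \sum_(i <- s) c i * psi0 i p z), (fun k p z => \sum_(i <- s) c i * psi i k p z).
have fz (f : I -> P -> pt -> R) : (forall i, fam (f i)) -> fam (fun p z => \sum_(i <- s) c i * f i p z).
  by move=> ff; apply: fam_sum => i _; apply: fam_mul; [exact: fam_cst|exact: ff].
split.
- by apply: fz => i; case: (H i).
- by move=> k; apply: fz => i; case: (H i).
- by move=> p z nz; rewrite big1// => i _; case: (H i) => _ _ s0 _ _; rewrite s0 ?mulr0.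
- by move=> k p z nz; rewrite big1// => i _; case: (H i) => _ _ _ s0 _; rewrite s0 ?mulr0.
move=> p z.
have sm0 i : sm (psi0 i p) by case: (H i) => f0 *; exact: fam_sm f0.
have sm1 k i : sm (psi i k p) by case: (H i) => _ f1 *; exact: fam_sm (f1 k).
rewrite -X_None; last exact: sm_comb.
rewrite X_comb//.
under [X in _ = X + _]eq_bigr => k _ do rewrite -(X_Some B) X_comb//.
rewrite exchange_big -big_split; apply: eq_bigr => i _ /=.
by case: (H i) => _ _ _ _ ->; rewrite mulrDr mulr_sumr X_None.
Qed.

Lemma rep_ext phi phi' : (forall p z, phi p z = phi' p z) -> rep phi' -> rep phi.
Proof. by move=> E; congr rep; apply/funext => p; apply/funext => z. Qed.

Lemma repD phi phi' : rep phi -> rep phi' -> rep (fun p z => phi p z + phi' p z).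
Proof.
move=> r1 r2; apply: rep_ext (rep_comb [:: true; false] (fun _ => 1) (phi := fun b => if b then phi else phi') _).
  by move=> p z; rewrite !big_cons big_nil !mul1r addr0.
by case.
Qed.

Lemma rep0 : rep (fun _ _ => 0).
Proof.
apply: rep_ext (rep_comb (I := void) [::] (fun=> 0) (phi := fun v => match v with end) _) => //.
by move=> p z; rewrite big_nil.
Qed.

Lemma rep_Yop eta : fam eta -> psupp eta -> rep (fun p => Yop (eta p)).
Proof.
move=> fe e0; exists eta, (fun _ _ _ => 0); split=> //; first by move=> i; exact: fam_cst.
by move=> p z; rewrite big1 ?add0r// => i _; rewrite derive_cst.
Qed.

(** Induction on the block of j. The rank condition writes d_j as a combination of commutators
    [d_i, Y] with i in the previous block. The part d_i (Y eta) falls under the induction hypothesis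
    applied to Y eta, the part Y (d_i eta) has the desired form already. *)
Lemma rep_derive_Some j eta : fam eta -> psupp eta -> rep (fun p => 'D_(dir (Some j)) (eta p)).
Proof.
have [N] := ubnP (blk j); elim: N j eta => // N IH j eta jN fe e0.
have [j0|j0] := posnP (blk j).
  exists (fun _ _ => 0), (fun i p z => (i == j)%:R * eta p z); split=> //.
  - exact: fam_cst.
  - by move=> i; apply: fam_mul; first exact: fam_cst.
  - by move=> i p z nz; rewrite e0 ?mulr0.
  move=> p z; have -> : Yop (fun _ => 0) z = 0.
    rewrite /Yop_of derive_cst subr0 big1// => k _; rewrite big1// => l _.
    by rewrite derive_cst !mulr0.
  have se : sm (eta p) by exact: fam_sm.
  rewrite addr0 (bigD1 j); last by rewrite /fb_of j0.
  rewrite big1; first by rewrite -!(X_Some B) XZ// eqxx mul1r; exact/esym/addr0.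
  move=> i /andP[_ /negbTE ij]; rewrite -(X_Some B) XZ; last exact: fam_sm.
  by rewrite ij mul0r.
have [c [c1 c2]] := B_rank j0.
(* The factor [(c i != 0)%:R] discards the indices outside the previous block, for which the
   induction hypothesis says nothing. *)
apply: (rep_ext (phi' := fun p z => \sum_i c i * ((c i != 0)%:R * 'D_(dir (Some i)) (Yop (eta p)) z)
     + \sum_i (- c i) * Yop ('D_(dir (Some i)) (eta p)) z)).
  move=> p z; have se : sm (eta p) by exact: fam_sm.
  have -> : 'D_(dir (Some j)) (eta p) z = \sum_l (\sum_i c i * B i l) * 'D_(dir (Some l)) (eta p) z.
    rewrite (bigD1 j)//= c2 eqxx mul1r big1 ?addr0// => l /negbTE lj.
    by rewrite c2 lj mul0r.
  rewrite -big_split/=.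
  transitivity (\sum_i c i * \sum_l B i l * 'D_(dir (Some l)) (eta p) z).
    under eq_bigr do rewrite mulr_suml; rewrite exchange_big; apply: eq_bigr => i _.
    by rewrite mulr_sumr; apply: eq_bigr => l _; rewrite mulrA.
  apply: eq_bigr => i _; have [->|ci] := eqVneq (c i) 0; first by rewrite oppr0 !mul0r addr0.
  by rewrite (commutator _ _ se) mul1r; ring.
apply: repD; apply: rep_comb => i; last first.
  by apply: rep_Yop; [exact: fam_derive|exact: psupp_derive].
have [ci|ci] := eqVneq (c i) 0.
  apply: (rep_ext (phi' := fun _ _ => 0)) rep0 => p z.
  by rewrite mul0r.
apply: rep_ext (IH i (fun p => Yop (eta p)) _ _ _).
- by move=> p z; rewrite mul1r.
- by have := c1 _ ci; rewrite -ltnS => ->.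
- exact: fam_Yop.
- exact: psupp_Yop.
Qed.

(** The time derivative is the drift minus Y, and in the drift x_k commutes with d_l, so that it is
    a sum of space derivatives of x_k eta. *)
Lemma rep_derive_None eta : fam eta -> psupp eta -> rep (fun p => 'D_(dir None) (eta p)).
Proof.
move=> fe e0.
pose xe (kl : 'I_n * 'I_n) p z := crd (Some kl.1) z * eta p z.
have fxe kl : fam (xe kl) by apply: fam_mul; [exact: fam_crd|exact: fe].
apply: (rep_ext (phi' := fun p z => (\sum_(kl : 'I_n * 'I_n) B kl.1 kl.2 * 'D_(dir (Some kl.2)) (xe kl p) z)
     + (\sum_(b <- [:: tt]) (-1) * Yop (eta p) z))).
  move=> p z; have se : sm (eta p) by exact: fam_sm.
  rewrite big_cons big_nil addr0 mulN1r /Yop_of pair_big opprB addrCA.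
  rewrite -[LHS]addr0; congr (_ + _); apply/esym/eqP; rewrite subr_eq0; apply/eqP.
  apply: eq_bigr => -[k l] _ /=.
  have [->|/B_blk Bij] := eqVneq (B k l) 0; first by rewrite !mul0r.
  rewrite -(X_Some B) (X_crdM l k z se); case: eqP => [e|_]; last by rewrite mul0r addr0.
  by move: Bij; rewrite e => /eqP; rewrite -[X in X == _]addn0 -addn1 eqn_add2l.
apply: repD; apply: rep_comb; last by move=> _; exact: rep_Yop.
by move=> [k l]; apply: rep_derive_Some => // p z nz; rewrite /xe e0 ?mulr0.
Qed.

End with_parameter.

(** The functions [psi i] are tested in the definition of h. [psi0] is tested first in that of k,
    then in the equation, which trades k for g and for the flux against derivatives of [psi0]; the
    flux is bounded by [wsol_bd]. *)
Lemma rep_bound (P : Type) (rad lam M : R) (phi : P -> pt -> R) : 0 <= M -> rep rad phi ->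
  exists2 C : R, 0 <= C & forall p U u h F k f g, cbox rad `<=` U ->
    wsol lam M U u h F k f g ->
  `|\int[vol]_z (u z * phi p z)| <= C * \int[vol]_z (\1_(cbox rad) z *
     (\sum_(i | fb i) `|h i z| + \sum_(i | fb i) `|f i z| + `|g z|)).
Proof.
move=> M0 [psi0 [psi [f0 f1 s0 s1 phiE]]].
have bdd (eta : P -> pt -> R) : fam eta -> psupp rad eta ->
    exists C : R, forall p z, `|eta p z| <= C * \1_(cbox rad) z.
  move=> fe e0; have [C HC] := fam_bounded fe rad; exists `|C| => p z; rewrite indicE.
  have [zr|zr] := pselect (cbox rad z); last by rewrite e0// memNset// mulr0 normr0.
  by rewrite mem_set// mulr1 (le_trans (HC p z zr))// ler_norm.
have [C0 HC0] := bdd _ f0 s0.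
have /choice[C1 HC1] (i : 'I_n) := bdd _ (f1 i) (s1 i).
have /choice[C2 HC2] (i : 'I_n) := bdd _ (fam_derive (dir (Some i)) (f1 i)) (psupp_derive (dir (Some i)) (s1 i)).
have /choice[C3 HC3] (i : 'I_n) := bdd _ (fam_derive (dir (Some i)) f0) (psupp_derive (dir (Some i)) s0).
pose C := `|C0| + \sum_i `|C1 i| + \sum_i `|C3 i|.
have N0 : (0 : R) <= n.+1%:R by [].
have S1 : 0 <= \sum_i `|C1 i| by exact: sumr_ge0.
have S3 : 0 <= \sum_i `|C3 i| by exact: sumr_ge0.
have Cn0 : 0 <= C by rewrite /C !addr_ge0.
exists (C * (1 + n.+1%:R * M)); first by rewrite mulr_ge0// addr_ge0// mulr_ge0.
move=> p U u h F k f g rU [su sh sF sk sf sg dx dY deq ell bd].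
have tpsi (eta : P -> pt -> R) : fam eta -> psupp rad eta -> tst U (eta p).
  move=> fe e0; split; first exact: fam_sm.
  by exists (cbox rad); [split => //; exact: compact_cbox|exact: e0].
have t0 := tpsi _ f0 s0; have t1 i := tpsi _ (f1 i) (s1 i).
pose J z := - (\sum_(i | fb i) h i z * psi i p z + g z * psi0 p z
   + \sum_(i | fb i) F i z * 'D_(dir (Some i)) (psi0 p) z).
have i1 i : fb i -> intg vol (fun z => h i z * psi i p z).
  by move=> fi; exact: sq_mul (sh i fi) (tst_sq (t1 i)).
have i2 : intg vol (fun z => g z * psi0 p z) by exact: sq_mul sg (tst_sq t0).
have i3 i : fb i -> intg vol (fun z => F i z * 'D_(dir (Some i)) (psi0 p) z).
  by move=> fi; exact: sq_mul (sF i fi) (tst_sq (tst_derive _ t0)).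
have is1 : intg vol (fun z => \sum_(i | fb i) h i z * psi i p z) by exact: intg_sum.
have is3 : intg vol (fun z => \sum_(i | fb i) F i z * 'D_(dir (Some i)) (psi0 p) z) by exact: intg_sum.
have iJ : intg vol J by apply: intgN; apply: intgD => //; exact: intgD.
have -> : \int[vol]_z (u z * phi p z) = \int[vol]_z J z.
  rewrite /J IntN; last by apply: intgD => //; exact: intgD.
  rewrite IntD//; last exact: intgD.
  rewrite IntD// !Int_sum// -addrA -(deq _ t0) (dY _ t0) opprD opprK -sumrN.
  have iu i : intg vol (fun z => u z * 'D_(dir (Some i)) (psi i p) z).
    exact: sq_mul su (tst_sq (tst_derive _ (t1 i))).
  under [in RHS]eq_bigr => i fi do rewrite (dx _ _ (t1 i) fi) opprK.
  have iY : intg vol (fun z => u z * Yop (psi0 p) z) by exact: sq_mul su (tst_sq (tst_Yop B t0)).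
  rewrite -Int_sum// -IntD//; last exact: intg_sum.
  by apply: eq_Rintegral => z _; rewrite phiE mulrDr mulr_sumr.
apply: le_trans (Int_norm iJ) _.
have sc : sq vol (\1_(@cbox R n rad)) by apply: sq_indic; [exact: measurable_cbox|exact: vol_cbox_lty].
have iG : intg vol (fun z => \1_(cbox rad) z *
     (\sum_(i | fb i) `|h i z| + \sum_(i | fb i) `|f i z| + `|g z|)).
  apply: sq_mul => //; apply: sqD; last exact: sq_abs.
  by apply: sqD; apply: sq_sum => i fi; apply: sq_abs; [exact: sh|exact: sf].
rewrite -IntZ//; apply: Int_le => [||z]; [exact: intg_abs|exact: intgZ|].
rewrite /J normrN.
set A := \sum_(i | fb i) `|h i z|; set D := \sum_(i | fb i) `|f i z|; set x := \1_(cbox rad) z : R.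
have x0 : 0 <= x by rewrite /x indicE.
have A0 : 0 <= A by exact: sumr_ge0.
have D0 : 0 <= D by exact: sumr_ge0.
have leC (c : R) (Ci : 'I_n -> R) i : c <= Ci i * x -> 0 <= \sum_i `|Ci i| -> \sum_i `|Ci i| <= C -> c <= C * x.
  move=> H1 _ H2; apply: (le_trans H1); rewrite ler_wpM2r//; apply: le_trans H2.
  by rewrite (le_trans (ler_norm _))// (bigD1 i)//= lerDl sumr_ge0.
have B1 : `|\sum_(i | fb i) h i z * psi i p z| <= C * x * A.
  apply: le_trans (ler_norm_sum _ _ _) _; rewrite /A mulr_sumr; apply: ler_sum => i fi.
  rewrite normrM mulrC ler_wpM2r//; apply: (leC _ _ _ (HC1 i p z)) => //.
  by rewrite /C -addrA addrCA lerDl addr_ge0.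
have B2 : `|g z * psi0 p z| <= C * x * `|g z|.
  rewrite normrM mulrC ler_wpM2r// (le_trans (HC0 p z))// ler_wpM2r//.
  by rewrite /C -addrA (le_trans (ler_norm _))// lerDl addr_ge0.
have B3 : `|\sum_(i | fb i) F i z * 'D_(dir (Some i)) (psi0 p) z| <= C * x * (n.+1%:R * M * (A + D)).
  apply: le_trans (ler_norm_sum _ _ _) _.
  apply: (@le_trans _ _ (\sum_(i | fb i) C * x * (M * (A + D)))).
    apply: ler_sum => i fi; rewrite normrM mulrC ler_pM//; last exact: bd.
    by apply: (leC _ _ _ (HC3 i p z)) => //; rewrite /C lerDr addr_ge0.
  rewrite sumr_const -(mulr_natl (C * x * _)) [leLHS]mulrCA; apply: ler_wpM2l; first exact: mulr_ge0.
  rewrite -(mulrA n.+1%:R M); apply: ler_wpM2r; first by rewrite mulr_ge0 ?addr_ge0.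
  by rewrite ler_nat (leq_trans (max_card _))// card_ord.
apply: (le_trans (ler_normD _ _)); apply: (le_trans (lerD (ler_normD _ _) (lexx _))).
apply: (le_trans (lerD (lerD B1 B2) B3)).
rewrite -subr_ge0.
have -> : C * (1 + n.+1%:R * M) * (x * (A + D + `|g z|)) -
   (C * x * A + C * x * `|g z| + C * x * (n.+1%:R * M * (A + D))) =
   C * x * (D + n.+1%:R * M * `|g z|) by ring.
by rewrite !(mulr_ge0, addr_ge0).
Qed.

End representation.

(** * The difference of two bumps as a divergence *)

Lemma perm_option n : perm_eq (index_enum (option 'I_n)) (None :: map Some (index_enum 'I_n)).
Proof.
apply: uniq_perm; first exact: index_enum_uniq.
  rewrite /= map_inj_uniq; last by move=> ? ? [].
  by rewrite index_enum_uniq andbT; apply/mapP => -[].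
case=> [j|]; rewrite mem_index_enum// in_cons/=; apply/esym/mapP.
by exists j => //; rewrite mem_index_enum.
Qed.

(** The zeros stand for the derivatives that vanish when the product rule is expanded in
    [mol_difference]. *)
Lemma telescope_alg (R : comNzRingType) (a s s' q q' P P' : R) :
  a * (P * q - P' * q') =
  a * ((s + -1 * s') * 0 + q * (P + (-1 * P' + s' * 0))) + (s + -1 * s') * q * 0 + a * P' * (q - q').
Proof. ring. Qed.

Section bump_difference.
Context {R : realType} {n : nat}.
Local Notation pt := ('cV[R]_n * R)%type.
Local Notation idx := (option 'I_n).
Variables (B : 'M[R]_n) (blk : 'I_n -> nat) (r : nat).
Hypothesis B_blk : forall i j, B i j != 0 -> blk j = (blk i).+1.
Hypothesis blk_ord : forall i j : 'I_n, (blk i < blk j)%N -> (i < j)%N.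
Hypothesis blk_le : forall i, (blk i <= r)%N.
Hypothesis B_rank : forall j, (0 < blk j)%N -> exists c : 'I_n -> R,
  (forall i, c i != 0 -> (blk i).+1 = blk j) /\
  forall l, \sum_i c i * B i l = (l == j)%:R.
Local Notation rep := (rep B blk).
Local Notation flow := (flow B r).
Local Notation Psi := (Psi B blk r).
Local Notation hdim := (hdim blk).
Local Notation wt := (wt blk).
Local Notation wto := (wto blk).
Implicit Types (z w y : pt) (o : idx).

Local Notation P := {z : pt | cbox 2 z}.
Implicit Types p : P.

Lemma cbox00 : cbox 2 (0 : pt).
Proof. by case=> [j|] /=; rewrite ?mxE normr0. Qed.

Definition p00 : P := exist _ 0 cbox00.

(** The power of rho makes it the derivative of [Sf] in its own coordinate, so a product bump of any
    size is a product of derivatives of steps. *)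
Definition Pf (rho : R) p o y : R := rho^-1 ^+ wto o * bump (crd o (Psi (sval p) rho y)).
Definition Sf (rho : R) p o y : R := step (crd o (Psi (sval p) rho y)).

Definition mol (rho : R) p y : R := \prod_o Pf rho p o y.

Lemma fam_A (rho : R) o : fam (fun p y => crd o (Psi (sval p) rho y)).
Proof. by apply: (@fam_Psi _ _ _ _ _ _ _ _ 2) => -[z zz] o1; exact: zz. Qed.

Lemma fam_Pf rho o : fam (fun p => Pf rho p o).
Proof. by apply: fam_mul; [exact: fam_cst|apply: fam_comp; [exact: c1_bump|exact: fam_A]]. Qed.

Lemma fam_Sf rho o : fam (fun p => Sf rho p o).
Proof. by apply: fam_comp; [exact: c1_step|exact: fam_A]. Qed.

Lemma derive_comp0 (g : R -> R) (f : pt -> R) y e : c1 g -> differentiable f y -> 'D_e f y = 0 ->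
  'D_e (fun z => g (f z)) y = 0.
Proof.
move=> /c1_derive[g' _ dg] df f0.
by rewrite (derive_comp_line e (dg (f y)) df) f0 mulr0.
Qed.

Lemma dA (rho : R) p o y : differentiable (fun y => crd o (Psi (sval p) rho y)) y.
Proof. exact: (differentiable_fam p y (fam_A rho o)). Qed.

Lemma derive_Pf0 rho p o e y : 'D_e (fun y => crd o (Psi (sval p) rho y)) y = 0 ->
  'D_e (Pf rho p o) y = 0.
Proof.
move=> A0; have db : differentiable (fun y => bump (crd o (Psi (sval p) rho y))) y.
  exact: (differentiable_fam p y (fam_comp c1_bump (fam_A rho o))).
rewrite /Pf (deriveME _ (differentiable_cst _ _) db) derive_cst mulr0 addr0.
by rewrite (derive_comp0 c1_bump (dA rho p o y) A0) mulr0.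
Qed.

Lemma derive_Sf rho p o y : 'D_(dir o) (Sf rho p o) y = Pf rho p o y.
Proof.
rewrite /Sf (derive_comp_line (dir o) (is_derive_step _) (dA rho p o y)) derive_crd_Psi//.
rewrite /Pf mulrC; case: o => [j|] /=; first by rewrite eqxx mulr1.
by rewrite exprVn.
Qed.

Lemma derive_Pf_off rho p k j y : k != j -> 'D_(dir (Some j)) (Pf rho p (Some k)) y = 0.
Proof. by move=> kj; apply: derive_Pf0; rewrite derive_crd_Psi// (negbTE kj) mulr0. Qed.

Lemma derive_Pf_time rho p j y : 'D_(dir (Some j)) (Pf rho p None) y = 0.
Proof. by apply: derive_Pf0; rewrite derive_crd_Psi. Qed.

Lemma derive_Pf0_time rho k y : 'D_(dir None) (Pf rho p00 (Some k)) y = 0.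
Proof.
apply: derive_Pf0; rewrite derive_crd_Psi//=.
by rewrite mulmx0 mulmx0 mxE mulr0.
Qed.

Lemma derive_prod0 (I : eqType) (s : seq I) (f : I -> pt -> R) e y : (forall i, sm (f i)) ->
  (forall i, i \in s -> 'D_e (f i) y = 0) -> 'D_e (fun z => \prod_(i <- s) f i z) y = 0.
Proof.
move=> sf; elim: s => [|i s IH] H.
  under eq_fun do rewrite big_nil; exact: derive_cst.
under eq_fun do rewrite big_cons.
have sp : sm (fun z => \prod_(i <- s) f i z) by apply: (@fam_prod R n unit I s xpredT (fun i _ => f i)) => j _; exact: sf.
rewrite (deriveME _ (differentiable_fam tt y (sf i)) (differentiable_fam tt y sp)).
by rewrite IH ?H ?mem_head ?mulr0 ?addr0// => j js; rewrite H// in_cons js orbT.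
Qed.

(** The centre of the bump in space moves with time. On the time range |t| <= 3, outside which time
    factors of size at most 1 centred in [cbox 2] vanish, this displacement is bounded. *)
Lemma shift_bounded : exists2 K : R, 0 <= K & forall p (t : R) j, `|t| <= 3 ->
  `|(flow (t - (sval p).2) *m (sval p).1) j 0| <= K.
Proof.
have /choice[M HM] (j : 'I_n) := fam_bounded (fam_A 1 (Some j)) 3.
exists (\sum_j `|M j|) => [|p t j t3]; first exact: sumr_ge0.
have := HM j p (0, t); rewrite /= dilE invr1 expr1n mul1r add0r [X in `|X|]mxE normrN => H.
rewrite (bigD1 j)//= (@le_trans _ _ (M j)) ?H//; last first.
  by rewrite (le_trans (ler_norm _))// lerDl sumr_ge0.
by case=> [i|] //=; rewrite mxE normr0.
Qed.

Lemma crd_A_sign (K rho : R) p y j : 0 < rho <= 1 ->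
  `|(flow (y.2 - (sval p).2) *m (sval p).1) j 0| <= K ->
  (K + 1 < y.1 j 0 -> 1 <= crd (Some j) (Psi (sval p) rho y)) /\
  (y.1 j 0 < - (K + 1) -> crd (Some j) (Psi (sval p) rho y) <= -1).
Proof.
move=> /andP[r0 r1]; rewrite ler_norml => /andP[K1 K2].
have e1 : 1 <= rho^-1 ^+ wt j by rewrite exprn_ege1// invf_ge1.
have -> : crd (Some j) (Psi (sval p) rho y) = rho^-1 ^+ wt j *
    (y.1 j 0 - (flow (y.2 - (sval p).2) *m (sval p).1) j 0).
  by rewrite /= dilE [in LHS]mxE [X in _ + X]mxE.
set s := (_ *m _) j 0 in K1 K2 *; set e := rho^-1 ^+ _ in e1 *.
by split=> H; nra.
Qed.

Lemma crd_None_sign (rho : R) p y : 0 < rho <= 1 ->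
  (3 < y.2 -> 1 <= crd None (Psi (sval p) rho y)) /\
  (y.2 < - 3 -> crd None (Psi (sval p) rho y) <= -1).
Proof.
move=> /andP[r0 r1]; have e1 : 1 <= rho ^- 2 by rewrite invf_ge1 ?exprn_gt0// expr_le1// ltW.
have := svalP p None; rewrite [crd None _]/= ler_norml => /andP[K1 K2].
rewrite [crd None _]/=; set s := (sval p).2 in K1 K2 *; set e := rho ^- 2 in e1 *.
by split=> H; nra.
Qed.

(** The factors of the product are exchanged one coordinate at a time, each difference of factors
    being the derivative of a difference of steps. Far away both steps have the same value 0 or 1,
    which keeps the functions under the derivatives compactly supported. *)
Lemma mol_difference : exists2 kap : R, 3 <= kap & forall rho rho' : R,
  0 < rho <= 1 -> 0 < rho' <= 1 -> rep kap (fun p y => mol rho p y - mol rho' p00 y).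
Proof.
have [K K0 HK] := shift_bounded; exists (K + 3); first by lra.
move=> rho rho' rr rr'.
have sgn (s : R) p y j : 0 < s <= 1 -> `|y.2| <= 3 -> K + 3 < `|y.1 j 0| ->
    Sf s p (Some j) y = (0 < y.1 j 0)%R%:R /\ Pf s p (Some j) y = 0.
  move=> s1 t3 yK; have [H1 H2] := crd_A_sign s1 (HK p y.2 j t3).
  move: yK; rewrite /Sf /Pf; case: (ltP 0 (y.1 j 0)) => y0 yK.
    rewrite gtr0_norm// in yK; have A1 := H1 (ltac:(lra)).
    by rewrite step_ge// bump_eq0 ?mulr0// ger0_norm// (le_trans ler01).
  rewrite ler0_norm// in yK; have A1 := H2 (ltac:(lra)).
  by rewrite step_le// bump_eq0 ?mulr0// ler0_norm; lra.
have sgnT (s : R) p y : 0 < s <= 1 -> 3 < `|y.2| ->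
    Sf s p None y = (0 < y.2)%R%:R /\ Pf s p None y = 0.
  move=> s1 yK; have [H1 H2] := crd_None_sign p y s1.
  move: yK; rewrite /Sf /Pf; case: (ltP 0 y.2) => y0 yK.
    rewrite gtr0_norm// in yK; have A1 := H1 yK.
    by rewrite step_ge// bump_eq0 ?mulr0// ger0_norm// (le_trans ler01).
  rewrite ler0_norm// in yK; have A1 := H2 (ltac:(lra)).
  by rewrite step_le// bump_eq0 ?mulr0// ler0_norm; lra.
pose Pi s p (js : seq 'I_n) y := \prod_(j <- js) Pf s p (Some j) y.
have Pi0 s p js y k : k \in js -> Pf s p (Some k) y = 0 -> Pi s p js y = 0.
  by move=> kjs P0; apply/eqP; rewrite prodf_seq_eq0; apply/hasP; exists k; rewrite ?P0 ?eqxx.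
have fPi s js : fam (fun p => Pi s p js) by apply: fam_prod => j _; exact: fam_Pf.
have fPi0 s js : fam (fun (_ : P) => Pi s p00 js) by exact: (fam_reparam (fun _ => p00) (fPi s js)).
have fPf0 s o : fam (fun (_ : P) => Pf s p00 o) by exact: (fam_reparam (fun _ => p00) (fam_Pf s o)).
have fSf0 s o : fam (fun (_ : P) => Sf s p00 o) by exact: (fam_reparam (fun _ => p00) (fam_Sf s o)).
have smP s p o : sm (Pf s p o) by exact: fam_sm (fam_Pf s o).
have fsub (f g : P -> pt -> R) : fam f -> fam g -> fam (fun p y => f p y + -1 * g p y).
  by move=> ff fg; apply: fam_add => //; apply: fam_mul => //; exact: fam_cst.
(* [Th] gathers the factors already treated. It does not depend on the coordinates still to come and
   confines the others, time included. *)
have tele : forall (js : seq 'I_n) (Th : P -> pt -> R), uniq js -> fam Th ->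
   (forall p y j, j \in js -> 'D_(dir (Some j)) (Th p) y = 0) ->
   (forall p y, Th p y != 0 -> `|y.2| <= 3 /\ forall j, j \notin js -> `|y.1 j 0| <= K + 3) ->
   rep (K + 3) (fun p y => Th p y * (Pi rho p js y - Pi rho' p00 js y)).
  elim=> [|j js IH] Th ujs fT dT sT.
    apply: (rep_ext (phi' := fun _ _ => 0)); last exact: rep0.
    have P1 s q y : Pi s q [::] y = 1 by exact: big_nil.
    by move=> p y; rewrite !P1 subrr mulr0.
  move: ujs => /= /andP[jjs ujs].
  pose eta p y := Th p y * ((Sf rho p (Some j) y + -1 * Sf rho' p00 (Some j) y) * Pi rho p js y).
  have feta : fam eta.
    by apply: fam_mul => //; apply: fam_mul => //; apply: fsub => //; exact: fam_Sf.
  apply: (rep_ext (phi' := fun p y => 'D_(dir (Some j)) (eta p) y +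
      Th p y * Pf rho' p00 (Some j) y * (Pi rho p js y - Pi rho' p00 js y))).
    move=> p y; rewrite /eta.
    have s1 : sm (Th p) by exact: fam_sm.
    have s2 : sm (Sf rho p (Some j)) by apply: fam_sm (fam_Sf rho (Some j)).
    have s3 : sm (Sf rho' p00 (Some j)) by apply: fam_sm (fam_Sf rho' (Some j)).
    have s4 : sm (Pi rho p js) by apply: fam_sm (fPi rho js).
    have s5 : sm (fun y => -1 * Sf rho' p00 (Some j) y) by exact: fam_mul (@fam_cst _ _ unit (-1)) s3.
    have s6 : sm (fun y => Sf rho p (Some j) y + -1 * Sf rho' p00 (Some j) y) by exact: fam_add s2 s5.
    have dPi : 'D_(dir (Some j)) (Pi rho p js) y = 0.
      apply: derive_prod0 => // i ijs; apply: derive_Pf_off.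
      by apply: contraNneq jjs => <-.
    have s7 : sm (fun y => -1 : R) by exact: fam_cst.
    have df f : sm f -> differentiable f y by move=> sf; exact: (differentiable_fam tt y sf).
    rewrite (deriveME _ (df _ s1) (df _ (fam_mul s6 s4))) (deriveME _ (df _ s6) (df _ s4)).
    rewrite (deriveDE _ (df _ s2) (df _ s5)) (deriveME _ (df _ s7) (df _ s3)).
    rewrite derive_cst (dT p y j (mem_head _ _)) dPi (derive_Sf rho p (Some j) y) (derive_Sf rho' p00 (Some j) y).
    have consE s q : Pi s q (j :: js) y = Pf s q (Some j) y * Pi s q js y by exact: big_cons.
    by rewrite !consE; exact: telescope_alg.
  apply: repD.
    apply: rep_derive_Some => // p y nz; rewrite /eta.
    have [->|/sT[t3 Hj]] := eqVneq (Th p y) 0; first by rewrite mul0r.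
    suff [k yk] : exists k, K + 3 < `|y.1 k 0|.
      have [kjs|kjs] := boolP (k \in js).
        have [_ P0] := sgn rho p y k rr t3 yk.
        by rewrite (Pi0 _ _ _ _ _ kjs P0) !mulr0.
      have [kj|kj] := eqVneq k j; last first.
        by have := Hj k; rewrite in_cons negb_or kj kjs leNgt yk => /(_ isT).
      rewrite kj in yk; have [-> _] := sgn rho p y j rr t3 yk.
      by have [-> _] := sgn rho' p00 y j rr' t3 yk; rewrite mulN1r subrr mul0r mulr0.
    apply: contra_notP nz => H; case=> [k|] /=; last by lra.
    by rewrite leNgt; apply/negP => yk; apply: H; exists k.
  apply: IH => //.
  - exact: fam_mul.
  - move=> p y i ijs; have s1 : sm (Th p) by exact: fam_sm.
    rewrite -(X_Some B) (XM B (Some i) y s1 (smP _ _ _)) !X_Some dT ?in_cons ?ijs ?orbT//.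
    by rewrite mulr0 addr0 derive_Pf_off ?mulr0//; apply: contraNneq jjs => ->.
  - move=> p y; rewrite mulf_eq0 negb_or => /andP[/sT[t3 Hj] Pn0]; split=> // k kjs.
    have [kj|kj] := eqVneq k j; last by apply: Hj; rewrite in_cons negb_or kj.
    rewrite leNgt; apply/negP => yk; rewrite kj in yk.
    by have [_ P0] := sgn rho' p00 y j rr' t3 yk; rewrite P0 eqxx in Pn0.
pose js := index_enum 'I_n.
have molE s p y : mol s p y = Pf s p None y * Pi s p js y.
  by rewrite /mol (perm_big _ (perm_option n)) big_cons big_map.
(* Time is exchanged next to the space factors of the bump centred at 0, which do not depend on
   time; the space factors of the bump at p do. *)
pose eta (p : P) y := (Sf rho p None y + -1 * Sf rho' p00 None y) * Pi rho' p00 js y.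
apply: (rep_ext (phi' := fun p y => Pf rho p None y * (Pi rho p js y - Pi rho' p00 js y) +
   'D_(dir None) (eta p) y)).
  move=> p y; rewrite !molE /eta.
  have s2 : sm (Sf rho p None) by apply: fam_sm (fam_Sf rho None).
  have s3 : sm (Sf rho' p00 None) by apply: fam_sm (fam_Sf rho' None).
  have s4 : sm (Pi rho' p00 js) by apply: fam_sm p00 (fPi rho' js).
  have s5 : sm (fun y => -1 * Sf rho' p00 None y) by apply: fam_mul => //; exact: fam_cst.
  have s6 : sm (fun y => Sf rho p None y + -1 * Sf rho' p00 None y) by exact: fam_add.
  have dPi : 'D_(dir None) (Pi rho' p00 js) y = 0.
    by apply: derive_prod0 => // i _; exact: derive_Pf0_time.
  have s7 : sm (fun y => -1 : R) by exact: fam_cst.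
  rewrite (deriveME _ (differentiable_fam tt y s6) (differentiable_fam tt y s4)) dPi mulr0 add0r.
  rewrite (deriveDE _ (differentiable_fam tt y s2) (differentiable_fam tt y s5)).
  rewrite (deriveME _ (differentiable_fam tt y s7) (differentiable_fam tt y s3)).
  rewrite derive_cst mulr0 addr0 (derive_Sf rho p None y) (derive_Sf rho' p00 None y).
  by move: (Pf rho p None y) (Pf rho' p00 None y) (Pi rho p js y) (Pi rho' p00 js y) => a1 a2 a3 a4; ring.
apply: repD.
  apply: tele => //; first exact: index_enum_uniq.
  - exact: fam_Pf.
  - by move=> p y j _; exact: derive_Pf_time.
  - move=> p y Pn0; split; last by move=> j; rewrite mem_index_enum.
    by rewrite leNgt; apply/negP => yk; have [_ P0] := sgnT rho p y rr yk; rewrite P0 eqxx in Pn0.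
apply: rep_derive_None => //.
  by apply: fam_mul => //; apply: fsub => //; exact: fam_Sf.
move=> p y nz; rewrite /eta; have [t3|t3] := ltP 3 `|y.2|.
  have [-> _] := sgnT rho p y rr t3; have [-> _] := sgnT rho' p00 y rr' t3.
  by rewrite mulN1r subrr mul0r.
suff [k yk] : exists k, K + 3 < `|y.1 k 0|.
  have [_ P0] := sgn rho' p00 y k rr' t3 yk.
  by rewrite (Pi0 _ _ _ _ _ (mem_index_enum k) P0) mulr0.
apply: contra_notP nz => H; case=> [k|] /=; last by lra.
by rewrite leNgt; apply/negP => yk; apply: H; exists k.
Qed.

Lemma molE (rho : R) p y : mol rho p y = rho^-1 ^+ hdim * bumpf (Psi (sval p) rho y).
Proof.
rewrite /mol /Pf big_split; congr (_ * _).
rewrite -expr_sum; congr (_ ^+ _).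
by rewrite (perm_big _ (perm_option n)) big_cons big_map.
Qed.

End bump_difference.

(** * The L^2 norm and averaging operators *)

Section minkowski.
Context d (T : measurableType d) (R : realType) (mu : {measure set T -> \bar R}).

Definition nrm (a : T -> R) : R := Num.sqrt (\int[mu]_x a x ^+ 2).

Lemma nrm_ge0 a : 0 <= nrm a. Proof. exact: sqrtr_ge0. Qed.

Lemma nrm_sqr a : nrm a ^+ 2 = \int[mu]_x a x ^+ 2.
Proof. by rewrite sqr_sqrtr// Int_ge0// => x; exact: sqr_ge0. Qed.

Lemma nrmD a b : sq mu a -> sq mu b -> nrm (fun x => a x + b x) <= nrm a + nrm b.
Proof.
move=> sa sb; rewrite -ler_sqr ?nnegrE ?addr_ge0 ?nrm_ge0// sqrrD !nrm_sqr.
have ab : \int[mu]_x (a x * b x) <= nrm a * nrm b.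
  apply: (le_trans (ler_norm _)); rewrite -ler_sqr ?nnegrE ?mulr_ge0 ?nrm_ge0//.
  by rewrite real_normK ?num_real// exprMn !nrm_sqr; exact: cauchy_schwarz.
have -> : \int[mu]_x (a x + b x) ^+ 2 =
    \int[mu]_x a x ^+ 2 + 2 * \int[mu]_x (a x * b x) + \int[mu]_x b x ^+ 2.
  have i1 := intgZ 2 (sq_mul sa sb).
  rewrite -IntZ; last exact: sq_mul.
  rewrite -(IntD (sq_intg2 sa) i1) -(IntD (intgD (sq_intg2 sa) i1) (sq_intg2 sb)).
  by apply: eq_Rintegral => x _; ring.
by rewrite lerD2r lerD2l -mulr_natl; lra.
Qed.

Lemma nrm_le a b : sq mu a -> sq mu b -> (forall x, `|a x| <= `|b x|) -> nrm a <= nrm b.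
Proof.
move=> sa sb ab; rewrite ler_wsqrtr//; apply: Int_le => [||x].
- exact: sq_intg2 sa.
- exact: sq_intg2 sb.
- by rewrite -[leLHS]real_normK ?num_real// -[leRHS]real_normK ?num_real// ler_sqr ?nnegrE.
Qed.

Lemma nrmZ (c : R) a : sq mu a -> nrm (fun x => c * a x) = `|c| * nrm a.
Proof.
move=> sa; rewrite /nrm.
have -> : \int[mu]_x (c * a x) ^+ 2 = c ^+ 2 * \int[mu]_x a x ^+ 2.
  by rewrite -IntZ ?sq_intg2//; apply: eq_Rintegral => x _; rewrite exprMn.
by rewrite sqrtrM ?sqr_ge0// sqrtr_sqr.
Qed.

End minkowski.

Section averaging_operator.
Context {R : realType} {n : nat}.
Local Notation pt := ('cV[R]_n * R)%type.
Local Notation sq := (sq (@vol R n)).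
Local Notation intg := (intg (@vol R n)).
Local Notation vol2 := (@vol R n \x @vol R n)%E.
Implicit Types (z w y v : pt) (p a b : pt -> R).

(** Cauchy-Schwarz in w at fixed z, with b supported in [cbox kap], followed by Tonelli in z. The
    hypothesis on sections makes the inner integrals meaningful for every z. *)
Lemma sq_average (kap rad beta : R) b (q : pt * pt -> R) : sq b -> supp kap b ->
  measurable_fun setT q ->
  (forall z, sq (fun w => \1_(cbox kap) w * q (w, z))) ->
  (\int[vol2]_(x in cbox kap `*` cbox rad) ((q x) ^+ 2)%:E <= beta%:E)%E ->
  let t z := \1_(cbox rad) z * \int[vol]_w (b w * q (w, z)) in
  sq t /\ \int[vol]_z t z ^+ 2 <= (\int[vol]_w b w ^+ 2) * beta.
Proof.
move=> sb b0 mq sqq qb t.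
pose D : set (pt * pt) := cbox kap `*` cbox rad.
have mc s : measurable (@cbox R n s) by exact: measurable_cbox.
have mD : measurable D by exact: measurableX.
have s1 : sq (\1_(@cbox R n rad)) by apply: sq_indic; [exact: measurable_cbox|exact: vol_cbox_lty].
pose f1 (x : pt * pt) := b x.1 * (\1_(cbox rad) x.2 : R).
pose f2 (x : pt * pt) := \1_D x * q x.
have sf1 : sq_of vol2 f1.
  split; last first.
    have := intg_prod (sq_intg2 sb) (sq_intg2 s1).
    by congr (integrable _ _ _); apply/funext => x; rewrite /= exprMn.
  apply: measurable_funM; first exact: (measurableT_comp (sq_meas sb) measurable_fst).
  exact: (measurableT_comp (sq_meas s1) measurable_snd).
have mf2 : measurable_fun setT f2 by apply: measurable_funM => //; exact: measurable_indic.
have f2b : (\int[vol2]_x (f2 x ^+ 2)%:E <= beta%:E)%E.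
  move: qb; rewrite integral_mkcond; congr (_ <= _)%E; apply: eq_integral => x _.
  rewrite /patch /f2 indicE; case: ifP => _; first by rewrite mul1r.
  by rewrite mul0r expr0n.
have sf2 : sq_of vol2 f2.
  split=> //; apply: intg_lty => //; first exact: measurable_funX.
    by move=> x; exact: sqr_ge0.
  exact: le_lt_trans f2b (ltry _).
have f2E w z : f2 (w, z) = \1_(cbox rad) z * (\1_(cbox kap) w * q (w, z)).
  rewrite /f2 !indicE in_setX /=; case: (w \in _); case: (z \in _); rewrite ?(mul1r, mul0r)//.
have sf2z z : sq (fun w => f2 (w, z)).
  have := sqZ (\1_(cbox rad) z) (sqq z); congr (sq_of _ _).
  by apply/funext => w; rewrite f2E.
have tE z : t z = \int[vol]_w (f1 (w, z) * f2 (w, z)).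
  rewrite /t -IntZ; last first.
    have := sq_mul sb (sqq z); congr (integrable _ _ _); apply/funext => w /=; rewrite mulrA indicE.
    have [wk|wk] := pselect (cbox kap w); first by rewrite mem_set// mulr1.
    by rewrite b0// !mul0r.
  apply: eq_Rintegral => w _; rewrite f2E /f1 /= !indicE.
  have [wk|wk] := pselect (cbox kap w); last by rewrite b0// !(mul0r, mulr0).
  by rewrite (mem_set wk); case: (z \in _); rewrite ?(mul1r, mulr1, mul0r, mulr0).
have sf1z z : sq (fun w => f1 (w, z)).
  have := sqZ (\1_(cbox rad) z) sb; congr (sq_of _ _).
  by apply/funext => w; rewrite /f1 mulrC.
have sec z : intg (fun w => f1 (w, z) * f2 (w, z)) by exact: sq_mul.
have sec2 z : intg (fun w => f2 (w, z) ^+ 2) by exact: sq_intg2 (sf2z z).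
have it : intg t.
  have := intg_fubini2 (sq_mul sf1 sf2) sec; congr (integrable _ _ _).
  by apply/funext => z; rewrite /= tE.
have i2 : intg (fun z => \int[vol]_w f2 (w, z) ^+ 2).
  exact: (intg_fubini2 (f := fun x => f2 x ^+ 2) (sq_intg2 sf2) sec2).
have B0 : 0 <= \int[vol]_w b w ^+ 2 by apply: Int_ge0 => w; exact: sqr_ge0.
have tle z : t z ^+ 2 <= (\int[vol]_w b w ^+ 2) * \int[vol]_w f2 (w, z) ^+ 2.
  rewrite tE; apply: le_trans (cauchy_schwarz (sf1z z) (sf2z z)) _.
  rewrite ler_wpM2r//; first by apply: Int_ge0 => w; exact: sqr_ge0.
  apply: Int_le => [||w]; [exact: sq_intg2 (sf1z z)|exact: sq_intg2 sb|].
  by rewrite /f1 /= indicE; case: (_ \in _); rewrite ?mulr1// mulr0 expr0n sqr_ge0.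
have it2 : intg (fun z => t z ^+ 2).
  apply: (intg_le _ _ (intgZ (\int[vol]_w b w ^+ 2) i2)).
    by apply: measurable_funX; exact: intg_meas it.
  by move=> z; rewrite ger0_norm ?sqr_ge0.
split; first by split=> //; exact: intg_meas it.
apply: (@le_trans _ _ (\int[vol]_z ((\int[vol]_w b w ^+ 2) * \int[vol]_w f2 (w, z) ^+ 2))).
  by apply: Int_le => //; exact: intgZ.
rewrite IntZ// ler_wpM2l//.
rewrite (Int_fubini2 (f := fun x => f2 x ^+ 2) (sq_intg2 sf2) sec2).
by rewrite -lee_fin (IntE (sq_intg2 sf2)).
Qed.

End averaging_operator.

Notation nrm_of := nrm.

Lemma sqr_le_add2 (R : realFieldType) (x a b : R) : 0 <= x -> x <= a + b ->
  x ^+ 2 <= 2 * a ^+ 2 + 2 * b ^+ 2.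
Proof.
move=> x0 xab; apply: (@le_trans _ _ ((a + b) ^+ 2)); last by have := sqr_ge0 (a - b); nra.
by rewrite ler_sqr ?nnegrE// (le_trans x0).
Qed.

Lemma cvg_Phi_dyadic (R : realType) n (B : 'M[R]_n) (blk : 'I_n -> nat) r
  (B_blk : forall i j, B i j != 0 -> blk j = (blk i).+1) (blk_le : forall i, (blk i <= r)%N)
  (e : R) : 0 < e <= 1 -> forall v (z : 'cV[R]_n * R), cbox 1 v -> Phi B blk r z (e / 2 ^+ L) v @[L --> \oo] --> z.
Proof.
move=> /andP[e0 e1] v z v1.
have eL0 (L : nat) : 0 < e / 2 ^+ L by rewrite divr_gt0 ?exprn_gt0.
have eL1 (L : nat) : e / 2 ^+ L <= L.+1%:R^-1.
  apply: (@le_trans _ _ (1 / 2 ^+ L)); first by rewrite ler_wpM2r ?invr_ge0 ?exprn_ge0.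
  rewrite mul1r lef_pV2 ?posrE ?exprn_gt0 ?ltr0n// -natrX ler_nat.
  exact: ltn_expl.
pose r0 : R := 1 + \sum_o `|crd o z|.
have r1 : 1 <= r0 by rewrite lerDl sumr_ge0.
have zr : cbox r0 z.
  by move=> o; rewrite /r0 (bigD1 o)//= addrCA lerDl addr_ge0// sumr_ge0.
apply: (@cvg_crd_pt _ _ _ _ (1 + flowC B r * r0)) => L o.
have ub : e / 2 ^+ L <= 1 by rewrite (le_trans (eL1 L))// invf_le1 ?ltr0n// ler1n.
have v1' : bx B blk r z (e / 2 ^+ L) (Phi B blk r z (e / 2 ^+ L) v).
  by rewrite /bx /= PhiK ?gt_eqF.
have el : 0 < e / 2 ^+ L <= 1 by rewrite eL0.
have cl := bx_close o r1 el zr v1'; apply: (le_trans cl).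
by rewrite ler_wpM2r// addr_ge0// mulr_ge0 ?flowC_ge0// (le_trans ler01).
Qed.

(** * The Poincare inequality for weak solutions *)

Section poincare.
Context {R : realType} {n : nat}.
Local Notation pt := ('cV[R]_n * R)%type.
Local Notation idx := (option 'I_n).
Variables (B : 'M[R]_n) (blk : 'I_n -> nat) (r : nat).
Hypothesis B_blk : forall i j, B i j != 0 -> blk j = (blk i).+1.
Hypothesis blk_ord : forall i j : 'I_n, (blk i < blk j)%N -> (i < j)%N.
Hypothesis blk_le : forall i, (blk i <= r)%N.
Hypothesis B_rank : forall j, (0 < blk j)%N -> exists c : 'I_n -> R,
  (forall i, c i != 0 -> (blk i).+1 = blk j) /\
  forall l, \sum_i c i * B i l = (l == j)%:R.
Local Notation fb := (fb blk).
Local Notation wsol := (wsol B blk).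
Local Notation flow := (flow B r).
Local Notation Phi := (Phi B blk r).
Local Notation Psi := (Psi B blk r).
Local Notation hdim := (hdim blk).
Local Notation sq := (sq (@vol R n)).
Local Notation intg := (intg (@vol R n)).
Local Notation nrm := (nrm (@vol R n)).
Local Notation mol := (mol B blk r).
Local Notation P := {z : pt | cbox 2 z}.
Implicit Types (z w y v q : pt) (o : idx) (p a b : pt -> R).

Lemma Phi_bounded (s t : R) : exists2 c : R, s <= c & forall z w (e : R), cbox s z -> cbox t w ->
  0 <= e <= 1 -> cbox c (Phi z e w).
Proof.
have /choice[M flM] (kl : 'I_n * 'I_n) : exists M : R, forall s, `|s| <= t -> `|flow s kl.1 kl.2| <= M.
  have [M HM] := fam_bounded (@fam_flowN R n B r unit kl.1 kl.2) t.
  exists M => s0 st; have := HM tt (0, - s0); rewrite /= opprK; apply => -[j|] /=.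
    by rewrite mxE normr0 (le_trans _ st).
  by rewrite normrN.
have S0 : 0 <= \sum_k \sum_l `|M (k, l)| * `|s| by apply: sumr_ge0 => k _; apply: sumr_ge0 => l _; rewrite mulr_ge0.
exists (`|s| + `|t| + \sum_k \sum_l `|M (k, l)| * `|s|) => [|z w e zs wt_ /andP[e0 e1] o].
  by have := ler_norm s; have := normr_ge0 t; lra.
have w2 : `|e ^+ 2 * w.2| <= t.
  rewrite normrM ger0_norm ?exprn_ge0// (le_trans _ (wt_ None))//.
  by rewrite ler_piMl// expr_le1.
case: o => [j|] /=; last first.
  have := ler_normD (e ^+ 2 * w.2) z.2; have := zs None; rewrite /=.
  by have := ler_norm s; have := ler_norm t; lra.
rewrite mxE dilE; apply: le_trans (ler_normD _ _) _; apply: lerD.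
  rewrite normrM ger0_norm ?exprn_ge0//.
  apply: (@le_trans _ _ `|w.1 j 0|); first by rewrite ler_piMl// exprn_ile1.
  have := wt_ (Some j); rewrite /=; have := ler_norm t; have := normr_ge0 s; lra.
rewrite mxE [leRHS](bigD1 j)//= -[leLHS]addr0 lerD//; last first.
  by apply: sumr_ge0 => k _; apply: sumr_ge0 => l _; rewrite mulr_ge0.
apply: le_trans (ler_norm_sum _ _ _) _; apply: ler_sum => l _.
rewrite normrM ler_pM//; first by rewrite (le_trans (flM (j, l) _ w2)) ?ler_norm.
by rewrite (le_trans (zs (Some l))) ?ler_norm.
Qed.

Lemma Int_mol p (q : P) (e : R) : 0 < e -> sq p ->
  \int[vol]_y (p y * mol e q y) = \int[vol]_w (bumpf w * p (Phi (sval q) e w)).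
Proof.
move=> e0 sp; have tb : tst (Phi (sval q) e @^-1` setT) bumpf by exact: tst_bumpf.
have := Int_Phi_mul B_blk blk_le e0 sp tb.
under [in X in X -> _]eq_Rintegral => w _ do rewrite mulrC.
move=> ->; rewrite -IntZ; last first.
  apply: sq_mul => //; apply: (@tst_sq _ _ setT).
  exact: (tst_Psi B_blk blk_le (lt0r_neq0 e0) tb).
by apply: eq_Rintegral => y _; rewrite molE// exprVn mulrCA.
Qed.

Definition Gf (h f : 'I_n -> pt -> R) (g : pt -> R) z : R :=
  \sum_(i | fb i) `|h i z| + \sum_(i | fb i) `|f i z| + `|g z|.

Lemma Gf_ge0 h f g z : 0 <= Gf h f g z.
Proof. by rewrite /Gf !addr_ge0// sumr_ge0. Qed.

Lemma sq_Gf lam M U u h F k f g : wsol lam M U u h F k f g -> sq (Gf h f g).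
Proof.
case=> su sh sF sk sf sg *; apply: sqD; last exact: sq_abs.
by apply: sqD; apply: sq_sum => i fi; apply: sq_abs; [exact: sh|exact: sf].
Qed.

Definition avg (u : pt -> R) (e : R) z : R := \int[vol]_w (bumpf w * u (Phi z e w)).

Lemma sq_ind (s : R) : sq (\1_(@cbox R n s)).
Proof. by apply: sq_indic; [exact: measurable_cbox|exact: vol_cbox_lty]. Qed.

Lemma ind_le1 (s : R) z : `|(\1_(@cbox R n s) z : R)| <= 1.
Proof. by rewrite indicE; case: (_ \in _); rewrite ?normr1 ?normr0. Qed.

Lemma ind_meas (s : R) : measurable_fun setT (\1_(@cbox R n s) : pt -> R).
Proof. exact: sq_meas (sq_ind s). Qed.

Lemma sq_cut (s : R) p : sq p -> sq (fun z => \1_(cbox s) z * p z).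
Proof. by move=> sp; apply: sqMb (ind_meas s) (ind_le1 s) sp. Qed.

Variable kap : R.
Hypothesis kap3 : 3 <= kap.
Hypothesis kap_rep : forall rho rho' : R, 0 < rho <= 1 -> 0 < rho' <= 1 ->
  rep B blk kap (fun (p : P) y => mol rho p y - mol rho' p00 y).

(** [Phi z e] carries the scales e and e/2 at z to the scales 1 and 1/2 at 0, so one constant serves
    all z and e. The factor e comes from the scaling of h and f by e; g even gains e^2. *)
Lemma avg_dyadic (lam M : R) : 0 <= M -> exists2 C : R, 0 <= C &
  forall U u h F k f g z (e : R), 0 < e <= 1 -> (forall w, cbox kap w -> U (Phi z e w)) ->
  wsol lam M U u h F k f g ->
  `|avg u e z - avg u (e / 2) z| <= C * e * \int[vol]_w (\1_(cbox kap) w * Gf h f g (Phi z e w)).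
Proof.
move=> M0; have h1 : 0 < (2^-1 : R) <= 1 by rewrite invr_gt0 ltr0n /= invf_le1 ?ltr0n ?ler1n.
have o1 : 0 < (1 : R) <= 1 by rewrite ltr01 lexx.
have [C C0 HC] := rep_bound lam M0 (kap_rep o1 h1); exists C => // U u h F k f g z e /andP[e0 e1] zU ws.
have kU : cbox kap `<=` Phi z e @^-1` U by move=> w /zU.
have ws' := wsol_Phi B_blk blk_le z e0 ws.
have su : sq u by case: ws.
have := HC (p00) _ _ _ _ _ _ _ kU ws'.
have su' := sq_Phi B_blk blk_le z e0 su.
have h0 : 0 < (2^-1 : R) by rewrite invr_gt0.
have tm (s : R) : 0 < s -> sq (mol s p00).
  move=> s0; apply: (@tst_sq _ _ setT).
  rewrite (_ : mol s p00 = fun y => s^-1 ^+ hdim * bumpf (Psi 0 s y)); last by apply/funext => y; exact: molE.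
  by apply: tstZ; exact: (tst_Psi B_blk blk_le (lt0r_neq0 s0) (@tst_bumpf R n)).
under [in X in `|X|]eq_Rintegral => w _ do rewrite mulrBr.
rewrite IntB; [|exact: sq_mul su' (tm _ ltr01)|exact: sq_mul su' (tm _ h0)].
rewrite !Int_mol// /avg.
have -> : \int[vol]_w (bumpf w * u (Phi z e (Phi (sval p00) 1 w))) = avg u e z.
  by apply: eq_Rintegral => w _; rewrite (Phi01 B blk r).
have -> : \int[vol]_w (bumpf w * u (Phi z e (Phi (sval p00) 2^-1 w))) = avg u (e / 2) z.
  apply: eq_Rintegral => w _; rewrite Phi_comp//; congr (_ * u (Phi _ _ _)).
  by rewrite /Phi_of/= mulmx0 mulr0 flow0 mul1mx !add0r; case: (z).
move/le_trans; apply; rewrite -mulrA ler_wpM2l//.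
have sG : sq (fun w => Gf h f g (Phi z e w)) by apply: (sq_Phi B_blk blk_le) => //; exact: sq_Gf ws.
have iG : intg (fun w => \1_(cbox kap) w * Gf h f g (Phi z e w)) by exact: sq_mul (sq_ind kap) sG.
rewrite -IntZ//; apply: Int_le => [||w]; [|exact: intgZ|].
  exact: sq_mul (sq_ind kap) (sq_Gf ws').
rewrite mulrCA ler_wpM2l ?indicE// /Gf.
under eq_bigr do rewrite normrM (ger0_norm (ltW e0)).
under [X in _ + X + _]eq_bigr do rewrite normrM (ger0_norm (ltW e0)).
rewrite -!mulr_sumr !mulrDr lerD2l normrM ger0_norm ?exprn_ge0 ?(ltW e0)//.
by rewrite ler_wpM2r// expr2 ler_piMl// ltW.
Qed.

(** At a fixed scale the centres vary. The constant depends on e, and only the L^1 norm of the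
    right-hand side enters. *)
Lemma avg_center (lam M e : R) : 0 <= M -> 0 < e <= 1 -> exists2 C : R, 0 <= C &
  forall U u h F k f g z, cbox kap `<=` U -> cbox 2 z ->
  wsol lam M U u h F k f g ->
  `|avg u e z - avg u e 0| <= C * \int[vol]_w (\1_(cbox kap) w * Gf h f g w).
Proof.
move=> M0 e01; have [C C0 HC] := rep_bound lam M0 (kap_rep e01 e01).
exists C => // U u h F k f g z kU z2 ws; have /andP[e0 e1] := e01.
have := HC (exist _ z z2) _ _ _ _ _ _ _ kU ws; have su : sq u by case: ws.
have tm (q : P) : sq (mol e q).
  apply: (@tst_sq _ _ setT).
  rewrite (_ : mol e q = fun y => e^-1 ^+ hdim * bumpf (Psi (sval q) e y)); last by apply/funext => y; exact: molE.
  by apply: tstZ; exact: (tst_Psi B_blk blk_le (lt0r_neq0 e0) (@tst_bumpf R n)).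
under [in X in `|X|]eq_Rintegral => w _ do rewrite mulrBr.
by rewrite IntB; [|exact: sq_mul su (tm _)|exact: sq_mul su (tm _)]; rewrite !Int_mol.
Qed.

Lemma shift_int (e : R) v (f : pt -> \bar R) : measurable_fun setT f -> (forall y, 0 <= f y)%E ->
  (\int[vol]_z f (Phi z e v) = \int[vol]_z f z)%E.
Proof.
move=> mf f0; rewrite (@ge0_int_cov _ _ _ _ _ vol vol (fun z => Phi z e v) 1%:nng) ?mul1e//.
  exact: measurable_Phi_left.
by move=> A mA; apply: vol_Phi_left.
Qed.

Lemma measurable_shift (e : R) : measurable_fun setT (fun x : pt * pt => Phi x.2 e x.1).
Proof. exact: (measurableT_comp (measurable_Phi2 B_blk blk_le e) (@measurable_swap _ _ _ _)). Qed.

Definition vc (s : R) : R := fine (vol (@cbox R n s)).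

Lemma vcE s : vol (@cbox R n s) = (vc s)%:E.
Proof. by rewrite /vc fineK// ge0_fin_numE// vol_cbox_lty. Qed.

Lemma vc_ge0 s : 0 <= vc s. Proof. by rewrite fine_ge0. Qed.

Lemma sq_shift_avg (s e : R) b p : 0 < e -> sq b -> supp s b -> sq p ->
  let t z := \1_(cbox 2) z * \int[vol]_w (b w * p (Phi z e w)) in
  sq t /\ \int[vol]_z t z ^+ 2 <= (\int[vol]_w b w ^+ 2) * (vc s * \int[vol]_z p z ^+ 2).
Proof.
move=> e0 sb b0 sp.
apply: (@sq_average _ _ s 2 _ b (fun x => p (Phi x.2 e x.1)) sb b0).
- exact: (measurableT_comp (sq_meas sp) (measurable_shift e)).
- by move=> z; apply: sq_cut; exact: sq_Phi.
have mp2 : measurable_fun setT (EFin \o (fun z => p z ^+ 2)).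
  by apply/measurable_EFinP; apply: measurable_funX; exact: sq_meas sp.
apply: le_trans (int_shift_le s 2 (measurable_shift e) (fun v f => @shift_int e v f) mp2 _) _.
  by move=> y; rewrite lee_fin sqr_ge0.
by rewrite vcE EFinM -(IntE (sq_intg2 sp)).
Qed.

Lemma avg_to_id u (e eta : R) : sq u -> 0 < e <= 1 -> 0 < eta -> exists L : nat,
  nrm (fun z => \1_(cbox 2) z * avg u (e / 2 ^+ L) z - @mass R n * (\1_(cbox 2) z * u z)) <= eta.
Proof.
move=> su /andP[e0 e1] eta0.
pose s_ (L : nat) (x : pt * pt) := Phi x.2 (e / 2 ^+ L) x.1.
have eL0 (L : nat) : 0 < e / 2 ^+ L by rewrite divr_gt0 ?exprn_gt0.
have sc v z : cbox 1 v -> s_ L (v, z) @[L --> \oo] --> z.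
  by apply: (cvg_Phi_dyadic B_blk blk_le); rewrite e0.
have ms L : measurable_fun setT (s_ L) by exact: measurable_shift.
have B0 : 0 <= \int[vol]_w (@bumpf R n w) ^+ 2 by apply: Int_ge0 => w; exact: sqr_ge0.
set Bb := \int[vol]_w bumpf w ^+ 2 in B0.
have eta1 : 0 < eta ^+ 2 / (Bb + 1) by rewrite divr_gt0 ?exprn_gt0// ltr_wpDl.
have [L _ HL] := avg_cvg 2 ms (fun L v f => @shift_int (e / 2 ^+ L) v f) sc su eta1.
exists L; have {}HL := HL L (leqnn L).
have sb := tst_sq (@tst_bumpf R n).
have := @sq_average _ _ 1 2 _ bumpf (fun x => u (s_ L x) - u x.2) sb (@bumpf_eq0 R n) _ _ HL.
case.
- apply: measurable_funB; first exact: (measurableT_comp (sq_meas su) (ms L)).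
  exact: (measurableT_comp (sq_meas su) measurable_snd).
- move=> z; have := sqB (sq_cut 1 (sq_Phi B_blk blk_le z (eL0 L) su)) (sqZ (u z) (sq_ind 1)).
  by congr (sq_of _ _); apply/funext => w; rewrite /s_ /=; ring.
set t := (fun z => _) => st tb.
have -> : (fun z => \1_(cbox 2) z * avg u (e / 2 ^+ L) z - @mass R n * (\1_(cbox 2) z * u z)) = t.
  apply/funext => z; rewrite /t mulrCA -mulrBr; congr (_ * _).
  have i1 : intg (fun w => bumpf w * u (Phi z (e / 2 ^+ L) w)).
    exact: sq_mul sb (sq_Phi B_blk blk_le z (eL0 L) su).
  have i2 : intg (fun w => u z * bumpf w) by apply: intgZ; exact: tst_intg (@tst_bumpf R n).
  have -> : @mass R n * u z = \int[vol]_w (u z * @bumpf R n w).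
    by rewrite mulrC IntZ//; exact: tst_intg (@tst_bumpf R n).
  by rewrite -(IntB i1 i2); apply: eq_Rintegral => w _; rewrite /s_ /=; ring.
rewrite -ler_sqr ?nnegrE ?nrm_ge0 ?(ltW eta0)// nrm_sqr (le_trans tb)//.
rewrite -/Bb mulrCA ler_piMr ?exprn_ge0 ?(ltW eta0)//; exact: frac_le1.
Qed.

(** Averages at the scales e / 2^L tend to [mass] times u. The sum of the dyadic differences is
    bounded in L^2 by a multiple of e, small by the choice of e; the average at scale e differs from
    its value at 0 by an L^1 norm with a large constant. The constant c is that value divided by
    [mass]. *)
Lemma poincare (lam M kap1 : R) : 0 <= M -> 2 <= kap1 -> kap <= kap1 ->
  (forall z w (e : R), cbox 2 z -> cbox kap w -> 0 <= e <= 1 -> cbox kap1 (Phi z e w)) ->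
  forall th : R, 0 < th -> exists2 C : R, 0 <= C &
  forall U u h F k f g, cbox kap1 `<=` U -> wsol lam M U u h F k f g -> exists c : R,
  \int[vol]_z (\1_(cbox 2) z * (u z - c) ^+ 2) <=
    th * \int[vol]_z (\1_(cbox kap1) z * Gf h f g z ^+ 2)
    + C * (\int[vol]_z (\1_(cbox kap1) z * Gf h f g z)) ^+ 2.
Proof.
move=> M0 k2 kk PB th th0.
have [C1 C10 HC1] := avg_dyadic lam M0.
have m0 := @mass_gt0 R n; set m := @mass R n in m0.
pose V := Num.sqrt (vc kap * vc kap).
pose a := 2 * (2 * C1 * V) ^+ 2 / m ^+ 2.
have a0 : 0 <= a by exact: divr_ge0 (mulr_ge0 (ler0n _ 2) (sqr_ge0 _)) (sqr_ge0 _).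
(* The fine scales contribute a e^2 times the L^2 term; the two bounds on e give a e^2 <= th. *)
pose e := Num.min 1 (th / (a + 1)).
have a1 : 0 < a + 1 by lra.
have e0 : 0 < e by rewrite lt_min ltr01 divr_gt0.
have e1 : e <= 1 by rewrite ge_min lexx.
have eth : e <= th / (a + 1) by rewrite ge_min lexx orbT.
have e01 : 0 < e <= 1 by rewrite e0.
have [C2 C20 HC2] := avg_center lam M0 e01.
exists (2 * C2 ^+ 2 * vc 2 / m ^+ 2).
  exact: divr_ge0 (mulr_ge0 (mulr_ge0 (ler0n _ 2) (sqr_ge0 _)) (vc_ge0 _)) (sqr_ge0 _).
move=> U u h F k f g kU ws; exists (avg u e 0 / m).
have su : sq u by case: ws.
have sG := sq_Gf ws; have sG1 := sq_cut kap1 sG.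
pose g1 z := \1_(cbox kap1) z * Gf h f g z.
have g10 z : 0 <= g1 z by rewrite mulr_ge0 ?indicE ?Gf_ge0.
pose T (L : nat) z := \1_(cbox 2) z * avg u (e / 2 ^+ L) z.
have eL (L : nat) : 0 < e / 2 ^+ L <= 1.
  rewrite divr_gt0 ?exprn_gt0//= ler_pdivrMr ?exprn_gt0// mul1r (le_trans e1)//.
  by rewrite exprn_ege1// ler1n.
have sT L : sq (T L).
  have /andP[eL0 _] := eL L.
  by have [] := sq_shift_avg eL0 (tst_sq (@tst_bumpf R n)) (@bumpf_eq0 R n) su.
pose J (L : nat) z := \1_(cbox 2) z * \int[vol]_w ((\1_(cbox kap) w : R) * g1 (Phi z (e / 2 ^+ L) w)).
have ik0 : supp kap (\1_(@cbox R n kap)) by move=> z zk; rewrite indicE memNset.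
have sqi (s : R) z : (\1_(@cbox R n s) z : R) ^+ 2 = \1_(cbox s) z.
  by rewrite indicE; case: (_ \in _); rewrite ?expr1n ?expr0n.
have Iv (s : R) : \int[vol]_z (\1_(@cbox R n s) z : R) = vc s.
  rewrite /vc /Rintegral integral_indic ?setIT//; exact: measurable_cbox.
have JB L : sq (J L) /\ nrm (J L) <= V * nrm g1.
  have /andP[eL0 _] := eL L.
  have [sJ HJ] := sq_shift_avg eL0 (sq_ind kap) ik0 sG1.
  split=> //; rewrite -ler_sqr ?nnegrE ?mulr_ge0 ?nrm_ge0 ?sqrtr_ge0// exprMn !nrm_sqr.
  apply: (le_trans HJ); rewrite sqr_sqrtr ?mulr_ge0 ?vc_ge0// mulrA.
  by under eq_Rintegral => z _ do rewrite sqi; rewrite Iv.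
have i2 z : 0 <= (\1_(@cbox R n 2) z : R) by rewrite indicE.
have step L : nrm (fun z => T L z - T L.+1 z) <= C1 * (e / 2 ^+ L) * (V * nrm g1).
  have [sJ HJ] := JB L; have /andP[eL0 eL1] := eL L.
  have ce0 : 0 <= C1 * (e / 2 ^+ L) by rewrite mulr_ge0// ltW.
  apply: (@le_trans _ _ (nrm (fun z => C1 * (e / 2 ^+ L) * J L z))); last first.
    by rewrite nrmZ// ger0_norm// ler_wpM2l.
  apply: nrm_le => [||z]; [exact: sqB|exact: sqZ|].
  rewrite /T /J -mulrBr indicE; have [z2|z2] := pselect (cbox 2 z); last by rewrite memNset// mul0r normr0.
  rewrite mem_set// !mul1r.
  have -> : e / 2 ^+ L.+1 = e / 2 ^+ L / 2 by rewrite exprSr invfM mulrA.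
  have zU w : cbox kap w -> U (Phi z (e / 2 ^+ L) w).
    by move=> wk; apply: kU; apply: PB => //; rewrite (ltW eL0).
  apply: le_trans (HC1 _ _ _ _ _ _ _ _ _ (eL L) zU ws) _.
  rewrite [leRHS]ger0_norm; last first.
    by rewrite mulr_ge0// Int_ge0// => w; rewrite mulr_ge0 ?indicE.
  rewrite le_eqVlt; apply/orP; left; apply/eqP; congr (_ * _); apply: eq_Rintegral => w _.
  rewrite /g1 !indicE; have [wk|wk] := pselect (cbox kap w); last by rewrite (memNset wk) !mul0r.
  by rewrite (mem_set wk) mem_set ?mul1r//; apply: PB => //; rewrite (ltW eL0).
(* The differences decrease geometrically in L, so that all of them together are at most 2 [S]. *)
pose S := C1 * e * (V * nrm g1).
have S0 : 0 <= S by rewrite /S !mulr_ge0 ?(ltW e0) ?nrm_ge0 ?sqrtr_ge0.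
have tele L : nrm (fun z => T 0%N z - T L z) <= 2 * S * (1 - 2 ^- L).
  elim: L => [|L IH].
    rewrite expr0 invr1 subrr mulr0 /nrm.
    under eq_Rintegral => z _ do rewrite subrr expr0n /=.
    by rewrite Int0 sqrtr0.
  apply: (@le_trans _ _ (nrm (fun z => T 0%N z - T L z) + nrm (fun z => T L z - T L.+1 z))).
    apply: le_trans (nrmD (sqB (sT _) (sT _)) (sqB (sT _) (sT _))).
    rewrite le_eqVlt; apply/orP; left; apply/eqP; congr (nrm_of _ _).
    by apply/funext => z; ring.
  apply: (le_trans (lerD IH (step L))).
  have -> : C1 * (e / 2 ^+ L) * (V * nrm g1) = S * 2 ^- L by rewrite /S; ring.
  have p0 : (2 : R) ^+ L != 0 by rewrite expf_neq0.
  by rewrite exprS le_eqVlt; apply/orP; left; apply/eqP; field.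
have s2u : sq (fun z => \1_(cbox 2) z * u z) by exact: sq_cut.
have H1 : nrm (fun z => T 0%N z - m * (\1_(cbox 2) z * u z)) <= 2 * S.
  apply/ler_addgt0Pr => eta eta0.
  have [L HL] := avg_to_id su e01 eta0.
  apply: (@le_trans _ _ (nrm (fun z => T 0%N z - T L z) + nrm (fun z => T L z - m * (\1_(cbox 2) z * u z)))).
    apply: le_trans (nrmD (sqB (sT _) (sT _)) (sqB (sT _) (sqZ m s2u))).
    rewrite le_eqVlt; apply/orP; left; apply/eqP; congr (nrm_of _ _).
    by apply/funext => z; ring.
  apply: lerD => //; apply: (le_trans (tele L)).
  apply: ler_piMr; first exact: mulr_ge0 (ler0n _ 2) S0.
  by rewrite gerBl invr_ge0 exprn_ge0.
pose W := C2 * \int[vol]_z g1 z.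
have ig1 : intg g1 by exact: sq_mul (sq_ind kap1) sG.
have W0 : 0 <= W by rewrite mulr_ge0 ?Int_ge0.
have H2 : nrm (fun z => T 0%N z - avg u e 0 * \1_(cbox 2) z) <= W * Num.sqrt (vc 2).
  apply: (@le_trans _ _ (nrm (fun z => W * \1_(cbox 2) z))); last first.
    rewrite nrmZ ?(ger0_norm W0) ?ler_wpM2l//; last exact: sq_ind.
    by rewrite /nrm; under eq_Rintegral => z _ do rewrite sqi; rewrite Iv.
  apply: nrm_le => [||z]; [|by apply: sqZ; exact: sq_ind|].
    by apply: sqB => //; apply: sqZ; exact: sq_ind.
  rewrite /T expr0 divr1 indicE; have [z2|z2] := pselect (cbox 2 z); last first.
    by rewrite memNset// mul0r !mulr0 subrr.
  rewrite mem_set// mul1r !mulr1 [leRHS]ger0_norm//.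
  have kU' : cbox kap `<=` U by move=> w wk; apply: kU => o; rewrite (le_trans (wk o)).
  apply: le_trans (HC2 _ _ _ _ _ _ _ _ kU' z2 ws) _; rewrite ler_wpM2l//.
  apply: Int_le => // [|w]; first exact: sq_mul (sq_ind kap) sG.
  rewrite ler_wpM2r ?Gf_ge0// !indicE; have [wk|wk] := pselect (cbox kap w); last by rewrite (memNset wk).
  by rewrite mem_set// mem_set// => o; rewrite (le_trans (wk o)).
have H3 : m * nrm (fun z => \1_(cbox 2) z * (u z - avg u e 0 / m)) <= 2 * S + W * Num.sqrt (vc 2).
  have sQ : sq (fun z => \1_(cbox 2) z * (u z - avg u e 0 / m)).
    have := sqB s2u (sqZ (avg u e 0 / m) (sq_ind 2)); congr (sq_of _ _).
    by apply/funext => z; ring.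
  rewrite -[m in m * _]gtr0_norm// -nrmZ//.
  have sA := sqB (sT 0%N) (sqZ m s2u); have sB := sqB (sT 0%N) (sqZ (avg u e 0) (sq_ind 2)).
  apply: (@le_trans _ _ (nrm (fun z => T 0%N z - m * (\1_(cbox 2) z * u z)) + nrm (fun z => T 0%N z - avg u e 0 * \1_(cbox 2) z))); last exact: lerD.
  have -> : nrm (fun z => T 0%N z - m * (\1_(cbox 2) z * u z)) = nrm (fun z => -1 * (T 0%N z - m * (\1_(cbox 2) z * u z))).
    by rewrite nrmZ// normrN1 mul1r.
  apply: le_trans (nrmD (sqZ (-1) sA) sB).
  rewrite le_eqVlt; apply/orP; left; apply/eqP; congr (nrm_of _ _).
  by apply/funext => z; field; rewrite gt_eqF.
have H4 : m ^+ 2 * \int[vol]_z (\1_(cbox 2) z * (u z - avg u e 0 / m) ^+ 2) <=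
    2 * (2 * S) ^+ 2 + 2 * (W * Num.sqrt (vc 2)) ^+ 2.
  have -> : \int[vol]_z (\1_(cbox 2) z * (u z - avg u e 0 / m) ^+ 2) =
     nrm (fun z => \1_(cbox 2) z * (u z - avg u e 0 / m)) ^+ 2.
    by rewrite nrm_sqr; apply: eq_Rintegral => z _; rewrite exprMn sqi.
  rewrite -exprMn; set X1 := m * _ in H3 *; set X2 := 2 * S in H3 *; set X3 := W * _ in H3 *.
  have X10 : 0 <= X1 by rewrite mulr_ge0 ?(ltW m0) ?nrm_ge0.
  apply: sqr_le_add2 X10 H3.
have m2 : 0 < m ^+ 2 by rewrite exprn_gt0.
rewrite -(ler_pM2l m2) (le_trans H4)// mulrDr; apply: lerD.
  have -> : 2 * (2 * S) ^+ 2 = m ^+ 2 * (a * e * e * nrm g1 ^+ 2) by rewrite /S /a; field; rewrite gt_eqF.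
  rewrite ler_pM2l// nrm_sqr.
  have -> : \int[vol]_x g1 x ^+ 2 = \int[vol]_z (\1_(cbox kap1) z * Gf h f g z ^+ 2).
    by apply: eq_Rintegral => z _; rewrite exprMn sqi.
  rewrite ler_wpM2r//; first by apply: Int_ge0 => z; rewrite mulr_ge0 ?sqr_ge0 ?indicE.
  apply: (@le_trans _ _ (a * e)); first exact: ler_piMr (mulr_ge0 a0 (ltW e0)) e1.
  apply: (@le_trans _ _ ((a + 1) * (th / (a + 1)))); last by rewrite mulrCA divff ?mulr1 ?gt_eqF.
  by rewrite ler_pM ?(ltW e0)// lerDl.
rewrite exprMn sqr_sqrtr ?vc_ge0// /W le_eqVlt; apply/orP; left; apply/eqP.
by field; rewrite gt_eqF.
Qed.

End poincare.

(** * The reverse Holder inequality *)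

Lemma reverse_holder_alg (R : realFieldType) (N Cc Cp th vk i1 s2 j2 IG2 IG1 IH2 IH1 IP2 IP1 u2 : R) :
  0 <= N -> 0 <= Cc -> 0 <= Cp -> 0 < th -> 0 <= vk -> 0 <= IH2 -> 0 <= IP2 ->
  i1 <= N * s2 -> s2 <= Cc * (u2 + j2) -> j2 <= IP2 ->
  u2 <= th / (2 * N * Cc + 1) * IG2 + Cp * IG1 ^+ 2 -> IG2 <= 2 * IH2 + 2 * IP2 -> IG1 = IH1 + IP1 ->
  IP1 ^+ 2 <= vk * IP2 ->
  i1 <= th * IH2 + N * Cc * (2 * (th / (2 * N * Cc + 1)) + 2 * Cp * (1 + vk) + 1) * (IH1 ^+ 2 + IP2).
Proof.
move=> N0 Cc0 Cp0 th0 vk0 IH20 IP20 h1 h2 h3 h4 h5 E1 h6; rewrite E1 in h4.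
have D0 : 0 < 2 * N * Cc + 1 by have := mulr_ge0 N0 Cc0; lra.
(* The parameter given to the Poincare inequality: 2 N Cc t <= th, which compensates the Caccioppoli
   constant. *)
set t := th / (2 * N * Cc + 1) in h4 *.
have t0 : 0 <= t by rewrite divr_ge0 ?ltW.
have NC : 0 <= N * Cc by exact: mulr_ge0.
have tE : 2 * (N * Cc) * t <= th.
  have -> : th = (2 * N * Cc + 1) * t by rewrite /t mulrC divfK ?gt_eqF.
  lra.
have h7 : (IH1 + IP1) ^+ 2 <= 2 * IH1 ^+ 2 + 2 * (vk * IP2) by have := sqr_ge0 (IH1 - IP1); nra.
have h8 : u2 <= t * (2 * IH2 + 2 * IP2) + Cp * (2 * IH1 ^+ 2 + 2 * (vk * IP2)).
  by apply: (le_trans h4); apply: lerD; rewrite ler_wpM2l.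
have h9 : i1 <= N * (Cc * (u2 + j2)) by rewrite (le_trans h1)// ler_wpM2l.
apply: (le_trans h9); rewrite mulrA.
have := ler_wpM2l NC (lerD h8 h3); move/le_trans; apply.
have X0 : 0 <= IH1 ^+ 2 by exact: sqr_ge0.
set a := N * Cc in NC tE *; set X := IH1 ^+ 2 in X0 *; clearbody a t X.
have e1 := ler_wpM2r IH20 tE.
have e2 : 0 <= a * t * X by rewrite !mulr_ge0.
have e3 : 0 <= a * Cp * vk * X by rewrite !mulr_ge0.
have e4 : 0 <= a * Cp * IP2 by rewrite !mulr_ge0.
have e5 : 0 <= a * X by rewrite !mulr_ge0.
lra.
Qed.

Lemma sum_sqr_le (R : realFieldType) (k : nat) (P : pred 'I_k) (a : 'I_k -> R) :
  \sum_(i | P i) a i ^+ 2 <= (\sum_(i | P i) `|a i|) ^+ 2.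
Proof.
have [//] : \sum_(i | P i) a i ^+ 2 <= (\sum_(i | P i) `|a i|) ^+ 2 /\ 0 <= \sum_(i | P i) `|a i|.
elim/big_rec2: _ => [|i x y _ [xy x0]]; first by rewrite expr0n.
by rewrite addr_ge0//; split=> //; rewrite -(real_normK (num_real (a i))); have := normr_ge0 (a i); nra.
Qed.

Section reverse_holder.
Context {R : realType} {n : nat}.
Local Notation pt := ('cV[R]_n * R)%type.
Local Notation idx := (option 'I_n).
Variables (B : 'M[R]_n) (blk : 'I_n -> nat) (r : nat).
Hypothesis B_blk : forall i j, B i j != 0 -> blk j = (blk i).+1.
Hypothesis blk_ord : forall i j : 'I_n, (blk i < blk j)%N -> (i < j)%N.
Hypothesis blk_le : forall i, (blk i <= r)%N.
Hypothesis B_rank : forall j, (0 < blk j)%N -> exists c : 'I_n -> R,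
  (forall i, c i != 0 -> (blk i).+1 = blk j) /\
  forall l, \sum_i c i * B i l = (l == j)%:R.
Local Notation fb := (fb blk).
Local Notation wsol := (wsol B blk).
Local Notation Phi := (Phi B blk r).
Local Notation bx := (bx B blk r).
Local Notation hdim := (hdim blk).
Local Notation sq := (sq (@vol R n)).
Local Notation intg := (intg (@vol R n)).
Implicit Types (z w y v q : pt) (o : idx) (p a b : pt -> R).

Definition hsum (h : 'I_n -> pt -> R) z : R := \sum_(i | fb i) `|h i z|.
Definition psum (f : 'I_n -> pt -> R) (g : pt -> R) z : R := hsum f z + `|g z|.

Lemma hsum_ge0 h z : 0 <= hsum h z. Proof. exact: sumr_ge0. Qed.

Lemma psum_ge0 f g z : 0 <= psum f g z. Proof. by rewrite addr_ge0 ?hsum_ge0. Qed.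

Lemma sq_hsum h : (forall i, fb i -> sq (h i)) -> sq (hsum h).
Proof. by move=> sh; apply: sq_sum => i fi; apply: sq_abs; exact: sh. Qed.

Lemma sq_psum f g : (forall i, fb i -> sq (f i)) -> sq g -> sq (psum f g).
Proof. by move=> sf sg; apply: sqD; [exact: sq_hsum|exact: sq_abs]. Qed.

Lemma Int_ind_le A (f g : pt -> R) : measurable A -> intg f -> intg g -> (forall z, f z <= g z) ->
  \int[vol]_z (\1_A z * f z) <= \int[vol]_z (\1_A z * g z).
Proof.
move=> mA fi gi fg.
have mi : measurable_fun setT (\1_A : pt -> R) by exact: measurable_indic.
have b1 z : `|(\1_A z : R)| <= 1 by rewrite indicE; case: (_ \in _); rewrite ?normr1 ?normr0.
apply: Int_le => [||z]; [exact: intgMb mi b1 fi|exact: intgMb mi b1 gi|].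
by rewrite ler_wpM2l ?indicE.
Qed.

Lemma Int_ind_sub (A A' : set pt) (f : pt -> R) : measurable A -> measurable A' -> intg f -> (forall z, 0 <= f z) ->
  A `<=` A' -> \int[vol]_z (\1_A z * f z) <= \int[vol]_z (\1_A' z * f z).
Proof.
move=> mA mA' fi f0 AA.
have b1 (D : set pt) z : `|(\1_D z : R)| <= 1 by rewrite indicE; case: (_ \in _); rewrite ?normr1 ?normr0.
apply: Int_le => [||z].
- by apply: (intgMb _ (b1 A) fi); exact: measurable_indic.
- by apply: (intgMb _ (b1 A') fi); exact: measurable_indic.
rewrite ler_wpM2r// !indicE; have [Az|Az] := pselect (A z); last by rewrite (memNset Az).
by rewrite !mem_set//; exact: AA.
Qed.

Lemma reverse_holder_unit (lam M : R) : 0 < lam -> 0 <= M -> exists2 kap : R, 2 <= kap &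
  forall th : R, 0 < th -> exists2 C : R, 0 <= C &
  forall U u h F k f g, cbox kap `<=` U -> wsol lam M U u h F k f g ->
  \int[vol]_z (\1_(cbox 1) z * hsum h z ^+ 2) <=
   th * \int[vol]_z (\1_(cbox kap) z * hsum h z ^+ 2)
   + C * ((\int[vol]_z (\1_(cbox kap) z * hsum h z)) ^+ 2
          + \int[vol]_z (\1_(cbox kap) z * psum f g z ^+ 2)).
Proof.
move=> lam0 M0; have [kap0 kap3 kap_rep] := mol_difference B_blk blk_le B_rank.
(* The averages in the Poincare inequality at points of [cbox 2] look at [Phi z e w] with w in
   [cbox kap0]; [kap] is chosen to contain all of these, and 2 and [kap0] too. *)
have [kap k0 kapP] := Phi_bounded B blk r (Num.max 2 kap0) kap0.
have k2 : 2 <= kap by rewrite (le_trans _ k0)// le_max lexx.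
have kk : kap0 <= kap by rewrite (le_trans _ k0)// le_max lexx orbT.
exists kap => // th th0; have [Cc Cc0 HC] := caccioppoli B_blk blk_ord blk_le lam0 M0.
set N : R := n.+1%:R; have N0 : 0 <= N by rewrite ler0n.
pose th' := th / (2 * N * Cc + 1).
have th'0 : 0 < th' by rewrite divr_gt0// ltr_wpDl// !mulr_ge0.
have PB z w (e : R) : cbox 2 z -> cbox kap0 w -> 0 <= e <= 1 -> cbox kap (Phi z e w).
  by move=> z2; apply: kapP => o; rewrite (le_trans (z2 o))// le_max lexx.
have [Cp Cp0 HP] := poincare B_blk blk_ord blk_le kap_rep lam M0 k2 kk PB th'0.
exists (N * Cc * (2 * th' + 2 * Cp * (1 + @vc R n kap) + 1)).
  have v1 : 0 <= 1 + @vc R n kap by rewrite addr_ge0 ?vc_ge0.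
  have t1 : 0 <= 2 * th' + 2 * Cp * (1 + @vc R n kap) + 1.
    exact: addr_ge0 (addr_ge0 (mulr_ge0 (ler0n _ 2) (ltW th'0)) (mulr_ge0 (mulr_ge0 (ler0n _ 2) Cp0) v1)) ler01.
  exact: mulr_ge0 (mulr_ge0 N0 Cc0) t1.
move=> U u h F k f g kU ws.
have [c Hc] := HP _ _ _ _ _ _ _ kU ws.
have c2U : cbox 2 `<=` U by move=> z z2; apply: kU => o; rewrite (le_trans (z2 o)).
have := HC _ _ _ _ _ _ _ c c2U ws.
have [su sh sF sk sf sg _ _ _ _ _] := ws.
have sH := sq_hsum sh; have sP := sq_psum sf sg.
have mk s := @measurable_cbox R n s.
have i1 s (p : pt -> R) : intg p -> intg (fun z => \1_(cbox s) z * p z).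
  by move=> ip; apply: intgMb (ind_meas s) (ind_le1 s) ip.
have sh2 : intg (fun z => \sum_(i | fb i) h i z ^+ 2).
  by apply: intg_sum => i fi; exact: sq_intg2 (sh _ fi).
have sf2 : intg (fun z => g z ^+ 2 + \sum_(i | fb i) f i z ^+ 2).
  by apply: intgD; [exact: sq_intg2|apply: intg_sum => i fi; exact: sq_intg2 (sf _ fi)].
have sGE : Gf blk h f g = fun z => hsum h z + psum f g z.
  by apply/funext => z; rewrite /Gf /psum addrA.
rewrite sGE in Hc.
have iu : intg (fun z => \1_(cbox 2) z * (u z - c) ^+ 2).
  have := sq_intg2 (sqB (sq_cut 2 su) (sqZ c (sq_ind 2))); congr (intg_of _ _); apply/funext => z.
    by rewrite indicE; case: (_ \in _) => /=; ring.
set u2 := \int[vol]_z (\1_(cbox 2) z * (u z - c) ^+ 2) in Hc.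
have -> : \int[vol]_z (\1_(cbox 2) z * ((u z - c) ^+ 2 + g z ^+ 2 + \sum_(i | fb i) f i z ^+ 2)) =
   u2 + \int[vol]_z (\1_(cbox 2) z * (g z ^+ 2 + \sum_(i | fb i) f i z ^+ 2)).
  by rewrite /u2 -(IntD iu (i1 2 _ sf2)); apply: eq_Rintegral => z _; rewrite -addrA mulrDr.
set j2 := \int[vol]_z (\1_(cbox 2) z * (g z ^+ 2 + _)) => HCc.
apply: (@reverse_holder_alg _ N Cc Cp th (@vc R n kap) _ _ j2 _ _ _ _ _ (\int[vol]_z (\1_(cbox kap) z * psum f g z)) u2 N0 Cc0 Cp0 th0 (@vc_ge0 R n kap) _ _ _ HCc _ Hc).
- by apply: Int_ge0 => z; rewrite mulr_ge0 ?indicE ?sqr_ge0.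
- by apply: Int_ge0 => z; rewrite mulr_ge0 ?indicE ?sqr_ge0.
- rewrite -IntZ ?i1//; apply: (@le_trans _ _ (\int[vol]_z (\1_(cbox 1) z * (N * \sum_(i | fb i) h i z ^+ 2)))).
    apply: Int_ind_le => //; [exact: sq_intg2|exact: intgZ|move=> z].
    rewrite /hsum; apply: le_trans (sqr_sum_le _ _) _; rewrite ler_wpM2l//.
    by apply: ler_sum => i _; rewrite real_normK ?num_real.
  by rewrite le_eqVlt; apply/orP; left; apply/eqP; apply: eq_Rintegral => z _; rewrite mulrCA.
- apply: (@le_trans _ _ (\int[vol]_z (\1_(cbox 2) z * psum f g z ^+ 2))).
    apply: Int_ind_le => //; [exact: sq_intg2|move=> z].
    rewrite /psum /hsum -(real_normK (num_real (g z))) sqrrD [leLHS]addrC lerD2r.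
    rewrite (le_trans (sum_sqr_le (fun i => fb i) (fun i => f i z)))// lerDl mulrn_wge0//.
    by rewrite mulr_ge0// sumr_ge0.
  apply: Int_ind_sub => //; [exact: sq_intg2|by move=> z; rewrite sqr_ge0|].
  by move=> z z2 o; rewrite (le_trans (z2 o)).
- have -> : 2 * (\int[vol]_z (\1_(cbox kap) z * hsum h z ^+ 2)) + 2 * (\int[vol]_z (\1_(cbox kap) z * psum f g z ^+ 2)) =
    \int[vol]_z (\1_(cbox kap) z * (2 * hsum h z ^+ 2 + 2 * psum f g z ^+ 2)).
    rewrite -!IntZ ?i1//; [|exact: sq_intg2|exact: sq_intg2].
    rewrite -IntD; [|by apply: intgZ; apply: i1; exact: sq_intg2|by apply: intgZ; apply: i1; exact: sq_intg2].
    by apply: eq_Rintegral => z _; ring.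
  apply: Int_ind_le => //; [exact: sq_intg2 (sqD sH sP)|by apply: intgD; apply: intgZ; exact: sq_intg2|move=> z].
  by have := sqr_ge0 (hsum h z - psum f g z); nra.
- rewrite -IntD; [|exact: sq_mul (sq_ind kap) sH|exact: sq_mul (sq_ind kap) sP].
  by apply: eq_Rintegral => z _; rewrite mulrDr.
have := cauchy_schwarz (sq_ind kap) (sq_cut kap sP).
have sqi z : (\1_(@cbox R n kap) z : R) ^+ 2 = \1_(cbox kap) z.
  by rewrite indicE; case: (_ \in _); rewrite ?expr1n ?expr0n.
have -> : \int[vol]_x (\1_(@cbox R n kap) x : R) ^+ 2 = @vc R n kap.
  under eq_Rintegral => z _ do rewrite sqi.
  by rewrite /vc /Rintegral integral_indic ?setIT.
under [in X in X -> _]eq_Rintegral => z _ do rewrite mulrA -expr2 sqi.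
by under [in X in _ <= _ * X -> _]eq_Rintegral => z _ do rewrite exprMn sqi.
Qed.

(** The unit version pulled back by [Phi q e]. Quadratic integrals acquire the common factor e^2
    e^-hdim, and the squared L^1 integral one more e^-hdim. *)
Lemma reverse_holder (lam M : R) : 0 < lam -> 0 <= M -> exists2 kap : R, 2 <= kap &
  forall th : R, 0 < th -> exists2 C : R, 0 <= C &
  forall U u h F k f g, wsol lam M U u h F k f g -> forall q (e : R), 0 < e <= 1 ->
  bx q (kap * e) `<=` U ->
  \int[vol]_z (\1_(bx q e) z * hsum h z ^+ 2) <=
   th * \int[vol]_z (\1_(bx q (kap * e)) z * hsum h z ^+ 2)
   + C * (e ^- hdim * (\int[vol]_z (\1_(bx q (kap * e)) z * hsum h z)) ^+ 2
          + \int[vol]_z (\1_(bx q (kap * e)) z * psum f g z ^+ 2)).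
Proof.
move=> lam0 M0; have [kap k2 H] := reverse_holder_unit lam0 M0.
exists kap => // th th0; have [C C0 HC] := H th th0.
exists C => // U u h F k f g ws q e /andP[e0 e1] qU.
have ws' := wsol_Phi B_blk blk_le q e0 ws.
have k1 : 1 <= kap by rewrite (le_trans _ k2)// ler1n.
have kb w : cbox kap w -> bx q (kap * e) (Phi q e w).
  by move=> wk; apply: bx_scale => //; rewrite PhiK ?gt_eqF.
have kU : cbox kap `<=` Phi q e @^-1` U by move=> w /kb/qU.
have := HC _ _ _ _ _ _ _ kU ws'.
have [su sh sF sk sf sg _ _ _ _ _] := ws.
have sH := sq_hsum sh; have sP := sq_psum sf sg.
have hE : hsum (fun i w => e * h i (Phi q e w)) = fun w => e * hsum h (Phi q e w).
  by apply/funext => w; rewrite /hsum mulr_sumr; apply: eq_bigr => i _; rewrite normrM gtr0_norm.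
rewrite hE.
(* Here e <= 1 matters: g scales by e^2 and not by e. *)
have pE w : psum (fun i w => e * f i (Phi q e w)) (fun w => e ^+ 2 * g (Phi q e w)) w <= e * psum f g (Phi q e w).
  rewrite /psum mulrDr; apply: lerD.
    by rewrite /hsum mulr_sumr; apply: ler_sum => i _; rewrite normrM gtr0_norm.
  rewrite normrM gtr0_norm ?exprn_gt0// ler_wpM2r// expr2.
  exact: ler_piMr (ltW e0) e1.
have sE : e ^- hdim > 0 by rewrite invr_gt0 exprn_gt0.
set s := e ^- hdim in sE *.
have mb x := measurable_bx B blk r q x.
have b1 (D : set pt) z : `|(\1_D z : R)| <= 1 by rewrite indicE; case: (_ \in _); rewrite ?normr1 ?normr0.
have i1 x (p : pt -> R) : intg p -> intg (fun z => \1_(bx q x) z * p z).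
  by move=> ip; apply: (intgMb _ (b1 _) ip); exact: measurable_indic.
have ik x (p : pt -> R) : intg p -> intg (fun z => \1_(cbox x) z * p z).
  by move=> ip; apply: (intgMb (ind_meas x) (b1 _) ip).
have sv (D : set pt) : measurable D -> (vol D < +oo)%E -> forall p, sq p -> intg (fun z => \1_D z * p z).
  by move=> mD Df p sp; apply: sq_mul sp; exact: sq_indic.
have iP p : intg p -> intg (fun w => p (Phi q e w)).
  move=> ip; have c0 : 0 <= e ^- hdim by exact: ltW.
  apply: (@intg_cov _ _ _ _ _ vol vol (Phi q e) (NngNum c0)) => //.
    exact: measurable_Phi.
  by move=> A mA; apply: (vol_Phi B_blk blk_le).
have cmp p : intg p -> (forall z, 0 <= p z) ->
  \int[vol]_w (\1_(cbox kap) w * p (Phi q e w)) <= s * \int[vol]_z (\1_(bx q (kap * e)) z * p z).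
  move=> ip p0; rewrite -(Int_Phi B_blk blk_le q e0 (i1 _ _ ip)).
  apply: Int_le => [||w]; [exact: (ik _ _ (iP _ ip))|exact: (iP _ (i1 _ _ ip))|].
  rewrite ler_wpM2r// !indicE; have [wk|wk] := pselect (cbox kap w); last by rewrite (memNset wk).
  by rewrite !mem_set//; exact: kb.
have ke0 : 0 < kap * e by rewrite mulr_gt0// (lt_le_trans _ k1).
have iH2 := sq_intg2 sH; have iP2 := sq_intg2 sP.
have sHP := sq_Phi B_blk blk_le q e0 sH; have sPP := sq_Phi B_blk blk_le q e0 sP.
have L1 : \int[vol]_z (\1_(cbox 1) z * (e * hsum h (Phi q e z)) ^+ 2) = e ^+ 2 * (s * \int[vol]_z (\1_(bx q e) z * hsum h z ^+ 2)).
  rewrite -(Int_Phi B_blk blk_le q e0 (i1 _ _ iH2)) -IntZ; last exact: (iP _ (i1 _ _ iH2)).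
  apply: eq_Rintegral => w _; rewrite exprMn mulrCA; congr (_ * (_ * _)).
  by rewrite -(preimage_Phi_bx B blk r q (lt0r_neq0 e0)) !indicE.
have L2 : \int[vol]_z (\1_(cbox kap) z * (e * hsum h (Phi q e z)) ^+ 2) <= e ^+ 2 * (s * \int[vol]_z (\1_(bx q (kap * e)) z * hsum h z ^+ 2)).
  under eq_Rintegral => z _ do rewrite exprMn mulrCA.
  rewrite IntZ; last by apply: ik; exact: sq_intg2 sHP.
  by rewrite ler_wpM2l ?sqr_ge0//; apply: (cmp (fun z => hsum h z ^+ 2)) => // z; exact: sqr_ge0.
have iHk : intg (fun z => \1_(cbox kap) z * hsum h (Phi q e z)) by exact: sq_mul (sq_ind kap) sHP.
have iHb : intg (fun z => \1_(bx q (kap * e)) z * hsum h z).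
  by apply: sv => //; exact: vol_bx_lty.
have L3 : \int[vol]_z (\1_(cbox kap) z * (e * hsum h (Phi q e z))) <= e * (s * \int[vol]_z (\1_(bx q (kap * e)) z * hsum h z)).
  under eq_Rintegral => z _ do rewrite mulrCA.
  rewrite IntZ// ler_wpM2l ?(ltW e0)// -(Int_Phi B_blk blk_le q e0 iHb).
  apply: Int_le iHk (iP _ iHb) _ => w.
  rewrite ler_wpM2r ?hsum_ge0// !indicE; have [wk|wk] := pselect (cbox kap w); last by rewrite (memNset wk).
  by rewrite !mem_set//; exact: kb.
have L4 : \int[vol]_z (\1_(cbox kap) z * psum (fun i w => e * f i (Phi q e w)) (fun w => e ^+ 2 * g (Phi q e w)) z ^+ 2) <=
    e ^+ 2 * (s * \int[vol]_z (\1_(bx q (kap * e)) z * psum f g z ^+ 2)).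
  apply: (@le_trans _ _ (\int[vol]_z (\1_(cbox kap) z * (e * psum f g (Phi q e z)) ^+ 2))).
    apply: Int_ind_le; [exact: measurable_cbox| | |move=> z].
    - apply: sq_intg2; apply: sq_psum => [i fi|]; [|by apply: sqZ; exact: (sq_Phi B_blk blk_le)].
      by apply: sqZ; apply: (sq_Phi B_blk blk_le) => //; exact: sf.
    - by apply: sq_intg2; exact: sqZ.
    - by rewrite ler_sqr ?nnegrE ?psum_ge0// mulr_ge0 ?psum_ge0 ?ltW.
  under eq_Rintegral => z _ do rewrite exprMn mulrCA.
  rewrite IntZ; last by apply: ik; exact: sq_intg2 sPP.
  by rewrite ler_wpM2l ?sqr_ge0//; apply: (cmp (fun z => psum f g z ^+ 2)) => // z; exact: sqr_ge0.
have L30 : 0 <= \int[vol]_z (\1_(cbox kap) z * (e * hsum h (Phi q e z))).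
  by apply: Int_ge0 => z; rewrite mulr_ge0 ?indicE// mulr_ge0 ?hsum_ge0 ?ltW.
have L5 := L3; rewrite -ler_sqr ?nnegrE// in L5; last exact: le_trans L30 L3.
rewrite L1; set X1 := \int[vol]_z _; set X2 := \int[vol]_z (_ * _) in L2 *; set X3 := \int[vol]_z (_ * _) in L3 L5 L30 *.
set X4 := \int[vol]_z (_ * _) in L4 *.
set Y2 := \int[vol]_z _ in L2 *; set Y3 := \int[vol]_z _ in L3 L5 *; set Y4 := \int[vol]_z _ in L4 *.
move=> HH; have es : 0 < e ^+ 2 * s by rewrite mulr_gt0// exprn_gt0.
rewrite -(ler_pM2l es) -mulrA (le_trans HH)//.
apply: (@le_trans _ _ (th * (e ^+ 2 * (s * Y2)) + C * ((e * (s * Y3)) ^+ 2 + e ^+ 2 * (s * Y4)))).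
  by rewrite lerD ?ler_wpM2l ?(ltW th0)// lerD.
by rewrite le_eqVlt; apply/orP; left; apply/eqP; ring.
Qed.

End reverse_holder.

(** * Distance to the complement, covering lemma, level algebra *)

Section distance.
Context {R : realType} {n : nat}.
Local Notation pt := ('cV[R]_n * R)%type.
Implicit Types (z w y : pt) (U : set pt).

(** The distance to the complement of U truncated at 1; the element 1 also keeps the set nonempty
    when U is the whole space. *)
Definition bdist U z : R := inf [set x | x = 1 \/ exists2 y, ~ U y & x = `|z - y|].

Let ne U z : [set x : R | x = 1 \/ exists2 y, ~ U y & x = `|z - y|] !=set0.
Proof. by exists 1; left. Qed.

Let lb U z : has_lbound [set x : R | x = 1 \/ exists2 y, ~ U y & x = `|z - y|].
Proof. by exists 0 => x [->|[y _ ->]]. Qed.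

Lemma bdist_ge0 U z : 0 <= bdist U z.
Proof. by apply: lb_le_inf => [|x [->|[y _ ->]]]. Qed.

Lemma bdist_le1 U z : bdist U z <= 1.
Proof. by apply: ge_inf => //; left. Qed.

Lemma bdist_lip U z w : bdist U z <= bdist U w + `|z - w|.
Proof.
rewrite -lerBlDr; apply: lb_le_inf => // x [->|[y Uy ->]].
  by rewrite (le_trans _ (bdist_le1 U z))// gerBl.
rewrite lerBlDr; apply: (@le_trans _ _ `|z - y|); first by apply: ge_inf => //; right; exists y.
by rewrite [leRHS]addrC ler_distD.
Qed.

Lemma bdist_out U z : ~ U z -> bdist U z = 0.
Proof.
move=> Uz; apply/eqP; rewrite eq_le bdist_ge0 andbT.
by apply: ge_inf => //; right; exists z => //; rewrite subrr normr0.
Qed.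

Lemma bdist_gt0 U z : open U -> U z -> 0 < bdist U z.
Proof.
move=> oU Uz; have [e e0 He] := open_crd oU Uz.
have m0 : 0 < Num.min 1 e by rewrite lt_min ltr01.
apply: (lt_le_trans m0); apply: lb_le_inf => // x [->|[y Uy ->]]; first by rewrite ge_min lexx.
rewrite ge_min; apply/orP; right; rewrite leNgt; apply/negP => ye; apply: Uy; apply: He => o.
by rewrite -crdB (le_lt_trans (crd_le_norm o _)).
Qed.

Lemma continuous_bdist U : continuous (bdist U).
Proof.
move=> z; apply/cvgrPdist_lt => e e0; near=> w.
have zw : `|z - w| < e by near: w; apply: cvgr_dist_lt.
rewrite ltr_norml; apply/andP; split.
  by rewrite ltrNl opprB ltrBlDl (le_lt_trans (bdist_lip U w z))// ltrD2l distrC.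
by rewrite ltrBlDl (le_lt_trans (bdist_lip U z w))// ltrD2l.
Unshelve. all: by end_near. Qed.

Lemma measurable_bdist U : measurable_fun setT (bdist U).
Proof. by apply: continuous_measurable_pt; exact: continuous_bdist. Qed.

Lemma bdist_compact U K : open U -> compact K -> K `<=` U -> exists2 e : R, 0 < e & forall z, K z -> e <= bdist U z.
Proof.
move=> oU cK KU; have [->|K0] := eqVneq K set0; first by exists 1.
have K0' : K !=set0 by exact/set0P.
have cf : {within K, continuous (bdist U)} by apply: continuous_subspaceT => z; exact: continuous_bdist.
have [z Kz Hz] := compact_EVT_min K0' cK cf.
exists (bdist U z); first by apply: bdist_gt0 => //; apply: KU; rewrite -in_setE.
by move=> w Kw; apply: Hz; rewrite in_setE.
Qed.

End distance.

(** Greedy selection. The list is sorted by decreasing j, hence by increasing size for radii 2^-j,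
    so the induction treats the largest boxes first and a discarded box lies in the enlargement of a
    chosen one. Disjointness is expressed as a bound on the sum of indicators, the form used under
    an integral. *)
Lemma vitali_seq (R : realType) (I : Type) (T : Type) (A A' A'' : I -> set T) (j : I -> nat) (s : seq I) :
  (forall k l, (j k <= j l)%N -> A' k `&` A' l !=set0 -> A l `<=` A'' k) ->
  (forall k, A k `<=` A'' k) -> sorted (fun a b => (j b <= j a)%N) s ->
  exists s' : seq I, [/\ forall p : pred I, all p s -> all p s',
    forall y, \sum_(k <- s') (\1_(A' k) y : R) <= 1 &
    forall y, has (fun k => `[< A k y >]) s -> has (fun k => `[< A'' k y >]) s'].
Proof.
move=> H HA; elim: s => [|x s IH] ss.
  by exists [::]; split => // y; rewrite big_nil.
have [s' [s'1 s'2 s'3]] := IH (path_sorted ss).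
have xj : all (fun k => (j k <= j x)%N) s.
  have := order_path_min _ ss; apply => a b c ba cb; exact: leq_trans cb ba.
have /s'1 xj' := xj.
have [hx|hx] := boolP (has (fun k => `[< A' k `&` A' x !=set0 >]) s').
  exists s'; split => //= [p /andP[_]|y /orP[/asboolP xy|]]; [exact: s'1| |exact: s'3].
  elim: s' {s'1 s'2 s'3} xj' hx => [//|k s' IHs] /= /andP[kx sx] /orP[/asboolP hk|hk].
    by apply/orP; left; apply/asboolP; exact: H kx hk _ xy.
  by rewrite IHs ?orbT.
exists (x :: s'); split => /= [p /andP[-> /s'1]//|y|y /orP[/asboolP xy|/s'3->]]; last by rewrite orbT.
  rewrite big_cons; have [xy|xy] := pselect (A' x y); last by rewrite indicE memNset// add0r.
  have -> : \sum_(k <- s') (\1_(A' k) y : R) = 0.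
    elim: s' {s'1 s'2 s'3 xj'} hx => [|k s' IHs] /=; first by rewrite big_nil.
    rewrite negb_or => /andP[/asboolP hk /IHs]; rewrite big_cons => ->; rewrite addr0 indicE memNset//.
    by move=> ky; apply: hk; exists y.
  by rewrite addr0 indicE; case: (_ \in _).
by apply/orP; left; apply/asboolP; exact: HA.
Qed.

(** The algebra on one stopping box: w is its radius to the power hdim, J and Pi the integrals of H
    and P^2 on an enlargement, S' that of H^2. Cauchy-Schwarz and the upper stopping bound give J <=
    E v t w, which makes the term J^2 / w linear in t J. The parts of H and P below the small level
    eta1 are absorbed, as is the term with S'. *)
Lemma good_pair_alg (R : realFieldType) (E v G t w X S' V' J Pi I1 I2 Cth eta1 : R) :
  1 <= E -> 0 <= v -> 0 <= G -> 0 <= t -> 0 < w -> 0 <= Cth -> 0 <= eta1 <= 1 -> 0 <= J -> 0 <= I1 -> 0 <= I2 ->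
  X = v * t ^+ 2 * w -> X <= (4 * E)^-1 * S' + Cth * (w^-1 * J ^+ 2 + Pi) -> S' <= E * X ->
  0 <= V' -> V' <= E * v * w -> J ^+ 2 <= V' * S' ->
  t * J <= G * I1 + eta1 * G * t ^+ 2 * V' -> Pi <= I2 + (eta1 * G * t) ^+ 2 * V' ->
  eta1 * (4 * (Cth * (E * v * G * E + G ^+ 2 * E))) <= 1 ->
  E * X <= 2 * E * Cth * (E * v * G + 1) * (I1 + I2).
Proof.
move=> E1 v0 G0 t0 w0 C0 /andP[e0 e1] J0 I10 I20 XE hX hS V0 hV hJ htJ hPi he.
have E0 : 0 < E by lra.
have X0 : 0 <= X by rewrite XE !mulr_ge0 ?sqr_ge0 ?(ltW w0).
have t20 : 0 <= t ^+ 2 by exact: sqr_ge0.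
have s1 : J <= E * v * t * w.
  rewrite -ler_sqr ?nnegrE ?mulr_ge0 ?(ltW w0) ?(ltW E0)//; apply: (le_trans hJ).
  apply: (@le_trans _ _ (E * v * w * (E * X))); last by rewrite XE le_eqVlt; apply/orP; left; apply/eqP; ring.
  apply: (@le_trans _ _ (V' * (E * X))); first by rewrite ler_wpM2l.
  by rewrite ler_wpM2r// mulr_ge0 ?(ltW E0).
have s2 : w^-1 * J ^+ 2 <= E * v * (t * J).
  rewrite ler_pdivrMl// expr2 [leRHS](_ : _ = E * v * t * w * J); last by ring.
  by rewrite ler_wpM2r.
have tV : t ^+ 2 * V' <= E * X.
  rewrite XE (_ : E * _ = t ^+ 2 * (E * v * w)); last by ring.
  by rewrite ler_wpM2l.
have s3 : t * J <= G * I1 + eta1 * G * (E * X).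
  by apply: (le_trans htJ); rewrite lerD2l -mulrA ler_wpM2l// mulr_ge0.
have s4 : Pi <= I2 + eta1 * G ^+ 2 * (E * X).
  apply: (le_trans hPi); rewrite lerD2l.
  have -> : (eta1 * G * t) ^+ 2 * V' = eta1 ^+ 2 * (G ^+ 2 * (t ^+ 2 * V')) by ring.
  rewrite -[leRHS]mulrA; apply: ler_pM.
  - exact: sqr_ge0.
  - by rewrite !mulr_ge0 ?sqr_ge0.
  - by rewrite expr2 ler_piMr.
  - by rewrite ler_wpM2l ?sqr_ge0.
have s5 : (4 * E)^-1 * S' <= 4^-1 * X.
  rewrite invfM -mulrA ler_wpM2l ?invr_ge0//.
  by rewrite mulrC ler_pdivrMr// mulrC.
have Ev0 : 0 <= E * v by rewrite mulr_ge0 ?(ltW E0).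
have s6 : w^-1 * J ^+ 2 + Pi <= E * v * G * I1 + I2 + eta1 * (E * v * G * E + G ^+ 2 * E) * X.
  have := lerD (le_trans s2 (ler_wpM2l Ev0 s3)) s4; move/le_trans; apply.
  by rewrite le_eqVlt; apply/orP; left; apply/eqP; ring.
have s7 := ler_wpM2l C0 s6.
have s8 : Cth * (eta1 * (E * v * G * E + G ^+ 2 * E)) * X <= 4^-1 * X.
  by rewrite ler_wpM2r//; lra.
have s9 : X <= 2 * (Cth * (E * v * G * I1 + I2)) by lra.
have s10 := ler_wpM2l (ltW E0) s9; apply: (le_trans s10).
have p1 : 0 <= E * Cth * (E * v * G * I2) by rewrite !mulr_ge0// ltW.
have p2 : 0 <= E * Cth * I1 by rewrite !mulr_ge0// ltW.
lra.
Qed.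

(** Here a and b are the weights at a point of a stopping box and at its stopping point. A level
    condition weighted by a is converted into one for the weight b, at the cost of the comparison
    constant G. *)
Lemma le_of_level (R : realFieldType) (a b G e1 lam h : R) : 0 < a -> 0 < b -> b <= G * a -> 0 < lam ->
  0 < e1 -> h * a <= e1 * lam -> h <= e1 * G * (lam / b).
Proof.
move=> a0 b0 ba l0 e10 ha; apply: (@le_trans _ _ (e1 * lam / a)); first by rewrite ler_pdivlMr.
rewrite -!mulrA ler_pM2l// [leRHS]mulrCA ler_pM2l// -div1r ler_pdivrMr// mulrAC ler_pdivlMr// mul1r.
exact: ba.
Qed.

Lemma mul_le_of_level (R : realFieldType) (a b G e1 lam h : R) : 0 < a -> 0 < b -> a <= G * b -> 0 <= G ->
  0 < lam -> 0 < e1 -> e1 * lam < h * a -> lam / b * h <= G * (h ^+ 2 / e1).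
Proof.
move=> a0 b0 ab G0 l0 e10 ha.
have h0 : 0 < h by rewrite -(pmulr_lgt0 _ a0); apply: lt_trans ha; rewrite mulr_gt0.
have s1 : lam / b <= G * (lam / a).
  rewrite ler_pdivrMr// (_ : G * (lam / a) * b = G * b * lam / a); last by ring.
  by rewrite ler_pdivlMr// mulrC ler_wpM2r// ltW.
apply: (@le_trans _ _ (G * (lam / a) * h)); first by rewrite ler_wpM2r// ltW.
rewrite -mulrA ler_wpM2l// expr2 [leLHS]mulrC -mulrA ler_pM2l//.
by rewrite ler_pdivrMr// mulrAC ler_pdivlMr// mulrC ltW.
Qed.

(** The truncations min (g, k f) have integral 0 and increase to g, since g vanishes wherever f
    does. *)
Lemma Int_null (d : measure_display) (X : measurableType d) (R : realType) (mu : {measure set X -> \bar R})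
  (f g : X -> R) : (forall x, 0 <= f x) -> (forall x, 0 <= g x) -> intg_of mu f -> intg_of mu g ->
  (forall x, f x = 0 -> g x = 0) -> \int[mu]_x f x <= 0 -> \int[mu]_x g x = 0.
Proof.
move=> f0 g0 fi gi fg f00.
pose h k x := Num.min (g x) (k%:R * f x).
have mh k : measurable_fun setT (h k).
  by apply: measurable_minr; [exact: intg_meas gi|apply: measurable_funM => //; exact: intg_meas fi].
have hg k x : 0 <= h k x <= g x.
  by rewrite /h le_min g0 mulr_ge0//= ge_min lexx.
have hi k : intg_of mu (h k).
  by apply: (intg_le (mh k) _ gi) => x; have /andP[a b] := hg k x; rewrite ger0_norm.
have h0 k : \int[mu]_x h k x = 0.
  apply/eqP; rewrite eq_le; apply/andP; split; last by apply: Int_ge0 => x; have /andP[] := hg k x.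
  apply: (@le_trans _ _ (k%:R * \int[mu]_x f x)); last by rewrite mulr_ge0_le0.
  by rewrite -IntZ//; apply: Int_le => // [|x]; [exact: intgZ|rewrite /h ge_min lexx orbT].
have c : \int[mu]_x h k x @[k --> \oo] --> \int[mu]_x g x.
  apply: (Int_dct mh (intg_meas gi) _ _ gi) => [x|k x]; last first.
    by have /andP[a b] := hg k x; rewrite ger0_norm.
  have [fx0|fx] := eqVneq (f x) 0.
    rewrite fg//; apply: cvg_near_cst; near=> k.
    by rewrite /h fx0 fg// mulr0 minxx.
  have fx0 : 0 < f x by rewrite lt_neqAle eq_sym fx f0.
  apply: cvg_near_cst; near=> k; rewrite /h; apply/min_idPl.
  rewrite -ler_pdivrMr//; near: k; exact: nbhs_infty_ger.
have c0 : \int[mu]_x h k x @[k --> \oo] --> (0 : R).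
  by apply: cvg_near_cst; near=> k; exact: h0.
exact: (cvg_unique (@Rhausdorff R) c c0).
Unshelve. all: by end_near. Qed.

(** * Gehring's lemma: stopping boxes and decay of level sets *)

Section gehring.
Context {R : realType} {n : nat}.
Local Notation pt := ('cV[R]_n * R)%type.
Variables (B : 'M[R]_n) (blk : 'I_n -> nat) (r : nat).
Hypothesis B_blk : forall i j, B i j != 0 -> blk j = (blk i).+1.
Hypothesis blk_ord : forall i j : 'I_n, (blk i < blk j)%N -> (i < j)%N.
Hypothesis blk_le : forall i, (blk i <= r)%N.
Local Notation Phi := (Phi B blk r).
Local Notation Psi := (Psi B blk r).
Local Notation bx := (bx B blk r).
Local Notation hdim := (hdim blk).
Local Notation geoC := (geoC B r).
Local Notation flowC := (flowC B r).
Local Notation sq := (sq (@vol R n)).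
Local Notation intg := (intg (@vol R n)).
Implicit Types (z w y q : pt) (p a b : pt -> R).

Variables (kap r0 Cth : R) (m : nat).
Hypothesis kap1 : 1 <= kap.
Hypothesis r01 : 1 <= r0.
Hypothesis Cth0 : 0 <= Cth.
(** Enlargement factors. A box around the stopping point is recentred at the cost of [geoC] and then
    enlarged by [kap], which makes [kp]; [kpp] serves the covering lemma; [dd] is a power of 2 so
    that dyadic radii are mapped to dyadic radii. *)
Definition kp := kap * geoC.
Definition kpp := geoC ^+ 3 * kp.
Definition dd : R := 2 ^+ m.
Hypothesis ddP : geoC * kpp <= dd.
(** A box at z of radius dd e with e < eta d(z) reaches at most half of the way to the complement,
    by [bx_close]. *)
Definition eta := (2 * dd * (1 + flowC * r0))^-1.
Definition Ee := dd ^+ hdim.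
Local Notation v := (@vc R n 1).
Definition Gg : R := 2 ^+ hdim.
Definition K0 := 2 * Ee * Cth * (Ee * v * Gg + 1).
(** The fraction of the level below which H and P are absorbed; its value is dictated by the last
    hypothesis of [good_pair_alg]. *)
Definition eta1 := (4 * (Cth * (Ee * v * Gg * Ee + Gg ^+ 2 * Ee)) + 1)^-1.

Definition rev_holder (U : set pt) (H P : pt -> R) := forall q (e : R), 0 < e <= 1 ->
  bx q (kap * e) `<=` U ->
  \int[vol]_z (\1_(bx q e) z * H z ^+ 2) <=
   (4 * Ee)^-1 * \int[vol]_z (\1_(bx q (kap * e)) z * H z ^+ 2)
   + Cth * (e ^- hdim * (\int[vol]_z (\1_(bx q (kap * e)) z * H z)) ^+ 2
          + \int[vol]_z (\1_(bx q (kap * e)) z * P z ^+ 2)).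

Lemma geoC1 : 1 <= geoC. Proof. exact: geoC_ge1. Qed.
Lemma geoC0 : 0 < geoC. Proof. exact: geoC_gt0. Qed.
Lemma kp1 : 1 <= kp. Proof. by rewrite /kp mulr_ege1 ?geoC1. Qed.
Lemma kp_le : kp <= kpp. Proof. by rewrite /kpp ler_peMl ?exprn_ege1 ?geoC1// (le_trans ler01 kp1). Qed.
Lemma kpp_le : kpp <= dd.
Proof. by apply: le_trans ddP; rewrite ler_peMl ?geoC1// (le_trans ler01)// (le_trans kp1 kp_le). Qed.
Lemma dd1 : 1 <= dd. Proof. by rewrite /dd exprn_ege1// ler1n. Qed.
Lemma dd0 : 0 < dd. Proof. exact: lt_le_trans dd1. Qed.
Lemma Ee1 : 1 <= Ee. Proof. by rewrite exprn_ege1// dd1. Qed.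
Lemma fr1 : 1 <= 1 + flowC * r0. Proof. by rewrite lerDl mulr_ge0 ?flowC_ge0// (le_trans ler01). Qed.
Lemma fr0 : 0 < 1 + flowC * r0. Proof. exact: lt_le_trans fr1. Qed.
Lemma eta_gt0 : 0 < eta. Proof. by rewrite invr_gt0 !mulr_gt0 ?dd0 ?fr0. Qed.
Lemma eta_dd : eta * dd * (1 + flowC * r0) = 2^-1.
Proof. by rewrite /eta; field; rewrite !gt_eqF ?fr0 ?dd0. Qed.
Lemma Gg0 : 0 <= Gg. Proof. by rewrite exprn_ge0. Qed.
Lemma cst0 : 0 <= Cth * (Ee * v * Gg * Ee + Gg ^+ 2 * Ee).
Proof.
have E0 := le_trans ler01 Ee1.
exact: mulr_ge0 Cth0 (addr_ge0 (mulr_ge0 (mulr_ge0 (mulr_ge0 E0 (vc_ge0 _)) Gg0) E0) (mulr_ge0 (sqr_ge0 _) E0)).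
Qed.
Lemma eta1_gt0 : 0 < eta1. Proof. by rewrite invr_gt0; have := cst0; lra. Qed.
Lemma eta1_le1 : eta1 <= 1. Proof. by rewrite invf_le1; have := cst0; lra. Qed.
Lemma eta1P : eta1 * (4 * (Cth * (Ee * v * Gg * Ee + Gg ^+ 2 * Ee))) <= 1.
Proof. by rewrite /eta1 mulrC ler_pdivrMr ?mul1r; have := cst0; lra. Qed.

Variables (U : set pt) (H P : pt -> R).
Hypothesis Ur0 : U `<=` cbox r0.
Hypothesis H0 : forall z, 0 <= H z.
Hypothesis P0 : forall z, 0 <= P z.
Hypothesis sH : sq H.
Hypothesis sP : sq P.
Hypothesis rhHP : rev_holder U H P.
Local Notation d := (bdist U).

(** With the weight d^hdim the stopping level at z is lam / d(z)^hdim, so high near the boundary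
    that stopping radii are less than eta d(z). *)
Definition lev (Q : pt -> R) (l : R) := [set z | l < Q z * d z ^+ hdim].

(** Up to a constant it dominates t H at the points of a stopping box where H exceeds the level eta1
    lam. Splitting at the level T lam leaves the small factor 1 / T on the highest part, which can
    then be moved to the left-hand side. *)
Definition Yl (T lam : R) y := H y ^+ 2 / eta1 * \1_(lev H (eta1 * lam) `\` lev H (T * lam)) y
   + H y ^+ 2 / T * \1_(lev H (T * lam)) y.
Definition Yp (lam : R) y := P y ^+ 2 * \1_(lev P (eta1 * lam)) y.

(** The box contains a point z with stopping radius e: the mean of H^2 is above t^2 on [bx z e] and
    no longer on [bx z (dd * e)]. Separating q from z permits rational centres q, hence countably
    many boxes. *)
Definition good (lam : R) q (e : R) := exists z, let t := lam / d z ^+ hdim in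
  [/\ 0 < d z, bx q e z, 0 < e /\ e < eta * d z, v * t ^+ 2 * e ^+ hdim < \int[vol]_y (\1_(bx z e) y * H y ^+ 2)
    & \int[vol]_y (\1_(bx z (dd * e)) y * H y ^+ 2) <= v * t ^+ 2 * (dd * e) ^+ hdim].

Lemma measurable_lev (Q : pt -> R) l : measurable_fun setT Q -> measurable (lev Q l).
Proof.
move=> mQ; have mf : measurable_fun setT (fun z => Q z * d z ^+ hdim).
  by apply: measurable_funM => //; apply: measurable_funX; exact: measurable_bdist.
rewrite (_ : lev Q l = [set: pt] `&` (fun z => Q z * d z ^+ hdim) @^-1` `]l, +oo[%classic).
  exact: mf.
by rewrite setTI; apply/seteqP; split => y /=; rewrite in_itv/= andbT.
Qed.

Lemma Yl_ge0 T lam y : 0 < T -> 0 <= Yl T lam y.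
Proof.
move=> T0; rewrite /Yl addr_ge0// mulr_ge0 ?indicE// divr_ge0 ?sqr_ge0 ?(ltW T0)//.
exact: ltW eta1_gt0.
Qed.

Lemma Yp_ge0 lam y : 0 <= Yp lam y.
Proof. by rewrite mulr_ge0 ?sqr_ge0 ?indicE. Qed.

Let ind1 (D : set pt) y : `|(\1_D y : R)| <= 1.
Proof. by rewrite indicE; case: (_ \in _); rewrite ?normr1 ?normr0. Qed.

Lemma intg_ind D p : measurable D -> intg p -> intg (fun z => \1_D z * p z).
Proof. by move=> mD ip; apply: (intgMb _ (ind1 D) ip); exact: measurable_indic. Qed.

Lemma intg_Yl T lam : intg (Yl T lam).
Proof.
have mL l : measurable (lev H l) by apply: measurable_lev; exact: sq_meas sH.
apply: intgD.
  have := intg_ind (measurableD (mL (eta1 * lam)) (mL (T * lam))) (intgZ eta1^-1 (sq_intg2 sH)).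
  by congr (intg_of _ _); apply/funext => y; ring.
have := intg_ind (mL (T * lam)) (intgZ T^-1 (sq_intg2 sH)).
by congr (intg_of _ _); apply/funext => y; ring.
Qed.

Lemma intg_Yp lam : intg (Yp lam).
Proof.
have mL l : measurable (lev P l) by apply: measurable_lev; exact: sq_meas sP.
by have := intg_ind (mL (eta1 * lam)) (sq_intg2 sP); congr (intg_of _ _); apply/funext => y; rewrite mulrC.
Qed.

(** The choice of [eta] keeps the enlarged box within d(z) / 2 of z, and the distance is
    1-Lipschitz: the box stays in U and the weights on it are comparable with that at z. *)
Lemma good_comparable lam q (e : R) : good lam q e -> exists z,
  let t := lam / d z ^+ hdim in
  [/\ [/\ 0 < d z, 0 < e, geoC * e <= 1 & 0 < dd * e <= 1],
      v * t ^+ 2 * e ^+ hdim < \int[vol]_y (\1_(bx z e) y * H y ^+ 2),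
      \int[vol]_y (\1_(bx z (dd * e)) y * H y ^+ 2) <= v * t ^+ 2 * (dd * e) ^+ hdim,
      bx z e `<=` bx q (geoC * e) &
      bx q (kpp * e) `<=` bx z (dd * e)] /\
  forall y, bx z (dd * e) y -> U y /\ d z <= 2 * d y /\ d y <= 2 * d z.
Proof.
move=> [z /= [dz qz [e0 ed] h1 h2]]; exists z => /=.
have de : dd * e < eta * dd * d z by rewrite [ltRHS]mulrAC mulrC ltr_pM2r ?dd0.
have de2 : dd * e * (1 + flowC * r0) < d z / 2.
  have -> : d z / 2 = eta * dd * d z * (1 + flowC * r0) by rewrite -eta_dd; ring.
  by rewrite ltr_pM2r ?fr0.
have de0 : 0 < dd * e by rewrite mulr_gt0 ?dd0.
have de1 : dd * e <= 1.
  apply: (@le_trans _ _ (dd * e * (1 + flowC * r0))); first by rewrite ler_peMr ?fr1 ?ltW.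
  by rewrite (le_trans (ltW de2))// (@le_trans _ _ (d z))// ?bdist_le1// ler_pdivrMr// ler_peMr ?ler1n// ltW.
have Cdd : geoC <= dd.
  apply: le_trans ddP; rewrite ler_peMr ?(ltW geoC0)//; exact: le_trans kp1 kp_le.
have zU : U z by apply: contrapT => /bdist_out z0; rewrite z0 ltxx in dz.
have qz' : bx z (geoC * e) q by exact: bx_sym.
have kpp1 : 1 <= kpp by exact: le_trans kp1 kp_le.
split; first split => //.
- by split => //; rewrite ?de0//; rewrite (le_trans _ de1)// ler_wpM2r// ltW.
- by apply: bx_trans => //; rewrite e0 lexx.
- move=> y qy.
  have Ck : geoC <= kpp.
    rewrite /kpp exprS -!mulrA; apply: ler_peMr; first exact: ltW geoC0.
    by rewrite !mulr_ege1 ?kp1 ?geoC1.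
  have : bx z (geoC * (kpp * e)) y.
    apply: (@bx_trans _ _ B blk r B_blk blk_le z (kpp * e) (kpp * e) q) => //.
      by rewrite lexx andbT mulr_gt0// (lt_le_trans ltr01).
    apply: bxS qz'; rewrite mulr_gt0 ?geoC0//= ler_wpM2r// ltW//.
  apply: bxS; rewrite (mulr_gt0 geoC0 (mulr_gt0 (lt_le_trans ltr01 kpp1) e0)) /=.
  by rewrite mulrA ler_wpM2r// ltW.
move=> y zy.
have yz : `|z - y| < d z / 2.
  apply: (norm_lt_crd (e := d z / 2)); first by rewrite divr_gt0.
  move=> o; rewrite crdB distrC (le_lt_trans _ de2)//.
  by apply: (bx_close o r01 _ (Ur0 zU) zy); rewrite de0.
have l1 := bdist_lip U z y; have l2 := bdist_lip U y z; rewrite distrC in l2.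
have dzy : d z <= 2 * d y by lra.
split; last by split => //; lra.
by apply: contrapT => /bdist_out y0; move: dzy; rewrite y0 mulr0 leNgt dz.
Qed.

(** The reverse Holder inequality is applied to [bx q (geoC * e)], which contains [bx z e]; its
    enlargement [bx q (kp * e)] still lies in [bx z (dd * e)], where the upper stopping bound holds.
    The rest is [good_pair_alg]. *)
Lemma good_pair T lam q (e : R) : 0 < lam -> eta1 < T -> good lam q e ->
  \int[vol]_y (\1_(bx q (kpp * e)) y * H y ^+ 2) <=
  \int[vol]_y (\1_(bx q (kp * e)) y * (K0 * (Yl T lam y + Yp lam y))).
Proof.
move=> lam0 T1 /good_comparable[z /= [[[dz e0 Ce1 /andP[de0 de1]] h1 h2 s1 s2] hU]].
have T0 : 0 < T by exact: lt_trans eta1_gt0 T1.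
set t := lam / d z ^+ hdim in h1 h2.
have dN : 0 < d z ^+ hdim by rewrite exprn_gt0.
have t0 : 0 < t by rewrite divr_gt0.
have mb x (a : R) : measurable (bx x a) by exact: measurable_bx.
have iH2 := sq_intg2 sH; have iP2 := sq_intg2 sP.
have kp0 : 0 < kp by exact: lt_le_trans kp1.
have s3 : bx q (kp * e) `<=` bx z (dd * e).
  move=> y qy; apply: s2; apply: bxS qy; rewrite mulr_gt0//= ler_wpM2r ?kp_le//; exact: ltW.
have iHA : intg (fun y => \1_(bx q (kp * e)) y * H y).
  by apply: sq_mul sH; apply: sq_indic => //; apply: (vol_bx_lty B_blk blk_le); rewrite mulr_gt0.
have w0 : 0 < e ^+ hdim by rewrite exprn_gt0.
have EX : v * t ^+ 2 * (dd * e) ^+ hdim = Ee * (v * t ^+ 2 * e ^+ hdim).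
  by rewrite (exprMn hdim dd e) mulrCA.
rewrite EX in h2; set X := v * t ^+ 2 * e ^+ hdim in h1 h2.
have cmpE (a : R) (p : pt -> R) : intg p -> (forall y, 0 <= p y) -> bx q (a * e) `<=` bx z (dd * e) ->
  \int[vol]_y (\1_(bx q (a * e)) y * p y) <= \int[vol]_y (\1_(bx z (dd * e)) y * p y).
  by move=> ip p0 aa; apply: Int_ind_sub.
have sq0 (p : pt -> R) y : 0 <= p y ^+ 2 by exact: sqr_ge0.
apply: (@le_trans _ _ (Ee * X)); first exact: le_trans (cmpE _ _ iH2 (sq0 H) s2) h2.
have iYl := intg_Yl T lam; have iYp := intg_Yp lam.
have -> : \int[vol]_y (\1_(bx q (kp * e)) y * (K0 * (Yl T lam y + Yp lam y))) =
   K0 * (\int[vol]_y (\1_(bx q (kp * e)) y * Yl T lam y) + \int[vol]_y (\1_(bx q (kp * e)) y * Yp lam y)).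
  rewrite -IntD ?intg_ind// -IntZ; last by apply: intgD; exact: intg_ind.
  by apply: eq_Rintegral => y _; ring.
set I1 := \int[vol]_y (_ * Yl _ _ _); set I2 := \int[vol]_y (_ * Yp _ _).
set V' := (kp * e) ^+ hdim * v.
set J := \int[vol]_y (\1_(bx q (kp * e)) y * H y) in iHA.
set S' := \int[vol]_y (\1_(bx q (kp * e)) y * H y ^+ 2).
set Pi := \int[vol]_y (\1_(bx q (kp * e)) y * P y ^+ 2).
have ke0 : 0 < kp * e by rewrite mulr_gt0.
have G0 := Gg0; have e1l := eta1_le1; have e10 := eta1_gt0.
have VE : \int[vol]_y (\1_(bx q (kp * e)) y : R) = V'.
  rewrite /Rintegral integral_indic ?setIT//.
  transitivity (fine ((kp * e) ^+ hdim * v)%:E) => //; congr fine.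
  by rewrite EFinM -vcE; exact: (vol_bx B_blk blk_le q ke0).
have sq1 : sq (\1_(bx q (kp * e))) by apply: sq_indic => //; exact: vol_bx_lty.
have i1 : intg (\1_(bx q (kp * e))) by apply: intg_indic_fin => //; exact: vol_bx_lty.
have sqi y : (\1_(bx q (kp * e)) y : R) ^+ 2 = \1_(bx q (kp * e)) y.
  by rewrite indicE; case: (_ \in _); rewrite ?expr1n ?expr0n.
have pw y : bx q (kp * e) y -> [/\ 0 < d y ^+ hdim, d z ^+ hdim <= Gg * d y ^+ hdim & d y ^+ hdim <= Gg * d z ^+ hdim].
  move=> /s3/hU[_ [l1 l2]]; have dy : 0 < d y by rewrite -(pmulr_rgt0 _ (ltr0n _ 2)) (lt_le_trans dz).
  rewrite exprn_gt0// /Gg -!exprMn !lerXn2r// nnegrE ?mulr_ge0 ?bdist_ge0//.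
have I10 : 0 <= I1 by apply: Int_ge0 => y; rewrite mulr_ge0 ?indicE ?Yl_ge0.
have I20 : 0 <= I2 by apply: Int_ge0 => y; rewrite mulr_ge0 ?indicE ?Yp_ge0.
have J0 : 0 <= J by apply: Int_ge0 => y; rewrite mulr_ge0 ?indicE.
apply: (@good_pair_alg _ Ee v Gg t (e ^+ hdim) X S' V' J Pi I1 I2 Cth eta1 Ee1 (vc_ge0 _) G0 (ltW t0) w0 Cth0 _ J0 I10 I20 erefl) => //.
- by rewrite (ltW e10).
- apply: (le_trans (ltW h1)); apply: (@le_trans _ _ (\int[vol]_y (\1_(bx q (geoC * e)) y * H y ^+ 2))).
    exact: Int_ind_sub.
  have kE : kap * (geoC * e) = kp * e by rewrite mulrA.
  have := @rhHP q (geoC * e); rewrite Ce1 andbT mulr_gt0 ?geoC0// kE => /(_ isT) HH.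
  apply: le_trans (HH _) _; first by move=> y /s3/hU[].
  rewrite lerD2l ler_wpM2l// lerD2r ler_wpM2r ?sqr_ge0// lef_pV2 ?posrE ?exprn_gt0 ?mulr_gt0 ?geoC0//.
  by rewrite lerXn2r ?nnegrE ?mulr_ge0 ?(ltW e0) ?(ltW geoC0)// ler_peMl ?geoC1// ltW.
- exact: le_trans (cmpE _ _ iH2 (sq0 H) s3) h2.
- by rewrite /V' mulr_ge0 ?vc_ge0// exprn_ge0// ltW.
- have kdd : kp ^+ hdim <= Ee.
    by rewrite /Ee lerXn2r ?nnegrE ?(ltW kp0) ?(ltW dd0)// (le_trans kp_le)// kpp_le.
  rewrite /V' (exprMn hdim kp e); move: (kp ^+ hdim) (e ^+ hdim) kdd w0 => a b kdd b0.
  by rewrite [leLHS]mulrAC ler_wpM2r ?(ltW b0)// ler_wpM2r ?vc_ge0.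
- have := cauchy_schwarz sq1 (sqMb (sq_meas sq1) (ind1 _) sH).
  under [in X in X -> _]eq_Rintegral => y _ do rewrite mulrA -expr2 sqi.
  under [in X in _ <= X * _ -> _]eq_Rintegral => y _ do rewrite sqi.
  by rewrite VE; under [in X in _ <= _ * X -> _]eq_Rintegral => y _ do rewrite exprMn sqi.
- have iA : intg (fun y => \1_(bx q (kp * e)) y * Yl T lam y) by exact: intg_ind.
  rewrite -VE -(IntZ t iHA) -(IntZ Gg iA) -(IntZ (eta1 * Gg * t ^+ 2) i1) -(IntD (intgZ Gg iA) (intgZ _ i1)).
  apply: (Int_le (intgZ t iHA) (intgD (intgZ Gg iA) (intgZ _ i1))) => y.
  rewrite indicE; have [ya|ya] := pselect (bx q (kp * e) y); last by rewrite memNset// !(mul0r, mulr0) addr0.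
  rewrite mem_set// !mul1r mulr1; have [a0 ba ab] := pw _ ya.
  have Y0 := Yl_ge0 lam y T0.
  have [hy|hy] := leP (H y * d y ^+ hdim) (eta1 * lam).
    have := le_of_level a0 dN ba lam0 e10 hy; rewrite -/t => hh.
    apply: (@le_trans _ _ (eta1 * Gg * t ^+ 2)); last by rewrite lerDr mulr_ge0.
    by rewrite expr2 mulrA mulrC ler_wpM2r// ltW.
  apply: (@le_trans _ _ (Gg * Yl T lam y)); last by rewrite lerDl mulr_ge0 ?sqr_ge0// mulr_ge0// ltW.
  have [hT|hT] := leP (H y * d y ^+ hdim) (T * lam).
    have := mul_le_of_level a0 dN ab G0 lam0 e10 hy; move/le_trans; apply; rewrite ler_wpM2l//.
    rewrite /Yl !indicE mem_set; last by split => //; apply/negP; rewrite -leNgt.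
    rewrite memNset ?mulr1 ?mulr0 ?addr0//; apply/negP; rewrite -leNgt//.
  have := mul_le_of_level a0 dN ab G0 lam0 T0 hT; move/le_trans; apply; rewrite ler_wpM2l//.
  by rewrite /Yl !indicE memNset ?mulr0 ?add0r ?mem_set ?mulr1// => -[_]; apply.
- have iA : intg (fun y => \1_(bx q (kp * e)) y * Yp lam y) by exact: intg_ind.
  rewrite -VE -(IntZ ((eta1 * Gg * t) ^+ 2) i1) -(IntD iA (intgZ _ i1)).
  apply: (Int_le (intg_ind (mb _ _) iP2) (intgD iA (intgZ _ i1))) => y.
  rewrite indicE; have [ya|ya] := pselect (bx q (kp * e) y); last by rewrite memNset// !(mul0r, mulr0) addr0.
  rewrite mem_set// !mul1r mulr1; have [a0 ba ab] := pw _ ya.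
  have [hy|hy] := leP (P y * d y ^+ hdim) (eta1 * lam).
    have := le_of_level a0 dN ba lam0 e10 hy; rewrite -/t => hh.
    apply: (@le_trans _ _ ((eta1 * Gg * t) ^+ 2)); last by rewrite lerDr Yp_ge0.
    by rewrite ler_sqr ?nnegrE// (le_trans (P0 y) hh).
  by rewrite /Yp indicE mem_set// mulr1 lerDl sqr_ge0.
exact: eta1P.
Qed.

Local Notation ratidx := ('cV[rat]_n * rat)%type.
Definition rad (j : nat) : R := 2^-1 ^+ j.

Lemma rad_gt0 j : 0 < rad j. Proof. by rewrite exprn_gt0. Qed.

Lemma vc1_gt0 : 0 < v.
Proof.
rewrite lt_neqAle vc_ge0 andbT; apply/negP => /eqP v0.
have sb := tst_sq (@tst_bumpf R n).
have := cauchy_schwarz (sq_ind 1) sb.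
have -> : \int[vol]_x (\1_(@cbox R n 1) x : R) ^+ 2 = v.
  rewrite /vc -[RHS](_ : \int[vol]_x (\1_(@cbox R n 1) x : R) = _); last first.
    rewrite /Rintegral integral_indic ?setIT//; exact: measurable_cbox.
  by apply: eq_Rintegral => z _; rewrite indicE; case: (_ \in _); rewrite ?expr1n ?expr0n.
rewrite -v0 mul0r.
have -> : \int[vol]_x ((\1_(@cbox R n 1) x : R) * bumpf x) = @mass R n.
  apply: eq_Rintegral => z _; rewrite indicE; have [z1|z1] := pselect (cbox 1 z); first by rewrite mem_set// mul1r.
  by rewrite (@bumpf_eq0 R n)// mulr0.
by apply/negP; rewrite -ltNge exprn_gt0// mass_gt0.
Qed.

Lemma ratpt_bx z (e : R) : 0 < e -> exists q : ratidx, bx (ratpt q) e z.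
Proof.
move=> e0; have s0 : 0 < e / geoC by rewrite divr_gt0 ?geoC0.
pose W : set pt := [set y | forall o, `|crd o y| < 1].
have oW : open W.
  apply: crd_open => y Wy; pose M := \big[Num.max/0]_o `|crd o y|.
  have M1 : M < 1 by apply: bigmax_lt => // o _; exact: Wy.
  exists (1 - M) => [|w yw o]; first by rewrite subr_gt0.
  have := le_bigmax_cond 0 (fun o => `|crd o y|) (erefl : predT o); rewrite -/M => oM.
  have := yw o; have := ler_normB (crd o y) (crd o y - crd o w); rewrite opprB addrC subrK.
  by move: oM => /=; lra.
have Pz : (Psi z (e / geoC) @^-1` W) z.
  move=> o; have -> : Psi z (e / geoC) z = 0.
    apply: (can_inj (@PhiK _ _ B blk r z (e / geoC) (lt0r_neq0 s0))); rewrite PsiK ?gt_eqF//.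
    by rewrite /Phi_of/= mulmx0 mulr0 flow0 mul1mx !add0r; case: (z).
  by case: o => [j|] /=; rewrite ?mxE normr0.
have oP : open (Psi z (e / geoC) @^-1` W).
  by apply: open_comp => // y _; exact: continuous_Psi.
have [c c0 Hc] := open_crd oP Pz.
have [q Hq] := ratpt_dense z c0; exists q.
have zq : bx z (e / geoC) (ratpt q) by move=> o; apply: ltW; exact: Hc Hq o.
have := bx_sym B_blk blk_le s0 zq; rewrite mulrC divfK ?gt_eqF ?geoC0//.
Qed.

Variable lam : R.
Hypothesis lam0 : 0 < lam.
Hypothesis lamP : \int[vol]_z H z ^+ 2 <= eta ^+ hdim * lam ^+ 2 * v.

Lemma lev_gt0 z : lev H lam z -> 0 < d z.
Proof.
rewrite /lev /= => hz; rewrite lt_neqAle bdist_ge0 andbT; apply/negP => /eqP d0.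
by move: hz; rewrite -d0 expr0n /hdim_of /= mulr0 => /(lt_trans lam0); rewrite ltxx.
Qed.

(** The least j with an excess gives the largest dyadic box with this property. A radius above eta
    d(z) is excluded by the bound [lamP] on the total integral, and minimality tested at j - m gives
    the upper bound, since dd = 2^m. *)
Lemma stopping z : 0 < d z -> let t := lam / d z ^+ hdim in
  (exists j, v * t ^+ 2 * rad j ^+ hdim < \int[vol]_y (\1_(bx z (rad j)) y * H y ^+ 2)) ->
  exists j, forall q, bx q (rad j) z -> good lam q (rad j).
Proof.
move=> dz t [j0 Hj0].
have mb x (a : R) : measurable (bx x a) by exact: measurable_bx.
have ex : exists j, `[< v * t ^+ 2 * rad j ^+ hdim < \int[vol]_y (\1_(bx z (rad j)) y * H y ^+ 2) >].
  by exists j0; exact/asboolP.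
case: (ex_minnP ex) => j /asboolP jP jmin; exists j => q qz; exists z => /=; rewrite -/t.
have h2 (e : R) : \int[vol]_y (\1_(bx z e) y * H y ^+ 2) <= \int[vol]_y H y ^+ 2.
  apply: Int_le => [||y]; [by apply: intg_ind => //; exact: sq_intg2|exact: sq_intg2|].
  by rewrite ler_piMl ?sqr_ge0// indicE; case: (_ \in _).
have dN : 0 < d z ^+ hdim by rewrite exprn_gt0.
have jd : rad j < eta * d z.
  rewrite ltNge; apply/negP => hj; have := lt_le_trans jP (h2 _); rewrite ltNge => /negP; apply.
  apply: (le_trans lamP).
  have e1 : eta ^+ hdim * d z ^+ hdim <= rad j ^+ hdim.
    by rewrite -exprMn lerXn2r ?nnegrE ?(ltW (rad_gt0 j)) ?mulr_ge0 ?(ltW eta_gt0) ?(ltW dz).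
  have d1 : d z ^+ hdim <= 1 by rewrite exprn_ile1 ?bdist_ge0 ?bdist_le1.
  apply: (@le_trans _ _ (v * t ^+ 2 * (eta ^+ hdim * d z ^+ hdim))); last first.
    by rewrite ler_wpM2l// mulr_ge0 ?vc_ge0 ?sqr_ge0.
  have -> : v * t ^+ 2 * (eta ^+ hdim * d z ^+ hdim) = eta ^+ hdim * lam ^+ 2 * v / d z ^+ hdim.
    by rewrite /t; move: (eta ^+ hdim) (d z ^+ hdim) dN => a b b0; field; rewrite gt_eqF.
  rewrite ler_pdivlMr// ler_piMr// mulr_ge0 ?vc_ge0// mulr_ge0 ?sqr_ge0//.
  by rewrite exprn_ge0// ltW// eta_gt0.
split=> //; first by rewrite rad_gt0.
have e1 : eta * d z <= (2 ^+ m)^-1.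
  apply: (@le_trans _ _ eta); first by rewrite ler_piMr ?bdist_le1// ltW// eta_gt0.
  rewrite /eta -/dd lef_pV2 ?posrE ?dd0//; last by rewrite !mulr_gt0 ?dd0 ?fr0.
  by rewrite mulrAC; apply: ler_peMl; [exact: ltW dd0|have := fr1; lra].
(* The radius is less than eta d(z) <= 2^-m, so j - m is not a truncated subtraction. *)
have mj : (m < j)%N.
  rewrite ltnNge; apply/negP => jm; have := lt_le_trans jd e1.
  rewrite /rad exprVn ltf_pV2 ?posrE ?exprn_gt0// -!natrX ltr_nat ltn_exp2l// ltnNge jm//.
have m0 : (0 < m)%N.
  rewrite lt0n; apply/eqP => m0; have := ddP; rewrite /dd m0 expr0 => k1.
  have : 2 <= geoC by rewrite /geoC_of lerDl flowC_ge0.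
  have : geoC <= geoC * kpp by rewrite ler_peMr ?(ltW geoC0)// (le_trans kp1 kp_le).
  lra.
have ddj : dd * rad j = rad (j - m).
  by rewrite /dd /rad -{1}(subnKC (ltnW mj)) exprD mulrA -exprMn divff// expr1n mul1r.
rewrite ddj leNgt; apply/negP => hlt.
have := jmin (j - m)%N; rewrite (_ : `[< _ >] = true); last exact/asboolP.
by move=> /(_ isT); rewrite leqNgt ltn_subrL m0 (leq_ltn_trans _ mj).
Qed.

Definition goodset : set pt := [set z | exists i : ratidx * nat,
  good lam (ratpt i.1) (rad i.2) /\ bx (ratpt i.1) (rad i.2) z].

Lemma measurable_goodset : measurable goodset.
Proof.
rewrite (_ : goodset = \bigcup_(i in [set i : ratidx * nat | good lam (ratpt i.1) (rad i.2)]) bx (ratpt i.1) (rad i.2)).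
  rewrite bigcup_mkcond; apply: countable_bigcupT_measurable => [|i]; first exact: countableP.
  by case: ifP => // _; exact: measurable_bx.
by apply/seteqP; split=> [z [i [gi iz]]|z [i gi iz]]; exists i.
Qed.

(* On the uncovered part of the level set all averages of H stay below
   H z - (H z - t), so H vanishes there by L^2 convergence of averages. *)
Lemma uncovered_null : \int[vol]_z (\1_(lev H lam `\` goodset) z * H z ^+ 2) = 0.
Proof.
set D := lev H lam `\` goodset; have mL : measurable (lev H lam) by apply: measurable_lev; exact: sq_meas sH.
have mD : measurable D by apply: measurableD => //; exact: measurable_goodset.
have v0 := vc1_gt0; have iH2 := sq_intg2 sH.
have mb x (a : R) : measurable (bx x a) by exact: measurable_bx.
pose f z := (\1_D z : R) * (H z * d z ^+ hdim - lam) ^+ 2.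
have d1 z : d z ^+ hdim <= 1 by rewrite exprn_ile1 ?bdist_ge0 ?bdist_le1.
have fH z : 0 <= f z <= H z ^+ 2.
  rewrite /f mulr_ge0 ?sqr_ge0 ?indicE//=; have [zD|zD] := pselect (D z); last by rewrite memNset// mul0r sqr_ge0.
  rewrite mem_set// mul1r; case: zD; rewrite /lev /= => zl _.
  rewrite ler_sqr ?nnegrE ?subr_ge0 ?(ltW zl)// lerBlDr (le_trans (ler_piMr (H0 z) (d1 z)))//.
  by rewrite lerDl ltW.
have mf : measurable_fun setT f.
  apply: measurable_funM; first exact: measurable_indic.
  apply: measurable_funX; apply: measurable_funB => //; apply: measurable_funM; first exact: sq_meas sH.
  by apply: measurable_funX; exact: measurable_bdist.
have fi : intg f by apply: (intg_le mf _ iH2) => z; have /andP[a b] := fH z; rewrite ger0_norm.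
apply: (Int_null (f := f)) => //.
- by move=> z; have /andP[] := fH z.
- by move=> z; rewrite mulr_ge0 ?indicE ?sqr_ge0.
- exact: intg_ind.
- move=> z; rewrite /f indicE; have [zD|zD] := pselect (D z); last by rewrite memNset// !mul0r.
  rewrite mem_set// !mul1r => /eqP; rewrite sqrf_eq0 subr_eq0 => /eqP E.
  by case: zD; rewrite /lev /= E ltxx.
apply/ler_addgt0Pr => e e0; rewrite add0r.
pose s_ (L : nat) (x : pt * pt) := Phi x.2 (1 / 2 ^+ L) x.1.
have ev0 : 0 < e * v by rewrite mulr_gt0.
have ms L : measurable_fun setT (s_ L) by exact: measurable_shift.
have o1 : 0 < (1 : R) <= 1 by rewrite ltr01 lexx.
have [L _ HL] := avg_cvg r0 ms (fun L v f => @shift_int _ _ B blk r B_blk blk_ord blk_le (1 / 2 ^+ L) v f) (cvg_Phi_dyadic B_blk blk_le o1) sH ev0.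
have {}HL := HL L (leqnn L).
have rE : 1 / 2 ^+ L = rad L by rewrite /rad exprVn div1r.
rewrite /s_ rE in HL ms.
have R0 := rad_gt0 L.
have ik0 : supp 1 (\1_(@cbox R n 1)) by move=> z zk; rewrite indicE memNset.
have sPz z := sq_Phi B_blk blk_le z R0 sH.
have := @sq_average _ _ 1 r0 _ _ (fun x => H (Phi x.2 (rad L) x.1) - H x.2) (sq_ind 1) ik0 _ _ HL.
case.
- apply: measurable_funB; first exact: (measurableT_comp (sq_meas sH) (measurable_shift B_blk blk_le (rad L))).
  exact: (measurableT_comp (sq_meas sH) measurable_snd).
- move=> z; have := sqB (sq_cut 1 (sPz z)) (sqZ (H z) (sq_ind 1)).
  by congr (sq_of _ _); apply/funext => w; rewrite /=; ring.
set t := (fun z => _) => st tb.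
have sqi z : (\1_(@cbox R n 1) z : R) ^+ 2 = \1_(cbox 1) z.
  by rewrite indicE; case: (_ \in _); rewrite ?expr1n ?expr0n.
have I1 : \int[vol]_w (\1_(@cbox R n 1) w : R) = v.
  rewrite /vc /Rintegral integral_indic ?setIT//; exact: measurable_cbox.
have I2 : \int[vol]_w (\1_(@cbox R n 1) w : R) ^+ 2 = v.
  by under eq_Rintegral => w _ do rewrite sqi.
rewrite I2 in tb.
have v2 : 0 < v ^+ 2 by rewrite exprn_gt0.
rewrite -(ler_pM2l v2) (_ : v ^+ 2 * e = v * (e * v)); last by ring.
apply: le_trans tb; rewrite -IntZ//; apply: Int_le => [||z]; [exact: intgZ|exact: sq_intg2|].
rewrite /f indicE; have [zD|zD] := pselect (D z); last by rewrite memNset// mul0r mulr0 sqr_ge0.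
rewrite mem_set// mul1r -exprMn.
have [zl zg] := zD; have dz := lev_gt0 zl; have dN : 0 < d z ^+ hdim by rewrite exprn_gt0.
have zU : U z by apply: contrapT => /bdist_out z0; rewrite z0 ltxx in dz.
pose tt := lam / d z ^+ hdim; have tt0 : 0 < tt by rewrite divr_gt0.
(* A larger mean would start the stopping argument and put z into a good box with rational
   centre. *)
have hb : \int[vol]_y (\1_(bx z (rad L)) y * H y ^+ 2) <= v * tt ^+ 2 * rad L ^+ hdim.
  rewrite leNgt; apply/negP => hlt; have [j Hj] := stopping dz (ex_intro _ L hlt).
  by apply: zg; have [q qz] := ratpt_bx z (rad_gt0 j); exists (q, j); split => //; exact: Hj.
have iw : intg (fun w => \1_(cbox 1) w * H (Phi z (rad L) w)) by exact: sq_mul (sq_ind 1) (sPz z).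
have i1 : intg (\1_(@cbox R n 1)) by apply: intg_indic_fin; [exact: measurable_cbox|exact: vol_cbox_lty].
have tE : t z = \int[vol]_w (\1_(cbox 1) w * H (Phi z (rad L) w)) - H z * v.
  rewrite /t indicE mem_set ?mul1r; last exact: Ur0.
  rewrite -I1 -(IntZ _ i1) -(IntB iw (intgZ _ i1)); apply: eq_Rintegral => w _; rewrite /=; ring.
have J0 : 0 <= \int[vol]_w (\1_(cbox 1) w * H (Phi z (rad L) w)).
  by apply: Int_ge0 => w; rewrite mulr_ge0 ?indicE.
have J1 : \int[vol]_w (\1_(cbox 1) w * H (Phi z (rad L) w)) <= v * tt.
  rewrite -ler_sqr ?nnegrE//; last by rewrite mulr_ge0 ?(ltW v0)// ltW.
  have := cauchy_schwarz (sq_ind 1) (sq_cut 1 (sPz z)).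
  under [in X in X -> _]eq_Rintegral => w _ do rewrite mulrA -expr2 sqi.
  rewrite I2; move/le_trans; apply.
  have -> : \int[vol]_x (\1_(cbox 1) x * H (Phi z (rad L) x)) ^+ 2 =
      rad L ^- hdim * \int[vol]_y (\1_(bx z (rad L)) y * H y ^+ 2).
    rewrite -(Int_Phi B_blk blk_le z R0 (intg_ind (mb _ _) iH2)).
    apply: eq_Rintegral => w _; rewrite exprMn sqi; congr (_ * _).
    by rewrite -(preimage_Phi_bx B blk r z (lt0r_neq0 R0)) !indicE.
  have rN : 0 < rad L ^+ hdim by rewrite exprn_gt0.
  rewrite exprMn expr2 -mulrA ler_pM2l// ler_pdivrMl// mulrC//.
have Hl : lam < H z * d z ^+ hdim by exact: zl.
have tH : tt < H z by rewrite /tt ltr_pdivrMr.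
have e1 : H z * d z ^+ hdim - lam = (H z - tt) * d z ^+ hdim by rewrite mulrBl /tt divfK ?gt_eqF.
have e2 : v * (H z * d z ^+ hdim - lam) <= - t z.
  rewrite e1 tE opprB; apply: (@le_trans _ _ (v * (H z - tt))).
    by rewrite ler_pM2l// ler_piMr ?d1// subr_ge0 ltW.
  by rewrite mulrBr (mulrC v (H z)) lerB.
rewrite -[leRHS]sqrrN ler_sqr// nnegrE.
  by rewrite mulr_ge0 ?(ltW v0)// subr_ge0 ltW.
by apply: le_trans e2; rewrite mulr_ge0 ?(ltW v0)// subr_ge0 ltW.
Qed.

Let A (i : ratidx * nat) := bx (ratpt i.1) (rad i.2).
Let isgood (i : ratidx * nat) := `[< good lam (ratpt i.1) (rad i.2) >].

(** The three factors [geoC] in [kpp] are spent here: one on symmetry, two on triangle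
    inequalities. *)
Lemma absorb (i k : ratidx * nat) : (i.2 <= k.2)%N ->
  bx (ratpt i.1) (kp * rad i.2) `&` bx (ratpt k.1) (kp * rad k.2) !=set0 ->
  A k `<=` bx (ratpt i.1) (kpp * rad i.2).
Proof.
move=> ik [y [iy ky]].
have kp0 : 0 < kp by exact: lt_le_trans kp1.
have Rk := rad_gt0 k.2; have Ri := rad_gt0 i.2.
have Rle : rad k.2 <= rad i.2.
  by rewrite /rad ler_wiXn2l// ?invr_ge0// invf_le1 ?ltr0n ?ler1n.
set a := kp * rad k.2 in ky; set b := kp * rad i.2 in iy.
have a0 : 0 < a by rewrite mulr_gt0.
have b0 : 0 < b by rewrite mulr_gt0.
have ab : a <= b by rewrite ler_wpM2l// ltW.
have Cg := geoC1; have Cg0 := geoC0.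
have ky' : bx y (geoC * a) (ratpt k.1) by exact: bx_sym.
have aC : a <= geoC * a by rewrite ler_peMl// ltW.
have bC : b <= geoC * (geoC * b).
  by rewrite mulrA ler_peMl ?(ltW b0)// mulr_ege1.
have s1 : bx (ratpt k.1) a `<=` bx y (geoC * (geoC * a)) by apply: bx_trans => //; rewrite a0.
have s2 : bx y (geoC * (geoC * a)) `<=` bx (ratpt i.1) (geoC * (geoC * (geoC * b))).
  have ab' : 0 < geoC * (geoC * a) <= geoC * (geoC * b).
    by rewrite (mulr_gt0 Cg0 (mulr_gt0 Cg0 a0)) !ler_pM2l.
  apply: (bx_trans B_blk blk_le ab').
  by apply: bxS iy; rewrite b0.
have kE : kpp * rad i.2 = geoC * (geoC * (geoC * b)) by rewrite /kpp /b; ring.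
rewrite kE => x kx; apply: s2; apply: s1; apply: bxS kx.
by rewrite Rk /a ler_peMl ?kp1// ltW.
Qed.

Definition covered (s : seq (ratidx * nat)) : set pt := [set z | has (fun i => `[< A i z >]) s].

Lemma measurable_covered s : measurable (covered s).
Proof.
elim: s => [|i s IH]; first by rewrite (_ : covered [::] = set0)//; apply/seteqP; split.
rewrite (_ : covered (i :: s) = A i `|` covered s).
  by apply: measurableU => //; exact: measurable_bx.
apply/seteqP; split=> z; rewrite /covered /=; first by move=> /orP[/asboolP|]; [left|right].
by case=> [iz|->]; [apply/orP; left; exact/asboolP|rewrite orbT].
Qed.

(** The enlargements by [kpp] of the boxes selected by [vitali_seq] cover the set, [good_pair]
    bounds each by an integral over its enlargement by [kp], and these are disjoint. *)
Lemma int_covered T s : eta1 < T -> all isgood s ->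
  \int[vol]_z (\1_(covered s) z * H z ^+ 2) <= \int[vol]_z (K0 * (Yl T lam z + Yp lam z)).
Proof.
move=> T1 gs; have T0 : 0 < T by exact: lt_trans eta1_gt0 T1.
pose leT (a b : ratidx * nat) := (b.2 <= a.2)%N.
have toT : total leT by move=> a b; rewrite /leT leq_total.
have mb x (a : R) : measurable (bx x a) by exact: measurable_bx.
have iH2 := sq_intg2 sH.
pose Y z := K0 * (Yl T lam z + Yp lam z).
have K00 : 0 <= K0.
  have E0 := le_trans ler01 Ee1.
  exact: mulr_ge0 (mulr_ge0 (mulr_ge0 (ler0n _ 2) E0) Cth0) (addr_ge0 (mulr_ge0 (mulr_ge0 E0 (vc_ge0 _)) Gg0) ler01).
have Y0 z : 0 <= Y z by rewrite mulr_ge0// addr_ge0 ?Yl_ge0 ?Yp_ge0.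
have iY : intg Y by apply: intgZ; apply: intgD; [exact: intg_Yl|exact: intg_Yp].
have kp0 : 0 < kp by exact: lt_le_trans kp1.
have AA k : A k `<=` bx (ratpt k.1) (kpp * rad k.2).
  apply: bxS; rewrite rad_gt0/= ler_peMl ?(ltW (rad_gt0 _))// (le_trans kp1)// kp_le//.
have [s' [s'1 s'2 s'3]] := @vitali_seq R _ _ A (fun i => bx (ratpt i.1) (kp * rad i.2))
  (fun i => bx (ratpt i.1) (kpp * rad i.2)) (fun i => i.2) (sort leT s) absorb AA (sort_sorted toT s).
have gs' : all isgood s' by apply: s'1; rewrite all_sort.
have hs z : has (fun i => `[< A i z >]) s -> has (fun i => `[< A i z >]) (sort leT s).
  by move=> /hasP[i si iz]; apply/hasP; exists i => //; rewrite mem_sort.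
apply: (@le_trans _ _ (\int[vol]_z (\sum_(k <- s') \1_(bx (ratpt k.1) (kpp * rad k.2)) z * H z ^+ 2))).
  apply: Int_le => [||z].
  - exact: intg_ind (measurable_covered _) iH2.
  - by apply: intg_sum => k _; exact: intg_ind.
  rewrite indicE; have [zs|zs] := pselect (covered s z); last first.
    by rewrite memNset// mul0r sumr_ge0// => k _; rewrite mulr_ge0 ?sqr_ge0 ?indicE.
  rewrite mem_set// mul1r; have := s'3 z (hs z zs).
  elim: s' {s'1 s'2 s'3 gs'} => [//|k s' IH] /= /orP[/asboolP kz|/IH h]; rewrite big_cons.
    rewrite indicE mem_set// mul1r lerDl sumr_ge0// => l _.
    by rewrite mulr_ge0 ?sqr_ge0 ?indicE.
  by apply: (le_trans h); rewrite lerDr mulr_ge0 ?sqr_ge0 ?indicE.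
rewrite Int_sum; last by move=> k _; exact: intg_ind.
apply: (@le_trans _ _ (\sum_(k <- s') \int[vol]_z (\1_(bx (ratpt k.1) (kp * rad k.2)) z * Y z))).
  elim: s' {s'1 s'2 s'3} gs' => [|k s' IH] /=; first by rewrite !big_nil.
  by move=> /andP[/asboolP gk /IH h]; rewrite !big_cons lerD// good_pair.
rewrite -Int_sum; last by move=> k _; exact: intg_ind.
apply: Int_le => [||z]; [by apply: intg_sum => k _; exact: intg_ind|exact: iY|].
by rewrite -mulr_suml ler_piMl.
Qed.

(** The part of the level set off [goodset] does not count by [uncovered_null], and the rest is
    exhausted by finite lists of good boxes, enumerated through their codes. *)
Lemma level_ineq T : eta1 < T ->
  \int[vol]_z (\1_(lev H lam) z * H z ^+ 2) <= \int[vol]_z (K0 * (Yl T lam z + Yp lam z)).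
Proof.
move=> T1; have mL : measurable (lev H lam) by apply: measurable_lev; exact: sq_meas sH.
have mG := measurable_goodset; have iH2 := sq_intg2 sH.
have -> : \int[vol]_z (\1_(lev H lam) z * H z ^+ 2) = \int[vol]_z (\1_(lev H lam `&` goodset) z * H z ^+ 2).
  rewrite -[RHS]addr0 -uncovered_null -IntD.
  - apply: eq_Rintegral => z _; rewrite -mulrDl; congr (_ * _); rewrite !indicE.
    have [zL|zL] := pselect (lev H lam z); last first.
      by rewrite !memNset ?addr0// => -[].
    have [zG|zG] := pselect (goodset z).
      by rewrite (mem_set zL) mem_set ?memNset ?addr0// => -[_].
    by rewrite (mem_set zL) memNset ?mem_set ?add0r// => -[].
  - by apply: intg_ind => //; exact: measurableI.
  - by apply: intg_ind => //; exact: measurableD.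
pose s_ (K : nat) : seq (ratidx * nat) := seq.filter isgood (pmap unpickle (iota 0 K)).
have cv : \int[vol]_z (\1_(lev H lam `&` covered (s_ K)) z * H z ^+ 2) @[K --> \oo] -->
    \int[vol]_z (\1_(lev H lam `&` goodset) z * H z ^+ 2).
  apply: (Int_dct (g := fun z => H z ^+ 2)) => //.
  - move=> K; apply: intg_meas; apply: intg_ind => //; apply: measurableI => //; exact: measurable_covered.
  - by apply: intg_meas; apply: intg_ind => //; exact: measurableI.
  - move=> z; have [zG|zG] := pselect (goodset z); last first.
      apply: cvg_near_cst; near=> K; rewrite !indicE; congr (_ * _).
      rewrite !memNset//; first by move=> -[].
      move=> [_] /hasP[i]; rewrite seq.mem_filter => /andP[/asboolP gi _] /asboolP iz; apply: zG.
      by exists i.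
    have [i [gi iz]] := zG.
    apply: cvg_near_cst; near=> K; congr (_ * _).
    have zc : covered (s_ K) z.
      apply/hasP; exists i; last exact/asboolP.
      rewrite seq.mem_filter; apply/andP; split; first exact/asboolP.
      rewrite mem_pmap; apply/mapP; exists (pickle i); last by rewrite pickleK.
      by rewrite mem_iota /= add0n; near: K; exact: nbhs_infty_gt.
    rewrite !indicE; have [zL|zL] := pselect (lev H lam z); last by rewrite !memNset// => -[].
    by rewrite !mem_set.
  move=> K z; rewrite normrM [X in _ * X]ger0_norm ?sqr_ge0// ler_piMl ?sqr_ge0//.
rewrite -(cvg_lim (@Rhausdorff R) cv); apply: limr_le; first by apply/cvg_ex; eexists; exact: cv.
apply: nearW => K; apply: (le_trans _ (@int_covered T (s_ K) T1 _)); last exact: filter_all.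
have mcv := measurable_covered (s_ K).
apply: (Int_ind_sub (measurableI _ _ mL mcv) mcv iH2) => [z|z []//]; exact: sqr_ge0.
Unshelve. all: by end_near. Qed.

Definition lvl (Q : pt -> R) (l : R) := \int[vol]_z (\1_(lev Q l) z * Q z ^+ 2).

Lemma K0_ge0 : 0 <= K0.
Proof.
have E0 := le_trans ler01 Ee1.
exact: mulr_ge0 (mulr_ge0 (mulr_ge0 (ler0n _ 2) E0) Cth0) (addr_ge0 (mulr_ge0 (mulr_ge0 E0 (vc_ge0 _)) Gg0) ler01).
Qed.

(** For T = 2 K0 + 2 the factor K0 / T is at most 1/2, so half of the left-hand side survives. The
    difference of levels in [Yl] contributes the second term of the coefficient on the left: this
    hole filling makes the ratio of the two H coefficients less than 1. *)
Lemma level_decay : (2^-1 + K0 / eta1) * lvl H ((2 * K0 + 2) * lam) <=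
  K0 / eta1 * lvl H (eta1 * lam) + K0 * lvl P (eta1 * lam).
Proof.
set T := 2 * K0 + 2; have K00 := K0_ge0.
have e1l := eta1_le1; have e10 := eta1_gt0.
have T1 : eta1 < T by rewrite /T; lra.
have T1' : 1 <= T by rewrite /T; lra.
have mL l : measurable (lev H l) by apply: measurable_lev; exact: sq_meas sH.
have mLP l : measurable (lev P l) by apply: measurable_lev; exact: sq_meas sP.
have iH2 := sq_intg2 sH; have iP2 := sq_intg2 sP.
have levS l l' : l <= l' -> lev H l' `<=` lev H l by move=> ll z; rewrite /lev /=; exact: le_lt_trans.
have h1 : lvl H (T * lam) <= \int[vol]_z (K0 * (Yl T lam z + Yp lam z)).
  apply: le_trans (level_ineq T1); apply: Int_ind_sub => //; first by move=> z; exact: sqr_ge0.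
  by apply: levS; rewrite ler_peMl// ltW.
have iL l := intg_ind (mL l) iH2; have iLP l := intg_ind (mLP l) iP2.
have YE : \int[vol]_z (K0 * (Yl T lam z + Yp lam z)) =
   K0 * (eta1^-1 * (lvl H (eta1 * lam) - lvl H (T * lam)) + T^-1 * lvl H (T * lam) + lvl P (eta1 * lam)).
  have i1 := intgB (iL (eta1 * lam)) (iL (T * lam)).
  have i2 := intgD (intgZ eta1^-1 i1) (intgZ T^-1 (iL (T * lam))).
  rewrite /lvl -(IntB (iL _) (iL _)) -(IntZ _ i1) -(IntZ _ (iL _)) -(IntD (intgZ _ i1) (intgZ _ (iL _))).
  rewrite -(IntD i2 (iLP _)) -(IntZ _ (intgD i2 (iLP _))); apply: eq_Rintegral => z _.
  rewrite /Yl /Yp; congr (_ * _); congr (_ + _); last by rewrite mulrC.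
  have [zT|zT] := pselect (lev H (T * lam) z).
    have ze : lev H (eta1 * lam) z by apply: levS zT; rewrite ler_wpM2r ?ltW.
    rewrite !indicE (mem_set zT) (mem_set ze) memNset; last by case.
    by rewrite /=; ring.
  rewrite !indicE (memNset zT); have [ze|ze] := pselect (lev H (eta1 * lam) z).
    by rewrite (mem_set ze) mem_set//=; ring.
  by rewrite (memNset ze) memNset /=; [ring|case].
have x0 : 0 <= lvl H (T * lam) by apply: Int_ge0 => z; rewrite mulr_ge0 ?sqr_ge0 ?indicE.
have t1 : K0 * T^-1 <= 2^-1 by rewrite ler_pdivrMr /T; lra.
rewrite YE in h1; move: (lvl H (T * lam)) (lvl H (eta1 * lam)) (lvl P _) h1 x0 => x y p h1 x0.
have := ler_wpM2r x0 t1; move: (eta1^-1) (T^-1) h1 => e t; lra.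
Qed.

End gehring.

(** * Summation over geometric levels *)

Section level_sum.
Context d (X : measurableType d) (R : realType) (mu : {measure set X -> \bar R}).
Local Notation sq := (sq mu).
Local Notation intg := (intg mu).

(** A discrete layer-cake formula: the levels below s form an initial segment, and a geometric sum
    is comparable with its last term. The converse bound is [le_geom_levels]. *)
Lemma geom_levels_le (tau l0 del s : R) (n : nat) : 1 < tau -> 0 < l0 -> 0 < del -> 0 <= s ->
  (tau `^ del - 1) * l0 `^ del * \sum_(k < n) (tau `^ del) ^+ k * (tau ^+ k * l0 < s)%R%:R
  <= tau `^ del * s `^ del.
Proof.
move=> t1 l00 d0 s0; set r := tau `^ del.
have t0 : 0 < tau by lra.
have r0 : 0 < r by exact: powR_gt0.
have r1 : 1 <= r.
  have <- : 1 `^ del = 1 :> R by rewrite powR1.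
  by rewrite /r ge0_ler_powR ?nnegrE ?(ltW d0) ?(ltW t0)// ltW.
have lk k : (tau ^+ k * l0) `^ del = r ^+ k * l0 `^ del.
  rewrite powRM ?exprn_ge0 ?(ltW t0) ?(ltW l00)//; congr (_ * _).
  elim: k => [|k IH]; first by rewrite !expr0 powR1.
  by rewrite !exprS powRM ?exprn_ge0 ?(ltW t0)// IH.
have L0 : 0 < l0 `^ del by exact: powR_gt0.
elim: n => [|n IH]; first by rewrite big_ord0 mulr0 mulr_ge0 ?powR_ge0 ?(ltW r0).
have [hn|hn] := ltP (tau ^+ n * l0) s; last first.
  by rewrite big_ord_recr /= ltNge hn /= mulr0 addr0.
have rs : r ^+ n * l0 `^ del <= s `^ del.
  rewrite -lk ge0_ler_powR ?nnegrE ?(ltW d0)// ?(ltW hn)// mulr_ge0 ?exprn_ge0 ?(ltW t0)//.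
  exact: ltW.
apply: (@le_trans _ _ (l0 `^ del * ((r - 1) * \sum_(k < n.+1) r ^+ k))).
  rewrite (mulrC (r - 1)) -[leLHS]mulrA ler_wpM2l ?(ltW L0)//.
  apply: ler_wpM2l; first by rewrite subr_ge0.
  by apply: ler_sum => k _; rewrite ler_piMr ?exprn_ge0 ?(ltW r0)//; case: (_ < _).
rewrite -subrX1 (le_trans (y := l0 `^ del * r ^+ n.+1))//.
  by rewrite ler_wpM2l ?(ltW L0)// gerBl.
by rewrite exprS mulrCA ler_wpM2l ?(ltW r0)// mulrC.
Qed.

Lemma le_geom_levels (tau l0 del s : R) (n : nat) : 1 < tau -> 0 < l0 -> 0 < del -> 0 <= s ->
  s <= tau ^+ n * l0 ->
  s `^ del <= l0 `^ del * (1 + tau `^ del * \sum_(k < n) (tau `^ del) ^+ k * (tau ^+ k * l0 < s)%R%:R).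
Proof.
move=> t1 l00 d0 s0; set r := tau `^ del.
have t0 : 0 < tau by lra.
have r0 : 0 < r by exact: powR_gt0.
have lk k : (tau ^+ k * l0) `^ del = r ^+ k * l0 `^ del.
  rewrite powRM ?exprn_ge0 ?(ltW t0) ?(ltW l00)//; congr (_ * _).
  elim: k => [|k IH]; first by rewrite !expr0 powR1.
  by rewrite !exprS powRM ?exprn_ge0 ?(ltW t0)// IH.
have L0 : 0 < l0 `^ del by exact: powR_gt0.
have S0 (k : nat) : 0 <= \sum_(k < k) r ^+ k * (tau ^+ k * l0 < s)%R%:R.
  by apply: sumr_ge0 => j _; rewrite mulr_ge0 ?exprn_ge0 ?(ltW r0).
elim: n => [|n IH] sn.
  rewrite big_ord0 mulr0 addr0 mulr1; rewrite expr0 mul1r in sn.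
  by rewrite ge0_ler_powR ?nnegrE ?(ltW d0) ?(ltW l00).
rewrite big_ord_recr /=; have [hn|hn] := ltP (tau ^+ n * l0) s; last first.
  by rewrite mulr0 addr0; exact: IH.
apply: (@le_trans _ _ (r ^+ n.+1 * l0 `^ del)).
  rewrite -lk ge0_ler_powR ?nnegrE ?(ltW d0)//; exact: le_trans sn.
rewrite mulrC ler_wpM2l ?(ltW L0)// mulr1 exprS mulrDr.
by have := mulr_ge0 (ltW r0) (S0 n); lra.
Qed.

Variables (w H P : X -> R).
Hypothesis w0 : forall x, 0 <= w x.
Hypothesis mw : measurable_fun setT w.
Hypothesis H0 : forall x, 0 <= H x.
Hypothesis P0 : forall x, 0 <= P x.
Hypothesis sH : sq H.
Hypothesis sP : sq P.
Let lvw (Q : X -> R) (l : R) := \int[mu]_z (\1_[set z | l < Q z * w z] z * Q z ^+ 2).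

(** The decay at tau^k l0 is multiplied by r^k with r = tau^del and summed. Because r th < 1 the sum
    over the levels of H is absorbed; this is legitimate for the partial sums, which are finite. The
    limit is taken only at the end. *)
Lemma level_sum (tau th K1 l0 del : R) : 1 < tau -> 0 <= th -> 0 <= K1 -> 0 < l0 -> 0 < del ->
  tau `^ del * th < 1 ->
  (forall l, l0 <= l -> lvw H (tau * l) <= th * lvw H l + K1 * lvw P l) ->
  intg (fun x => P x ^+ 2 * (P x * w x) `^ del) ->
  (\int[mu]_x (H x ^+ 2 * (H x * w x) `^ del)%:E <=
   ((1 + tau `^ del / (1 - tau `^ del * th)) * (l0 `^ del * \int[mu]_x H x ^+ 2)
    + tau `^ del * tau `^ del * K1 / (1 - tau `^ del * th) * (tau `^ del / (tau `^ del - 1))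
      * \int[mu]_x (P x ^+ 2 * (P x * w x) `^ del))%:E)%E.
Proof.
move=> t1 th0 K10 l00 d0; set r := tau `^ del => rth decay iP.
have t0 : 0 < tau by lra.
have r0 : 0 < r by exact: powR_gt0.
have r1 : 1 < r.
  have <- : 1 `^ del = 1 :> R by rewrite powR1.
  by rewrite /r gt0_ltr_powR ?nnegrE ?(ltW t0).
have L0 : 0 < l0 `^ del by exact: powR_gt0.
have mlv (Q : X -> R) l : measurable_fun setT Q -> measurable [set z | l < Q z * w z].
  move=> mQ; have mf : measurable_fun setT (fun z => Q z * w z) by exact: measurable_funM.
  rewrite (_ : [set z | l < Q z * w z] = [set: X] `&` (fun z => Q z * w z) @^-1` `]l, +oo[%classic).
    exact: mf.
  by rewrite setTI; apply/seteqP; split => y /=; rewrite in_itv/= andbT.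
have ilv (Q : X -> R) l : sq Q -> intg (fun z => \1_[set z | l < Q z * w z] z * Q z ^+ 2).
  move=> sQ; apply: (@intgMb _ _ _ _ _ _ 1) (sq_intg2 sQ).
    by apply: measurable_indic; apply: mlv; exact: sq_meas sQ.
  by move=> z; rewrite indicE; case: (_ \in _); rewrite ?normr1 ?normr0.
have iE (Q : X -> R) l z : (\1_[set z | l < Q z * w z] z : R) = (l < Q z * w z)%R%:R.
  rewrite indicE; have [h|h] := boolP (l < Q z * w z); first by rewrite mem_set.
  by rewrite memNset//; exact/negP.
pose lam k := tau ^+ k * l0.
pose A k := lvw H (lam k); pose Bk k := lvw P (lam k).
pose S n := \sum_(k < n) r ^+ k * A k; pose SB n := \sum_(k < n) r ^+ k * Bk k.
have A0 k : 0 <= A k by apply: Int_ge0 => z; rewrite mulr_ge0 ?sqr_ge0 ?indicE.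
pose h2 := \int[mu]_x H x ^+ 2.
have A0h : A 0%N <= h2.
  apply: Int_le => [||z]; [exact: ilv|exact: sq_intg2|].
  by rewrite ler_piMl ?sqr_ge0// indicE; case: (_ \in _).
have lam_ge k : l0 <= lam k by rewrite /lam ler_peMl ?(ltW l00)// exprn_ege1// ltW.
have Astep k : A k.+1 <= th * A k + K1 * Bk k.
  have -> : A k.+1 = lvw H (tau * lam k) by rewrite /A /lam exprS -mulrA.
  exact: decay.
(* The first level is bounded by the full integral [h2], each further one by the decay from the
   level below. *)
have Sstep n : (1 - r * th) * S n <= h2 + r * K1 * SB n.
  have SnS : S n <= S n.+1 by rewrite /S big_ord_recr /= lerDl mulr_ge0 ?exprn_ge0 ?(ltW r0).
  have : S n.+1 <= h2 + (r * th * S n + r * K1 * SB n).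
    rewrite /S big_ord_recl expr0 mul1r lerD// /SB !mulr_sumr -big_split /=; apply: ler_sum => k _.
    rewrite -[fintype.bump 0 k]/(nat_of_ord k).+1 exprS; have := ler_wpM2l (mulr_ge0 (ltW r0) (exprn_ge0 k (ltW r0))) (Astep k).
    by move/le_trans; apply; rewrite le_eqVlt; apply/orP; left; apply/eqP; ring.
  by lra.
have SBn n : (r - 1) * l0 `^ del * SB n <= r * \int[mu]_x (P x ^+ 2 * (P x * w x) `^ del).
  rewrite /SB; have -> : \sum_(k < n) r ^+ k * Bk k = \int[mu]_x \sum_(k < n) r ^+ k * (\1_[set z | lam k < P z * w z] x * P x ^+ 2).
    by rewrite Int_sum => [|k _]; [apply: eq_bigr => k _; rewrite IntZ//; exact: ilv|apply: intgZ; exact: ilv].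
  have iSP : intg (fun x => \sum_(k < n) r ^+ k * (\1_[set z | lam k < P z * w z] x * P x ^+ 2)).
    by apply: intg_sum => k _; apply: intgZ; exact: ilv.
  rewrite -!IntZ//; apply: Int_le => [||x]; [exact: intgZ|exact: intgZ|].
  have := @geom_levels_le tau l0 del (P x * w x) n t1 l00 d0 (mulr_ge0 (P0 x) (w0 x)).
  move/(ler_wpM2l (sqr_ge0 (P x))); rewrite -/r => HH.
  rewrite [leRHS]mulrCA (le_trans _ HH)// le_eqVlt; apply/orP; left; apply/eqP.
  rewrite [RHS]mulrCA; congr (_ * _); rewrite mulr_sumr; apply: eq_bigr => k _; rewrite iE; ring.
pose Pd := \int[mu]_x (P x ^+ 2 * (P x * w x) `^ del).
have Pd0 : 0 <= Pd by apply: Int_ge0 => x; rewrite mulr_ge0 ?sqr_ge0 ?powR_ge0.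
pose M := (1 + r / (1 - r * th)) * (l0 `^ del * h2) + r * r * K1 / (1 - r * th) * (r / (r - 1)) * Pd.
rewrite -[leRHS]/(M%:E).
pose s x := H x * w x; have s0 x : 0 <= s x by exact: mulr_ge0.
have ms : measurable_fun setT s by apply: measurable_funM => //; exact: sq_meas sH.
pose g n x := \1_[set x | s x <= lam n] x * (H x ^+ 2 * s x `^ del).
have g0 n x : 0 <= g n x by rewrite /g mulr_ge0 ?indicE// mulr_ge0 ?sqr_ge0 ?powR_ge0.
have mset n : measurable [set x | s x <= lam n].
  rewrite (_ : [set _ | _] = [set: X] `&` s @^-1` `]-oo, lam n]%classic); first exact: ms.
  by rewrite setTI; apply/seteqP; split => y /=; rewrite in_itv.
have mHs : measurable_fun setT (fun x => H x ^+ 2 * s x `^ del).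
  apply: measurable_funM; first by apply: measurable_funX; exact: sq_meas sH.
  exact: (@measurableT_comp _ _ _ _ _ _ (@powR R ^~ del) _ s _ ms).
have mg n : measurable_fun setT (g n) by apply: measurable_funM => //; exact: measurable_indic.
(* Where s is at most [lam n] only the first n levels are concerned, so [le_geom_levels] and [Sstep]
   apply with a bound independent of n. *)
have gM n : (\int[mu]_x (g n x)%:E <= M%:E)%E.
  pose F x := l0 `^ del * (H x ^+ 2 + r * \sum_(k < n) r ^+ k * (\1_[set z | lam k < H z * w z] x * H x ^+ 2)).
  have iS : intg (fun x => \sum_(k < n) r ^+ k * (\1_[set z | lam k < H z * w z] x * H x ^+ 2)).
    by apply: intg_sum => k _; apply: intgZ; exact: ilv.
  have iF : intg F by apply: intgZ; apply: intgD; [exact: sq_intg2|exact: intgZ].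
  apply: (@le_trans _ _ (\int[mu]_x (F x)%:E)%E).
    apply: ge0_le_integral => //=.
    - by move=> x _; rewrite lee_fin.
    - exact/measurable_EFinP.
    - by apply/measurable_EFinP; exact: intg_meas iF.
    move=> x _; rewrite lee_fin /g indicE.
    have [xn|xn] := pselect (s x <= lam n); last first.
      rewrite memNset// mul0r /F mulr_ge0 ?(ltW L0)// addr_ge0 ?sqr_ge0// mulr_ge0 ?(ltW r0)// sumr_ge0// => k _.
      by rewrite mulr_ge0 ?exprn_ge0 ?(ltW r0)// mulr_ge0 ?sqr_ge0 ?indicE.
    rewrite mem_set// mul1r; have := le_geom_levels t1 l00 d0 (s0 x) xn.
    move/(ler_wpM2l (sqr_ge0 (H x)))/le_trans; apply.
    rewrite /F mulrCA le_eqVlt; apply/orP; left; apply/eqP; congr (_ * _).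
    rewrite mulrDr mulr1; congr (_ + _); rewrite mulrCA; congr (_ * _).
    by rewrite mulr_sumr; apply: eq_bigr => k _; rewrite iE /s; ring.
  rewrite -(IntE iF) lee_fin /F IntZ; last by apply: intgD; [exact: sq_intg2|exact: intgZ].
  rewrite IntD; [|exact: sq_intg2|exact: intgZ].
  rewrite IntZ// Int_sum; last by move=> k _; apply: intgZ; exact: ilv.
  have -> : \sum_(k < n) \int[mu]_x (r ^+ k * (\1_[set z | lam k < H z * w z] x * H x ^+ 2)) = S n.
    by apply: eq_bigr => k _; rewrite IntZ//; exact: ilv.
  rewrite -/h2.
  have q0 : 0 < 1 - r * th by rewrite subr_gt0.
  have q1 : 0 < r - 1 by rewrite subr_gt0.
  have hS := Sstep n; have hB := SBn n; rewrite -/Pd in hB.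
  have hS' : S n <= (h2 + r * K1 * SB n) / (1 - r * th) by rewrite ler_pdivlMr// mulrC.
  have hB' : l0 `^ del * SB n <= r / (r - 1) * Pd by rewrite mulrAC ler_pdivlMr// mulrC mulrA.
  apply: (@le_trans _ _ (l0 `^ del * (h2 + r * ((h2 + r * K1 * SB n) / (1 - r * th))))).
    by rewrite ler_wpM2l ?(ltW L0)// lerD2l ler_wpM2l// ltW.
  have c0 : 0 <= r * r * K1 / (1 - r * th) by exact: divr_ge0 (mulr_ge0 (mulr_ge0 (ltW r0) (ltW r0)) K10) (ltW q0).
  apply: (@le_trans _ _ ((1 + r / (1 - r * th)) * (l0 `^ del * h2) + r * r * K1 / (1 - r * th) * (l0 `^ del * SB n))).
    by rewrite le_eqVlt; apply/orP; left; apply/eqP; ring.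
  by rewrite /M lerD2l -[leRHS]mulrA ler_wpM2l.
have lam_lim x : \forall n \near \oo, s x <= lam n.
  have b0 : 0 < tau - 1 by rewrite subr_gt0.
  near=> n; have bern : n%:R * (tau - 1) <= tau ^+ n.
    elim: (n) => [|k IH]; first by rewrite mul0r.
    rewrite exprS -natr1; have : 1 <= tau ^+ k by rewrite exprn_ege1// ltW.
    nra.
  rewrite /lam -ler_pdivrMr// (le_trans _ bern)// -ler_pdivrMr//; near: n; exact: nbhs_infty_ger.
have lamS n k : (n <= k)%N -> lam n <= lam k.
  by move=> nk; rewrite /lam ler_wpM2r ?(ltW l00)// ler_weXn2l// ltW.
have gS x n k : (n <= k)%N -> g n x <= g k x.
  move=> nk; rewrite /g ler_wpM2r ?mulr_ge0 ?sqr_ge0 ?powR_ge0// !indicE.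
  have [xn|xn] := boolP (s x <= lam n); first by rewrite !mem_set//=; exact: le_trans (lamS _ _ nk).
  by rewrite memNset//; exact/negP.
have gc x : (g n x)%:E @[n --> \oo] --> (H x ^+ 2 * s x `^ del)%:E.
  apply: cvg_near_cst; near=> n; rewrite /g indicE mem_set ?mul1r//=; near: n; exact: lam_lim.
have -> : (\int[mu]_x (H x ^+ 2 * s x `^ del)%:E = \int[mu]_x limn (fun n => (g n x)%:E))%E.
  by apply: eq_integral => x _; apply/esym/cvg_lim => //; exact: gc.
rewrite monotone_convergence//.
- apply: lime_le; last by apply: nearW => n; exact: gM.
  apply: ereal_nondecreasing_is_cvgn => n k nk; apply: ge0_le_integral => //=.
  + by move=> x _; rewrite lee_fin.
  + exact/measurable_EFinP.
  + exact/measurable_EFinP.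
  + move=> x _; rewrite lee_fin gS//.
- by move=> n; exact/measurable_EFinP.
- by move=> n x _; rewrite lee_fin.
- move=> x _ n k nk; rewrite lee_fin gS//.
Unshelve. all: by end_near. Qed.

End level_sum.

Lemma sqrM_powR (R : realType) (x del : R) : 0 <= x -> 0 < del -> x ^+ 2 * x `^ del = x `^ (2 + del).
Proof.
move=> x0 d0; have [->|xn] := eqVneq x 0.
  by rewrite expr0n mul0r powR0// gt_eqF// addr_gt0.
have xp : 0 < x by rewrite lt_neqAle eq_sym xn.
by rewrite powRD ?powR_mulrn// xn implybT.
Qed.

Lemma le_div_decay (R : realFieldType) (D a b x y p : R) : 0 < D -> D * x <= a * y + b * p ->
  x <= a / D * y + b / D * p.
Proof.
move=> D0 h; rewrite -(ler_pM2l D0) (le_trans h)// le_eqVlt; apply/orP; left; apply/eqP.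
by field; rewrite gt_eqF.
Qed.

(** * Higher integrability on compact subsets *)

Section higher_integrability.
Context {R : realType} {n : nat}.
Local Notation pt := ('cV[R]_n * R)%type.
Variables (B : 'M[R]_n) (blk : 'I_n -> nat) (r : nat).
Hypothesis B_blk : forall i j, B i j != 0 -> blk j = (blk i).+1.
Hypothesis blk_ord : forall i j : 'I_n, (blk i < blk j)%N -> (i < j)%N.
Hypothesis blk_le : forall i, (blk i <= r)%N.
Hypothesis B_rank : forall j, (0 < blk j)%N -> exists c : 'I_n -> R,
  (forall i, c i != 0 -> (blk i).+1 = blk j) /\
  forall l, \sum_i c i * B i l = (l == j)%:R.
Local Notation wsol := (wsol B blk).
Local Notation hdim := (hdim blk).
Local Notation intg := (intg (@vol R n)).
Local Notation nrm := (nrm (@vol R n)).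
Local Notation hsum := (hsum blk).
Local Notation psum := (psum blk).
Implicit Types (z w y q : pt) (U K : set pt).

(** The constants are fixed in the order [kap], m, [Cth]: the factor 1 / (4 E) required of the
    reverse Holder inequality depends on the volume ratio E, while [kap] does not depend on that
    factor. *)
Lemma gehring (lam M r0 : R) : 0 < lam -> 0 <= M -> 1 <= r0 -> exists2 del0 : R, 0 < del0 &
  forall del, 0 < del <= del0 -> exists C c : R, [/\ 0 <= C, 0 < c &
  forall U u h F k f g, U `<=` cbox r0 -> wsol lam M U u h F k f g ->
  forall l0, 0 < l0 -> \int[vol]_z hsum h z ^+ 2 <= c * l0 ^+ 2 ->
  intg (fun z => psum f g z ^+ 2 * (psum f g z * bdist U z ^+ hdim) `^ del) ->
  (\int[vol]_z (hsum h z ^+ 2 * (hsum h z * bdist U z ^+ hdim) `^ del)%:E <=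
   (C * (l0 `^ del * \int[vol]_z hsum h z ^+ 2 +
    \int[vol]_z (psum f g z ^+ 2 * (psum f g z * bdist U z ^+ hdim) `^ del)))%:E)%E].
Proof.
move=> lam0 M0 r01; have [kap kap2 RH] := reverse_holder B_blk blk_ord blk_le B_rank lam0 M0.
have kap1 : 1 <= kap by rewrite (le_trans _ kap2)// ler1n.
have [m Dm] : exists m : nat, geoC B r * kpp B r kap <= dd m.
  set x := geoC B r * _; exists (Num.bound x); rewrite /dd.
  apply: (@le_trans _ _ (Num.bound x)%:R); last by rewrite -natrX ler_nat ltnW// ltn_expl.
  apply: ltW; apply: archi_boundP.
  by rewrite /x /kpp /kp !mulr_ge0 ?exprn_ge0 ?(le_trans ler01 kap1) ?(ltW (geoC_gt0 B r)).
have E1 := @Ee1 R n blk m; have E0 : 0 < Ee blk m :> R by rewrite (lt_le_trans ltr01).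
have th0 : 0 < (4 * Ee blk m)^-1 :> R by rewrite invr_gt0 mulr_gt0.
have [Cth Cth0 {}RH] := RH _ th0.
have e10 : 0 < eta1 blk Cth m by exact: eta1_gt0.
have e1l : eta1 blk Cth m <= 1 by exact: eta1_le1.
have K00 : 0 <= K0 blk Cth m by exact: K0_ge0.
set K := K0 blk Cth m in K00; set e := eta1 blk Cth m in e10 e1l.
have Ke0 : 0 <= K / e by rewrite divr_ge0// ltW.
pose D := 2^-1 + K / e; have D0 : 0 < D by rewrite /D; lra.
pose th := (K / e) / D; pose K1 := K / D; pose tau := (2 * K + 2) / e.
have th00 : 0 <= th by rewrite divr_ge0// ltW.
have th1 : th < 1 by rewrite /th ltr_pdivrMr// mul1r /D; lra.
have K10 : 0 <= K1 by rewrite divr_ge0// ltW.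
have tau1 : 1 < tau.
  by rewrite /tau ltr_pdivlMr// mul1r (le_lt_trans e1l)// ltr_wpDl ?ltr1n// mulr_ge0.
have tau0 : 0 < tau := lt_trans ltr01 tau1.
have ltau : 0 < ln tau by rewrite ln_gt0.
have th10 : 0 < 1 + th by rewrite ltr_wpDr.
have X1 : 1 < 2 / (1 + th) by rewrite ltr_pdivlMr// mul1r [ltRHS]mulr2n ltrD2l.
(* For del up to this value tau^del <= 2 / (1 + th), hence tau^del th <= 2 th / (1 + th) < 1. *)
exists (ln (2 / (1 + th)) / ln tau); first by rewrite divr_gt0// ln_gt0.
move=> del /andP[d0 dl].
have rth : tau `^ del * th < 1.
  have h1 : tau `^ del <= 2 / (1 + th).
    rewrite /powR gt_eqF// -[leRHS]lnK ?posrE ?(lt_trans ltr01 X1)//.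
    by rewrite ler_expR -ler_pdivlMr.
  apply: (@le_lt_trans _ _ (2 / (1 + th) * th)); first by rewrite ler_wpM2r.
  by rewrite mulrAC ltr_pdivrMr// mul1r mulr_natl mulr2n ltrD2r.
have v0 := @vc1_gt0 R n.
have eta0 : 0 < eta B r r0 m by exact: eta_gt0.
have q0 : 0 < 1 - tau `^ del * th by rewrite subr_gt0.
have r1 : 1 < tau `^ del.
  have <- : 1 `^ del = 1 :> R by rewrite powR1.
  by rewrite gt0_ltr_powR ?nnegrE ?(ltW tau0).
have rr0 : 0 < tau `^ del := lt_trans ltr01 r1.
have rm0 : 0 < tau `^ del - 1 by rewrite subr_gt0.
set C1 := 1 + tau `^ del / (1 - tau `^ del * th).
set C2 := tau `^ del * tau `^ del * K1 / (1 - tau `^ del * th) * (tau `^ del / (tau `^ del - 1)).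
have C10 : 0 <= C1 by rewrite addr_ge0// divr_ge0 ?(ltW q0) ?(ltW rr0).
have C20 : 0 <= C2.
  exact: mulr_ge0 (divr_ge0 (mulr_ge0 (mulr_ge0 (ltW rr0) (ltW rr0)) K10) (ltW q0)) (divr_ge0 (ltW rr0) (ltW rm0)).
exists (C1 + C2), (eta B r r0 m ^+ hdim * (e^-1) ^+ 2 * @vc R n 1).
have ei0 : 0 < e^-1 by rewrite invr_gt0.
split; [exact: addr_ge0|exact: mulr_gt0 (mulr_gt0 (exprn_gt0 _ eta0) (exprn_gt0 _ ei0)) v0|].
move=> U u h F k f g Ur0 ws l0 l00 hl0 iP.
have [su sh sF sk sf sg _ _ _ _ _] := ws.
have sH := sq_hsum sh; have sP := sq_psum sf sg.
have rh : rev_holder B blk r kap Cth m U (hsum h) (psum f g) by move=> q e' e'01 qU; exact: RH ws _ _ e'01 qU.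
have w0 z : 0 <= bdist U z ^+ hdim by rewrite exprn_ge0 ?bdist_ge0.
have mw : measurable_fun setT (fun z => bdist U z ^+ hdim).
  by apply: measurable_funX; exact: measurable_bdist.
(* [level_decay] is used at l / e, so that its lower level eta1 (l / e) is l and its upper one is
   tau l. *)
have decay l : l0 <= l -> lvl blk U (hsum h) (tau * l) <= th * lvl blk U (hsum h) l + K1 * lvl blk U (psum f g) l.
  move=> ll; have l0' : 0 < l by exact: lt_le_trans ll.
  have le0 : 0 < l / e by rewrite divr_gt0.
  have hl : \int[vol]_z hsum h z ^+ 2 <= eta B r r0 m ^+ hdim * (l / e) ^+ 2 * @vc R n 1.
    apply: (le_trans hl0); have := exprn_ge0 hdim (ltW eta0); have := ltW v0.
    move: (eta B r r0 m ^+ hdim) (@vc R n 1) => a V V0 a0; rewrite (exprMn 2 l e^-1).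
    rewrite [leRHS](_ : _ = a * e^-1 ^+ 2 * V * l ^+ 2); last by ring.
    rewrite ler_wpM2l ?ler_sqr ?nnegrE ?(ltW l00) ?(ltW l0')// mulr_ge0// mulr_ge0//.
    by rewrite exprn_ge0// invr_ge0 ltW.
  have := level_decay B_blk blk_ord blk_le kap1 r01 Cth0 Dm Ur0 (@hsum_ge0 _ _ blk h) (@psum_ge0 _ _ blk f g) sH sP rh le0 hl.
  rewrite -/K -/e -/D.
  have -> : (2 * K + 2) * (l / e) = tau * l by rewrite /tau mulrA mulrAC.
  have -> : e * (l / e) = l by rewrite mulrCA divff ?mulr1// gt_eqF.
  exact: le_div_decay.
have := level_sum w0 mw (@hsum_ge0 _ _ blk h) (@psum_ge0 _ _ blk f g) sH sP tau1 th00 K10 l00 d0 rth decay iP.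
move/le_trans; apply; rewrite lee_fin -/C1 -/C2 mulrDr.
have p0 : 0 <= l0 `^ del * \int[vol]_z hsum h z ^+ 2.
  by rewrite mulr_ge0 ?powR_ge0// Int_ge0// => z; exact: sqr_ge0.
have p1 : 0 <= \int[vol]_z (psum f g z ^+ 2 * (psum f g z * bdist U z ^+ hdim) `^ del).
  by apply: Int_ge0 => z; rewrite mulr_ge0 ?sqr_ge0 ?powR_ge0.
by apply: lerD; rewrite ler_wpM2r// ?lerDl ?lerDr.
Qed.

(** The starting level is l0 = cc N, where N is the L^2 norm and c cc^2 = 1: the size condition of
    [gehring] holds with equality and the estimate becomes homogeneous. On K the weight is bounded
    from below. *)
Lemma higher_integrability (lam M r0 : R) : 0 < lam -> 0 <= M -> 1 <= r0 -> exists2 del0 : R, 0 < del0 &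
  forall del U K, 0 < del <= del0 -> open U -> U `<=` cbox r0 -> compact K -> K `<=` U ->
  exists2 C : R, 0 <= C &
  forall u h F k f g, wsol lam M U u h F k f g -> intg (fun z => psum f g z `^ (2 + del)) ->
  (\int[vol]_z (\1_K z * hsum h z `^ (2 + del))%:E <=
   (C * (nrm (hsum h) `^ (2 + del) + \int[vol]_z psum f g z `^ (2 + del)))%:E)%E.
Proof.
move=> lam0 M0 r01; have [del0 d00 HG] := gehring lam0 M0 r01; exists del0 => // del U K dd oU Ur0 cK KU.
have [C [c [C0 c0 {}HG]]] := HG del dd; have /andP[d0 _] := dd.
have [b b0 Hb] := bdist_compact oU cK KU.
pose bb := (b ^+ hdim) `^ del; have bb0 : 0 < bb by rewrite powR_gt0// exprn_gt0.
pose cc := (Num.sqrt c)^-1; have cc0 : 0 < cc by rewrite invr_gt0 sqrtr_gt0.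
exists (bb^-1 * (C * (cc `^ del + 1))).
  by rewrite mulr_ge0 ?invr_ge0 ?(ltW bb0)// mulr_ge0// addr_ge0// powR_ge0.
move=> u h F k f g ws iP.
have [su sh sF sk sf sg _ _ _ _ _] := ws.
have sH := sq_hsum sh; have sP := sq_psum sf sg.
have H0 := @hsum_ge0 _ _ blk h; have P0 := @psum_ge0 _ _ blk f g.
have d1 z : bdist U z ^+ hdim <= 1 by rewrite exprn_ile1 ?bdist_ge0 ?bdist_le1.
have d00' z : 0 <= bdist U z ^+ hdim by rewrite exprn_ge0 ?bdist_ge0.
have mpow (p : pt -> R) : measurable_fun setT p -> measurable_fun setT (fun z => p z `^ del).
  by move=> mp; exact: (@measurableT_comp _ _ _ _ _ _ (@powR R ^~ del) _ p _ mp).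
have md : measurable_fun setT (fun z => bdist U z ^+ hdim).
  by apply: measurable_funX; exact: measurable_bdist.
have Pb z : psum f g z ^+ 2 * (psum f g z * bdist U z ^+ hdim) `^ del <= psum f g z `^ (2 + del).
  rewrite -(sqrM_powR (P0 z) d0) ler_wpM2l ?sqr_ge0// ge0_ler_powR ?nnegrE ?(ltW d0) ?(mulr_ge0 (P0 z) (d00' z))//.
  by rewrite ler_piMr.
have iP' : intg (fun z => psum f g z ^+ 2 * (psum f g z * bdist U z ^+ hdim) `^ del).
  apply: (intg_le _ _ iP) => [|z]; last by rewrite ger0_norm// mulr_ge0 ?sqr_ge0 ?powR_ge0.
  apply: measurable_funM; first by apply: measurable_funX; exact: sq_meas sP.
  by apply: mpow; apply: measurable_funM => //; exact: sq_meas sP.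
have mH : measurable_fun setT (hsum h) by exact: sq_meas sH.
have mHd : measurable_fun setT (fun z => hsum h z ^+ 2 * (hsum h z * bdist U z ^+ hdim) `^ del).
  apply: measurable_funM; first exact: measurable_funX.
  by apply: mpow; exact: measurable_funM.
have h2E : \int[vol]_z hsum h z ^+ 2 = nrm (hsum h) ^+ 2 by rewrite nrm_sqr.
set N := nrm (hsum h) in h2E *; have N0 : 0 <= N by exact: nrm_ge0.
set I := \int[vol]_z psum f g z `^ (2 + del).
have I0 : 0 <= I by apply: Int_ge0 => z; exact: powR_ge0.
have key : (\int[vol]_z (hsum h z ^+ 2 * (hsum h z * bdist U z ^+ hdim) `^ del)%:E <=
   (C * (cc `^ del * N `^ (2 + del) + I))%:E)%E.
  have II : \int[vol]_z (psum f g z ^+ 2 * (psum f g z * bdist U z ^+ hdim) `^ del) <= I by exact: Int_le.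
  (* If the norm is 0 any positive level is admissible, and 1 is taken. *)
  have [NN|NN] := eqVneq N 0.
    have := HG _ _ _ _ _ _ _ Ur0 ws 1 ltr01; rewrite h2E NN expr0n /= => /(_ _ iP').
    rewrite powR1 mulr0 add0r expr1n mulr1 => /(_ (ltW c0)) /le_trans; apply.
    by rewrite lee_fin ler_wpM2l// powR0 ?mulr0 ?add0r// gt_eqF// addr_gt0.
  have Np : 0 < N by rewrite lt_neqAle eq_sym NN.
  have cE : c * cc ^+ 2 = 1 by rewrite /cc exprVn sqr_sqrtr ?(ltW c0)// divff// gt_eqF.
  have cN : N ^+ 2 <= c * (cc * N) ^+ 2 by rewrite [in leRHS](exprMn 2 cc N) mulrA cE mul1r.
  have := HG _ _ _ _ _ _ _ Ur0 ws (cc * N) (mulr_gt0 cc0 Np) _ iP'.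
  rewrite h2E => /(_ cN)/le_trans; apply.
  rewrite lee_fin ler_wpM2l// lerD//.
  by rewrite powRM ?invr_ge0 ?sqrtr_ge0 ?(ltW Np)// -mulrA [_ * N ^+ 2]mulrC sqrM_powR.
apply: (@le_trans _ _ (bb^-1%:E * (C * (cc `^ del * N `^ (2 + del) + I))%:E)%E); last first.
  rewrite -EFinM lee_fin -!mulrA ler_wpM2l ?invr_ge0 ?(ltW bb0)// ler_wpM2l//.
  have := powR_ge0 cc del; have := powR_ge0 N (2 + del); nra.
apply: (@le_trans _ _ (bb^-1%:E * \int[vol]_z (hsum h z ^+ 2 * (hsum h z * bdist U z ^+ hdim) `^ del)%:E)%E); last first.
  by rewrite lee_pmul2l ?lte_fin ?invr_gt0.
rewrite -ge0_integralZl_EFin//; last 3 first.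
- by move=> z _; rewrite lee_fin mulr_ge0 ?sqr_ge0 ?powR_ge0.
- exact/measurable_EFinP.
- by rewrite invr_ge0 ltW.
have mK : measurable K by exact: compact_measurable_pt.
apply: ge0_le_integral => //.
- by move=> z _; rewrite lee_fin mulr_ge0 ?indicE ?powR_ge0.
- apply/measurable_EFinP; apply: measurable_funM; first exact: measurable_indic.
  exact: (@measurableT_comp _ _ _ _ _ _ (@powR R ^~ (2 + del)) _ (hsum h) _ mH).
- by apply/measurable_EFinP; apply: measurable_funM.
move=> z _; rewrite -EFinM lee_fin indicE; have [zK|zK] := pselect (K z); last first.
  by rewrite memNset// mul0r mulr_ge0 ?invr_ge0 ?(ltW bb0)// mulr_ge0 ?sqr_ge0 ?powR_ge0.
rewrite mem_set// mul1r -(sqrM_powR (H0 z) d0) mulrCA ler_wpM2l ?sqr_ge0//.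
rewrite powRM// mulrCA ler_peMr ?powR_ge0// ler_pdivlMl// mulr1.
rewrite ge0_ler_powR ?nnegrE ?(ltW d0) ?exprn_ge0 ?bdist_ge0 ?(ltW b0)//.
by rewrite lerXn2r ?nnegrE ?(ltW b0) ?bdist_ge0//; exact: Hb.
Qed.

End higher_integrability.

(** * The block structure of B *)

Section blocks.
Context {R : realType} {r : nat}.
Variable m : 'I_r.+1 -> nat.
Local Notation N := (dimx m).
Local Notation m0 := (m ord0).
Local Notation pt := ('cV[R]_N * R)%type.

Definition blkm (j : 'I_N) : nat := tagnat.sig1 j.

Lemma blkm_le j : (blkm j <= r)%N.
Proof. by rewrite -ltnS; exact: ltn_ord. Qed.

Lemma blkm_ord (i j : 'I_N) : (blkm i < blkm j)%N -> (i < j)%N.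
Proof.
move=> ij; rewrite ltnNge; apply/negP => ji.
have := @tagnat.le_sig1 _ m j i ji; rewrite leEord /= => h.
by move: ij; rewrite /blkm ltnNge h.
Qed.

Lemma blkm_Rank k (s : 'I_(m k)) : blkm (tagnat.Rank k s) = k.
Proof. by rewrite /blkm tagnat.Rank1K. Qed.

Lemma RankP (j : 'I_N) : exists k (s : 'I_(m k)), j = tagnat.Rank k s.
Proof. by exists (tagnat.sig1 j), (tagnat.sig2 j); rewrite tagnat.sig2K. Qed.

Lemma Rank_inj k : injective (@tagnat.Rank _ m k).
Proof.
move=> a b /(@tagnat.rank_inj _ m) /eqP; rewrite eq_Tagged => /eqP; exact.
Qed.

Lemma Rank_neq k l (s : 'I_(m k)) (s' : 'I_(m l)) : k != l -> (tagnat.Rank k s == tagnat.Rank l s') = false.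
Proof.
move=> kl; apply/negP => /eqP E; move/negP: kl; apply; apply/eqP/val_inj.
by rewrite /= -(blkm_Rank s) E blkm_Rank.
Qed.

Variable B : 'M[R]_N.
Hypothesis hB : block_superdiag B.

Lemma B_Rank k l (s : 'I_(m k)) (s' : 'I_(m l)) :
  B (tagnat.Rank k s) (tagnat.Rank l s') = @submxblock R _ _ m m B k l s s'.
Proof. by rewrite !mxE. Qed.

Lemma blkm_B i j : B i j != 0 -> blkm j = (blkm i).+1.
Proof.
have [k [s ->]] := RankP i; have [l [s' ->]] := RankP j; rewrite B_Rank !blkm_Rank.
by have := hB k l; case: eqP => [//|_ ->]; rewrite mxE eqxx.
Qed.

(** A block of full column rank has a left inverse; the row of it that belongs to j, placed in the
    previous block, gives the coefficients. *)
Lemma blkm_rank j : (0 < blkm j)%N -> exists c : 'I_N -> R,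
  (forall i, c i != 0 -> (blkm i).+1 = blkm j) /\
  forall l, \sum_i c i * B i l = (l == j)%:R.
Proof.
have [l [sj ->]] := RankP j; rewrite blkm_Rank => l0.
have kr : (l.-1 < r.+1)%N by rewrite (leq_ltn_trans (leq_pred _) (ltn_ord l)).
pose k : 'I_r.+1 := Ordinal kr; have kl : l = k.+1 :> nat by rewrite /= prednK.
have := hB k l; rewrite {1}kl eqxx => rk.
have /row_fullP[D HD] : row_full (@submxblock R _ _ m m B k l) by rewrite /row_full rk.
pose c (i : 'I_N) : R := \sum_s (tagnat.Rank k s == i)%:R * D sj s.
have cE (G : 'I_N -> R) : \sum_(i : 'I_N) c i * G i = \sum_s D sj s * G (tagnat.Rank k s).
  transitivity (\sum_(i : 'I_N) \sum_s ((tagnat.Rank k s == i)%:R * D sj s * G i)).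
    by apply: eq_bigr => i _; rewrite mulr_suml.
  rewrite exchange_big; apply: eq_bigr => s _; rewrite (bigD1 (tagnat.Rank k s))//= eqxx mul1r big1 ?addr0//.
  by move=> i; rewrite eq_sym => /negbTE ->; rewrite !mul0r.
exists c; split=> [i|l'].
  move=> ci; have [s /eqP <-] : exists s, tagnat.Rank k s == i.
    apply: contrapT => h; move/negP: ci; apply; rewrite /c big1// => s _.
    by case: eqP => [E|_]; [case: h; exists s; apply/eqP|rewrite mul0r].
  by rewrite blkm_Rank kl.
rewrite cE; have [l1 [s1 ->]] := RankP l'.
under eq_bigr do rewrite B_Rank.
have [E|ll] := eqVneq l1 l.
  subst l1; have := congr1 (fun M : 'M[R]_(m l) => M sj s1) HD; rewrite !mxE => ->.
  by rewrite (inj_eq (@Rank_inj l)) eq_sym.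
rewrite Rank_neq// big1// => s _; have := hB k l1.
case: eqP => [E _|_ ->]; last by rewrite mxE mulr0.
by move/negP: ll; case; apply/eqP/val_inj; exact: etrans E (esym kl).
Qed.

Lemma fb_first (i : 'I_N) : fb blkm i = (i \in [set first_block i0 | i0 : 'I_m0]).
Proof.
apply/idP/imsetP => [|[i0 _ ->]]; last by rewrite /fb blkm_Rank.
have [k [s ->]] := RankP i; rewrite /fb blkm_Rank => /eqP k0.
have E : k = ord0 by exact: val_inj.
by subst k; exists s.
Qed.

Lemma sum_fb (G : 'I_N -> R) : \sum_(i | fb blkm i) G i = \sum_(i0 < m0) G (first_block i0).
Proof.
rewrite (eq_bigl _ _ fb_first) big_imset /=; last by move=> a b _ _; exact: Rank_inj.
by apply: eq_bigl => i; rewrite inE.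
Qed.

(** The record [wsol] indexes its fields by all space coordinates; those off the first block are set
    to 0. *)
Definition ext_fb (v : 'I_m0 -> pt -> R) (i : 'I_N) (z : pt) : R :=
  \sum_(i0 < m0) (first_block i0 == i)%:R * v i0 z.

Lemma ext_fb_first v (i0 : 'I_m0) : ext_fb v (first_block i0) = v i0.
Proof.
apply/funext => z; rewrite /ext_fb (bigD1 i0)//= eqxx mul1r big1 ?addr0// => i ii.
by rewrite (inj_eq (@Rank_inj ord0)) (negbTE ii) mul0r.
Qed.

Lemma fb_ind (P : 'I_N -> Prop) : (forall i0 : 'I_m0, P (first_block i0)) -> forall i, fb blkm i -> P i.
Proof. by move=> H i; rewrite fb_first => /imsetP[i0 _ ->]; exact: H. Qed.

Lemma tst_test_fun (U : set pt) phi : tst U phi -> test_fun U phi.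
Proof.
move=> [sp [K [cK KU] K0]].
have cl : closure [set z | phi z != 0] `<=` K.
  have clK : closed K by apply: compact_closed => //; exact: norm_hausdorff.
  rewrite [X in _ `<=` X](proj1 (closure_id K) clK); apply: closure_subset => z /= pz.
  by apply: contrapT => /K0 p0; rewrite p0 eqxx in pz.
split.
- move=> vs z; suff : sm (foldr (fun (e : pt) h => 'D_e h) phi vs) by move=> h; exact: (differentiable_fam tt z h).
  by elim: vs => [//|e vs IH] /=; exact: fam_derive.
- by apply: (subclosed_compact _ cK) => //; exact: closed_closure.
- by move=> z /cl /KU.
Qed.

(** The formal adjoint of Y is - Y: no nonzero entry of B is diagonal, so x_i may leave the
    derivative d_j. *)
Lemma Yadj_Yop phi z : sm phi -> Yadj B phi z = - Yop B phi z.
Proof.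
move=> sp; rewrite /Yadj /Yop opprB addrC; congr (_ - _).
apply: eq_bigr => i _; apply: eq_bigr => j _.
have [->|Bij] := eqVneq (B i j) 0; first by rewrite !mul0r.
have ij : i != j by apply/eqP => ij; have := blkm_B Bij; rewrite ij => /eqP; rewrite -[X in X == _]addn0 -addn1 eqn_add2l.
congr (_ * _); rewrite /dx -[(delta_mx j 0, 0)]/(dir (Some j)).
have := deriveME (dir (Some j)) (differentiable_crd (Some i) z) (differentiable_fam tt z sp).
rewrite derive_crd crd_dir (inj_eq Some_inj) (negbTE ij) mulr0 addr0 => <-.
by [].
Qed.

(** * Integrals, L^p norms and uniqueness of weak derivatives *)

Lemma int_st (D : set pt) (f : pt -> R) : measurable D ->
  \int[@lebesgue_st R r m]_(z in D) f z = \int[vol]_z (\1_D z * f z).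
Proof.
move=> mD; rewrite /Rintegral; congr fine.
transitivity (\int[vol]_(z in D) (f z)%:E)%E; first exact: eq_measure_integral.
rewrite [LHS]integral_mkcond; apply: eq_integral => z _.
by rewrite /patch indicE; case: ifP => _; rewrite ?mul1r ?mul0r.
Qed.

Lemma Lp_normE (p : R) (D : set pt) (v : pt -> R) : 0 < p ->
  Lp_norm p%:E D v = ((\int[vol]_z (\1_D z * `|v z| `^ p)%:E) `^ p^-1)%E.
Proof.
move=> p0; rewrite /Lp_norm unlock /=; congr (_ `^ _)%E.
transitivity (\int[vol]_z (`|(v \_ D) z|%:E `^ p))%E; first exact: eq_measure_integral.
apply: eq_integral => z _; rewrite poweR_EFin /patch indicE; congr EFin.
by case: ifP => _; rewrite ?mul1r// mul0r normr0 powR0// gt_eqF.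
Qed.

Lemma patch_ind (D : set pt) (v : pt -> R) : v \_ D = fun z => \1_D z * v z.
Proof. by apply/funext => z; rewrite /patch indicE; case: ifP => _; rewrite ?mul1r ?mul0r. Qed.

Lemma measurable_ind_mul (D : set pt) (v : pt -> R) : measurable D -> measurable_fun D v ->
  measurable_fun setT (fun z => \1_D z * v z).
Proof. by move=> mD mv; rewrite -patch_ind; exact/(measurable_restrictT _ mD). Qed.

Lemma in_Lp_fin (p : R) (D : set pt) (v : pt -> R) : 0 < p -> measurable D -> in_Lp p%:E D v <->
  measurable_fun D v /\ intg vol (fun z => \1_D z * `|v z| `^ p).
Proof.
move=> p0 mD; rewrite /in_Lp Lp_normE//.
have I0 : (0 <= \int[vol]_z (\1_D z * `|v z| `^ p)%:E)%E.
  by apply: integral_ge0 => z _; rewrite lee_fin mulr_ge0 ?indicE ?powR_ge0.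
split=> -[mv vi]; split=> //.
  apply: intg_lty.
  - apply: measurable_ind_mul => //.
    apply: (@measurableT_comp _ _ _ _ _ _ (@powR R ^~ p) _ (fun z => `|v z|)) => //.
    exact: measurableT_comp.
  - by move=> z; rewrite mulr_ge0 ?indicE ?powR_ge0.
  - by apply: lty_poweRy vi; rewrite invr_neq0// gt_eqF.
rewrite poweR_lty//; have := integrable_fin_num measurableT vi.
by rewrite ge0_fin_numE.
Qed.

Lemma loc_intg (Omega K : set pt) (v : pt -> R) : in_Lp_loc 1%:E Omega v -> compact K -> K `<=` Omega ->
  intg vol (fun z => \1_K z * v z).
Proof.
move=> lv cK KO; have mK := compact_measurable_pt cK.
have [mv vi] := (in_Lp_fin v ltr01 mK).1 (lv K cK KO).
apply: intg_le vi; first exact: measurable_ind_mul.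
by move=> z; rewrite normrM ger0_norm ?indicE// powRr1.
Qed.

Lemma weak_unique (Omega : set pt) (v v' : pt -> R) : open Omega ->
  in_Lp_loc 1%:E Omega v -> in_Lp_loc 1%:E Omega v' ->
  (forall phi, tst Omega phi -> \int[@lebesgue_st R r m]_(z in Omega) (v z * phi z) =
     \int[@lebesgue_st R r m]_(z in Omega) (v' z * phi z)) ->
  {ae vol, forall z, Omega z -> v z = v' z}.
Proof.
move=> oO lv lv' H; have mO := open_measurable_pt oO.
have : {ae vol, forall z, Omega z -> v z - v' z = 0}.
  apply: du_bois_reymond => // [K cK KO|phi tp].
    have := intgB (loc_intg lv cK KO) (loc_intg lv' cK KO).
    by congr (intg_of _ _); apply/funext => z; rewrite mulrBr.
  have [sp [K [cK KO] K0]] := tp; have [M HM] := tst_bounded tp.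
  have iv (w : pt -> R) : in_Lp_loc 1%:E Omega w -> intg vol (fun z => \1_Omega z * (w z * phi z)).
    move=> lw; have := intgMb (tst_meas tp) HM (loc_intg lw cK KO).
    congr (intg_of _ _); apply/funext => z; rewrite !indicE; have [zK|zK] := pselect (K z).
      by rewrite !mem_set ?mul1r 1?mulrC//; exact: KO.
    by rewrite K0// !(mul0r, mulr0).
  have := H phi tp; rewrite !int_st// => /eqP; rewrite -subr_eq0 -IntB; [|exact: iv|exact: iv].
  move=> /eqP HH; rewrite -[RHS]HH; apply: eq_Rintegral => z _.
  rewrite indicE; have [zO|zO] := pselect (Omega z); first by rewrite mem_set// !mul1r mulrBl.
  by rewrite K0 ?mulr0 ?subrr// => /KO.
by apply: filterS => z h /h /eqP; rewrite subr_eq0 => /eqP.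
Qed.

Lemma ae_int_eq (f g : pt -> R) : measurable_fun setT f -> measurable_fun setT g ->
  {ae vol, forall z, f z = g z} -> (\int[vol]_z (f z)%:E = \int[vol]_z (g z)%:E)%E.
Proof.
move=> mf mg fg; apply: ae_eq_integral => //; [exact/measurable_EFinP|exact/measurable_EFinP|].
by apply: filterS fg => z -> _.
Qed.

Lemma ae_Int_eq (f g : pt -> R) : measurable_fun setT f -> measurable_fun setT g ->
  {ae vol, forall z, f z = g z} -> \int[vol]_z f z = \int[vol]_z g z.
Proof. by move=> mf mg fg; rewrite /Rintegral (ae_int_eq mf mg fg). Qed.

Lemma ae_Lp_norm (p : R) (D Omega : set pt) (v v' : pt -> R) : 0 < p -> measurable D -> D `<=` Omega ->
  measurable_fun D v -> measurable_fun D v' -> {ae vol, forall z, Omega z -> v z = v' z} ->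
  Lp_norm p%:E D v = Lp_norm p%:E D v'.
Proof.
move=> p0 mD DO mv mv' vv; rewrite (Lp_normE D v p0) (Lp_normE D v' p0); apply: (congr1 (fun x : \bar R => x `^ p^-1)%E).
have mp (w : pt -> R) : measurable_fun D w -> measurable_fun setT (fun z => \1_D z * `|w z| `^ p).
  move=> mw; apply: measurable_ind_mul => //.
  apply: (@measurableT_comp _ _ _ _ _ _ (@powR R ^~ p) _ (fun z => `|w z|)) => //.
  exact: measurableT_comp.
apply: ae_int_eq; [exact: mp|exact: mp|]; apply: filterS vv => z h.
rewrite indicE; have [zD|zD] := pselect (D z); last by rewrite memNset// !mul0r.
by rewrite h//; exact: DO.
Qed.

Lemma Lp_norm_le (p : R) (D D' : set pt) (v v' : pt -> R) : 0 < p -> measurable D -> measurable D' ->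
  measurable_fun D v -> measurable_fun D' v' -> D `<=` D' -> (forall z, D z -> `|v z| <= `|v' z|) ->
  (Lp_norm p%:E D v <= Lp_norm p%:E D' v')%E.
Proof.
move=> p0 mD mD' mv mv' DD vv; rewrite (Lp_normE D v p0) (Lp_normE D' v' p0).
have mp (D0 : set pt) (w : pt -> R) : measurable D0 -> measurable_fun D0 w -> measurable_fun setT (fun z => \1_D0 z * `|w z| `^ p).
  move=> mD0 mw; apply: measurable_ind_mul => //.
  apply: (@measurableT_comp _ _ _ _ _ _ (@powR R ^~ p) _ (fun z => `|w z|)) => //.
  exact: measurableT_comp.
have g0 (D0 : set pt) (w : pt -> R) z : 0 <= (\1_D0 z : R) * `|w z| `^ p by rewrite mulr_ge0 ?indicE ?powR_ge0.
apply: gt0_ler_poweR.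
- by rewrite invr_ge0 ltW.
- by rewrite in_itv /= leey andbT; apply: integral_ge0 => z _; rewrite lee_fin.
- by rewrite in_itv /= leey andbT; apply: integral_ge0 => z _; rewrite lee_fin.
apply: ge0_le_integral => //.
- by apply/measurable_EFinP; exact: mp.
- by apply/measurable_EFinP; exact: mp.
move=> z _; rewrite lee_fin !indicE; have [zD|zD] := pselect (D z).
  rewrite !mem_set ?mul1r//; last exact: DD.
  by rewrite ge0_ler_powR ?nnegrE ?(ltW p0)// vv.
by rewrite memNset// mul0r mulr_ge0 ?powR_ge0.
Qed.

(** For p different from q the quadratic form is evaluated at e_p + e_q and e_p - e_q, whose
    difference is 4 a_pq; for p = q at e_p. *)
Lemma polarization (k : nat) (a : 'I_k -> 'I_k -> R) (Lam : R) : 1 < Lam -> (forall i j, a i j = a j i) ->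
  (forall xi : 'I_k -> R, Lam^-1 * \sum_i xi i ^+ 2 <= \sum_i \sum_j a i j * xi i * xi j <= Lam * \sum_i xi i ^+ 2) ->
  forall p q, `|a p q| <= Lam.
Proof.
move=> L1 aC H p q.
pose xi (s : R) (i : 'I_k) : R := (i == p)%:R + s * (i == q)%:R.
have E1 (b : 'I_k -> R) s : \sum_j b j * xi s j = b p + s * b q.
  rewrite /xi; under eq_bigr do rewrite mulrDr mulrCA.
  rewrite big_split /= -mulr_sumr; congr (_ + _ * _).
    by rewrite (bigD1 p)//= eqxx mulr1 big1 ?addr0// => j /negbTE ->; rewrite mulr0.
  by rewrite (bigD1 q)//= eqxx mulr1 big1 ?addr0// => j /negbTE ->; rewrite mulr0.
have E2 s : \sum_i \sum_j a i j * xi s i * xi s j = a p p + s * a p q + s * (a q p + s * a q q).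
  transitivity (\sum_i (a i p + s * a i q) * xi s i).
    apply: eq_bigr => i _; rewrite mulrC -E1 mulr_sumr; apply: eq_bigr => j _; ring.
  by rewrite (E1 (fun i => a i p + s * a i q)).
have E3 s : \sum_i xi s i ^+ 2 = xi s p + s * xi s q.
  by under eq_bigr do rewrite expr2; exact: E1.
have Li : 0 < Lam^-1 by rewrite invr_gt0; lra.
have T1 : true%:R = 1 :> R by [].
have F0 : false%:R = 0 :> R by [].
have [pq|pq] := eqVneq p q.
  have := H (xi 0); rewrite E2 E3 /xi eqxx -pq !mul0r !addr0 mulr1 => /andP[h1 h2].
  by rewrite T1 in h2; rewrite ger0_norm//; lra.
have := H (xi 1); have := H (xi (-1)); rewrite !E2 !E3 /xi !eqxx (negbTE pq) eq_sym (negbTE pq) -(aC p q).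
rewrite T1 F0 => /andP[h1 h2] /andP[h3 h4]; rewrite ler_norml; apply/andP; split; lra.
Qed.

End blocks.

(** * Localisation of a weak solution *)

Section localization.
Context {R : realType} {r : nat}.
Variable m : 'I_r.+1 -> nat.
Local Notation N := (dimx m).
Local Notation m0 := (m ord0).
Local Notation pt := ('cV[R]_N * R)%type.
Local Notation blk := (@blkm r m).
Local Notation sq := (sq (@vol R N)).
Local Notation intg := (intg (@vol R N)).
Variable B : 'M[R]_N.
Hypothesis hB : block_superdiag B.

Lemma tst_out (U : set pt) phi z : tst U phi -> ~ U z -> phi z = 0.
Proof. by move=> [_ [K [_ KU] K0]] Uz; apply: K0 => /KU. Qed.

Lemma in_Lp2_sq (U Omega : set pt) (v : pt -> R) : measurable U -> measurable Omega -> U `<=` Omega ->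
  in_Lp 2%:E Omega v -> sq (fun z => \1_U z * v z).
Proof.
move=> mU mO UO /(in_Lp_fin v (ltr0n R 2) mO)[mv vi]; split.
  by apply: measurable_ind_mul => //; exact: measurable_funS mv.
apply: intg_le vi => [|z].
  by apply: measurable_funX; apply: measurable_ind_mul => //; exact: measurable_funS mv.
have -> : `|v z| `^ 2 = v z ^+ 2.
  by rewrite -[LHS]/(`|v z| `^ 2%:R) powR_mulrn// real_normK ?num_real.
rewrite !indicE.
have [zU|zU] := pselect (U z); first by rewrite !mem_set ?mul1r//; [rewrite ger0_norm ?sqr_ge0|exact: UO].
by rewrite (memNset zU) mul0r expr0n /= normr0 mulr_ge0 ?sqr_ge0.
Qed.

Variables (Omega U : set pt) (a : 'I_m0 -> 'I_m0 -> pt -> R) (Lam : R).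
Hypothesis oO : open Omega.
Hypothesis oU : open U.
Hypothesis UO : U `<=` Omega.
Hypothesis Lam1 : 1 < Lam.
Hypothesis a_meas : forall i j, measurable_fun Omega (a i j).
Hypothesis a_bd : forall i j z, `|a i j z| <= Lam.
Hypothesis a_ell : forall z (xi : 'I_m0 -> R),
  Lam^-1 * \sum_i xi i ^+ 2 <= \sum_i \sum_j a i j z * xi i * xi j.

Definition flux (Du f : 'I_m0 -> pt -> R) (i : 'I_m0) (z : pt) : R :=
  \sum_j a i j z * Du j z - f i z.

(** Multiplying everything by the indicator of U changes no integral against test functions in U and
    makes the functions measurable and square integrable on the whole space. Off U the ellipticity
    and growth conditions hold trivially; on U they hold with 1 / Lam and Lam. *)
Lemma wsol_of_weak u Du Yu (f : 'I_m0 -> pt -> R) g :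
  in_Lp 2%:E Omega u -> weak_D0 Omega u Du -> (forall i, in_Lp 2%:E Omega (Du i)) ->
  weak_Y B Omega u Yu -> in_Lp 2%:E Omega Yu ->
  in_Lp 2%:E Omega g -> (forall i, in_Lp 2%:E Omega (f i)) ->
  (forall psi, tst Omega psi ->
      - (\int[@lebesgue_st R r m]_(z in Omega)
           (\sum_(i < m0) \sum_(j < m0)
              a i j z * Du j z * dx (first_block i) psi z))
      + (\int[@lebesgue_st R r m]_(z in Omega) (psi z * Yu z)) =
      \int[@lebesgue_st R r m]_(z in Omega)
        (g z * psi z - \sum_(i < m0) f i z * dx (first_block i) psi z)) ->
  wsol B blk Lam^-1 Lam U (fun z => \1_U z * u z)
    (ext_fb (fun i z => \1_U z * Du i z)) (ext_fb (fun i z => \1_U z * flux Du f i z))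
    (fun z => \1_U z * Yu z) (ext_fb (fun i z => \1_U z * f i z)) (fun z => \1_U z * g z).
Proof.
move=> u2 wD D2 wY Y2 g2 f2 eqn.
have mO := open_measurable_pt oO; have mU := open_measurable_pt oU.
have s2 v := @in_Lp2_sq U Omega v mU mO UO.
have cut (p phi : pt -> R) : tst U phi -> \int[@lebesgue_st R r m]_(z in Omega) (p z * phi z) =
    \int[vol]_z (\1_U z * p z * phi z).
  move=> tp; rewrite int_st//; apply: eq_Rintegral => z _; rewrite !indicE.
  have [zU|zU] := pselect (U z); first by rewrite !mem_set ?mul1r//; exact: UO.
  by rewrite (tst_out tp zU) !mulr0.
have tO phi : tst U phi -> tst Omega phi by exact: tstS.
have sFl i : sq (fun z => \1_U z * flux Du f i z).
  have := sqB (sq_sum (index_enum 'I_m0) (P := xpredT) (F := fun j z => (\1_Omega z * a i j z) * (\1_U z * Du j z)) _) (s2 _ (f2 i)).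
  have h (j : 'I_m0) : true -> sq (fun z => (\1_Omega z * a i j z) * (\1_U z * Du j z)).
    move=> _; apply: (@sqMb _ _ _ _ _ _ Lam); [exact: measurable_ind_mul| |exact: s2].
    move=> z; rewrite indicE; case: (_ \in _); rewrite ?mul1r ?mul0r ?normr0//.
    by rewrite (le_trans ler01)// ltW.
  move=> /(_ h); congr (sq_of _ _); apply/funext => z; rewrite /flux mulrBr mulr_sumr; congr (_ - _).
  apply: eq_bigr => j _; rewrite !indicE; have [zU|zU] := pselect (U z); last by rewrite (memNset zU) !(mul0r, mulr0).
  by rewrite !mem_set ?mul1r//; exact: UO.
have sE (v : 'I_m0 -> pt -> R) i z : ext_fb v (first_block i) z = v i z by rewrite ext_fb_first.
split.
- exact: s2.
- by apply: fb_ind => i; rewrite ext_fb_first; exact: s2.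
- by apply: fb_ind => i; rewrite ext_fb_first.
- exact: s2.
- by apply: fb_ind => i; rewrite ext_fb_first; exact: s2.
- exact: s2.
- move=> phi i tp; move: i; apply: fb_ind => i; rewrite ext_fb_first.
  have [_ /(_ _ (tst_test_fun (tO _ tp)))] := wD i.
  by rewrite (cut _ _ tp) (cut u _ (tst_derive _ tp)).
- move=> phi tp; have [_ /(_ _ (tst_test_fun (tO _ tp)))] := wY.
  rewrite (cut _ _ tp) => ->; rewrite int_st// -IntN; last first.
    by apply: sq_mul; [exact: s2|apply: (@tst_sq _ _ U); exact: tst_Yop].
  apply: eq_Rintegral => z _; rewrite (Yadj_Yop hB)//; last by case: tp.
  rewrite !indicE; have [zU|zU] := pselect (U z).
    by rewrite !mem_set ?mul1r ?mulrN//; exact: UO.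
  by rewrite (tst_out (tst_Yop B tp) zU) oppr0 !mulr0 oppr0.
- move=> phi tp; have := eqn _ (tO _ tp).
  have td i : tst U (dx (first_block i) phi) by exact: tst_derive.
  have h1 : \int[@lebesgue_st R r m]_(z in Omega)
           (\sum_(i < m0) \sum_(j < m0) a i j z * Du j z * dx (first_block i) phi z) =
      \sum_(i < m0) \int[vol]_z (\1_U z * flux Du f i z * dx (first_block i) phi z) +
      \sum_(i < m0) \int[vol]_z (\1_U z * f i z * dx (first_block i) phi z).
    rewrite int_st// -big_split /=.
    have i1 i : intg (fun z => \1_U z * flux Du f i z * dx (first_block i) phi z).
      by apply: sq_mul => //; exact: tst_sq (td i).
    have i2 i : intg (fun z => \1_U z * f i z * dx (first_block i) phi z).
      by apply: sq_mul; [exact: s2|exact: tst_sq (td i)].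
    transitivity (\sum_(i < m0) \int[vol]_z (\1_U z * flux Du f i z * dx (first_block i) phi z + \1_U z * f i z * dx (first_block i) phi z)); last first.
      by apply: eq_bigr => i _; rewrite IntD.
    rewrite -Int_sum; last by move=> i _; exact: intgD.
    apply: eq_Rintegral => z _; rewrite mulr_sumr; apply: eq_bigr => i _.
    rewrite -mulr_suml !indicE; have [zU|zU] := pselect (U z).
      by rewrite !mem_set ?mul1r//; [rewrite /flux; ring|exact: UO].
    by rewrite (tst_out (td i) zU) !mulr0 addr0.
  have h2 : \int[@lebesgue_st R r m]_(z in Omega) (g z * phi z - \sum_(i < m0) f i z * dx (first_block i) phi z) =
     \int[vol]_z (\1_U z * g z * phi z) - \sum_(i < m0) \int[vol]_z (\1_U z * f i z * dx (first_block i) phi z).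
    have i1 : intg (fun z => \1_U z * g z * phi z) by apply: sq_mul; [exact: s2|exact: tst_sq tp].
    have i2 i : intg (fun z => \1_U z * f i z * dx (first_block i) phi z).
      by apply: sq_mul; [exact: s2|exact: tst_sq (td i)].
    rewrite int_st// -Int_sum// -IntB//; last exact: intg_sum.
    apply: eq_Rintegral => z _; rewrite !indicE; have [zU|zU] := pselect (U z).
      rewrite !mem_set ?mul1r//; last exact: UO.
      by congr (_ - _); apply: eq_bigr => i _; rewrite mul1r.
    rewrite (tst_out tp zU) !mulr0 !big1 ?subrr ?mulr0// => i _; by rewrite (tst_out (td i) zU) !mulr0.
  have h3 : \int[@lebesgue_st R r m]_(z in Omega) (phi z * Yu z) = \int[vol]_z (\1_U z * Yu z * phi z).
    by rewrite -(cut _ _ tp); apply: eq_Rintegral => z _; rewrite mulrC.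
  rewrite h1 h2 h3 sum_fb => h.
  have -> : \sum_(i0 < m0) \int[vol]_z (ext_fb (fun i z => \1_U z * flux Du f i z) (first_block i0) z * 'D_(dir (Some (first_block i0))) phi z) =
      \sum_(i < m0) \int[vol]_z (\1_U z * flux Du f i z * dx (first_block i) phi z).
    by apply: eq_bigr => i _; rewrite ext_fb_first.
  by move: h; set x1 := \sum_(i < m0) _; set x2 := \sum_(i < m0) _; lra.
- move=> z; rewrite !sum_fb; under eq_bigr do rewrite sE; under [leRHS]eq_bigr do rewrite !sE.
  have [zU|zU] := pselect (U z); last first.
    by rewrite !big1 ?mulr0// => i _; rewrite indicE memNset// !(mul0r, mulr0)// expr0n.
  have := a_ell z (fun i => Du i z); rewrite indicE mem_set//.
  under eq_bigr do rewrite mul1r.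
  move/le_trans; apply; rewrite le_eqVlt; apply/orP; left; apply/eqP; apply: eq_bigr => i _.
  rewrite !mul1r /flux subrK mulr_suml; apply: eq_bigr => j _; ring.
- move=> i z; move: i; apply: fb_ind => i; rewrite !sum_fb sE.
  under eq_bigr do rewrite sE; under [X in _ + X]eq_bigr do rewrite sE.
  have L0 : 0 <= Lam by rewrite (le_trans ler01)// ltW.
  rewrite indicE; have [zU|zU] := pselect (U z); last first.
    by rewrite memNset// mul0r normr0 mulr_ge0// addr_ge0// sumr_ge0.
  rewrite mem_set// mul1r; under eq_bigr do rewrite mul1r; under [X in _ + X]eq_bigr do rewrite mul1r.
  rewrite /flux (le_trans (ler_normB _ _))// mulrDr lerD//.
    rewrite (le_trans (ler_norm_sum _ _ _))// mulr_sumr; apply: ler_sum => j _.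
    by rewrite normrM ler_wpM2r.
  rewrite (bigD1 i)//= mulrDr -[leLHS]addr0 lerD//; last by rewrite mulr_ge0// sumr_ge0.
  by rewrite ler_peMl// ltW.
Qed.

End localization.

(** * Powers, and norms of the first-block gradient *)

Lemma powRD_le (R : realType) (p x y : R) : 0 <= p -> 0 <= x -> 0 <= y ->
  (x + y) `^ p <= 2 `^ p * (x `^ p + y `^ p).
Proof.
move=> p0; wlog xy : x y / x <= y => [H x0 y0|x0 y0].
  by have [xy|/ltW yx] := leP x y; [exact: H|rewrite addrC [X in _ * X]addrC; exact: H].
apply: (@le_trans _ _ ((2 * y) `^ p)).
  by rewrite ge0_ler_powR ?nnegrE ?addr_ge0 ?mulr_ge0//; lra.
by rewrite powRM// ler_wpM2l ?powR_ge0// lerDr powR_ge0.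
Qed.

Lemma powR_invK (R : realType) (p x : R) : 0 < p -> 0 <= x -> (x `^ p) `^ p^-1 = x.
Proof. by move=> p0 x0; rewrite -powRrM divff ?gt_eqF// powRr1. Qed.

Lemma powR_Kinv (R : realType) (p x : R) : 0 < p -> 0 <= x -> (x `^ p^-1) `^ p = x.
Proof. by move=> p0 x0; rewrite -powRrM mulVf ?gt_eqF// powRr1. Qed.

(** Each of N, Fp^(1/p) and Gp^(1/p) is bounded by a multiple of the sum s; after taking p-th powers
    the estimate is homogeneous in s, and the root returns s times a constant. *)
Lemma root_estimate (R : realType) (p C k N I x Fp Gp : R) : 0 < p -> 0 <= C -> 0 <= k -> 0 <= N ->
  0 <= I -> 0 <= x -> 0 <= Fp -> 0 <= Gp -> N <= k * x -> I <= 2 `^ p * (k `^ p * Fp + Gp) ->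
  (C * (N `^ p + I)) `^ p^-1 <=
  (C * (k `^ p + 2 `^ p * k `^ p + 2 `^ p)) `^ p^-1 * (x + Gp `^ p^-1 + Fp `^ p^-1).
Proof.
move=> p0 C0 k0 N0 I0 x0 F0 G0 hN hI.
set s := x + _ + _; have FF := powR_ge0 Fp p^-1; have GG := powR_ge0 Gp p^-1.
have s0 : 0 <= s by rewrite !addr_ge0.
have sp := powR_ge0 s p; have kp := powR_ge0 k p; have tp := powR_ge0 2 p.
have h1 : N `^ p <= k `^ p * s `^ p.
  rewrite -powRM//; apply: ge0_ler_powR; rewrite ?nnegrE ?mulr_ge0 ?(ltW p0)//.
  by rewrite (le_trans hN)// ler_wpM2l// /s -addrA lerDl addr_ge0.
have h2 : Fp <= s `^ p.
  by rewrite -{1}(powR_Kinv p0 F0) ge0_ler_powR ?nnegrE ?(ltW p0)// /s lerDr addr_ge0.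
have h3 : Gp <= s `^ p.
  by rewrite -{1}(powR_Kinv p0 G0) ge0_ler_powR ?nnegrE ?(ltW p0)// /s addrAC lerDr addr_ge0.
have h4 : I <= 2 `^ p * (k `^ p * s `^ p + s `^ p).
  apply: (le_trans hI); rewrite ler_wpM2l// lerD// ler_wpM2l//.
have D0 : 0 <= C * (k `^ p + 2 `^ p * k `^ p + 2 `^ p) by rewrite mulr_ge0// !addr_ge0// mulr_ge0.
rewrite -[X in _ <= _ * X](powR_invK p0 s0) -(powRM _ D0 sp).
apply: ge0_ler_powR; rewrite ?nnegrE ?invr_ge0 ?(ltW p0)//.
- by rewrite mulr_ge0// addr_ge0// powR_ge0.
- by rewrite mulr_ge0.
rewrite -mulrA ler_wpM2l// (le_trans (lerD h1 h4))// le_eqVlt; apply/orP; left; apply/eqP; ring.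
Qed.

Section first_block_norms.
Context {R : realType} {r : nat}.
Variable m : 'I_r.+1 -> nat.
Local Notation N := (dimx m).
Local Notation m0 := (m ord0).
Local Notation pt := ('cV[R]_N * R)%type.
Local Notation intg := (intg (@vol R N)).
Local Notation mu := (@lebesgue_st R r m).

Definition abs_sum (v : 'I_m0 -> pt -> R) z : R := \sum_i `|v i z|.

Lemma abs_sum_ge0 v z : 0 <= abs_sum v z. Proof. exact: sumr_ge0. Qed.

Lemma elen_ge0 (v : 'I_m0 -> pt -> R) z : 0 <= elen v z. Proof. exact: sqrtr_ge0. Qed.

Lemma elen_le v z : elen v z <= abs_sum v z.
Proof.
rewrite /elen -(ger0_norm (abs_sum_ge0 v z)) -sqrtr_sqr ler_wsqrtr//.
exact: (sum_sqr_le xpredT (fun i => v i z)).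
Qed.

Lemma abs_le_elen (v : 'I_m0 -> pt -> R) i z : `|v i z| <= elen v z.
Proof.
rewrite /elen -sqrtr_sqr ler_wsqrtr// (bigD1 i)//= lerDl sumr_ge0// => j _; exact: sqr_ge0.
Qed.

Lemma abs_sum_le v z : abs_sum v z <= m0%:R * elen v z.
Proof.
rewrite /abs_sum (le_trans (ler_sum _ (fun i _ => abs_le_elen v i z)))//.
by rewrite sumr_const card_ord mulr_natl.
Qed.

Lemma measurable_elen (D : set pt) (v : 'I_m0 -> pt -> R) : (forall i, measurable_fun D (v i)) -> measurable_fun D (elen v).
Proof.
move=> mv; have ms : measurable_fun setT (@Num.sqrt R) by apply: continuous_measurable_fun; exact: sqrt_continuous.
apply: (measurableT_comp ms); apply: measurable_sum => i; exact: measurable_funX.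
Qed.

Lemma intg_powR_sum (p : R) (D : set pt) (s : seq (pt -> R)) : 0 < p -> measurable D ->
  (forall i : nat, (i < size s)%N -> in_Lp (m := m) p%:E D (nth (fun=> 0) s i)) ->
  intg (fun z => \1_D z * (\sum_(v <- s) `|v z|) `^ p).
Proof.
move=> p0 mD; elim: s => [_|v s IH H].
  have -> : (fun z : pt => \1_D z * (\sum_(v <- ([::] : seq (pt -> R))) `|v z|) `^ p) = (fun=> 0); last exact: intg0.
  by apply/funext => z; rewrite big_nil powR0 ?mulr0// gt_eqF.
have iv := H 0%N (ltn0Sn _); have {}IH := IH (fun i => H i.+1).
have {iv}[mv iv] := (in_Lp_fin v p0 mD).1 iv.
have ms : measurable_fun setT (fun z => \1_D z * \sum_(w <- s) `|w z|).
  have -> : (fun z => \1_D z * \sum_(w <- s) `|w z|) = fun z => (\1_D z * (\sum_(w <- s) `|w z|) `^ p) `^ p^-1.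
    apply/funext => z; rewrite indicE; case: (_ \in _).
      by rewrite !mul1r powR_invK// sumr_ge0.
    by rewrite !mul0r powR0// invr_neq0// gt_eqF.
  exact: (@measurableT_comp _ _ _ _ _ _ (@powR R ^~ p^-1) _ _ _ (intg_meas IH)).
have := intgZ (2 `^ p) (intgD iv IH); apply: intg_le.
  have -> : (fun z => \1_D z * (\sum_(w <- v :: s) `|w z|) `^ p) =
      fun z => (\1_D z * `|v z| + \1_D z * \sum_(w <- s) `|w z|) `^ p.
    apply/funext => z; rewrite big_cons indicE; case: (_ \in _); rewrite ?mul1r// !mul0r addr0 powR0// gt_eqF//.
  apply: (@measurableT_comp _ _ _ _ _ _ (@powR R ^~ p)) => //; apply: measurable_funD => //.
  by apply: measurable_ind_mul => //; exact: measurableT_comp.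
move=> z; rewrite ger0_norm ?mulr_ge0 ?powR_ge0 ?indicE//; case: (_ \in _); last by rewrite !mul0r addr0 mulr0.
rewrite !mul1r big_cons; apply: powRD_le => //; [exact: ltW|exact: sumr_ge0].
Qed.

Lemma measurable_tst_mul (Omega : set pt) (v phi : pt -> R) : measurable Omega -> tst Omega phi ->
  (forall K, compact K -> K `<=` Omega -> measurable_fun K v) ->
  measurable_fun setT (fun z => \1_Omega z * (v z * phi z)).
Proof.
move=> mO tp H; have [_ [K [cK KO] K0]] := tp.
have := measurable_ind_mul (compact_measurable_pt cK) (measurable_funM (H K cK KO) (measurable_funTS (tst_meas tp))).
congr (measurable_fun _ _); apply/funext => z; rewrite !indicE.
have [zK|zK] := pselect (K z); first by rewrite !mem_set//; exact: KO.
by rewrite /= K0// !mulr0.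
Qed.

Variable B : 'M[R]_N.
Hypothesis hB : block_superdiag B.

(** Membership in [W112] and the equation each come with their own weak derivatives, and those in
    the equation are only known to be locally integrable. Uniqueness almost everywhere lets the
    square integrable ones replace them. *)
Lemma weak_reduce (Omega : set pt) (a : 'I_m0 -> 'I_m0 -> pt -> R) g f u : open Omega ->
  (forall i j, measurable_fun Omega (a i j)) -> weak_solution B Omega a g f u ->
  exists Du Yu, [/\ in_Lp 2%:E Omega u, weak_D0 Omega u Du /\ (forall i, in_Lp 2%:E Omega (Du i)),
    weak_Y B Omega u Yu /\ in_Lp 2%:E Omega Yu,
    forall Du' : 'I_m0 -> pt -> R, weak_D0 Omega u Du' -> forall i, {ae vol, forall z, Omega z -> Du' i z = Du i z} &
    forall psi, tst Omega psi ->
      - (\int[mu]_(z in Omega)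
           (\sum_(i < m0) \sum_(j < m0)
              a i j z * Du j z * dx (first_block i) psi z))
      + (\int[mu]_(z in Omega) (psi z * Yu z)) =
      \int[mu]_(z in Omega)
        (g z * psi z - \sum_(i < m0) f i z * dx (first_block i) psi z)].
Proof.
move=> oO ma [[u2 [Du wD D2] [Yu wY Y2]] [Du1 [Yu1 [wD1 wY1 eqn]]]].
have mO := open_measurable_pt oO.
have uD (Du' : 'I_m0 -> pt -> R) : weak_D0 Omega u Du' -> forall i, {ae vol, forall z, Omega z -> Du' i z = Du i z}.
  move=> wD' i; have [l1 e1] := wD' i; have [l2 e2] := wD i.
  by apply: weak_unique => // phi /tst_test_fun tp; rewrite e1// e2.
have uD' : forall i, {ae vol, forall z, Omega z -> Du1 i z = Du i z} by exact: uD.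
have uY : {ae vol, forall z, Omega z -> Yu1 z = Yu z}.
  have [l1 e1] := wY1; have [l2 e2] := wY.
  by apply: weak_unique => // phi /tst_test_fun tp; rewrite e1// e2.
exists Du, Yu; split => // psi tp; have := eqn _ (tst_test_fun tp).
have td i : tst Omega (dx (first_block i) psi) by exact: tst_derive.
have lm (v : pt -> R) : in_Lp_loc (m := m) 1%:E Omega v -> forall K, compact K -> K `<=` Omega -> measurable_fun K v.
  by move=> lv K cK KO; have [] := lv K cK KO.
have mT (D : 'I_m0 -> pt -> R) : (forall j, in_Lp_loc (m := m) 1%:E Omega (D j)) ->
    measurable_fun setT (fun z => \1_Omega z * \sum_(i < m0) \sum_(j < m0) a i j z * D j z * dx (first_block i) psi z).
  move=> lD; have -> : (fun z => \1_Omega z * \sum_(i < m0) \sum_(j < m0) a i j z * D j z * dx (first_block i) psi z) =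
     (fun z => \sum_(i < m0) \sum_(j < m0) \1_Omega z * (a i j z * D j z * dx (first_block i) psi z)).
    by apply/funext => z; rewrite mulr_sumr; apply: eq_bigr => i _; rewrite mulr_sumr.
  apply: measurable_sum => i; apply: measurable_sum => j; apply: measurable_tst_mul => // K cK KO.
  by apply: measurable_funM; [exact: measurable_funS (ma i j)|exact: lm (lD j) K cK KO].
have <- : \int[mu]_(z in Omega) (\sum_(i < m0) \sum_(j < m0) a i j z * Du1 j z * dx (first_block i) psi z) =
   \int[mu]_(z in Omega) (\sum_(i < m0) \sum_(j < m0) a i j z * Du j z * dx (first_block i) psi z).
  rewrite !int_st//; apply: ae_Int_eq.
  - by apply: mT => j; have [] := wD1 j.
  - by apply: mT => j; have [] := wD j.
  have : {ae vol, forall z, forall j : 'I_m0, Omega z -> Du1 j z = Du j z} by apply: filter_forall => j; exact: uD'.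
  apply: filterS => z h; rewrite indicE; have [zO|zO] := pselect (Omega z); last by rewrite memNset// !mul0r.
  by congr (_ * _); apply: eq_bigr => i _; apply: eq_bigr => j _; rewrite h.
have <- // : \int[mu]_(z in Omega) (psi z * Yu1 z) = \int[mu]_(z in Omega) (psi z * Yu z).
rewrite !int_st//; apply: ae_Int_eq.
- under eq_fun do rewrite (mulrC (psi _)); apply: measurable_tst_mul => //; apply: lm; by case: wY1.
- under eq_fun do rewrite (mulrC (psi _)); apply: measurable_tst_mul => //; apply: lm; by case: wY.
apply: filterS uY => z h; rewrite indicE; have [zO|zO] := pselect (Omega z); last by rewrite memNset// !mul0r.
by rewrite h.
Qed.

End first_block_norms.

Notation abs_sum_of := abs_sum.

(** * The interior estimate for weak solutions *)

Section interior.
Context {R : realType} {r : nat}.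
Variable m : 'I_r.+1 -> nat.
Local Notation N := (dimx m).
Local Notation m0 := (m ord0).
Local Notation pt := ('cV[R]_N * R)%type.
Local Notation blk := (@blkm r m).
Local Notation intg := (intg (@vol R N)).
Local Notation nrm := (nrm (@vol R N)).
Local Notation mu := (@lebesgue_st R r m).
Local Notation abs_sum := (@abs_sum R r m).

Lemma in_Lp_2 (p : R) (Omega : set pt) v : 2 <= p -> measurable Omega -> (vol Omega < +oo)%E ->
  in_Lp (m := m) p%:E Omega v -> in_Lp (m := m) 2%:E Omega v.
Proof.
move=> p2 mO fO; have p0 : 0 < p by lra.
move=> /(in_Lp_fin v p0 mO)[mv vi]; apply/(in_Lp_fin v (ltr0n R 2) mO); split => //.
apply: (intg_le _ _ (intgD (intg_indic_fin mO fO) vi)) => [|z].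
  apply: measurable_ind_mul => //.
  apply: (@measurableT_comp _ _ _ _ _ _ (@powR R ^~ 2) _ (fun z => `|v z|)) => //.
  exact: measurableT_comp.
rewrite ger0_norm ?mulr_ge0 ?indicE ?powR_ge0//; case: (_ \in _); last by rewrite !mul0r addr0.
rewrite !mul1r -[true%:R]/(1 : R); have [v1|v1] := leP `|v z| 1.
  have : `|v z| `^ 2 <= 1 `^ 2 by rewrite ge0_ler_powR ?nnegrE.
  by rewrite powR1; have := powR_ge0 `|v z| p; lra.
by have := @ler_powR R `|v z| (ltW v1) 2 p p2; lra.
Qed.

Lemma intg_source (p : R) (Omega : set pt) g (f : 'I_m0 -> pt -> R) : 0 < p -> measurable Omega ->
  in_Lp (m := m) p%:E Omega g -> (forall i, in_Lp (m := m) p%:E Omega (f i)) ->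
  intg (fun z => \1_Omega z * (abs_sum f z + `|g z|) `^ p).
Proof.
move=> p0 mO gp fp.
have := @intg_powR_sum R r m p Omega (g :: [seq f i | i <- enum 'I_m0]) p0 mO _.
have H (i : nat) : (i < size (g :: [seq f i | i <- enum 'I_m0]))%N ->
    in_Lp (m := m) p%:E Omega (nth (fun=> 0) (g :: [seq f i | i <- enum 'I_m0]) i).
  case: i => [//|i] /=; rewrite ltnS size_map => iz.
  have i0 : 'I_m0 by move: iz; rewrite size_enum_ord => h; exact: Ordinal h.
  by rewrite (nth_map i0).
move=> /(_ H); congr (intg_of _ _); apply/funext => z.
by rewrite big_cons big_map big_enum /= addrC.
Qed.

Variable B : 'M[R]_N.
Hypothesis hB : block_superdiag B.
Variables (Omega : set pt) (a : 'I_m0 -> 'I_m0 -> pt -> R) (Lam r0 : R).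
Hypothesis oO : open Omega.
Hypothesis Or0 : Omega `<=` cbox r0.
Hypothesis r01 : 1 <= r0.
Hypothesis Lam1 : 1 < Lam.
Hypothesis a_meas : forall i j, measurable_fun Omega (a i j).
Hypothesis a_bd : forall i j z, `|a i j z| <= Lam.
Hypothesis a_ell : forall z (xi : 'I_m0 -> R),
  Lam^-1 * \sum_i xi i ^+ 2 <= \sum_i \sum_j a i j z * xi i * xi j.

Lemma vol_Omega : (vol Omega < +oo)%E.
Proof.
apply: le_lt_trans (vol_cbox_lty r0); apply: le_measure => //; rewrite inE.
  exact: open_measurable_pt.
exact: measurable_cbox.
Qed.

Lemma interior_estimate : exists2 del0 : R, 0 < del0 &
  forall del U K, 0 < del <= del0 -> open U -> U `<=` Omega -> compact K -> K `<=` U ->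
  exists2 C : R, 0 <= C & forall g f u Du Yu,
  in_Lp (m := m) (2 + del)%:E Omega g -> (forall i, in_Lp (m := m) (2 + del)%:E Omega (f i)) ->
  in_Lp (m := m) 2%:E Omega u -> weak_D0 Omega u Du /\ (forall i, in_Lp 2%:E Omega (Du i)) ->
  weak_Y B Omega u Yu /\ in_Lp 2%:E Omega Yu ->
  (forall psi, tst Omega psi ->
      - (\int[mu]_(z in Omega)
           (\sum_(i < m0) \sum_(j < m0)
              a i j z * Du j z * dx (first_block i) psi z))
      + (\int[mu]_(z in Omega) (psi z * Yu z)) =
      \int[mu]_(z in Omega)
        (g z * psi z - \sum_(i < m0) f i z * dx (first_block i) psi z)) ->
  (\int[vol]_z (\1_K z * abs_sum Du z `^ (2 + del))%:E <=
   (C * (nrm (fun z => \1_U z * abs_sum Du z) `^ (2 + del)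
     + \int[vol]_z (\1_Omega z * (abs_sum f z + `|g z|) `^ (2 + del))))%:E)%E.
Proof.
have Li0 : 0 < Lam^-1 by rewrite invr_gt0 (lt_trans ltr01).
have L0 : 0 <= Lam by rewrite ltW// (lt_trans ltr01).
have [del0 d0 HI] := higher_integrability (blkm_B hB) (@blkm_ord r m) (@blkm_le r m) (blkm_rank hB) Li0 L0 r01.
exists del0 => // del U K dd oU UO cK KU; have /andP[dp _] := dd.
have [C C0 HC] := HI del U K dd oU (subset_trans UO Or0) cK KU.
exists C => // g f u Du Yu gp fp u2 [wD D2] [wY Y2] eqn.
have mO := open_measurable_pt oO; have mU := open_measurable_pt oU.
have p2 : 2 <= 2 + del by lra.
have p0 : 0 < 2 + del by lra.
have ws := wsol_of_weak hB oO oU UO Lam1 a_meas a_bd a_ell u2 wD D2 wY Y2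
  (in_Lp_2 p2 mO vol_Omega gp) (fun i => in_Lp_2 p2 mO vol_Omega (fp i)) eqn.
have hE (v : 'I_m0 -> pt -> R) z : hsum blk (ext_fb (fun i z => \1_U z * v i z)) z = \1_U z * abs_sum v z.
  rewrite /hsum sum_fb /abs_sum_of mulr_sumr; apply: eq_bigr => i _; rewrite ext_fb_first normrM ger0_norm//.
have pE z : psum blk (ext_fb (fun i z => \1_U z * f i z)) (fun z => \1_U z * g z) z = \1_U z * (abs_sum f z + `|g z|).
  by rewrite /psum hE normrM (ger0_norm (x := \1_U z)) ?indicE// mulrDr.
have iS := intg_source p0 mO gp fp.
have pw z : psum blk (ext_fb (fun i z => \1_U z * f i z)) (fun z => \1_U z * g z) z `^ (2 + del) <=
    \1_Omega z * (abs_sum f z + `|g z|) `^ (2 + del).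
  rewrite pE !indicE; have [zU|zU] := pselect (U z); first by rewrite !mem_set ?mul1r//; exact: UO.
  by rewrite (memNset zU) mul0r powR0 ?gt_eqF// mulr_ge0 ?powR_ge0.
have [_ sh _ _ sf sg _ _ _ _ _] := ws.
have iP : intg (fun z => psum blk (ext_fb (fun i z => \1_U z * f i z)) (fun z => \1_U z * g z) z `^ (2 + del)).
  apply: (intg_le _ _ iS) => [|z]; last by rewrite ger0_norm ?powR_ge0.
  by apply: (@measurableT_comp _ _ _ _ _ _ (@powR R ^~ (2 + del))) => //; exact: sq_meas (sq_psum sf sg).
have := HC _ _ _ _ _ _ ws iP.
have -> : hsum blk (ext_fb (fun i z => \1_U z * Du i z)) = fun z => \1_U z * abs_sum Du z.
  by apply/funext => z; exact: hE.
have -> : (\int[vol]_z (\1_K z * (\1_U z * abs_sum Du z) `^ (2 + del))%:E =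
    \int[vol]_z (\1_K z * abs_sum Du z `^ (2 + del))%:E)%E.
  apply: eq_integral => z _; rewrite !indicE; have [zK|zK] := pselect (K z); last by rewrite (memNset zK) !mul0r.
  by rewrite (mem_set (KU _ zK)) mul1r.
move/le_trans; apply; rewrite lee_fin ler_wpM2l// lerD2l; exact: Int_le.
Qed.

End interior.

(** * Conclusion: norms and constants *)

Section assembly.
Context {R : realType} {r : nat}.
Variable m : 'I_r.+1 -> nat.
Local Notation N := (dimx m).
Local Notation m0 := (m ord0).
Local Notation pt := ('cV[R]_N * R)%type.
Local Notation intg := (intg (@vol R N)).
Local Notation nrm := (nrm (@vol R N)).

Lemma measurable_abs_powR (p : R) (D : set pt) (v : pt -> R) : measurable D -> measurable_fun D v ->
  measurable_fun setT (fun z => \1_D z * `|v z| `^ p).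
Proof.
move=> mD mv; apply: measurable_ind_mul => //.
apply: (@measurableT_comp _ _ _ _ _ _ (@powR R ^~ p) _ (fun z => `|v z|)) => //.
exact: measurableT_comp.
Qed.

Lemma Lp_norm_EFin (p : R) (D : set pt) (v : pt -> R) : 0 < p ->
  intg (fun z => \1_D z * `|v z| `^ p) ->
  Lp_norm p%:E D v = ((\int[vol]_z (\1_D z * `|v z| `^ p)) `^ p^-1)%:E.
Proof. by move=> p0 iv; rewrite (Lp_normE D v p0) -(IntE iv) poweR_EFin. Qed.

Lemma nrm_abs_sum (U : set pt) (Du : 'I_m0 -> pt -> R) : measurable U ->
  (forall i, measurable_fun U (Du i)) -> intg (fun z => \1_U z * `|elen Du z| `^ 2) ->
  nrm (fun z => \1_U z * abs_sum Du z) <=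
  m0%:R * (\int[vol]_z (\1_U z * `|elen Du z| `^ 2)) `^ 2^-1.
Proof.
move=> mU mD iE.
have I0 : 0 <= \int[vol]_z (\1_U z * `|elen Du z| `^ 2).
  by apply: Int_ge0 => z; rewrite mulr_ge0 ?indicE ?powR_ge0.
rewrite (powR12_sqrt I0) -ler_sqr ?nnegrE ?nrm_ge0 ?(mulr_ge0 (ler0n _ m0) (sqrtr_ge0 _))//.
rewrite nrm_sqr exprMn (sqr_sqrtr I0).
have ms : measurable_fun setT (fun z => \1_U z * abs_sum Du z).
  apply: measurable_ind_mul => //; apply: measurable_sum => i; exact: measurableT_comp.
have le z : (\1_U z * abs_sum Du z) ^+ 2 <= m0%:R ^+ 2 * (\1_U z * `|elen Du z| `^ 2).
  rewrite ger0_norm ?elen_ge0// -[X in _ `^ X]/(2%:R) powR_mulrn ?elen_ge0// indicE.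
  case: (_ \in _); last by rewrite !mul0r expr0n /= mulr0.
  by rewrite !mul1r -exprMn ler_sqr ?nnegrE ?mulr_ge0 ?abs_sum_ge0 ?elen_ge0// abs_sum_le.
rewrite -IntZ//; apply: Int_le => //; last exact: intgZ.
apply: (intg_le _ _ (intgZ _ iE)) => [|z]; first exact: measurable_funX.
by rewrite ger0_norm ?sqr_ge0.
Qed.

Lemma source_le (p : R) (Omega : set pt) g (f : 'I_m0 -> pt -> R) : 0 < p -> measurable Omega ->
  in_Lp (m := m) p%:E Omega g -> (forall i, in_Lp (m := m) p%:E Omega (f i)) ->
  intg (fun z => \1_Omega z * `|elen f z| `^ p) /\
  \int[vol]_z (\1_Omega z * (abs_sum f z + `|g z|) `^ p) <=
  2 `^ p * (m0%:R `^ p * \int[vol]_z (\1_Omega z * `|elen f z| `^ p) + \int[vol]_z (\1_Omega z * `|g z| `^ p)).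
Proof.
move=> p0 mO gp fp; have iS := intg_source p0 mO gp fp.
have [mg ig] := (in_Lp_fin g p0 mO).1 gp.
have mf i : measurable_fun Omega (f i) by have [] := fp i.
have ie : intg (fun z => \1_Omega z * `|elen f z| `^ p).
  apply: (intg_le _ _ iS) => [|z]; first by apply: measurable_abs_powR => //; exact: measurable_elen.
  rewrite ger0_norm ?mulr_ge0 ?powR_ge0 ?indicE// ler_wpM2l// ger0_norm ?elen_ge0//.
  rewrite ge0_ler_powR ?nnegrE ?elen_ge0 ?(ltW p0) ?addr_ge0 ?abs_sum_ge0//.
  by rewrite (le_trans (elen_le f z))// lerDl.
split => //; rewrite -IntZ// -IntD//; last exact: intgZ.
rewrite -IntZ; last by apply: intgD => //; exact: intgZ.
apply: Int_le => // [|z]; first by apply: intgZ; apply: intgD => //; exact: intgZ.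
rewrite indicE; case: (_ \in _); last by rewrite !(mul0r, mulr0) addr0 mulr0.
rewrite -[true%:R]/(1 : R) !mul1r [`|elen f z|]ger0_norm ?elen_ge0// -(powRM _ (ler0n _ m0) (elen_ge0 f z)).
apply: le_trans (powRD_le (ltW p0) (mulr_ge0 (ler0n _ m0) (elen_ge0 f z)) (normr_ge0 (g z))).
rewrite ge0_ler_powR ?nnegrE ?(ltW p0) ?addr_ge0 ?mulr_ge0 ?abs_sum_ge0 ?elen_ge0//.
by rewrite lerD2r abs_sum_le.
Qed.

End assembly.

Unset Implicit Arguments.

Theorem theorem1p1 (R : realType) (r : nat) (m : 'I_r.+1 -> nat)
    (hm : block_sizes m)
    (B : 'M[R]_(dimx m)) (hB : block_superdiag B)
    (Omega : set (spacetime R m)) (hOmega : bounded_domain Omega)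
    (a : 'I_(m ord0) -> 'I_(m ord0) -> spacetime R m -> R) (ha : vmo_elliptic B Omega a) :
  exists2 eps0 : R, 0 < eps0 &
  forall p : R,
    2 <= p < 2 + 2 * (Qdim m)%:R / ((Qdim m)%:R + 2) * eps0 ->
    (forall (g : spacetime R m -> R) (f : 'I_(m ord0) -> spacetime R m -> R)
       (u : spacetime R m -> R),
       in_Lp p%:E Omega g -> (forall i, in_Lp p%:E Omega (f i)) ->
       weak_solution B Omega a g f u ->
       forall Du, weak_D0 Omega u Du ->
       forall i, in_Lp_loc p%:E Omega (Du i)) /\
    (forall Omega' Omega'' : set (spacetime R m),
       open Omega' -> open Omega'' ->
       compactly_included Omega' Omega'' -> compactly_included Omega'' Omega ->
       exists2 c : R, 0 < c &
       forall (g : spacetime R m -> R) (f : 'I_(m ord0) -> spacetime R m -> R)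
         (u : spacetime R m -> R),
         in_Lp p%:E Omega g -> (forall i, in_Lp p%:E Omega (f i)) ->
         weak_solution B Omega a g f u ->
         forall Du, weak_D0 Omega u Du ->
         (Lp_norm p%:E Omega' (elen Du) <=
          c%:E * (Lp_norm 2%:E Omega'' (elen Du) +
                  Lp_norm p%:E Omega g + Lp_norm p%:E Omega (elen f)))%E).
Proof.
have [_ oO _ bO] := hOmega; have [hij [Lam Lam1 hell]] := ha.
have a_meas i j : measurable_fun Omega (a i j) by have [_ _ []] := hij i j.
have a_bd i j z : `|a i j z| <= Lam.
  apply: (polarization (a := fun i j => a i j z)) => // i' j'.
  by have [-> _ _] := hij i' j'.
have a_ell z (xi : 'I_(m ord0) -> R) :
    Lam^-1 * \sum_i xi i ^+ 2 <= \sum_i \sum_j a i j z * xi i * xi j.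
  by have /andP[] := hell z xi.
have [r0 r01 Or0] : exists2 r0 : R, 1 <= r0 & Omega `<=` cbox r0.
  have [M [Mr HM]] := bO; exists (Num.max 1 (M + 1)); first by rewrite le_max lexx.
  move=> z Oz o; rewrite (le_trans (crd_le_norm o z))// le_max.
  by rewrite (HM (M + 1)) ?ltrDl// orbT.
have mO := open_measurable_pt oO.
have [del0 del00 IE] := interior_estimate hB oO Or0 r01 Lam1 a_meas a_bd a_ell.
(* The factor 2 Q / (Q + 2) is at most 2, so p - 2 stays within [del0]. *)
exists (del0 / 2) => [|p /andP[p2 pl]]; first by rewrite divr_gt0.
have p0 : 0 < p by lra.
have pdel : p - 2 <= del0.
  have Q0 : 0 < (Qdim m)%:R + 2 :> R by rewrite ltr_wpDl.
  have : 2 * (Qdim m)%:R / ((Qdim m)%:R + 2) * (del0 / 2) <= del0.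
    have q1 : (Qdim m)%:R / ((Qdim m)%:R + 2) <= 1 :> R by rewrite ler_pdivrMr// mul1r lerDl.
    have -> : 2 * (Qdim m)%:R / ((Qdim m)%:R + 2) * (del0 / 2) = (Qdim m)%:R / ((Qdim m)%:R + 2) * del0.
      by field; rewrite gt_eqF.
    by rewrite ler_piMl ?(ltW del00).
  lra.
have pE : 2 + (p - 2) = p by rewrite addrC subrK.
have KmE (K : set (spacetime R m)) (Du : 'I_(m ord0) -> spacetime R m -> R) u :
    weak_D0 Omega u Du -> compact K -> K `<=` Omega -> forall i, measurable_fun K (Du i).
  by move=> wD cK KO i; have [l1 _] := wD i; have [] := l1 K cK KO.
split.
- move=> g f u gp fp ws Du wD i K cK KO.
  have mK := compact_measurable_pt cK.
  have [Du0 [Yu0 [u2 [wD0 D2] wY ae eqn]]] := weak_reduce oO a_meas ws.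
  split; first exact: KmE wD cK KO i.
  rewrite (ae_Lp_norm p0 mK KO (KmE _ _ _ wD cK KO i) (KmE _ _ _ wD0 cK KO i) (ae Du wD i)).
  have [mD0 D0f] := D2 i.
  (* The interior estimate needs a positive gain; at p = 2 the square integrability of the
     derivative is enough. *)
  have [->|p2'] := eqVneq p 2.
    apply: le_lt_trans D0f; apply: Lp_norm_le => //; exact: KmE wD0 cK KO i.
  have dd : 0 < p - 2 <= del0 by rewrite pdel andbT subr_gt0 lt_neqAle eq_sym p2'.
  have [C C0] := IE _ _ _ dd oO (@subset_refl _ Omega) cK KO; rewrite pE => HC.
  have {}HC := HC _ _ _ _ _ gp fp u2 (conj wD0 D2) wY eqn.
  suff : in_Lp p%:E K (Du0 i) by case.
  have mDi : measurable_fun K (Du0 i) by exact: KmE wD0 cK KO i.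
  apply/(in_Lp_fin (Du0 i) p0 mK); split => //.
  apply: intg_lty => [|z|]; [exact: measurable_abs_powR|by rewrite mulr_ge0 ?indicE ?powR_ge0|].
  apply: (le_lt_trans (le_trans _ HC)); last exact: ltry.
  apply: ge0_le_integral => //.
  + by apply/measurable_EFinP; exact: measurable_abs_powR.
  + apply/measurable_EFinP; apply: measurable_ind_mul => //.
    apply: (@measurableT_comp _ _ _ _ _ _ (@powR R ^~ p)) => //.
    by apply: measurable_sum => j; apply: measurableT_comp => //; exact: KmE wD0 cK KO j.
  + move=> z _; rewrite lee_fin ler_wpM2l ?indicE// ge0_ler_powR ?nnegrE ?abs_sum_ge0 ?(ltW p0)//.
    by rewrite /abs_sum (bigD1 i)//= lerDl sumr_ge0.
- move=> O1 O2 oO1 oO2 [cK KU] [cK2 KO2].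
  have m1 := open_measurable_pt oO1; have m2 := open_measurable_pt oO2.
  have O12 : O1 `<=` O2 by move=> z z1; apply: KU; exact: subset_closure.
  have O2O : O2 `<=` Omega by move=> z z1; apply: KO2; exact: subset_closure.
  (* A weak derivative is known to be measurable on compact subsets of [Omega]; the closure of [O2]
     is one. *)
  have mE (Du : 'I_(m ord0) -> spacetime R m -> R) u : weak_D0 Omega u Du -> forall i, measurable_fun O2 (Du i).
    move=> wD i; apply: measurable_funS (KmE _ _ _ wD cK2 KO2 i); last exact: subset_closure.
    exact: compact_measurable_pt.
  have [p22|p2'] := eqVneq p 2.
    exists 1 => // g f u gp fp ws Du wD; rewrite mul1e p22.
    have me := measurable_elen (mE _ _ wD).
    have L0 q v : (0 <= Lp_norm (m := m) q Omega v)%E by exact: Lnorm_ge0.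
    apply: (@le_trans _ _ (Lp_norm 2%:E O2 (elen Du))); last by rewrite -addeA leeDl// adde_ge0.
    by apply: Lp_norm_le => //; exact: measurable_funS me.
  have dd : 0 < p - 2 <= del0 by rewrite pdel andbT subr_gt0 lt_neqAle eq_sym p2'.
  (* The solution is localised to [O2] and not to [Omega], so that the L^2 norm of its gradient on
     the right is taken over [O2]. *)
  have [C C0] := IE _ _ _ dd oO2 O2O cK KU; rewrite pE => HC.
  pose k : R := (m ord0)%:R; have k0 : 0 <= k by rewrite ler0n.
  pose cc := (C * (k `^ p + 2 `^ p * k `^ p + 2 `^ p)) `^ p^-1.
  have cc0 : 0 <= cc by exact: powR_ge0.
  exists (cc + 1) => [|g f u gp fp ws Du wD]; first by rewrite ltr_wpDl.
  have [Du0 [Yu0 [u2 [wD0 D2] wY ae eqn]]] := weak_reduce oO a_meas ws.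
  have {}HC := HC _ _ _ _ _ gp fp u2 (conj wD0 D2) wY eqn.
  have aee : {ae vol, forall z, Omega z -> elen Du z = elen Du0 z}.
    have : {ae vol, forall z, forall i, Omega z -> Du i z = Du0 i z} by apply: filter_forall => i; exact: ae.
    apply: filterS => z h zO; rewrite /elen; congr Num.sqrt; apply: eq_bigr => i _; by rewrite h.
  have mD := mE _ _ wD; have mD0 := mE _ _ wD0.
  have me := measurable_elen mD; have me0 := measurable_elen mD0.
  (* Both norms of the given derivative are replaced by those of the square integrable
     representative. *)
  rewrite (ae_Lp_norm p0 m1 (subset_trans O12 O2O) (measurable_funS m2 O12 me) (measurable_funS m2 O12 me0) aee).
  rewrite (ae_Lp_norm (ltr0n R 2) m2 O2O me me0 aee).
  have [mg ig] := (in_Lp_fin g p0 mO).1 gp.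
  have [ife sle] := source_le p0 mO gp fp.
  have ix : intg_of vol (fun z => \1_O2 z * `|elen Du0 z| `^ 2).
    have [ixf _] := source_le (ltr0n R 2) mO u2 D2.
    apply: (intg_le _ _ ixf) => [|z]; first exact: measurable_abs_powR.
    rewrite ger0_norm ?mulr_ge0 ?indicE ?powR_ge0// ler_wpM2r ?powR_ge0//.
    have [zO|zO] := pselect (O2 z); last by rewrite memNset.
    by rewrite !mem_set//; exact: O2O.
  rewrite (Lp_norm_EFin (ltr0n R 2) ix) (Lp_norm_EFin p0 ig) (Lp_norm_EFin p0 ife).
  set I := \int[vol]_z _ in HC sle; set NN := nrm_of _ _ in HC.
  have I0 : 0 <= I by apply: Int_ge0 => z; rewrite mulr_ge0 ?indicE ?powR_ge0.
  have hN : NN <= k * (\int[vol]_z (\1_O2 z * `|elen Du0 z| `^ 2)) `^ 2^-1 by exact: nrm_abs_sum.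
  have G0 : 0 <= \int[vol]_z (\1_Omega z * `|g z| `^ p).
    by apply: Int_ge0 => z; rewrite mulr_ge0 ?indicE ?powR_ge0.
  have F0 : 0 <= \int[vol]_z (\1_Omega z * `|elen f z| `^ p).
    by apply: Int_ge0 => z; rewrite mulr_ge0 ?indicE ?powR_ge0.
  have key := root_estimate p0 C0 k0 (nrm_ge0 _ _) I0 (powR_ge0 _ _) F0 G0 hN sle.
  apply: (@le_trans _ _ (((C * (NN `^ p + I)) `^ p^-1)%:E)).
    rewrite (Lp_normE _ _ p0) -poweR_EFin; apply: gt0_ler_poweR.
    + by rewrite invr_ge0 ltW.
    + by rewrite in_itv /= leey andbT; apply: integral_ge0 => z _; rewrite lee_fin mulr_ge0 ?indicE ?powR_ge0.
    + by rewrite in_itv /= leey andbT lee_fin (mulr_ge0 C0 (addr_ge0 (powR_ge0 _ _) I0)).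
    apply: le_trans HC; apply: ge0_le_integral => //.
    + by apply/measurable_EFinP; apply: measurable_abs_powR => //; exact: measurable_funS me0.
    + apply/measurable_EFinP; apply: measurable_ind_mul; first exact: compact_measurable_pt.
      apply: (@measurableT_comp _ _ _ _ _ _ (@powR R ^~ p)) => //.
      apply: measurable_sum => j; apply: measurableT_comp => //.
      by apply: KmE wD0 cK _ j; exact: subset_trans KU O2O.
    + move=> z _; rewrite lee_fin !indicE; have [z1|z1] := pselect (O1 z); last first.
        by rewrite memNset// mul0r mulr_ge0 ?powR_ge0.
      rewrite !mem_set ?mul1r//; last exact: subset_closure.
      rewrite ger0_norm ?elen_ge0// ge0_ler_powR ?nnegrE ?elen_ge0 ?abs_sum_ge0 ?(ltW p0)//.
      exact: elen_le.
  rewrite -!EFinD -EFinM lee_fin (le_trans key)// ler_wpM2r ?addr_ge0 ?powR_ge0//.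
  by rewrite lerDl.
Qed.
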